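(* Let $G$ be a Lie group and let $\mathcal{C}(G)=\Gamma^{finite}(\mathcal{U}(G))$ be the space of de Rham currents on $G$ with finite support, graded by dimension and filtered by order. With the convolution product $\ast$, the unit $\delta_e$ (evaluation of functions at the identity $e$), the co-product $\Delta$ and co-unit $\varepsilon$ dual to the wedge product of forms and its unit, and the boundary $\partial$ dual to exterior derivative, the space $\mathcal{C}(G)$ is a filtered differential graded Hopf algebra. Moreover, its structure maps $\partial,\Delta,\varepsilon,\ast$ and its antipode are all induced, by applying the finitely supported sections functor $\Gamma^{finite}$, from smooth bundle maps: $\partial$, $\Delta$ and $\varepsilon$ from bundle maps covering the identity of $G$, $\ast$ from a bundle map covering the group law $G\times G\to G$, and the antipode from a bundle map $\mathcal{U}(G)\to\mathcal{U}(G)$ covering the inversion map $g\mapsto g^{-1}$ of $G$.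
   Context: Currents. A compactly supported $k$-dimensional current on $G$ is a continuous linear functional on smooth $k$-forms with compact support (as a distribution). It has order at most $r$ if it extends to a continuous linear functional on $C^r$ forms. For $p\in G$, $\mathcal{U}_k(G;p)$ is the space of $k$-dimensional currents with support contained in $\{p\}$, $\mathcal{U}_k^r(G;p)$ is the subspace of those of order at most $r$, and $\mathcal{U}(G;p)=\bigoplus_k\mathcal{U}_k(G;p)$. $\mathcal{U}(G)=\bigoplus_k \mathcal{U}_k(G)$, $\mathcal{U}_k(G)=\bigcup_r\mathcal{U}_k^r(G)$, is the vector bundle over $G$ with fibers $\mathcal{U}(G;p)$. Smooth structure. Let $\mathfrak{g}$ be the Lie algebra of $G$, $U(\mathfrak{g})$ its enveloping algebra with the usual filtration $U^r(\mathfrak g)$, viewed as left-invariant differential operators acting on forms by iterated Lie derivatives, and view elements of $\wedge^k\mathfrak{g}$ as right-invariant $k$-vector fields. Then $(p,v\otimes\alpha)\mapsto\big(\omega\mapsto (v(\omega))_p(\alpha)\big)$ identifies $G\times (U^r(\mathfrak{g})\otimes\wedge^k\mathfrak{g})$ with $\mathcal{U}_k^r(G)$, giving it the structure of a finite rank smooth vector bundle; a bundle map between the filtered bundles is smooth if it is smooth on these finite rank subbundles. Functor $\Gamma^{finite}$. For a vector bundle $E\to X$, $\Gamma^{finite}(E)=\bigoplus_{x\in X}E_x$ is the space of (not necessarily continuous) sections with finite support. A bundle map $\varphi:E\to F$ covering $f:X\to Y$ induces $\Gamma^{finite}(\varphi)(s)(y)=\sum_{f(x)=y}\varphi(s(x))$.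 $\Gamma^{finite}(\mathcal{U}(G))$ is identified with the space of finitely supported currents by summation. The product is induced from a bundle map $\pi_1^*\mathcal{U}(G)\otimes\pi_2^*\mathcal{U}(G)\to\mathcal{U}(G)$, where $\pi_1,\pi_2:G\times G\to G$ are the projections, using $\Gamma^{finite}(\pi_1^*E\otimes\pi_2^*E)=\Gamma^{finite}(E)\otimes\Gamma^{finite}(E)$. The co-product is induced from a bundle map $\mathcal{U}(G)\to\mathcal{U}(G)\otimes\mathcal{U}(G)$ over $G$ (fiberwise tensor product), using the inclusion $\bigoplus_p \mathcal{U}(G;p)\otimes\mathcal{U}(G;p)\subset \mathcal{C}(G)\otimes\mathcal{C}(G)$. The co-unit is induced from a bundle map $\mathcal{U}(G)\to G\times\mathbb{R}$ followed by summation $\Gamma^{finite}(G\times\mathbb{R})\to\mathbb{R}$. Structure maps. $(A\ast B)(\omega)=(A\otimes B)(m^*\omega)$, where $m:G\times G\to G$ is multiplication and $A\otimes B$ is the current on $G\times G$ determined by $(A\otimes B)(\pi_1^*\eta\wedge\pi_2^*\zeta)=A(\eta)B(\zeta)$. $(\partial T)(\omega)=T(d\omega)$. On the fiber $\mathcal{U}(G;p)$, $\Delta$ is determined by $(\Delta T)(\omega\otimes\eta)=T(\omega\wedge\eta)$, where $(T_1\otimes T_2)(\omega\otimes\eta)=T_1(\omega)T_2(\eta)$, and $\varepsilon(T)=T(1)$, where $1$ is the constant function (so $\varepsilon=0$ on currents of positive dimension). Filtered differential graded Hopf algebra. A graded vector space $\mathcal{H}=\bigoplus_{k\ge0}\mathcal{H}_k$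 with increasing filtrations $\mathcal{H}_k=\bigcup_r\mathcal{H}_k^r$, together with a graded Hopf algebra structure (associative unital product, co-associative co-unital co-product, the co-product and co-unit being unital algebra maps where $\mathcal{H}\otimes\mathcal{H}$ has product $(x\otimes y)(x'\otimes y')=(-1)^{|y||x'|}xx'\otimes yy'$, and an antipode $S$ with $S(x_{(1)})x_{(2)}=x_{(1)}S(x_{(2)})=\varepsilon(x)1$), such that $\mathcal{H}_i^s\mathcal{H}_j^t\subseteq\mathcal{H}_{i+j}^{s+t}$, $\Delta(\mathcal{H}_k^r)\subseteq\bigoplus_{i+j=k}\sum_{s+t=r}\mathcal{H}_i^s\otimes\mathcal{H}_j^t$, $\varepsilon(\mathcal H_k)=0$ for $k>0$, $S(\mathcal{H}_k^r)\subseteq\mathcal{H}_k^r$; and a linear map $\partial$ with $\partial(\mathcal{H}_k^r)\subseteq\mathcal{H}_{k-1}^{r+1}$, $\partial^2=0$, $\partial(xy)=\partial(x)y+(-1)^{|x|}x\,\partial(y)$ and $\Delta\partial(x)=\partial x_{(1)}\otimes x_{(2)}+(-1)^{|x_{(1)}|}x_{(1)}\otimes\partial x_{(2)}$. *)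

(* Defs.v *)
From HB Require Import structures.
From mathcomp Require Import all_boot all_order all_algebra perm.
From mathcomp Require Import all_classical all_reals all_analysis.

Set Implicit Arguments.
Unset Strict Implicit.
Unset Printing Implicit Defensive.

Import Order.TTheory GRing.Theory Num.Theory.
Import numFieldNormedType.Exports.

Local Open Scope classical_set_scope.
Local Open Scope ring_scope.

(* [f] is C^m on the open set [O]. In finite dimension the existence and the
   continuity of all directional derivatives characterise C^1. *)
Fixpoint Ck (R : realType) (V W : normedModType R) (m : nat) (O : set V)
    (f : V -> W) : Prop :=
  (forall x, O x -> {for x, continuous f}) /\
  (if m is m'.+1 then
     forall v, (forall x, O x -> derivable f x v) /\
               Ck m' O (fun x => 'D_v f x)
   else True).

(* [Some m] stands for C^m and [None] for C^oo. *)
Definition Creg (R : realType) (V W : normedModType R) (r : option nat)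
    (O : set V) (f : V -> W) : Prop :=
  if r is Some m then Ck m O f else forall m, Ck m O f.

Record chart (R : realType) (n : nat) (X : Type) := Chart {
  cdom : set X;
  cmap : X -> 'rV[R]_n;
  cinv : 'rV[R]_n -> X }.

Definition cimg (R : realType) (n : nat) (X : Type) (c : chart R n X) :
  set 'rV[R]_n := cmap c @` cdom c.

(* A smooth structure is presented by a family of charts, one chart [A p]
   around each point [p]; the tangent space at [p] is the model space
   ['rV[R]_n], seen through [A p]. *)
Definition atlas (R : realType) (n : nat) (X : Type) := X -> chart R n X.

Record is_atlas (R : realType) (n : nat) (X : topologicalType)
    (A : atlas R n X) : Prop := {
  atlas_mem : forall p, cdom (A p) p;
  atlas_dom_open : forall p, open (cdom (A p));
  atlas_img_open : forall p, open (cimg (A p));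
  atlas_inv : forall p x, cdom (A p) x -> cinv (A p) (cmap (A p) x) = x;
  atlas_map_cont : forall p x, cdom (A p) x -> {for x, continuous (cmap (A p))};
  atlas_inv_cont : forall p z, cimg (A p) z -> {for z, continuous (cinv (A p))};
  atlas_compat : forall p q, Creg None
    (cmap (A p) @` (cdom (A p) `&` cdom (A q))) (cmap (A q) \o cinv (A p)) }.

Definition prod_atlas (R : realType) (m n : nat) (X Y : Type)
    (A : atlas R m X) (B : atlas R n Y) : atlas R (m + n) (X * Y) := fun pq =>
  Chart (cdom (A pq.1) `*` cdom (B pq.2))
    (fun xy => row_mx (cmap (A pq.1) xy.1) (cmap (B pq.2) xy.2))
    (fun z => (cinv (A pq.1) (lsubmx z), cinv (B pq.2) (rsubmx z))).

Definition smooth_fun (R : realType) (n : nat) (X : Type) (A : atlas R n X)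
    (a : X -> R) : Prop :=
  forall p, Creg (W := R^o) None (cimg (A p)) (a \o cinv (A p)).

Definition smooth_map (R : realType) (m n : nat) (X Y : topologicalType)
    (A : atlas R m X) (B : atlas R n Y) (f : X -> Y) : Prop :=
  continuous f /\
  forall p, Creg None (cmap (A p) @` (cdom (A p) `&` f @^-1` cdom (B (f p))))
                 (cmap (B (f p)) \o f \o cinv (A p)).

(* The matrix of the differential of [f] at [p]; like [jacobian], it acts on
   row vectors from the right. *)
Definition tangent_mx (R : realType) (m n : nat) (X Y : Type)
    (A : atlas R m X) (B : atlas R n Y) (f : X -> Y) (p : X) : 'M[R]_(m, n) :=
  jacobian (cmap (B (f p)) \o f \o cinv (A p)) (cmap (A p) p).

(* [w p M] is the value of [w] at [p] on the [k] rows of [M], which are tangent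
   vectors at [p]. *)
Definition form (R : realType) (n : nat) (X : Type) (k : nat) :=
  X -> 'M[R]_(k, n) -> R^o.

Definition set_row (R : realType) (k n : nat) (i : 'I_k) (u : 'rV[R]_n)
    (M : 'M[R]_(k, n)) : 'M[R]_(k, n) :=
  \matrix_(l, c) if l == i then u 0 c else M l c.

Definition alternating_form (R : realType) (k n : nat)
    (w : 'M[R]_(k, n) -> R^o) : Prop :=
  (forall i M, linear (fun u => w (set_row i u M))) /\
  (forall M i j, i != j -> row i M = row j M -> w M = 0).

(* The expression of [w] in the chart [A q], evaluated on the rows of [M],
   seen as constant vector fields in that chart. *)
Definition local_form (R : realType) (n : nat) (X : Type) (A : atlas R n X)
    (k : nat) (w : form R n X k) (q : X) (M : 'M[R]_(k, n)) :
    'rV[R]_n -> R^o := fun x =>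
  let p := cinv (A q) x in
  w p (M *m jacobian (cmap (A p) \o cinv (A q)) x).

Definition Creg_form (R : realType) (n : nat) (X : Type) (A : atlas R n X)
    (r : option nat) (k : nat) (w : form R n X k) : Prop :=
  (forall p, alternating_form (w p)) /\
  (forall q M, Creg r (cimg (A q)) (local_form A w q M)).

Definition smooth_form (R : realType) (n : nat) (X : Type) (A : atlas R n X)
    (k : nat) (w : form R n X k) : Prop := Creg_form A None w.

Definition unit_form (R : realType) (n : nat) (X : Type) : form R n X 0 :=
  fun _ _ => 1.

(* Normalised so that [wedge dx dy] takes the value 1 on the standard basis. *)
Definition wedge (R : realType) (n : nat) (X : Type) (k l : nat)
    (w : form R n X k) (v : form R n X l) : form R n X (k + l) := fun p M =>
  ((k`! * l`!)%:R)^-1 *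
  \sum_(s : 'S_(k + l)) (-1) ^+ s *
     (w p (usubmx (row_perm s M)) * v p (dsubmx (row_perm s M))).

Definition extd (R : realType) (n : nat) (X : Type) (A : atlas R n X)
    (k : nat) (w : form R n X k) : form R n X k.+1 := fun p M =>
  \sum_(i < k.+1)
     (-1) ^+ i * 'D_(row i M) (local_form A w p (row' i M)) (cmap (A p) p).

Definition pullback (R : realType) (m n : nat) (X Y : Type)
    (A : atlas R m X) (B : atlas R n Y) (f : X -> Y) (k : nat)
    (w : form R n Y k) : form R m X k :=
  fun p M => w (f p) (M *m tangent_mx A B f p).

Definition contraction (R : realType) (n : nat) (X : Type)
    (xi : X -> 'rV[R]_n) (k : nat) (w : form R n X k.+1) : form R n X k :=
  fun p M => w p (col_mx (xi p) M).

(* Cartan's formula. *)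
Definition lie_derivative (R : realType) (n : nat) (X : Type)
    (A : atlas R n X) (xi : X -> 'rV[R]_n) (k : nat) :
    form R n X k -> form R n X k :=
  match k with
  | 0 => fun w => contraction xi (extd A w)
  | _.+1 => fun w => extd A (contraction xi w) + contraction xi (extd A w)
  end.

(* Currents of mixed dimension. By convention their value on anything that is
   not a smooth form is 0, so that equality is equality of functionals. *)
Definition current (R : realType) (n : nat) (X : Type) :=
  {k & form R n X k} -> R^o.

Definition cev (R : realType) (n : nat) (X : Type) (T : current R n X)
  (k : nat) (w : form R n X k) : R^o := T (existT _ k w).

Definition linear_on_forms (R : realType) (n : nat) (X : Type)
    (A : atlas R n X) (r : option nat) (k : nat) (T : form R n X k -> R^o) :=
  forall a (w v : form R n X k), Creg_form A r w -> Creg_form A r v ->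
    T (a *: w + v) = a *: T w + T v.

Definition basis_mx (R : realType) (k n : nat) (I : 'I_k -> 'I_n) :
  'M[R]_(k, n) := \matrix_(i < k) delta_mx 0 (I i).

Definition iter_deriv (R : realType) (n : nat) (al : seq 'I_n)
    (f : 'rV[R]_n -> R^o) : 'rV[R]_n -> R^o :=
  foldr (fun i g => fun x => 'D_(delta_mx 0 i) g x) f al.

(* Continuity for the topology of uniform convergence on compact sets of the
   coefficients of the forms and of their derivatives of order at most [r]:
   [T] is bounded by a multiple of the maximum of finitely many of the defining
   seminorms. *)
Definition continuous_on_forms (R : realType) (n : nat) (X : Type)
    (A : atlas R n X) (r : option nat) (k : nat) (T : form R n X k -> R^o) :=
  exists (c : R) (m N : nat) (q : 'I_N -> X) (K : 'I_N -> set 'rV[R]_n),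
  [/\ (if r is Some r' then (m <= r')%N else true),
      forall l, compact (K l) /\ K l `<=` cimg (A (q l)) &
      forall w, Creg_form A r w -> forall b, 0 <= b ->
        (forall l x al (I : 'I_k -> 'I_n), K l x -> (size al <= m)%N ->
           `|iter_deriv al (local_form A w (q l) (basis_mx R I)) x| <= b) ->
        `|T w| <= c * b].

(* Continuity on all smooth forms includes compactness of the support. *)
Record is_current (R : realType) (n : nat) (X : Type) (A : atlas R n X)
    (k : nat) (T : form R n X k -> R^o) : Prop := {
  current_junk : forall w, ~ smooth_form A w -> T w = 0;
  current_linear : linear_on_forms A None T;
  current_cont : continuous_on_forms A None T }.

Definition order_le (R : realType) (n : nat) (X : Type) (A : atlas R n X)
    (k r : nat) (T : current R n X) : Prop :=
  (forall j (w : form R n X j), j != k -> cev T w = 0) /\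
  exists T' : form R n X k -> R^o,
    [/\ linear_on_forms A (Some r) T', continuous_on_forms A (Some r) T' &
        forall w, smooth_form A w -> cev T w = T' w].

Record supported_at (R : realType) (n : nat) (X : topologicalType)
    (A : atlas R n X) (p : X) (T : current R n X) : Prop := {
  supp_current : forall k, is_current A (cev T (k := k));
  supp_point : forall k (w : form R n X k), smooth_form A w ->
    (\forall x \near p, w x = 0) -> cev T w = 0;
  supp_degree : exists N, forall k (w : form R n X k),
    (N <= k)%N -> cev T w = 0 }.

Lemma cevZD (R : realType) (n : nat) (X : Type) (a : R)
    (T S : current R n X) (k : nat) (w : form R n X k) :
  cev (a *: T + S) w = a * cev T w + cev S w.
Proof. by []. Qed.

Lemma is_current0 (R : realType) (n : nat) (X : Type) (A : atlas R n X) k :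
  is_current A (cev (0 : current R n X) (k := k)).
Proof.
split=> //; first by move=> a w v _ _; rewrite [RHS]addr0 [RHS]mulr0.
exists 0, 0%N, 0%N, (fun i : 'I_0 => False_rect _ (notF (ltn_ord i))),
  (fun=> set0); split; [by []|by case|].
by move=> w _ b b0 _; rewrite normr0 mul0r.
Qed.

Lemma is_currentZD (R : realType) (n : nat) (X : Type) (A : atlas R n X) k
    (a : R) (T S : current R n X) :
  is_current A (cev T (k := k)) -> is_current A (cev S (k := k)) ->
  is_current A (cev (a *: T + S) (k := k)).
Proof.
case=> jT lT [c [m [N [q [K [_ cK bT]]]]]].
case=> jS lS [c' [m' [N' [q' [K' [_ cK' bS]]]]]].
split.
- by move=> w w_ns; rewrite cevZD jT// jS// mulr0 addr0.
- move=> b w v sw sv; rewrite !cevZD lT// lS//.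
  have E (x y x' y' : R) :
      a * (b * x + y) + (b * x' + y') = b * (a * x + x') + (a * y + y').
    by rewrite !mulrDr addrACA mulrCA.
  exact: E.
- pose pick (U : Type) (f : 'I_N -> U) (g : 'I_N' -> U) (i : 'I_(N + N')) :=
    match fintype.split i with inl j => f j | inr j => g j end.
  exists (`|a| * c + c'), (maxn m m'), (N + N')%N, (pick _ q q'),
    (pick _ K K'); split=> //.
  + by move=> l; rewrite /pick; case: (fintype.split l).
  + move=> w sw b b0 Hb.
    have hT : `|cev T w| <= c * b.
      apply: bT => // l x al I Kx al_m.
      have := Hb (lshift N' l) x al I.
      rewrite /pick (unsplitK (inl l)); apply => //.
      exact: leq_trans al_m (leq_maxl _ _).
    have hS : `|cev S w| <= c' * b.
      apply: bS => // l x al I Kx al_m.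
      have := Hb (rshift N l) x al I.
      rewrite /pick (unsplitK (inr l)); apply => //.
      exact: leq_trans al_m (leq_maxr _ _).
    rewrite cevZD (le_trans (ler_normD _ _))// normrM mulrDl -mulrA lerD//.
    exact: ler_wpM2l.
Qed.

Section PointCurrents.
Context (R : realType) (n : nat) (X : topologicalType).
Context (A : atlas R n X) (p : X).

Definition supported_at_pred : {pred current R n X} :=
  fun T => `[< supported_at A p T >].

Lemma supported_at_submod : submod_closed supported_at_pred.
Proof.
split.
  apply/asboolP; split=> [k|//|]; first exact: is_current0.
  by exists 0%N.
move=> a T S /asboolP[cT pT [N dT]] /asboolP[cS pS [N' dS]].
apply/asboolP; split.
- by move=> k; exact: is_currentZD.
- by move=> k w sw w0; rewrite cevZD pT// pS// mulr0 addr0.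
- exists (maxn N N') => k w; rewrite geq_max => /andP[Nk N'k].
  by rewrite cevZD dT// dS// mulr0 addr0.
Qed.

HB.instance Definition _ := GRing.isSubmodClosed.Build R (current R n X)
  supported_at_pred supported_at_submod.

Record ptcurrent := PtCurrent {
  ptval :> current R n X;
  _ : ptval \in supported_at_pred }.

HB.instance Definition _ := [isSub for ptval].
HB.instance Definition _ := [Choice of ptcurrent by <:].
HB.instance Definition _ := [SubChoice_isSubLmodule of ptcurrent by <:].

End PointCurrents.

Section Tensor.
Context (R : realType) (V W : lmodType R).

Definition bilinear_form := {b : V -> W -> R^o |
  (forall y, linear (b^~ y)) /\ (forall x, linear (b x))}.

Definition pure_functional (x : V) (y : W) : bilinear_form -> R^o :=
  fun b => sval b x y.

Definition tensor_pred : {pred bilinear_form -> R^o} := fun t =>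
  `[< exists s : seq (V * W), t = \sum_(u <- s) pure_functional u.1 u.2 >].

Lemma pure_tensorP (x : V) (y : W) : pure_functional x y \in tensor_pred.
Proof. by apply/asboolP; exists [:: (x, y)]; rewrite big_seq1. Qed.

Lemma tensor_submod : submod_closed tensor_pred.
Proof.
split; first by apply/asboolP; exists [::]; rewrite big_nil.
move=> a t t' /asboolP[s ->] /asboolP[s' ->]; apply/asboolP.
exists ([seq (a *: u.1, u.2) | u <- s] ++ s').
rewrite big_cat big_map scaler_sumr; congr (_ + _); apply: eq_bigr => u _.
apply/funext => b; rewrite /pure_functional /=.
have := (svalP b).1 u.2 a u.1 0; rewrite addr0 => e.
have e0 : sval b 0 u.2 = 0.
  have := (svalP b).1 u.2 1 0 0; rewrite scale1r addr0 scale1r.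
  by move/eqP; rewrite eq_sym -subr_eq0 addrK => /eqP.
by rewrite e e0 addr0.
Qed.

HB.instance Definition _ := GRing.isSubmodClosed.Build R (bilinear_form -> R^o)
  tensor_pred tensor_submod.

(* The tensor product of V and W, realised as the span of the functionals
   b |-> b x y on the space of bilinear forms on V x W; over a field this is the
   algebraic tensor product. *)
Record tensor := Tensor {
  tensor_val : bilinear_form -> R^o;
  _ : tensor_val \in tensor_pred }.

HB.instance Definition _ := [isSub for tensor_val].
HB.instance Definition _ := [Choice of tensor by <:].
HB.instance Definition _ := [SubChoice_isSubLmodule of tensor by <:].

Definition pure (x : V) (y : W) : tensor := Tensor (pure_tensorP x y).

(* For a bilinear [b], the linear map sending [pure x y] to [b x y]; it is
   computed on an arbitrary decomposition of [t] as a sum of pure tensors. *)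
Definition tlift (Z : zmodType) (b : V -> W -> Z) (t : tensor) : Z :=
  \sum_(u <- sval (cid (asboolW (valP t)))) b u.1 u.2.

End Tensor.

Notation "x ⊗ y" := (pure x y) (at level 40, left associativity).

Section FiniteSections.
Context (R : realType) (X : choiceType) (E : X -> lmodType R).

Record gfin := GFin {
  gval :> forall x, E x;
  gfinP : finite_set [set x | gval x != 0] }.

Lemma gfin_eq (s t : gfin) : (forall x, s x = t x) -> s = t.
Proof.
case: s t => [s sP] [t tP] /= st.
have {}st := functional_extensionality_dep st; move: sP tP.
by rewrite st => sP tP; congr GFin; exact: Prop_irrelevance.
Qed.

HB.instance Definition _ := gen_eqMixin gfin.
HB.instance Definition _ := gen_choiceMixin gfin.

Lemma gfin0_subproof : finite_set [set x | (0 : E x) != 0].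
Proof. by rewrite [X in finite_set X](_ : _ = set0) // -subset0 => x /=;
  rewrite eqxx. Qed.

Lemma gfinD_subproof (s t : gfin) : finite_set [set x | s x + t x != 0].
Proof.
apply: (@sub_finite_set _ _ ([set x | s x != 0] `|` [set x | t x != 0])).
  move=> x /= st; apply/orP; rewrite -negb_and; apply: contra st.
  by move=> /andP[/eqP-> /eqP->]; rewrite addr0.
by rewrite finite_setU; split; exact: gfinP.
Qed.

Lemma gfinN_subproof (s : gfin) : finite_set [set x | - s x != 0].
Proof. by apply: sub_finite_set (gfinP s) => x /=; rewrite oppr_eq0. Qed.

Lemma gfinZ_subproof (a : R) (s : gfin) : finite_set [set x | a *: s x != 0].
Proof.
by apply: sub_finite_set (gfinP s) => x /=; apply: contra => /eqP->;
  rewrite scaler0.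
Qed.

Definition gfin0 := GFin gfin0_subproof.
Definition gfinD s t := GFin (gfinD_subproof s t).
Definition gfinN s := GFin (gfinN_subproof s).
Definition gfinZ a s := GFin (gfinZ_subproof a s).

Lemma gfinDA : associative gfinD.
Proof. by move=> s t u; apply: gfin_eq => x /=; rewrite addrA. Qed.
Lemma gfinDC : commutative gfinD.
Proof. by move=> s t; apply: gfin_eq => x /=; rewrite addrC. Qed.
Lemma gfin0D : left_id gfin0 gfinD.
Proof. by move=> s; apply: gfin_eq => x /=; rewrite add0r. Qed.
Lemma gfinND : left_inverse gfin0 gfinN gfinD.
Proof. by move=> s; apply: gfin_eq => x /=; rewrite addNr. Qed.

HB.instance Definition _ :=
  GRing.isZmodule.Build gfin gfinDA gfinDC gfin0D gfinND.

Lemma gfinZA a b s : gfinZ a (gfinZ b s) = gfinZ (a * b) s.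
Proof. by apply: gfin_eq => x /=; rewrite scalerA. Qed.
Lemma gfin1Z : left_id 1 gfinZ.
Proof. by move=> s; apply: gfin_eq => x /=; rewrite scale1r. Qed.
Lemma gfinZDr : right_distributive gfinZ +%R.
Proof. by move=> a s t; apply: gfin_eq => x /=; rewrite scalerDr. Qed.
Lemma gfinZDl s : {morph gfinZ^~ s : a b / a + b}.
Proof. by move=> a b; apply: gfin_eq => x /=; rewrite scalerDl. Qed.

HB.instance Definition _ :=
  GRing.Zmodule_isLmodule.Build R gfin gfinZA gfin1Z gfinZDr gfinZDl.

Definition gsupp (s : gfin) : set X := [set x | s x != 0].

Lemma gdelta_subproof (x : X) (v : E x) :
  finite_set [set y | dfwith (fun=> 0) x v y != 0].
Proof.
apply: (@sub_finite_set _ _ [set x]); last exact: finite_set1.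
by move=> y /=; case: dfwithP => // z xz; rewrite eqxx.
Qed.

(* The section with value [v] at [x] and 0 elsewhere. *)
Definition gdelta (x : X) (v : E x) : gfin := GFin (gdelta_subproof v).

End FiniteSections.

(* The map Gamma^finite(phi), s |-> (y |-> sum over f x = y of phi (s x)). *)
Definition gamma (R : realType) (X Y : choiceType) (E : X -> lmodType R)
    (F : Y -> lmodType R) (f : X -> Y) (phi : forall x, E x -> F (f x))
    (s : gfin E) : gfin F :=
  \sum_(x \in gsupp s) gdelta (phi x (s x)).

Lemma gbox_subproof (R : realType) (X Y : choiceType) (E : X -> lmodType R)
    (F : Y -> lmodType R) (s : gfin E) (t : gfin F) :
  finite_set [set xy | s xy.1 ⊗ t xy.2 != 0].
Proof.
have tensor_eq0 (V W : lmodType R) (x : V) (y : W) :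
    (x = 0) \/ (y = 0) -> x ⊗ y = 0.
  move=> xy; apply/val_inj/funext => b; rewrite /= /pure_functional /=.
  case: b => b [bl br] /=; case: xy => ->.
    have := bl y 1 0 0; rewrite scale1r addr0 scale1r => /eqP.
    by rewrite eq_sym -subr_eq0 addrK => /eqP.
  have := br x 1 0 0; rewrite scale1r addr0 scale1r => /eqP.
  by rewrite eq_sym -subr_eq0 addrK => /eqP.
apply: (@sub_finite_set _ _ (gsupp s `*` gsupp t)).
  move=> [x y] /= nz; split; apply: contra nz => /eqP z; apply/eqP/tensor_eq0.
    by left.
  by right.
by apply: finite_setX; exact: gfinP.
Qed.

(* The identification of Gamma^finite(E) ⊗ Gamma^finite(F) with
   Gamma^finite(pi_1^* E ⊗ pi_2^* F), on pure tensors. *)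
Definition gbox (R : realType) (X Y : choiceType) (E : X -> lmodType R)
    (F : Y -> lmodType R) (s : gfin E) (t : gfin F) :
    gfin (fun xy : X * Y => tensor (E xy.1) (F xy.2)) :=
  GFin (gbox_subproof s t).

(* The inclusion of the direct sum of the E x ⊗ E x in
   Gamma^finite(E) ⊗ Gamma^finite(E). *)
Definition gdiag (R : realType) (X : choiceType) (E : X -> lmodType R)
    (t : gfin (fun x => tensor (E x) (E x))) : tensor (gfin E) (gfin E) :=
  \sum_(x \in gsupp t) tlift (fun a b => gdelta a ⊗ gdelta b) (t x).

Definition gsum (R : realType) (X : choiceType)
    (s : gfin (fun _ : X => R^o)) : R^o := \sum_(x \in gsupp s) s x.

(* A filtered union of finite rank vector bundles, each of which is trivialised
   by finitely many of the global sections [fframe i]. The sections are only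
   required to span: a map into a finite dimensional space is smooth iff it is a
   combination of a given finite spanning family with smooth coefficients. *)
Record fbundle (R : realType) (X : Type) := FBundle {
  fib :> X -> lmodType R;
  fidx : Type;
  fframe : fidx -> forall x, fib x }.

Definition smooth_bundle_map (R : realType) (m n : nat)
    (X Y : topologicalType) (A : atlas R m X) (B : atlas R n Y)
    (E : fbundle R X) (F : fbundle R Y)
    (f : X -> Y) (phi : forall x, E x -> F (f x)) : Prop :=
  [/\ smooth_map A B f,
      forall x, linear (phi x) &
      forall i : fidx E, exists N (a : 'I_N -> X -> R) (j : 'I_N -> fidx F),
        (forall l, smooth_fun A (a l)) /\
        (forall x, phi x (fframe i x) =
                   \sum_l a l x *: fframe (j l) (f x))].

Definition triv_bundle (R : realType) (X : Type) : fbundle R X :=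
  @FBundle R X (fun _ => R^o) unit (fun _ _ => 1).

Definition diag_bundle (R : realType) (X : Type) (E : fbundle R X) :
    fbundle R X :=
  @FBundle R X (fun x => tensor (E x) (E x)) (fidx E * fidx E)%type
    (fun ij x => fframe ij.1 x ⊗ fframe ij.2 x).

(* The bundle pi_1^* E ⊗ pi_2^* F over the product of the bases. *)
Definition box_bundle (R : realType) (X Y : Type) (E : fbundle R X)
    (F : fbundle R Y) : fbundle R (X * Y) :=
  @FBundle R (X * Y) (fun xy => tensor (E xy.1) (F xy.2))
    (fidx E * fidx F)%type
    (fun ij xy => fframe ij.1 xy.1 ⊗ fframe ij.2 xy.2).

Section Hopf.
Context (R : realType) (H : lmodType R) (F : nat -> nat -> set H).
Context (one : H) (mul : H -> H -> H) (Delta : H -> tensor H H).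
Context (eps : H -> R^o) (bd S : H -> H).

(* [F k r] is the [r]-th step of the filtration of the degree [k] part. *)
Definition degree (k : nat) : set H := [set x | exists r, F k r x].

Record filtered_graded : Prop := {
  filt_submod : forall k r, F k r 0 /\
    forall a x y, F k r x -> F k r y -> F k r (a *: x + y);
  filt_incr : forall k r s, (r <= s)%N -> F k r `<=` F k s;
  graded_span : forall x, exists N (c : nat -> H),
    (forall k, degree k (c k)) /\ x = \sum_(k < N) c k;
  graded_direct : forall N (c : nat -> H), (forall k, degree k (c k)) ->
    \sum_(k < N) c k = 0 -> forall k, (k < N)%N -> c k = 0 }.

Record graded_hopf : Prop := {
  mul_linl : forall y, linear (mul^~ y);
  mul_linr : forall x, linear (mul x);
  mul_assoc : associative mul;
  mul_1l : left_id one mul;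
  mul_1r : right_id one mul;
  one_degree : degree 0 one;
  Delta_linear : linear Delta;
  Delta_coassoc : forall x,
    tlift (fun x1 x2 => tlift (fun a b => a ⊗ (b ⊗ x2)) (Delta x1)) (Delta x)
    = tlift (fun x1 x2 => tlift (fun a b => x1 ⊗ (a ⊗ b)) (Delta x2)) (Delta x);
  eps_linear : linear eps;
  counitl : forall x, tlift (fun x1 x2 => eps x1 *: x2) (Delta x) = x;
  counitr : forall x, tlift (fun x1 x2 => eps x2 *: x1) (Delta x) = x;
  Delta_one : Delta one = one ⊗ one;
  Delta_mul : forall x y N M (a b : 'I_N -> H) (a' b' : 'I_M -> H)
      (db : 'I_N -> nat) (da' : 'I_M -> nat),
    (forall u, degree (db u) (b u)) -> (forall v, degree (da' v) (a' v)) ->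
    Delta x = \sum_u a u ⊗ b u -> Delta y = \sum_v a' v ⊗ b' v ->
    Delta (mul x y) = \sum_u \sum_v
      (-1) ^+ (db u * da' v) *: (mul (a u) (a' v) ⊗ mul (b u) (b' v));
  eps_one : eps one = 1;
  eps_mul : forall x y, eps (mul x y) = eps x * eps y;
  S_linear : linear S;
  antipodel : forall x,
    tlift (fun x1 x2 => mul (S x1) x2) (Delta x) = eps x *: one;
  antipoder : forall x,
    tlift (fun x1 x2 => mul x1 (S x2)) (Delta x) = eps x *: one }.

Record filtered_hopf : Prop := {
  mul_filt : forall i j s t x y,
    F i s x -> F j t y -> F (i + j) (s + t) (mul x y);
  Delta_filt : forall k r x, F k r x -> exists N (a b : 'I_N -> H),
    Delta x = \sum_u a u ⊗ b u /\
    forall u, exists i j s t, [/\ (i + j = k)%N, (s + t = r)%N,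
                                  F i s (a u) & F j t (b u)];
  eps_degree : forall k x, (0 < k)%N -> degree k x -> eps x = 0;
  S_filt : forall k r x, F k r x -> F k r (S x) }.

Record hopf_differential : Prop := {
  bd_linear : linear bd;
  bd_filt : forall k r x, F k.+1 r x -> F k r.+1 (bd x);
  bd_degree0 : forall x, degree 0 x -> bd x = 0;
  bd_bd : forall x, bd (bd x) = 0;
  bd_mul : forall k x y, degree k x ->
    bd (mul x y) = mul (bd x) y + (-1) ^+ k *: mul x (bd y);
  bd_Delta : forall x N (a b : 'I_N -> H) (da : 'I_N -> nat),
    (forall u, degree (da u) (a u)) -> Delta x = \sum_u a u ⊗ b u ->
    Delta (bd x) =
      \sum_u (bd (a u) ⊗ b u + (-1) ^+ da u *: (a u ⊗ bd (b u))) }.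

Definition filtered_dg_hopf : Prop :=
  [/\ filtered_graded, graded_hopf, filtered_hopf & hopf_differential].

End Hopf.

#[short(type="topGroupType")]
HB.structure Definition TopGroup := {G of Topological G & Group G}.

(* Second countability is not required. *)
HB.mixin Record TopGroup_isLieGroup (R : realType) (n : nat) G of TopGroup G := {
  lie_atlas : atlas R n G;
  lie_hausdorff : hausdorff_space G;
  lie_is_atlas : is_atlas lie_atlas;
  lie_mul_smooth : smooth_map (prod_atlas lie_atlas lie_atlas) lie_atlas
    (fun xy : G * G => (xy.1 * xy.2)%g);
  lie_inv_smooth : smooth_map lie_atlas lie_atlas (fun x : G => x^-1%g) }.

#[short(type="lieGroupType")]
HB.structure Definition LieGroup (R : realType) (n : nat) :=
  {G of TopGroup_isLieGroup R n G & TopGroup G}.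

Section LieGroupCurrents.
Context (R : realType) (n : nat) (G : lieGroupType R n).

Local Notation A := (lie_atlas : atlas R n G).
Local Notation AA := (prod_atlas A A).
Local Notation e := (1%g : G).

Definition left_invariant (v : 'rV[R]_n) : G -> 'rV[R]_n := fun p =>
  v *m tangent_mx A A (fun g => (p * g)%g) e.

Definition right_invariant (k : nat) (al : 'M[R]_(k, n)) : G -> 'M[R]_(k, n) :=
  fun p => al *m tangent_mx A A (fun g => (g * p)%g) e.

(* For v = v_1 ... v_r in U(g) and al = al_1 /\ ... /\ al_k, the functional
   w |-> (v(w))_p(al) on k-forms. *)
Definition frame_current (v al : seq 'rV[R]_n) (p : G) : current R n G :=
  fun w => let k := tag w in
  if `[< smooth_form A (tagged w) >] && (k == size al) then
    foldr (fun u eta => lie_derivative A (left_invariant u) eta) (tagged w) v p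
      (right_invariant (\matrix_(i < k) nth 0 al i) p)
  else 0.

(* The fibre U(G; p) is [ptcurrent A p]. The framing is given by the spanning
   elements of U(g) ⊗ /\g; the default value of [insubd] is never used, as
   [frame_current] is always a current supported at [p]. *)
Definition current_bundle : fbundle R G :=
  @FBundle R G (fun p => ptcurrent A p) (seq 'rV[R]_n * seq 'rV[R]_n)%type
    (fun i p => insubd (0 : ptcurrent A p) (frame_current i.1 i.2 p)).

Definition CG : lmodType R := gfin current_bundle.

Definition CG_filt (k r : nat) : set CG :=
  [set s : CG | forall p, order_le A k r (ptval (s p))].

(* The identification of Gamma^finite(U(G)) with currents of finite support. *)
Definition CG_current (s : CG) : current R n G :=
  \sum_(p \in gsupp s) ptval (s p).

Definition is_unit_current (one : CG) : Prop :=
  (forall w : form R n G 0, smooth_form A w ->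
     cev (CG_current one) w = w e 0) /\
  (forall k (w : form R n G k.+1), cev (CG_current one) w = 0).

Definition is_cross (T S : current R n G) (Z : current R (n + n) (G * G)) :
    Prop :=
  (forall k, is_current AA (cev Z (k := k))) /\
  (forall i j (w : form R n G i) (v : form R n G j),
     smooth_form A w -> smooth_form A v ->
     cev Z (wedge (pullback AA A fst w) (pullback AA A snd v)) =
     cev T w * cev S v).

Definition is_convolution (mul : CG -> CG -> CG) : Prop :=
  forall s t, exists2 Z, is_cross (CG_current s) (CG_current t) Z &
    forall k (w : form R n G k), smooth_form A w ->
      cev (CG_current (mul s t)) w =
      cev Z (pullback AA A (fun xy : G * G => (xy.1 * xy.2)%g) w).

Definition is_coproduct (Delta : CG -> tensor CG CG) : Prop :=
  linear Delta /\
  forall p (T : current_bundle p),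
  exists2 t : tensor (current_bundle p) (current_bundle p),
    Delta (gdelta T) = tlift (fun a b => gdelta a ⊗ gdelta b) t &
    forall k l (w : form R n G k) (v : form R n G l),
      smooth_form A w -> smooth_form A v ->
      tlift (fun T1 T2 => cev (ptval T1) w * cev (ptval T2) v) t =
      cev (ptval T) (wedge w v).

Definition is_counit (eps : CG -> R^o) : Prop :=
  forall s, eps s = cev (CG_current s) (@unit_form R n G).

Definition is_boundary (bd : CG -> CG) : Prop :=
  forall s k (w : form R n G k), smooth_form A w ->
    cev (CG_current (bd s)) w = cev (CG_current s) (extd A w).

Definition product_induced (mul : CG -> CG -> CG) : Prop :=
  exists2 phi : forall pq : G * G,
      box_bundle current_bundle current_bundle pq ->
      current_bundle (pq.1 * pq.2)%g,
    smooth_bundle_map AA A phi &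
    forall s t, mul s t = gamma phi (gbox s t).

Definition coproduct_induced (Delta : CG -> tensor CG CG) : Prop :=
  exists2 phi : forall p : G,
      current_bundle p -> diag_bundle current_bundle p,
    smooth_bundle_map A A (f := id) phi &
    forall s, Delta s = gdiag (gamma (f := id) phi s).

Definition counit_induced (eps : CG -> R^o) : Prop :=
  exists2 phi : forall p : G, current_bundle p -> triv_bundle R G p,
    smooth_bundle_map A A (f := id) phi &
    forall s, eps s = gsum (gamma (f := id) phi s).

Definition endo_induced (f : G -> G) (h : CG -> CG) : Prop :=
  exists2 phi : forall p : G, current_bundle p -> current_bundle (f p),
    smooth_bundle_map A A phi & forall s, h s = gamma phi s.

End LieGroupCurrents.

(* Main.v *)
(* By Taylor's formula and a cut-off estimate, a current supported at a point p
   is a finite combination of the functionals [E p a s], which differentiate the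
   coefficient of a form on the vectors s, read in the chart at p, along the
   vectors a. On them the structure maps are explicit: the product and the
   antipode are push-forwards (of cross products, which concatenate), the
   boundary appends a derivative, and the coproduct sums over the ways of
   splitting s and a. The Hopf identities are checked on these generators, or by
   evaluation on pairs of forms, which separates the points of the tensor
   products.
   For smoothness let K(al) be evaluation on al at the identity e, D_u the
   boundary of K(u), and delta_p the Dirac current. By Cartan's formula,
   convolution on the right by D_u is the Lie derivative along the left-invariant
   field of u, so the frame is K(al) * delta_p * D_(u_1) * ... * D_(u_r). At p = e
   the frame spans, by induction on the order through principal symbols. Since
   delta_p * K(u) = K(Ad_p u) * delta_p, and hence D_u * delta_p =
   delta_p * D_(Ad_(p^-1) u), with Ad smooth, every structure map has smooth
   coefficients in the frame. *)
Require Import Defs.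
From HB Require Import structures.
From mathcomp Require Import all_boot all_order all_algebra perm.
From mathcomp Require Import all_classical all_reals all_analysis.
From mathcomp Require Import ring lra zify.
(* Repeated because MathComp shadows the name [form]. *)
Require Import Defs.

Set Implicit Arguments.
Unset Strict Implicit.
Unset Printing Implicit Defensive.

Import Order.TTheory GRing.Theory Num.Theory.
Import numFieldNormedType.Exports.

Local Open Scope classical_set_scope.
Local Open Scope ring_scope.

(** * C^k functions *)

(** Three obstacles shape the proof. The fibres over [(p * q) * r] and [p * (q * r)] are different
    types, so identities between products are stated in [CG G], where [dg_eq] compares deltas at
    provably equal points by their values on forms. Signs depend on degrees, which a general current
    does not have; they are carried by the involution that is (-1)^k in degree k ([sg] on forms,
    [csig] on currents), so that every signed rule becomes an equality of linear or bilinear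
    expressions, and the axioms about homogeneous decompositions follow by evaluating it. Finally
    [tlift] is computed on an arbitrary decomposition of a tensor; its value is independent of the
    choice because linear functionals separate the points of the target, for spaces of currents by
    evaluation on smooth forms. On lists of vectors, wedge and exterior derivative are governed by
    contraction with the first vector, which turns associativity and the Leibniz rule into
    inductions on the list. Coassociativity and the rule for the boundary of a coproduct are their
    transposes. The antipode identities come from the diagonal followed by a map that is constant on
    it. *)

Section CkGeneral.
Context (R : realType) (V W : normedModType R).
Implicit Types (O : set V) (f g : V -> W).

Lemma near_open O (x : V) (P : V -> Prop) :
  open O -> O x -> (forall y, O y -> P y) -> \forall y \near x, P y.
Proof.
by move=> oO Ox OP; near=> y; apply: OP; near: y; exact: open_nbhs_nbhs.
Unshelve. all: by end_near. Qed.

Lemma Ck_cont m O f x : Ck m O f -> O x -> {for x, continuous f}.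
Proof. by case: m => [|m] [cf _]; exact: cf. Qed.

Lemma Ck_ext m O f g : open O -> (forall x, O x -> f x = g x) ->
  Ck m O f -> Ck m O g.
Proof.
move=> oO.
have ext_cont f' g' x : O x -> (forall x, O x -> f' x = g' x) ->
    {for x, continuous f'} -> {for x, continuous g'}.
  move=> Ox fg cf; have := cf; rewrite /prop_for /continuous_at -(fg x Ox) => cfx.
  apply: cvg_trans cfx; apply: near_eq_cvg.
  exact: (near_open oO Ox).
elim: m f g => [|m IH] f g fg [cf Df].
  by split=> // x Ox; exact: (ext_cont f g x Ox fg (cf x Ox)).
split.
  by move=> x Ox; exact: (ext_cont f g x Ox fg (cf x Ox)).
move=> v; split=> [x Ox|].
  apply: near_eq_derivable ((Df v).1 x Ox).
  exact: (near_open oO Ox).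
apply: IH (Df v).2 => x Ox; apply: near_eq_derive; exact: (near_open oO Ox).
Qed.

Lemma Ck_sub m O O' f : O' `<=` O -> Ck m O f -> Ck m O' f.
Proof.
move=> OO'; elim: m f => [|m IH] f [cf Df].
  by split=> // x /OO'; exact: cf.
split=> [x /OO'|v]; first exact: cf.
by split=> [x /OO'/(Df v).1//|]; apply: IH (Df v).2.
Qed.

Lemma CkW m O f : Ck m.+1 O f -> Ck m O f.
Proof.
elim: m f => [|m IH] f [cf Df]; first by split.
by split=> // v; split; [exact: (Df v).1|exact: IH (Df v).2].
Qed.

Lemma Ck_le m k O f : (m <= k)%N -> Ck k O f -> Ck m O f.
Proof. by move=> /subnK <-; elim: (k - m)%N => // d IH /CkW. Qed.

Lemma CkD m O f g : open O -> Ck m O f -> Ck m O g -> Ck m O (f + g).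
Proof.
move=> oO; elim: m f g => [|m IH] f g [cf Df] [cg Dg].
  by split=> // x Ox; apply: cvgD; [exact: cf|exact: cg].
split=> [x Ox|v]; first by apply: cvgD; [exact: cf|exact: cg].
split=> [x Ox|]; first by apply: derivableD; [exact: (Df v).1|exact: (Dg v).1].
apply: (Ck_ext oO _ (IH _ _ (Df v).2 (Dg v).2)) => x Ox /=.
by rewrite deriveD//; [exact: (Df v).1|exact: (Dg v).1].
Qed.

Lemma Ck_cst m O (c : W) : Ck m O (cst c).
Proof.
elim: m c => [|m IH] c.
  by split=> // x _; exact: cvg_cst.
split=> [x _|v]; first exact: cvg_cst.
split=> [x _|]; first exact: derivable_cst.
rewrite (_ : (fun x => _) = cst 0); first exact: IH.
by apply/funext => x; rewrite derive_cst.
Qed.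

End CkGeneral.

Lemma CkM (R : realType) (V : normedModType R) m (O : set V) (f g : V -> R^o) :
  open O -> Ck m O f -> Ck m O g -> Ck m O (f * g : V -> R^o).
Proof.
move=> oO; elim: m f g => [|m IH] f g Cf Cg.
  split=> // x Ox; apply: (@cvgM R); [exact: (Ck_cont Cf)|exact: (Ck_cont Cg)].
case: (Cf) (Cg) => [cf Df] [cg Dg].
split=> [x Ox|v]; first by apply: (@cvgM R); [exact: cf|exact: cg].
split=> [x Ox|].
  by apply: (@derivableM R V); [exact: (Df v).1|exact: (Dg v).1].
apply: (Ck_ext oO _ (CkD oO (IH _ _ (CkW Cf) (Dg v).2) (IH _ _ (CkW Cg) (Df v).2))).
move=> x Ox /=; rewrite (@deriveM R V)//; [exact: (Df v).1|exact: (Dg v).1].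
Qed.

(** * Mean values along lines and symmetry of second derivatives *)

Section Line.
Context (R : realType) (V : normedModType R).

Lemma line_quotient (W : normedModType R) (f : V -> W) x v (s : R) :
  (fun h : R => h^-1 *: (((fun t => f (t *: v + x)) \o shift s) (h *: 1) - f (s *: v + x)))
  = (fun h : R => h^-1 *: ((f \o shift (s *: v + x)) (h *: v) - f (s *: v + x))).
Proof.
by apply/funext => h /=; rewrite [h%:A]mulr1 scalerDl addrA.
Qed.

Lemma is_derive_line (W : normedModType R) (f : V -> W) x v (s : R) :
  derivable f (s *: v + x) v ->
  is_derive s 1 (fun t : R => f (t *: v + x)) ('D_v f (s *: v + x)).
Proof.
move=> df; split; first by rewrite /derivable line_quotient.
by rewrite /derive line_quotient.
Qed.

(** The sign of [t] is free: the one-variable theorem is applied on [[0, t]] or on [[t, 0]]. *)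
Lemma MVT_line (f : V -> R^o) x v (t : R) :
  (forall s : R, `|s| <= `|t| -> derivable f (s *: v + x) v) ->
  exists2 s : R, `|s| <= `|t| & f (t *: v + x) - f x = t * 'D_v f (s *: v + x).
Proof.
move=> df.
pose g (s : R) : R := f (s *: v + x); pose dg (s : R) : R := 'D_v f (s *: v + x).
have dgP (s : R) : `|s| <= `|t| -> is_derive s 1 g (dg s).
  by move=> st; apply: is_derive_line; exact: df.
have g0 : g 0 = f x by rewrite /g scale0r add0r.
case: (lerP 0 t) => [t0|/ltW t0].
  have In s : s \in `[0, t] -> `|s| <= `|t|.
    by rewrite in_itv /= => /andP[s0 st]; rewrite !ger0_norm.
  have [||c ct e] := @MVT_segment R g dg 0 t t0.
  - by move=> s /subset_itv_oo_cc /In /dgP.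
  - by apply: derivable_within_continuous => s /In /dgP H; exact: (@ex_derive _ _ _ _ _ _ _ H).
  exists c; first exact: In.
  by move: e; rewrite g0 subr0 mulrC.
have In s : s \in `[t, 0] -> `|s| <= `|t|.
  by rewrite in_itv /= => /andP[ts s0]; rewrite !ler0_norm// lerN2.
have [||c ct e] := @MVT_segment R g dg t 0 t0.
- by move=> s /subset_itv_oo_cc /In /dgP.
- by apply: derivable_within_continuous => s /In /dgP H; exact: (@ex_derive _ _ _ _ _ _ _ H).
exists c; first exact: In.
by apply: oppr_inj; rewrite opprB -g0 -/(g t) e sub0r mulrN mulrC.
Qed.

Lemma derive_shift_arg (W : normedModType R) (f : V -> W) (a x v : V) :
  'D_v (fun y => f (a + y)) x = 'D_v f (a + x).
Proof.
rewrite /derive (_ : (fun h : R => _) = (fun h : R =>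
  h^-1 *: ((f \o shift (a + x)) (h *: v) - f (a + x))))//.
by apply/funext => h /=; rewrite addrCA.
Qed.

Lemma derivable_shift_arg (W : normedModType R) (f : V -> W) (a x v : V) :
  derivable (fun y => f (a + y)) x v = derivable f (a + x) v.
Proof.
rewrite /derivable (_ : (fun h : R => _) = (fun h : R =>
  h^-1 *: ((f \o shift (a + x)) (h *: v) - f (a + x))))//.
by apply/funext => h /=; rewrite addrCA.
Qed.

End Line.

Lemma ball_of_near (R : realType) (V : normedModType R) (x : V) (P : V -> Prop) :
  (\forall y \near x, P y) ->
  exists2 d : R, 0 < d &forall h, `|h| < d -> P (h + x).
Proof.
move=> /nbhs_normP[d d0 dP]; exists d => // h hd; apply: dP.
by rewrite /= opprD addrC subrK normrN.
Qed.

(** The second difference of [f] over the parallelogram with sides [t *: u] and [t *: v] is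
    symmetric in the two directions. Two mean value steps express it as [t * t] times either mixed
    derivative at a nearby point, and continuity lets that point tend to [x]. *)
Lemma schwarz (R : realType) (V : normedModType R) (O : set V) (f : V -> R^o) x u v :
  open O -> O x -> Ck 2 O f -> 'D_u (fun y => 'D_v f y) x = 'D_v (fun y => 'D_u f y) x.
Proof.
move=> oO Ox Cf.
have half (a b : V) (e : R) : 0 < e -> exists2 d : R, 0 < d & forall t : R, 0 < t -> t < d ->
  exists2 z : R, `|z - 'D_b (fun y => 'D_a f y) x| < e &
  f (t *: a + (t *: b + x)) - f (t *: a + x) - (f (t *: b + x) - f x) = t * (t * z).
  move=> e0.
  have [cf Df] := Cf; have [dfa [cfa Dfa]] := Df a; have [dfab [cfab _]] := Dfa b.
  have near1 : \forall y \near x, O y /\ `|'D_b (fun y => 'D_a f y) y - 'D_b (fun y => 'D_a f y) x| < e.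
    near=> y; split; near: y; first exact: open_nbhs_nbhs.
    by have /cvgr_distC_lt := cfab x Ox; apply.
  have [d d0 dP] := ball_of_near near1.
  have ab0 : 0 < `|a| + `|b| + 1 by rewrite ltr_wpDl// addr_ge0.
  (* The [1] keeps the denominator positive when [a] and [b] both vanish; the radius keeps
     [r *: a + s *: b] inside the ball of radius [d] for [r] and [s] bounded by [t]. *)
  exists (d / (`|a| + `|b| + 1)); first by rewrite divr_gt0.
  move=> t t0 td.
  have small (r s : R) : `|r| <= `|t| -> `|s| <= `|t| -> `|r *: a + s *: b| < d.
    move=> rt st; rewrite (le_lt_trans (ler_normD _ _))// !normrZ.
    rewrite (@le_lt_trans _ _ (`|t| * (`|a| + `|b| + 1)))//; last first.
      by rewrite gtr0_norm// -ltr_pdivlMr.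
    rewrite mulrDr mulrDr -addrA lerD ?ler_wpM2r//.
    by rewrite ler_wpDr ?ler_wpM2r// mulr1.
  have inO (r s : R) : `|r| <= `|t| -> `|s| <= `|t| -> O (s *: b + (r *: a + x)).
    by move=> rt st; rewrite addrCA addrA; exact: (dP _ (small _ _ rt st)).1.
  have inO0 (r : R) : `|r| <= `|t| -> O (r *: a + x).
    by move=> rt; have := inO r 0 rt; rewrite normr0 normr_ge0 scale0r add0r; apply.
  pose g y := f (t *: b + y) - f y.
  have dg1 (s : R) : `|s| <= `|t| -> derivable (fun y => f (t *: b + y)) (s *: a + x) a.
    by move=> st; rewrite derivable_shift_arg; apply: dfa; exact: inO.
  have dg2 (s : R) : `|s| <= `|t| -> derivable f (s *: a + x) a.
    by move=> st; apply: dfa; exact: inO0.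
  have [|s st eg] := @MVT_line R V g x a t.
    by move=> s st; apply: derivableB; [exact: dg1|exact: dg2].
  have eD : 'D_a g (s *: a + x) = 'D_a f (t *: b + (s *: a + x)) - 'D_a f (s *: a + x).
    by rewrite deriveB ?derive_shift_arg//; [exact: dg1|exact: dg2].
  have [|r rt er] := @MVT_line R V (fun y => 'D_a f y) (s *: a + x) b t.
    by move=> r rt; apply: dfab; exact: inO.
  exists ('D_b (fun y => 'D_a f y) (r *: b + (s *: a + x))).
    by rewrite addrCA addrA; exact: (dP _ (small _ _ st rt)).2.
  by rewrite -er -eD -eg /g [t *: b + (t *: a + x)]addrCA.
apply/eqP; rewrite -subr_eq0 -normr_le0; apply/ler_addgt0Pl => e e0; rewrite addr0.
have e20 : 0 < e / 2 by rewrite divr_gt0.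
have [d d0 dP] := half u v _ e20; have [d' d'0 d'P] := half v u _ e20.
pose t := Num.min d d' / 2.
have m0 : 0 < Num.min d d' by rewrite lt_min d0.
have t0 : 0 < t by rewrite divr_gt0.
have tm : t < Num.min d d' by rewrite ltr_pdivrMr// ltr_pMr// ltr1n.
have [||z zP ez] := dP t; rewrite ?(lt_le_trans tm)// ?ge_min ?lexx//.
have [||z' z'P ez'] := d'P t; rewrite ?(lt_le_trans tm)// ?ge_min ?lexx ?orbT//.
(* Both estimates describe the same second difference, so the two intermediate values agree after
   cancelling [t] twice. *)
have zz : z = z'.
  have tt : t != 0 by rewrite gt_eqF.
  apply: (mulfI tt); apply: (mulfI tt); rewrite -ez -ez' addrCA.
  by rewrite !opprB addrACA [RHS]addrACA [- f _ - _]addrC.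
have tri (p q w : R) : `|w - p| < e / 2 -> `|w - q| < e / 2 -> `|q - p| <= e.
  move=> wp wq; have -> : q - p = (w - p) - (w - q) by rewrite opprB [RHS]addrC subrKA.
  by rewrite (splitr e) (le_trans (ler_normB _ _))// lerD// ltW.
by apply: tri z'P; rewrite -zz.
Unshelve. all: by end_near. Qed.

(** * Continuous partial derivatives imply differentiability *)

Section C1.
Context (R : realType) (n : nat).
Local Notation V := 'rV[R]_n.
Local Notation e_ i := (delta_mx 0 i : 'rV[R]_n).

Lemma mx_norm_coord (h : V) i : `|h 0 i| <= `|h|.
Proof.
rewrite [leRHS]/Num.Def.normr /= mx_normrE.
by apply/bigmax_geP; right; exists (0, i).
Qed.

Lemma mx_norm_le (h : V) (M : R) : 0 <= M -> (forall i, `|h 0 i| <= M) -> `|h| <= M.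
Proof.
move=> M0 hM; rewrite [leLHS]/Num.Def.normr /= mx_normrE; apply/bigmax_leP; split=> //.
by move=> [i j] _ /=; rewrite ord1.
Qed.

(** A linear form with given coefficients on row vectors is continuous, so the explicit first-order
    estimate identifies it as the differential. *)
Lemma differentiable_crit (f : V -> R^o) x (c : 'I_n -> R) :
  (forall e : R, 0 < e -> \forall h \near (0 : V),
     `|f (h + x) - f x - \sum_i h 0 i * c i| <= e * `|h|) ->
  differentiable f x.
Proof.
move=> fP.
pose df (h : V) : R^o := \sum_i h 0 i * c i.
have df_lin : linear df.
  move=> a u v; rewrite /df scaler_sumr -big_split; apply: eq_bigr => i _ /=.
  by rewrite !mxE mulrDl /GRing.scale /= mulrA.
pose dfM := GRing.isLinear.Build R V R^o _ df df_lin.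
pose dfL : {linear V -> R^o} := HB.pack df dfM.
have cdf : continuous dfL.
  have cr (r : seq 'I_n) : continuous (fun h : V => \sum_(i <- r) h 0 i * c i : R^o).
    elim: r => [|i r IH] h.
      have -> : (fun y : V => \sum_(j <- [::]) y 0 j * c j : R^o) = (fun=> 0).
        by apply/funext => y; rewrite big_nil.
      exact: cst_continuous.
    have -> : (fun y : V => \sum_(j <- i :: r) y 0 j * c j : R^o) =
        (fun y : V => y 0 i * c i : R^o) + (fun y : V => \sum_(j <- r) y 0 j * c j : R^o).
      by apply/funext => y; rewrite big_cons.
    apply: (@continuousD R R^o V); last exact: IH.
    exact: (@continuousM R V (fun y => y 0 i) (cst (c i)) h
      (@coord_continuous R 1 n 0 i h) (@cst_continuous V R (c i) h)).
  exact: cr.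
have fo : f \o shift x = (cst (f x) + dfL) +o_ (0 : V) id.
  apply/eqaddoP => e e0; have := fP e e0; apply: filterS => h.
  by rewrite /= -[(_ - _) h]/(f (h + x) - (f x + df h)) opprD addrA.
by apply/diff_locallyP; rewrite (diff_unique cdf fo).
Qed.

(** The increment is split along a path that changes one coordinate at a time. On each edge the mean
    value theorem gives a partial derivative at a nearby point, and continuity replaces it by its
    value at [x]. *)
Lemma C1_differentiable (O : set V) (f : V -> R^o) x :
  open O -> O x -> Ck 1 O f -> differentiable f x.
Proof.
move=> oO Ox [_ Df].
apply: (@differentiable_crit _ _ (fun i => 'D_(e_ i) f x)) => e e0.
(* There are [n] edges, each with an error of at most this multiple of the norm of [h]; [n.+1]
   avoids a zero denominator. *)
have e'0 : 0 < e / n.+1%:R by rewrite divr_gt0.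
have near1 : \forall y \near x, O y /\
    forall i, `|'D_(e_ i) f y - 'D_(e_ i) f x| < e / n.+1%:R.
  near=> y; split; near: y; first exact: open_nbhs_nbhs.
  apply: filter_forall => i.
  have /cvgr_distC_lt := (Df (e_ i)).2.1 x Ox; exact.
have [d d0 dP] := ball_of_near near1.
have : \forall h \near (0 : V), `|h| < d.
  by apply/nbhs_normP; exists d => //= h; rewrite /= sub0r normrN.
apply: filterS => h hd.
(* [hk k] keeps the first [k] coordinates of [h], so [hk i.+1] and [hk i] differ only in coordinate
   [i]. *)
pose hk k : V := \row_j if (j < k)%N then h 0 j else 0.
have hk0 : hk 0%N = 0 by apply/rowP => j; rewrite !mxE.
have hkn : hk n = h by apply/rowP => j; rewrite !mxE ltn_ord.
have hkS (i : 'I_n) : hk i.+1 = h 0 i *: e_ i + hk i.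
  apply/rowP => j; rewrite !mxE eqxx ltnS leq_eqVlt -val_eqE /=.
  by case: (ltngtP j i) => [ji|ji|/val_inj ->]; rewrite ?mulr0 ?add0r ?mulr1 ?addr0.
have -> : f (h + x) - f x = \sum_(i < n) (f (hk i.+1 + x) - f (hk i + x)).
  rewrite -(big_mkord xpredT (fun i => f (hk i.+1 + x) - f (hk i + x))).
  by rewrite (telescope_sumr (fun i => f (hk i + x)))// hk0 hkn add0r.
rewrite -sumrB (le_trans (ler_norm_sum _ _ _))//.
rewrite (@le_trans _ _ (\sum_(i < n) (e / n.+1%:R * `|h|)))//; last first.
  rewrite sumr_const card_ord -mulrnAl ler_wpM2r//.
  rewrite -mulr_natr -mulrA ger_pMr// ler_pdivrMl// mulr1.
  by rewrite ler_nat.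
apply: ler_sum => i _.
have small (s : R) : `|s| <= `|h 0 i| -> `|s *: e_ i + hk i| < d.
  move=> sh; apply: le_lt_trans hd; apply: mx_norm_le => // j.
  rewrite !mxE eqxx /=; have [->|ji] := eqVneq j i.
    by rewrite ltnn mulr1 addr0 (le_trans sh)// mx_norm_coord.
  rewrite mulr0 add0r; case: ifP => _; first exact: mx_norm_coord.
  by rewrite normr0.
have [s sh es] : exists2 s : R, `|s| <= `|h 0 i| &
    f (h 0 i *: e_ i + (hk i + x)) - f (hk i + x) =
    h 0 i * 'D_(e_ i) f (s *: e_ i + (hk i + x)).
  apply: MVT_line => s sh; apply: (Df _).1; rewrite addrA; exact: (dP _ (small _ sh)).1.
have -> : hk i.+1 + x = h 0 i *: e_ i + (hk i + x) by rewrite hkS addrA.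
rewrite es -mulrBr normrM mulrC ler_pM//; last exact: mx_norm_coord.
by rewrite addrA ltW//; exact: (dP _ (small _ sh)).2.
Unshelve. all: by end_near. Qed.

End C1.

(** * Germs of smooth functions and the chain rule *)

Section Smooth.
Context (R : realType).

Local Notation e_ i := (delta_mx 0 i).

Lemma near_openE (T : topologicalType) (x : T) (P : T -> Prop) :
  (\forall y \near x, P y) -> exists U, [/\ open U, U x & forall y, U y -> P y].
Proof. by rewrite /prop_near1 nbhsE => -[U [oU Ux] UP]; exists U. Qed.

Lemma cont_sum (T : topologicalType) (W : normedModType R) (I : Type) (r : seq I)
    (F : I -> T -> W) x : (forall i, {for x, continuous (F i)}) ->
  {for x, continuous (fun y => \sum_(i <- r) F i y)}.
Proof.
move=> cF; elim: r => [|i r IH].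
  have -> : (fun y => \sum_(i <- [::]) F i y) = (fun=> 0).
    by apply/funext => y; rewrite big_nil.
  exact: cst_continuous.
have -> : (fun y => \sum_(j <- i :: r) F j y) = F i + (fun y => \sum_(j <- r) F j y).
  by apply/funext => y; rewrite big_cons.
exact: continuousD.
Qed.

Lemma rv_decomp n (u : 'rV[R]_n) : u = \sum_i u 0 i *: e_ i.
Proof.
apply/rowP => j; rewrite summxE (bigD1 j)//= !mxE !eqxx mulr1 big1 ?addr0//.
by move=> i ij; rewrite !mxE (eq_sym j) (negbTE ij) mulr0.
Qed.

(** Smoothness as a condition at a point: one neighbourhood serves all orders, so the condition
    spreads to nearby points and is stable under composition. [Ck_sm1] returns to [Ck] on an open
    set. *)
Definition sm1 n (f : 'rV[R]_n -> R^o) (x : 'rV[R]_n) : Prop :=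
  exists O : set 'rV[R]_n, [/\ open O, O x & forall m, Ck m O f].

Definition smv n p (f : 'rV[R]_n -> 'rV[R]_p) (x : 'rV[R]_n) : Prop :=
  forall j, sm1 (fun y => f y 0 j) x.

(** Taken coordinatewise, so that everything reduces to scalar directional derivatives and
    differentiability is not presupposed; for smooth [f] it is the differential ([Dv_diffE]). *)
Definition Dv n p (f : 'rV[R]_n -> 'rV[R]_p) (x u : 'rV[R]_n) : 'rV[R]_p :=
  \row_j 'D_u (fun y => f y 0 j : R^o) x.

Section Scalar.
Context (n : nat).
Implicit Types (f g : 'rV[R]_n -> R^o) (x u v : 'rV[R]_n).

Lemma sm1_near f x : sm1 f x -> \forall y \near x, sm1 f y.
Proof. by case=> O [oO Ox Cf]; apply: (near_open oO Ox) => y Oy; exists O. Qed.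

Lemma sm1_ext f g x : (\forall y \near x, f y = g y) -> sm1 f x -> sm1 g x.
Proof.
move=> fg [D [oO Ox Cf]].
have [U [oU Ux UP]] := near_openE fg.
exists (D `&` U); split; [exact: openI|by []|move=> m].
apply: (Ck_ext (openI oO oU) _ (Ck_sub (@subIsetl _ _ _) (Cf m))) => y [_ Uy].
exact: UP.
Qed.

Lemma sm1_eq f g x : f =1 g -> sm1 f x -> sm1 g x.
Proof. by move=> /funext ->. Qed.

Lemma sm1_cst (c : R) x : sm1 (fun=> c) x.
Proof. by exists setT; split; [exact: openT|by []|move=> m; exact: Ck_cst]. Qed.

Lemma sm1_op2 (op : R -> R -> R) f g x :
  (forall m O f g, open O -> Ck m O f -> Ck m O g -> @Ck R 'rV[R]_n R^o m O (fun y => op (f y) (g y))) ->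
  sm1 f x -> sm1 g x -> sm1 (fun y => op (f y) (g y)) x.
Proof.
move=> opP [D [oO Ox Cf]] [D' [oO' O'x Cg]].
have oI := openI oO oO'.
exists (D `&` D'); split=> // m; apply: opP => //.
  by apply: Ck_sub (Cf m) => y [].
by apply: Ck_sub (Cg m) => y [].
Qed.

Lemma sm1D f g x : sm1 f x -> sm1 g x -> sm1 (fun y => f y + g y) x.
Proof. by apply: sm1_op2 => m O f' g' oO; exact: CkD. Qed.

Lemma sm1M f g x : sm1 f x -> sm1 g x -> sm1 (fun y => f y * g y) x.
Proof. by apply: sm1_op2 => m O f' g' oO; exact: CkM. Qed.

Lemma sm1Z (c : R) f x : sm1 f x -> sm1 (fun y => c * f y) x.
Proof. by apply: sm1M; exact: sm1_cst. Qed.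

Lemma sm1N f x : sm1 f x -> sm1 (fun y => - f y) x.
Proof.
by move=> /(sm1Z (-1)); apply: sm1_eq => y; rewrite mulN1r.
Qed.

Lemma sm1_sum (I : Type) (r : seq I) (F : I -> 'rV[R]_n -> R^o) x :
  (forall i, sm1 (F i) x) -> sm1 (fun y => \sum_(i <- r) F i y) x.
Proof.
move=> FP; elim: r => [|i r IH].
  by apply: sm1_eq (sm1_cst 0 x) => y; rewrite big_nil.
by apply: sm1_eq (sm1D (FP i) IH) => y; rewrite big_cons.
Qed.

Lemma sm1_D v f x : sm1 f x -> sm1 (fun y => 'D_v f y) x.
Proof.
case=> O [oO Ox Cf]; exists O; split=> // m.
exact: ((Cf m.+1).2 v).2.
Qed.

Lemma sm1_diff f x : sm1 f x -> differentiable f x.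
Proof. by case=> O [oO Ox Cf]; exact: C1_differentiable (Cf 1%N). Qed.

Lemma sm1_der f x v : sm1 f x -> derivable f x v.
Proof. by move/sm1_diff/diff_derivable. Qed.

Lemma sm1_cts f x : sm1 f x -> {for x, continuous f}.
Proof. by move/sm1_diff/differentiable_continuous. Qed.

Lemma D_addE f g x v : sm1 f x -> sm1 g x ->
  'D_v (fun y => f y + g y) x = 'D_v f x + 'D_v g x.
Proof. by move=> sf sg; rewrite -deriveD//; exact: sm1_der. Qed.

Lemma D_mulE f g x v : sm1 f x -> sm1 g x ->
  'D_v (fun y => f y * g y : R^o) x = 'D_v f x * g x + f x * 'D_v g x.
Proof.
move=> sf sg; rewrite (@deriveM R _ f g); [|exact: sm1_der..].
by rewrite addrC; congr (_ + _); rewrite /GRing.scale /= mulrC.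
Qed.

Lemma D_cstE (c : R) x v : 'D_v (fun=> c : R^o) x = 0.
Proof. exact: derive_cst. Qed.

Lemma D_mulcE (c : R) f x v : sm1 f x ->
  'D_v (fun y => c * f y : R^o) x = c * 'D_v f x.
Proof. by move=> sf; rewrite D_mulE ?D_cstE ?mul0r ?add0r//; exact: sm1_cst. Qed.

Lemma D_oppE f x v : sm1 f x -> 'D_v (fun y => - f y : R^o) x = - 'D_v f x.
Proof. by move=> sf; rewrite -deriveN//; exact: sm1_der. Qed.

Lemma D_sumE (I : Type) (r : seq I) (F : I -> 'rV[R]_n -> R^o) x v :
  (forall i, sm1 (F i) x) ->
  'D_v (fun y => \sum_(i <- r) F i y) x = \sum_(i <- r) 'D_v (F i) x.
Proof.
move=> FP; elim: r => [|i r IH].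
  rewrite (_ : (fun _ => _) = fun=> 0); last by apply/funext => y; rewrite big_nil.
  by rewrite big_nil D_cstE.
rewrite (_ : (fun _ => _) = fun y => F i y + \sum_(j <- r) F j y); last first.
  by apply/funext => y; rewrite big_cons.
by rewrite big_cons D_addE ?IH//; exact: sm1_sum.
Qed.

Lemma D_dirE f x a u v : sm1 f x -> 'D_(a *: u + v) f x = a * 'D_u f x + 'D_v f x.
Proof. by move=> /sm1_diff df; rewrite !deriveE// linearP. Qed.

Lemma D_basisE f x v : sm1 f x -> 'D_v f x = \sum_i v 0 i * 'D_(e_ i) f x.
Proof.
move=> /sm1_diff df; rewrite deriveE// [in LHS](rv_decomp v) linear_sum.
by apply: eq_bigr => i _; rewrite linearZ -deriveE.
Qed.

Lemma D_swap f x u v : sm1 f x -> 'D_u (fun y => 'D_v f y) x = 'D_v (fun y => 'D_u f y) x.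
Proof. by case=> O [oO Ox Cf]; exact: (@schwarz _ _ O). Qed.

Lemma sm1_coord (i : 'I_n) x : sm1 (fun y : 'rV[R]_n => y 0 i) x.
Proof.
have dE (v y : 'rV[R]_n) : derivable (fun y : 'rV[R]_n => y 0 i : R^o) y v /\
    'D_v (fun y : 'rV[R]_n => y 0 i : R^o) y = v 0 i.
  have dc := @differentiable_coord R 1 n y 0 i.
  split; first exact: diff_derivable.
  rewrite /derive; apply: lim_near_cst => //=; near=> h.
  rewrite !mxE addrK /GRing.scale /= mulrA mulVf ?mul1r//.
  by near: h; exact: nbhs_dnbhs_neq.
have ci y : {for y, continuous (fun y : 'rV[R]_n => y 0 i : R^o)}.
  exact: coord_continuous.
exists setT; split; [exact: openT|by []|move=> [|m]; split=> // v].
split=> [y _|]; first exact: (dE v y).1.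
rewrite (_ : (fun y => _) = cst (v 0 i)); first exact: Ck_cst.
by apply/funext => y; exact: (dE v y).2.
Unshelve. all: by end_near. Qed.

Lemma D_coordE (i : 'I_n) x v : 'D_v (fun y : 'rV[R]_n => y 0 i : R^o) x = v 0 i.
Proof.
rewrite /derive; apply: lim_near_cst => //=; near=> h.
rewrite !mxE addrK /GRing.scale /= mulrA mulVf ?mul1r//.
by near: h; exact: nbhs_dnbhs_neq.
Unshelve. all: by end_near. Qed.

End Scalar.

Lemma rv_cont (T : topologicalType) p (f : T -> 'rV[R]_p) x :
  (forall j, {for x, continuous (fun y => f y 0 j : R^o)}) -> {for x, continuous f}.
Proof.
move=> cf.
rewrite (_ : f = fun y => \sum_j f y 0 j *: (e_ j : 'rV[R]_p)); last first.
  by apply/funext => y; exact: rv_decomp.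
apply: (@cont_sum _ _ _ _ (fun j y => f y 0 j *: (e_ j : 'rV[R]_p))) => j.
apply: continuousZr_tmp; exact: cf.
Qed.

Lemma rv_diff n p (f : 'rV[R]_n -> 'rV[R]_p) x :
  (forall j, differentiable (fun y => f y 0 j : R^o) x) -> differentiable f x.
Proof.
move=> df.
rewrite (_ : f = \sum_j (fun y => f y 0 j *: (e_ j : 'rV[R]_p))); last first.
  by apply/funext => y; rewrite fct_sumE; exact: rv_decomp.
by apply: differentiable_sum => j; apply: differentiableZl.
Qed.

Lemma D_chain_diff n p (f : 'rV[R]_n -> 'rV[R]_p) (g : 'rV[R]_p -> R^o) x v :
  (forall j, differentiable (fun y => f y 0 j : R^o) x) -> differentiable g (f x) ->
  'D_v (fun y => g (f y)) x =
  \sum_j 'D_v (fun y => f y 0 j : R^o) x * 'D_(e_ j) g (f x).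
Proof.
move=> dfj dg; have df := rv_diff dfj.
have dgf : differentiable (g \o f) x by exact: differentiable_comp.
have fv : 'd f x v = \row_j 'D_v (fun y => f y 0 j : R^o) x.
  rewrite -deriveE// derive_mx; last exact: diff_derivable.
  by apply/rowP => j; rewrite !mxE.
rewrite -[fun y => _]/(g \o f) deriveE// diff_comp//= fv.
rewrite [X in 'd g _ X]rv_decomp linear_sum; apply: eq_bigr => j _.
by rewrite linearZ mxE (deriveE (e_ j) dg).
Qed.

(** Induction on the order, for all [g] at once: a derivative of the composite is a sum of products
    of a derivative of a coordinate of [f] with a partial derivative of [g] composed with [f], and
    each factor loses only one order. *)
Lemma Ck_comp n p m (O : set 'rV[R]_n) (O' : set 'rV[R]_p)
    (f : 'rV[R]_n -> 'rV[R]_p) (g : 'rV[R]_p -> R^o) :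
  open O -> open O' -> (forall x, O x -> O' (f x)) ->
  (forall j, Ck m O (fun y => f y 0 j : R^o)) -> Ck m O' g ->
  Ck m O (fun y => g (f y)).
Proof.
move=> oO oO' OO' Cf; elim: m g Cf => [|m IH] g Cf Cg.
  split=> // x Ox; apply: (@continuous_comp _ _ _ f g).
    by apply: rv_cont => j; exact: (Ck_cont (Cf j)).
  exact: (Ck_cont Cg (OO' _ Ox)).
have C1f j : Ck 1 O (fun y => f y 0 j : R^o) by exact: Ck_le (Cf j).
have C1g : Ck 1 O' g by exact: Ck_le Cg.
have dfj x : O x -> forall j, differentiable (fun y => f y 0 j : R^o) x.
  by move=> Ox j; exact: C1_differentiable (C1f j).
have dg x : O x -> differentiable g (f x).
  by move=> Ox; exact: C1_differentiable (OO' _ Ox) C1g.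
have dgf x : O x -> differentiable (g \o f) x.
  by move=> Ox; apply: differentiable_comp; [exact: rv_diff (dfj x Ox)|exact: dg].
split=> [x Ox|v]; first by have := differentiable_continuous (dgf x Ox).
split=> [x Ox|]; first exact: diff_derivable (dgf x Ox).
apply: (@Ck_ext _ _ _ _ _
  (\sum_j (fun y => 'D_v (fun y => f y 0 j : R^o) y * 'D_(e_ j) g (f y)) : _ -> R^o)) => //.
  move=> x Ox; rewrite fct_sumE D_chain_diff//; [exact: dfj|exact: dg].
elim/big_ind : _ => [|a b Ca Cb|j _]; [exact: Ck_cst|exact: CkD|].
apply: (CkM oO); first exact: ((Cf j).2 v).2.
apply: (IH (fun y => 'D_(e_ j) g y)) => [j'|]; first exact: CkW.
exact: (Cg.2 (e_ j)).2.
Qed.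

Section Chain.
Context (n p : nat).
Implicit Types (f : 'rV[R]_n -> 'rV[R]_p) (g : 'rV[R]_p -> R^o).

Lemma smv_cts f x : smv f x -> {for x, continuous f}.
Proof. by move=> sf; apply: rv_cont => j; exact: sm1_cts. Qed.

Lemma smv_near f x : smv f x -> \forall y \near x, smv f y.
Proof.
move=> sf; near=> y; rewrite /smv; near: y.
by apply: filter_forall => j; exact: sm1_near.
Unshelve. all: by end_near. Qed.

Lemma smv_ext f f' x : (\forall y \near x, f y = f' y) -> smv f x -> smv f' x.
Proof.
move=> ff' sf j; apply: sm1_ext (sf j).
by apply: filterS ff' => y ->.
Qed.

Lemma smv_diff f x : smv f x -> differentiable f x.
Proof. by move=> sf; apply: rv_diff => j; exact: sm1_diff. Qed.

Lemma Dv_diffE f x u : smv f x -> Dv f x u = 'd f x u.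
Proof.
move=> sf; rewrite -deriveE; last exact: smv_diff.
rewrite derive_mx; last exact/diff_derivable/smv_diff.
by apply/rowP => j; rewrite !mxE.
Qed.

Lemma Dv_lin f x : smv f x -> linear (Dv f x).
Proof. by move=> sf a u v; rewrite !Dv_diffE// linearP. Qed.

Lemma Dv_jacobian f x u : smv f x -> u *m jacobian f x = Dv f x u.
Proof. by move=> sf; rewrite -deriveEjacobian ?Dv_diffE ?deriveE//; exact: smv_diff. Qed.

Lemma Dv_ext f f' x u : (\forall y \near x, f y = f' y) -> Dv f x u = Dv f' x u.
Proof.
move=> ff'; apply/rowP => j; rewrite !mxE; apply: near_eq_derive.
by apply: filterS ff' => y ->.
Qed.

Lemma D_chain f g x v : smv f x -> sm1 g (f x) ->
  'D_v (fun y => g (f y)) x = 'D_(Dv f x v) g (f x).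
Proof.
move=> sf sg; rewrite (D_basisE _ sg) D_chain_diff; last exact: sm1_diff.
  by apply: eq_bigr => j _; rewrite mxE.
by move=> j; exact: sm1_diff.
Qed.

Lemma sm1_comp f g x : smv f x -> sm1 g (f x) -> sm1 (fun y => g (f y)) x.
Proof.
move=> sf [D' [oO' O'x Cg]].
have /choice[D OP] : forall j, exists O : set 'rV[R]_n,
  [/\ open O, O x & forall m, Ck m O (fun y => f y 0 j)] by move=> j; exact: sf.
have : \forall y \near x, (forall j, D j y) /\ D' (f y).
  near=> y; split.
    near: y; apply: filter_forall => j; have [oO Ox _] := OP j.
    exact: open_nbhs_nbhs.
  near: y; apply: (smv_cts sf); exact: open_nbhs_nbhs.
move=> /near_openE [U [oU Ux UP]].
exists U; split=> // m; apply: (@Ck_comp _ _ _ _ D') => //.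
- by move=> y /UP[].
- move=> j; have [_ _ Cj] := OP j; apply: Ck_sub (Cj m) => y /UP[+ _]; exact.
Unshelve. all: by end_near. Qed.

End Chain.

Lemma Dv_comp n p q (f : 'rV[R]_n -> 'rV[R]_p) (g : 'rV[R]_p -> 'rV[R]_q) x u :
  smv f x -> smv g (f x) -> Dv (fun y => g (f y)) x u = Dv g (f x) (Dv f x u).
Proof. by move=> sf sg; apply/rowP => j; rewrite !mxE (D_chain _ sf (sg j)). Qed.

Lemma smv_comp n p q (f : 'rV[R]_n -> 'rV[R]_p) (g : 'rV[R]_p -> 'rV[R]_q) x :
  smv f x -> smv g (f x) -> smv (fun y => g (f y)) x.
Proof. by move=> sf sg j; exact: (sm1_comp sf (sg j)). Qed.

Lemma smv_id n (x : 'rV[R]_n) : smv (fun y => y) x.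
Proof. by move=> j; exact: sm1_coord. Qed.

Lemma Dv_id n (x u : 'rV[R]_n) : Dv (fun y => y) x u = u.
Proof. by apply/rowP => j; rewrite !mxE D_coordE. Qed.

Lemma Ck_coord n p m (O : set 'rV[R]_n) (f : 'rV[R]_n -> 'rV[R]_p) j :
  open O -> Ck m O f -> Ck m O (fun y => f y 0 j : R^o).
Proof.
move=> oO; elim: m f => [|m IH] f Cf.
  split=> // x Ox; apply: (@continuous_comp _ _ _ f (fun M : 'rV[R]_p => M 0 j)).
    exact: (Ck_cont Cf).
  exact: coord_continuous.
have [cf Df] := Cf; split=> [x Ox|v].
  apply: (@continuous_comp _ _ _ f (fun M : 'rV[R]_p => M 0 j)).
    exact: (Ck_cont Cf).
  exact: coord_continuous.
split=> [x Ox|]; first by have /derivable_mxP := (Df v).1 x Ox; exact.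
apply: (Ck_ext oO _ (IH _ (Df v).2)) => x Ox /=.
by rewrite (derive_mx ((Df v).1 x Ox)) mxE.
Qed.

Lemma Ck_rv n p m (O : set 'rV[R]_n) (f : 'rV[R]_n -> 'rV[R]_p) :
  open O -> (forall j, Ck m O (fun y => f y 0 j : R^o)) -> Ck m O f.
Proof.
move=> oO; elim: m f => [|m IH] f Cf.
  by split=> // x Ox; apply: rv_cont => j; exact: (Ck_cont (Cf j)).
split=> [x Ox|v]; first by apply: rv_cont => j; exact: (Ck_cont (Cf j)).
have dv x : O x -> derivable f x v.
  by move=> Ox; apply/derivable_mxP => i j; rewrite ord1; exact: ((Cf j).2 v).1.
split=> //; apply: IH => j; apply: (Ck_ext oO _ ((Cf j).2 v).2) => x Ox /=.
by rewrite (derive_mx (dv x Ox)) mxE.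
Qed.

Lemma smv_Ck n p (O : set 'rV[R]_n) (f : 'rV[R]_n -> 'rV[R]_p) x :
  open O -> O x -> (forall m, Ck m O f) -> smv f x.
Proof. by move=> oO Ox Cf j; exists O; split=> // m; exact: Ck_coord. Qed.

Lemma Ck_sm1 n (O : set 'rV[R]_n) (f : 'rV[R]_n -> R^o) :
  open O -> (forall x, O x -> sm1 f x) -> forall m, Ck m O f.
Proof.
move=> oO sf m; elim: m f sf => [|m IH] f sf.
  by split=> // x /sf /sm1_cts.
split=> [x /sf /sm1_cts //|v]; split=> [x /sf/sm1_der //|].
by apply: IH => x /sf /sm1_D.
Qed.

Lemma Ck_smv n p (O : set 'rV[R]_n) (f : 'rV[R]_n -> 'rV[R]_p) :
  open O -> (forall x, O x -> smv f x) -> forall m, Ck m O f.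
Proof. by move=> oO sf m; apply: Ck_rv => // j; apply: Ck_sm1 => // x Ox; exact: sf. Qed.

End Smooth.

(** * Alternating functions on lists *)

Section Splits.
Context (T : Type).

(* [(k, s1, s2)] is a distribution of the entries of [s] over [s1] and [s2];
   [k] transpositions of neighbours lead from [s] to [s1 ++ s2]. *)
Fixpoint splits (s : seq T) : seq (nat * seq T * seq T) :=
  if s is u :: s' then
    [seq (t.1.1, u :: t.1.2, t.2) | t <- splits s'] ++
    [seq ((t.1.1 + size t.1.2)%N, t.1.2, u :: t.2) | t <- splits s']
  else [:: (0%N, [::], [::])].

Fixpoint Allp (I : Type) (P : I -> Prop) (r : seq I) : Prop :=
  if r is i :: r' then P i /\ Allp P r' else True.

Lemma Allp_cat (I : Type) (P : I -> Prop) r r' : Allp P r -> Allp P r' -> Allp P (r ++ r').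
Proof. by elim: r => //= i r IH [Pi /IH Pr] /Pr. Qed.

Lemma Allp_map (I J : Type) (P : J -> Prop) (h : I -> J) r :
  Allp (fun i => P (h i)) r -> Allp P (map h r).
Proof. by elim: r => //= i r IH [Pi /IH]. Qed.

Lemma Allp_impl (I : Type) (P Q : I -> Prop) r :
  (forall i, P i -> Q i) -> Allp P r -> Allp Q r.
Proof. by move=> PQ; elim: r => //= i r IH [/PQ Pi /IH]. Qed.

Lemma splits_size s :
  Allp (fun t => (size t.1.2 + size t.2)%N = size s) (splits s).
Proof.
elim: s => //= u s IH; apply: Allp_cat; apply: Allp_map; apply: Allp_impl IH => t /= <-.
  by rewrite addSn.
by rewrite addnS.
Qed.

End Splits.

Lemma splits_map (T U : Type) (L : T -> U) s :
  splits (map L s) = [seq (t.1.1, map L t.1.2, map L t.2) | t <- splits s].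
Proof.
elim: s => //= u s ->; rewrite map_cat -!map_comp; congr (_ ++ _).
by apply: eq_map => -[[k a] b] /=; rewrite size_map.
Qed.

Lemma eq_big_Forall (R : nmodType) (I : Type) (r : seq I) (F G : I -> R) (P : I -> Prop) :
  Allp P r -> (forall i, P i -> F i = G i) ->
  \sum_(i <- r) F i = \sum_(i <- r) G i.
Proof.
elim: r => [|i r IH] Pr FG; first by rewrite !big_nil.
have [Pi Pr'] := Pr.
by rewrite !big_cons FG// IH.
Qed.

Section ListForms.
Context (R : realType) (V : lmodType R).
Implicit Types (f g h : seq V -> R) (s t : seq V) (u v : V).

(** One predicate for all degrees: each length of the list is constrained separately. Vanishing is
    asked only for equal neighbours; [alt_swap] and [alt_move] reach distant positions. *)
Record alt f : Prop := {
  alt_lin : forall s1 s2 a u v,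
    f (s1 ++ (a *: u + v) :: s2) = a * f (s1 ++ u :: s2) + f (s1 ++ v :: s2);
  alt_rep : forall s1 s2 u, f (s1 ++ u :: u :: s2) = 0 }.

Lemma alt_add f s1 s2 u v : alt f ->
  f (s1 ++ (u + v) :: s2) = f (s1 ++ u :: s2) + f (s1 ++ v :: s2).
Proof. by move=> [fl _]; rewrite -[u in LHS]scale1r fl mul1r. Qed.

Lemma alt0 f s1 s2 : alt f -> f (s1 ++ 0 :: s2) = 0.
Proof.
move=> af; apply: (@addrI _ (f (s1 ++ 0 :: s2))).
by rewrite -alt_add// !addr0.
Qed.

Lemma alt_sum f s1 s2 (I : Type) (r : seq I) (c : I -> R) (F : I -> V) : alt f ->
  f (s1 ++ (\sum_(i <- r) c i *: F i) :: s2) = \sum_(i <- r) c i * f (s1 ++ F i :: s2).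
Proof.
move=> af; elim: r => [|i r IH]; first by rewrite !big_nil alt0.
by rewrite !big_cons (alt_lin af) IH.
Qed.

Lemma alt_swap f s1 s2 u v : alt f -> f (s1 ++ u :: v :: s2) = - f (s1 ++ v :: u :: s2).
Proof.
move=> af; apply/eqP; rewrite -addr_eq0; apply/eqP.
have := alt_rep af s1 s2 (u + v).
rewrite alt_add// -[s1 ++ u :: (u + v) :: s2]cat_rcons -[s1 ++ v :: (u + v) :: s2]cat_rcons.
rewrite !alt_add// !cat_rcons !(alt_rep af) add0r addr0; exact.
Qed.

Lemma alt_move f s0 s1 s2 u : alt f ->
  f (s0 ++ s1 ++ u :: s2) = (-1) ^+ size s1 * f (s0 ++ u :: s1 ++ s2).
Proof.
move=> af; elim: s1 s0 => [|v s1 IH] s0; first by rewrite mul1r.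
rewrite cat_cons -cat_rcons IH cat_rcons /= exprS -mulrA mulrCA.
by rewrite alt_swap// mulN1r mulrN.
Qed.

Lemma alt_move0 f s1 s2 u : alt f ->
  f (s1 ++ u :: s2) = (-1) ^+ size s1 * f (u :: s1 ++ s2).
Proof. exact: (@alt_move f [::]). Qed.

Lemma alt_rep_far f s1 s2 s3 u : alt f -> f (s1 ++ u :: s2 ++ u :: s3) = 0.
Proof. by move=> af; rewrite -cat_rcons alt_move// cat_rcons (alt_rep af) mulr0. Qed.

Lemma alt_pre f p : alt f -> alt (fun s => f (p ++ s)).
Proof.
by move=> af; split=> *; rewrite !catA; [rewrite (alt_lin af)|rewrite (alt_rep af)].
Qed.

Lemma alt_cons f u : alt f -> alt (fun s => f (u :: s)).
Proof. exact: (@alt_pre f [:: u]). Qed.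

Lemma alt_suf f q : alt f -> alt (fun s => f (s ++ q)).
Proof.
by move=> af; split=> *; rewrite -!catA /=; [rewrite (alt_lin af)|rewrite (alt_rep af)].
Qed.

Lemma alt_zero : alt (fun=> 0).
Proof. by split=> // *; rewrite mulr0 addr0. Qed.

Lemma alt_comb a f g : alt f -> alt g -> alt (fun s => a * f s + g s).
Proof.
move=> af ag; split=> [s1 s2 b u v|*]; last by rewrite !alt_rep// mulr0 addr0.
by rewrite (alt_lin af) (alt_lin ag) !mulrDr addrACA mulrCA.
Qed.

(** The degree involution, (-1)^k on a form of degree k. It lets graded rules be written for forms
    of mixed degree. *)
Definition sg f s : R := (-1) ^+ size s * f s.

Lemma alt_sg f : alt f -> alt (sg f).
Proof.
move=> af; split=> [s1 s2 a u v|s1 s2 u]; rewrite /sg ?(alt_rep af) ?mulr0//.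
by rewrite (alt_lin af) !size_cat /= mulrDr mulrCA.
Qed.

Lemma sgK f : sg (sg f) = f.
Proof. by apply/funext => s; rewrite /sg mulrA -expr2 sqrr_sign mul1r. Qed.

Lemma sg_cons f u : (fun s => sg f (u :: s)) = (fun s => - sg (fun s => f (u :: s)) s).
Proof. by apply/funext => s; rewrite /sg /= exprS mulN1r mulNr. Qed.

(** The wedge product, defined by making contraction with the first vector an antiderivation;
    [wl_splits] recovers the signed shuffle sum. *)
Fixpoint wl f g s : R :=
  if s is u :: s' then wl (fun t => f (u :: t)) g s' + wl (sg f) (fun t => g (u :: t)) s'
  else f [::] * g [::].

Lemma wl_splits f g s :
  wl f g s = \sum_(t <- splits s) (-1) ^+ t.1.1 * (f t.1.2 * g t.2).
Proof.
elim: s f g => [|u s IH] f g /=; first by rewrite big_seq1 mul1r.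
rewrite big_cat !big_map !IH /=; congr (_ + _); apply: eq_bigr => t _ /=.
by rewrite exprD /sg -!mulrA.
Qed.

Lemma wl_comb_l a f f' g s :
  wl (fun s => a * f s + f' s) g s = a * wl f g s + wl f' g s.
Proof.
rewrite !wl_splits mulr_sumr -big_split /=; apply: eq_bigr => t _.
by rewrite mulrDl mulrDr -!mulrA; congr (_ + _); rewrite mulrCA.
Qed.

Lemma wl_comb_r a f g g' s :
  wl f (fun s => a * g s + g' s) s = a * wl f g s + wl f g' s.
Proof.
rewrite !wl_splits mulr_sumr -big_split /=; apply: eq_bigr => t _.
by rewrite !mulrDr; congr (_ + _); ring.
Qed.

Lemma wlDl f f' g s : wl (fun s => f s + f' s) g s = wl f g s + wl f' g s.
Proof. by have := wl_comb_l 1 f f' g s; rewrite mul1r; under eq_fun do rewrite mul1r. Qed.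

Lemma wlDr f g g' s : wl f (fun s => g s + g' s) s = wl f g s + wl f g' s.
Proof. by have := wl_comb_r 1 f g g' s; rewrite mul1r; under eq_fun do rewrite mul1r. Qed.

Lemma wlNl f g s : wl (fun s => - f s) g s = - wl f g s.
Proof.
rewrite !wl_splits -sumrN; apply: eq_bigr => t _; by rewrite mulNr mulrN.
Qed.

Lemma wlNr f g s : wl f (fun s => - g s) s = - wl f g s.
Proof.
rewrite !wl_splits -sumrN; apply: eq_bigr => t _; by rewrite !mulrN.
Qed.

Lemma wl0l g s : wl (fun=> 0) g s = 0.
Proof. by rewrite wl_splits big1// => t _; rewrite mul0r mulr0. Qed.

Lemma wl0r f s : wl f (fun=> 0) s = 0.
Proof. by rewrite wl_splits big1// => t _; rewrite !mulr0. Qed.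

(** Contracting with the entries in front reduces to an empty prefix. For a repeated first vector
    the double contractions vanish, and the two mixed terms cancel because [sg] anticommutes with
    contraction. *)
Lemma wl_alt f g : alt f -> alt g -> alt (wl f g).
Proof.
move=> af ag; split=> [s1 s2 a u v|s1 s2 u].
  elim: s1 f g af ag => [|x s1 IH] f g af ag /=.
    rewrite mulrDr addrACA -!(wl_comb_l, wl_comb_r); congr (wl _ _ _ + wl _ _ _).
      by apply/funext => t; exact: (@alt_lin _ af [::]).
    by apply/funext => t; exact: (@alt_lin _ ag [::]).
  rewrite (IH _ _ (alt_cons x af) ag) (IH _ _ (alt_sg af) (alt_cons x ag)).
  by rewrite mulrDr addrACA.
elim: s1 f g af ag => [|x s1 IH] f g af ag /=; last first.
  rewrite (IH _ _ (alt_cons x af) ag) (IH _ _ (alt_sg af) (alt_cons x ag)).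
  by rewrite addr0.
have -> : (fun t => f (u :: u :: t)) = fun=> 0.
  by apply/funext => t; exact: (@alt_rep _ af [::]).
have -> : (fun t => g (u :: u :: t)) = fun=> 0.
  by apply/funext => t; exact: (@alt_rep _ ag [::]).
by rewrite wl0l wl0r sg_cons wlNl add0r addr0 subrr.
Qed.

Lemma sg_wl f g s : sg (wl f g) s = wl (sg f) (sg g) s.
Proof.
rewrite /sg !wl_splits mulr_sumr; apply: eq_big_Forall (splits_size s) _ => t /= <-.
by rewrite exprD; ring.
Qed.

(** Contracting both sides with the first vector gives three matching terms, since [sg] is
    multiplicative ([sg_wl]); induction handles each of them. *)
Lemma wl_assoc f g h s : wl (wl f g) h s = wl f (wl g h) s.
Proof.
elim: s f g h => [|u s IH] f g h /=; first by rewrite mulrA.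
rewrite wlDl wlDr !IH -addrA; congr (_ + (_ + _)).
by rewrite -IH; congr wl; apply/funext => t; exact: sg_wl.
Qed.

Definition one s : R := (size s == 0%N)%:R.

Lemma alt_one : alt one.
Proof. by split=> [s1 s2 a u v|s1 s2 u]; rewrite /one !size_cat !addnS /= ?mulr0 ?addr0. Qed.

Lemma wl1l g s : wl one g s = g s.
Proof.
elim: s g => [|u s IH] g /=; first by rewrite mul1r.
rewrite (_ : (fun t => one (u :: t)) = fun=> 0)// wl0l add0r -[RHS](IH (fun t => g (u :: t))); congr wl.
by apply/funext => -[|x t]; rewrite /sg /one /= ?mul1r ?mulr0.
Qed.

Lemma wl1r f s : wl f one s = f s.
Proof.
elim: s f => [|u s IH] f /=; first by rewrite mulr1.
by rewrite (_ : (fun t => one (u :: t)) = fun=> 0)// wl0r addr0 IH.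
Qed.

(** The product [size p.2 * size q.1.2] counts the exchanges between entries of [s] sent to [g] and
    entries of [t] sent to [f]. It becomes the Koszul sign in the coproduct of a convolution. *)
Lemma wl_cat f g s t : wl f g (s ++ t) =
  \sum_(p <- splits s) \sum_(q <- splits t)
    (-1) ^+ (p.1.1 + q.1.1 + size p.2 * size q.1.2) *
    (f (p.1.2 ++ q.1.2) * g (p.2 ++ q.2)).
Proof.
elim: s f g => [|u s IH] f g /=.
  rewrite big_seq1 /= wl_splits; apply: eq_bigr => q _.
  by rewrite mul0n addn0 add0n.
rewrite big_cat !big_map !IH /=; congr (_ + _).
apply: eq_bigr => p _; apply: eq_bigr => q _ /=.
rewrite /sg size_cat mulSn !exprD; ring.
Qed.

(** Every shuffle but the trivial one hands a vector of [t] to [f] or one of [s] to [g]. Forms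
    pulled back from the two factors of a product satisfy both conditions. *)
Lemma wl_block f g s t :
  (forall a b u, List.In u t -> f (a ++ u :: b) = 0) ->
  (forall a u, List.In u s -> g (u :: a) = 0) -> wl f g (s ++ t) = f s * g t.
Proof.
elim: s f g => [|u s IH] f g fP gP /=.
  elim: t f g fP {gP} => [|u t IH] f g fP //=.
  rewrite (_ : (fun t => f (u :: t)) = fun=> 0); last first.
    by apply/funext => a; apply: (fP [::]); left.
  rewrite wl0l add0r IH.
    by rewrite /sg mul1r.
  by move=> a b v vt; rewrite /sg fP ?mulr0//; right.
rewrite (_ : (fun t => g (u :: t)) = fun=> 0); last first.
  by apply/funext => a; apply: gP; left.
rewrite wl0r addr0 IH//.
- by move=> a b v vt; apply: (fP (u :: a)).
- by move=> a v vs; apply: gP; right.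
Qed.

End ListForms.

Lemma alt_map (R : realType) (V W : lmodType R) (L : V -> W) (f : seq W -> R) :
  linear L -> alt f -> alt (fun s => f (map L s)).
Proof.
move=> lL af; split=> [s1 s2 a u v|s1 s2 u]; rewrite !map_cat /=.
  by rewrite lL (alt_lin af).
by rewrite (alt_rep af).
Qed.

Lemma wl_map (R : realType) (V W : lmodType R) (L : V -> W) (f g : seq W -> R) s :
  wl (fun s => f (map L s)) (fun s => g (map L s)) s = wl f g (map L s).
Proof.
rewrite !wl_splits splits_map big_map; exact: eq_bigr.
Qed.

(** Each entry is expanded and the [L1] entries are sorted to the front, with the sign counted by
    [splits]. It evaluates a pullback along the diagonal, whose differential sends [u] to
    [inl u + inr u]. *)
Lemma alt_diag (R : realType) (V W : lmodType R) (L1 L2 : V -> W) (f : seq W -> R) s :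
  alt f -> f (map (fun u => L1 u + L2 u) s) =
  \sum_(t <- splits s) (-1) ^+ t.1.1 * f (map L1 t.1.2 ++ map L2 t.2).
Proof.
elim: s f => [|u s IH] f af /=; first by rewrite big_seq1 mul1r.
rewrite (@alt_add _ _ f [::])//= (IH _ (alt_cons _ af)) (IH _ (alt_cons _ af)).
rewrite big_cat !big_map /=; congr (_ + _); apply: eq_bigr => t _ /=.
rewrite exprD -mulrA; congr (_ * _).
by rewrite [in RHS]alt_move0// size_map mulrA -expr2 sqrr_sign mul1r.
Qed.

(** * Exterior calculus in a chart *)

Section ExteriorCalculus.
Context (R : realType).
Local Notation e_ i := (delta_mx 0 i).
Local Notation lform n := ('rV[R]_n -> seq 'rV[R]_n -> R^o).

Definition rem_nth (T : Type) i (s : seq T) := take i s ++ drop i.+1 s.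

Definition smw n (w : lform n) x := forall s, sm1 (fun y => w y s) x.

(** The invariant formula for the exterior derivative on constant vector fields, where the bracket
    terms vanish. *)
Definition dl n (w : lform n) (x : 'rV[R]_n) (s : seq 'rV[R]_n) : R^o :=
  \sum_(i < size s) (-1) ^+ i * 'D_(nth 0 s i) (fun y => w y (rem_nth i s)) x.

Section Local.
Context (n : nat).
Implicit Types (w v : lform n) (x y u : 'rV[R]_n) (s t : seq 'rV[R]_n).

Lemma dl_nil w x : dl w x [::] = 0.
Proof. by rewrite /dl big_ord0. Qed.

(** Cartan's formula for the constant field [u]: the contraction of dw is the derivative along [u]
    minus d of the contraction. It drives the inductions on lists of vectors. *)
Lemma dl_cons w x u s :
  dl w x (u :: s) = 'D_u (fun y => w y s) x - dl (fun y t => w y (u :: t)) x s.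
Proof.
rewrite /dl big_ord_recl /= mul1r /rem_nth /= drop0; congr (_ + _).
by rewrite -sumrN; apply: eq_bigr => i _; rewrite exprS mulN1r mulNr.
Qed.

Lemma dl_ext w v x s : (forall t, \forall y \near x, w y t = v y t) -> dl w x s = dl v x s.
Proof.
move=> wv; apply: eq_bigr => i _; congr (_ * _).
by apply: near_eq_derive; exact: wv.
Qed.

Lemma dl_zero x s : dl (fun _ _ => 0) x s = 0 :> R.
Proof. by rewrite /dl big1// => i _; rewrite D_cstE mulr0. Qed.

Lemma dl_comb a w v x s : smw w x -> smw v x ->
  dl (fun y t => a * w y t + v y t : R^o) x s = a * dl w x s + dl v x s :> R.
Proof.
move=> sw sv; rewrite /dl mulr_sumr -big_split /=; apply: eq_bigr => i _.
rewrite D_addE; [|exact/sm1Z/sw|exact: sv].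
by rewrite D_mulcE; [rewrite mulrDr mulrCA|exact: sw].
Qed.

Lemma dlN w x s : smw w x -> dl (fun y t => - w y t : R^o) x s = - dl w x s :> R.
Proof.
move=> sw; rewrite /dl -sumrN; apply: eq_bigr => i _.
by rewrite D_oppE ?mulrN//; exact: sw.
Qed.

Lemma dlD w v x s : smw w x -> smw v x ->
  dl (fun y t => w y t + v y t : R^o) x s = dl w x s + dl v x s :> R.
Proof.
move=> sw sv; have := dl_comb 1 s sw sv; rewrite mul1r => <-.
by apply: dl_ext => t; near=> y; rewrite mul1r.
Unshelve. all: by end_near. Qed.

Lemma smw_cons w x u : smw w x -> smw (fun y t => w y (u :: t)) x.
Proof. by move=> sw s; exact: sw. Qed.

Lemma smw_D w x u : smw w x -> smw (fun y t => 'D_u (fun z => w z t) y) x.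
Proof. by move=> sw s; apply: sm1_D. Qed.

Lemma smw_dl w x : smw w x -> smw (dl w) x.
Proof.
move=> sw s; apply: sm1_sum => i; apply: sm1Z; apply: sm1_D; exact: sw.
Qed.

Lemma D_dl w x u s : smw w x ->
  'D_u (fun y => dl w y s) x = dl (fun y t => 'D_u (fun z => w z t) y) x s.
Proof.
move=> sw; rewrite /dl D_sumE; last first.
  by move=> i; apply: sm1Z; apply: sm1_D; exact: sw.
apply: eq_bigr => i _; rewrite D_mulcE; last by apply: sm1_D; exact: sw.
by rewrite D_swap//; exact: sw.
Qed.

(** By [dl_cons] used twice, the contraction of ddw with u is D_u dw - d(D_u w) + dd(i_u w). The
    first two terms cancel since D_u commutes with d, and the last one vanishes by induction. *)
Lemma dl_dl w x s : smw w x -> dl (dl w) x s = 0.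
Proof.
elim: s w => [|u s IH] w sw; first exact: dl_nil.
rewrite dl_cons D_dl// [X in _ - X](@dl_ext _ (fun y t => 'D_u (fun z => w z t) y +
    - dl (fun z q => w z (u :: q)) y t)); last first.
  by move=> t; near=> y; exact: dl_cons.
have swu := smw_cons u sw.
rewrite dlD; [|exact: smw_D|by move=> t; apply: sm1N; exact: smw_dl].
rewrite dlN; last exact: smw_dl.
by rewrite IH// oppr0 addr0 subrr.
Unshelve. all: by end_near. Qed.

Lemma dl_alt w x : smw w x -> (\forall y \near x, alt (w y)) -> alt (dl w x).
Proof.
move=> sw aw; split=> [s1 s2 a u v|s1 s2 u].
  elim: s1 w sw aw => [|z s1 IH] w sw aw /=.
    rewrite !dl_cons D_dirE; last exact: sw.
    rewrite (@dl_ext _ (fun y t => a * w y (u :: t) + w y (v :: t) : R^o)).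
      by rewrite dl_comb; [lra|exact: smw_cons..].
    by move=> t; apply: filterS aw => y ay; exact: (@alt_lin _ _ _ ay [::]).
  rewrite !dl_cons IH; [|exact: smw_cons|]; last first.
    by apply: filterS aw => y ay; exact: alt_cons.
  rewrite (@near_eq_derive _ _ _ _ (fun y => a * w y (s1 ++ u :: s2) + w y (s1 ++ v :: s2) : R^o)).
    rewrite D_addE; [|exact/sm1Z/sw|exact: sw].
    by rewrite D_mulcE; [lra|exact: sw].
  by apply: filterS aw => y ay; exact: (alt_lin ay).
elim: s1 w sw aw => [|z s1 IH] w sw aw /=.
  rewrite !dl_cons opprB addrC subrK (@dl_ext _ (fun _ _ => 0)) ?dl_zero//.
  by move=> t; apply: filterS aw => y ay; exact: (@alt_rep _ _ _ ay [::]).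
rewrite !dl_cons IH; [|exact: smw_cons|]; last first.
  by apply: filterS aw => y ay; exact: alt_cons.
rewrite (@near_eq_derive _ _ _ _ (fun y => 0 : R^o)) ?D_cstE ?subr0//.
by apply: filterS aw => y ay; exact: (alt_rep ay).
Qed.

Lemma smw_wl w v x : smw w x -> smw v x -> smw (fun y t => wl (w y) (v y) t : R^o) x.
Proof.
move=> sw sv s; apply: sm1_eq (_ : sm1 (fun y => \sum_(t <- splits s)
  (-1) ^+ t.1.1 * (w y t.1.2 * v y t.2)) x) => [y|]; first by rewrite -wl_splits.
by apply: sm1_sum => t; apply: sm1Z; apply: sm1M.
Qed.

Lemma D_wl w v x u s : smw w x -> smw v x ->
  'D_u (fun y => wl (w y) (v y) s : R^o) x =
  wl (fun t => 'D_u (fun y => w y t) x) (v x) s +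
  wl (w x) (fun t => 'D_u (fun y => v y t) x) s.
Proof.
move=> sw sv; rewrite !wl_splits -big_split /=.
have -> : (fun y => wl (w y) (v y) s : R^o) = (fun y => \sum_(t <- splits s)
  (-1) ^+ t.1.1 * (w y t.1.2 * v y t.2)) by apply/funext => y; exact: wl_splits.
rewrite D_sumE; last by move=> t; apply: sm1Z; apply: sm1M.
apply: eq_bigr => t _; rewrite D_mulcE; last exact: sm1M.
by rewrite D_mulE//= mulrDr.
Qed.

Lemma smw_sg w x : smw w x -> smw (fun y t => sg (w y) t : R^o) x.
Proof. by move=> sw s; apply: sm1Z; exact: sw. Qed.

Lemma dl_sg w x s : smw w x -> dl (fun y t => sg (w y) t : R^o) x s = - sg (dl w x) s.
Proof.
move=> sw; rewrite /sg /dl mulr_sumr -sumrN; apply: eq_bigr => i _.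
rewrite D_mulcE; last exact: sw.
have e (j : nat) : (j < size s)%N -> size s = (size (rem_nth j s)).+1.
  by move=> js; rewrite size_cat size_take size_drop js -addSn subnKC.
rewrite mulrCA (_ : (-1) ^+ size s = - (-1) ^+ size (rem_nth i s) :> R).
  by rewrite mulNr opprK mulrCA.
by rewrite {1}(e i (ltn_ord i)) exprS mulN1r.
Qed.

(** Induction on the list: after contraction the derivatives along [u] obey the ordinary product
    rule, and what remains are Leibniz rules for contracted forms. The sign in [dl_sg] reflects that
    d raises the degree by one. *)
Lemma dl_wl w v x s : smw w x -> smw v x ->
  dl (fun y t => wl (w y) (v y) t : R^o) x s =
  wl (dl w x) (v x) s + wl (sg (w x)) (dl v x) s.
Proof.
elim: s w v => [|u s IH] w v sw sv.
  by rewrite dl_nil /= !dl_nil mul0r mulr0 addr0.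
rewrite dl_cons D_wl//= dlD; last 2 first.
- by apply: smw_wl => //; exact: smw_cons.
- by apply: smw_wl; [exact: smw_sg|exact: smw_cons].
rewrite !IH; try solve [exact: smw_cons|exact: smw_sg|assumption].
have -> : (fun t => dl w x (u :: t)) = (fun t => 'D_u (fun y => w y t) x +
    - dl (fun y q => w y (u :: q)) x t).
  by apply/funext => t; rewrite dl_cons.
have -> : (fun t => dl v x (u :: t)) = (fun t => 'D_u (fun y => v y t) x +
    - dl (fun y q => v y (u :: q)) x t).
  by apply/funext => t; rewrite dl_cons.
have -> : dl (fun y t => sg (w y) t : R^o) x = (fun t => - sg (dl w x) t).
  by apply/funext => t; exact: dl_sg.
rewrite !wlDl !wlDr !wlNl !wlNr sg_cons wlNl !sgK; lra.
Qed.

End Local.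

(** * Naturality of the exterior derivative *)

Definition pullv n p (g : 'rV[R]_n -> 'rV[R]_p) (w : lform p) : lform n :=
  fun x s => w (g x) (map (Dv g x) s).

Section Pull.
Context (n p : nat) (g : 'rV[R]_n -> 'rV[R]_p) (x : 'rV[R]_n) (sg_ : smv g x).
Implicit Types (w : lform p).

Lemma near_pull (P : 'rV[R]_p -> Prop) : (\forall z \near g x, P z) ->
  \forall y \near x, P (g y).
Proof. by move=> Pg; exact: (smv_cts sg_). Qed.

Lemma pull_expand w u t : (\forall z \near g x, alt (w z)) ->
  \forall y \near x, pullv g w y (u :: t) =
    \sum_k 'D_u (fun y => g y 0 k : R^o) y * pullv g (fun z q => w z (e_ k :: q)) y t.
Proof.
move=> aw; apply: filterS (near_pull aw) => y ay.
rewrite /pullv /= [Dv g y u]rv_decomp (@alt_sum _ _ _ [::])//.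
by apply: eq_bigr => k _; rewrite mxE.
Qed.

Lemma alt_near_cons w u : (\forall z \near g x, alt (w z)) ->
  \forall z \near g x, alt (fun q => w z (u :: q)).
Proof. by apply: filterS => z az; exact: alt_cons. Qed.

Lemma smw_pull w : smw w (g x) -> (\forall z \near g x, alt (w z)) -> smw (pullv g w) x.
Proof.
move=> sw aw s; elim: s w sw aw => [|u s IH] w sw aw; first exact: (sm1_comp sg_ (sw _)).
apply: sm1_ext (_ : sm1 (fun y => \sum_k 'D_u (fun y => g y 0 k : R^o) y *
    pullv g (fun z q => w z (e_ k :: q)) y s) x).
  by apply: filterS (pull_expand u s aw) => y ->.
apply: sm1_sum => k; apply: sm1M; first exact/sm1_D/sg_.
by apply: IH; [exact: smw_cons|exact: alt_near_cons].
Qed.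

Definition hess u v : 'rV[R]_p :=
  \row_k 'D_u (fun y => 'D_v (fun y => g y 0 k : R^o) y) x.

Local Notation L := (Dv g x).

(** The product-rule terms in which the derivative along [u] hits one of the factors [Dv g]: the
    entry [L v] becomes [hess u v]. *)
Fixpoint slot_sum (f : seq 'rV[R]_p -> R) u t : R :=
  if t is v :: t' then f (hess u v :: map L t') + slot_sum (fun q => f (L v :: q)) u t'
  else 0.

Lemma slot_sum_lin (c : 'I_p -> R) (f : 'I_p -> seq 'rV[R]_p -> R) u t :
  slot_sum (fun q => \sum_k c k * f k q) u t = \sum_k c k * slot_sum (f k) u t.
Proof.
elim: t f => [|v t IH] f /=; first by rewrite big1// => k _; rewrite mulr0.
by rewrite IH -big_split; apply: eq_bigr => k _ /=; rewrite mulrDr.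
Qed.

(** Expanding the first vector in the basis of the target ([pull_expand]) isolates one factor of the
    differential of [g]; the product rule and induction give the rest. *)
Lemma D_pull w u t : smw w (g x) -> (\forall z \near g x, alt (w z)) ->
  'D_u (fun y => pullv g w y t) x =
  'D_(L u) (fun z => w z (map L t)) (g x) + slot_sum (w (g x)) u t.
Proof.
elim: t w => [|v t IH] w sw aw.
  by rewrite /= addr0 (D_chain _ sg_ (sw _)).
rewrite (near_eq_derive _ (pull_expand v t aw)).
have sk k : smw (fun z q => w z (e_ k :: q)) (g x) by exact: smw_cons.
have ak k := alt_near_cons (e_ k) aw.
have spk k : sm1 (fun y => pullv g (fun z q => w z (e_ k :: q)) y t) x by exact: smw_pull.
have sDk k : sm1 (fun y => 'D_v (fun y => g y 0 k : R^o) y) x by exact/sm1_D/sg_.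
rewrite D_sumE; last by move=> k; exact: sm1M.
under eq_bigr => k _ do rewrite (D_mulE _ (sDk k) (spk k)) (IH _ (sk k) (ak k)).
have awx : alt (w (g x)) by exact: nbhs_singleton aw.
have -> : 'D_(L u) (fun z => w z (L v :: map L t)) (g x) =
    \sum_k 'D_v (fun y => g y 0 k : R^o) x * 'D_(L u) (fun z => w z (e_ k :: map L t)) (g x).
  rewrite -(near_eq_derive _ (f := fun z => \sum_k 'D_v (fun y => g y 0 k : R^o) x *
      w z (e_ k :: map L t))).
    rewrite D_sumE; last by move=> k; apply: sm1Z; exact: sk.
    by apply: eq_bigr => k _; rewrite D_mulcE//; exact: sk.
  apply: filterS aw => z az; rewrite [in RHS](rv_decomp (L v)) (@alt_sum _ _ _ [::])//.
  by apply: eq_bigr => k _; rewrite mxE.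
have -> : slot_sum (w (g x)) u (v :: t) =
  w (g x) (hess u v :: map L t) + slot_sum (fun q => w (g x) (L v :: q)) u t by [].
have -> : w (g x) (hess u v :: map L t) =
    \sum_k 'D_u (fun y => 'D_v (fun y => g y 0 k : R^o) y) x * w (g x) (e_ k :: map L t).
  rewrite [hess u v]rv_decomp (@alt_sum _ _ _ [::])//.
  by apply: eq_bigr => k _; rewrite mxE.
have -> : slot_sum (fun q => w (g x) (L v :: q)) u t =
    \sum_k 'D_v (fun y => g y 0 k : R^o) x * slot_sum (fun q => w (g x) (e_ k :: q)) u t.
  rewrite -slot_sum_lin; congr slot_sum; apply/funext => q.
  rewrite [L v]rv_decomp (@alt_sum _ _ _ [::])//.
  by apply: eq_bigr => k _; rewrite mxE.
rewrite -!big_split /=; apply: eq_bigr => k _.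
by rewrite mulrDr addrCA.
Qed.

Lemma hessC u v : hess u v = hess v u.
Proof. by apply: eq_mx => i k; exact: (D_swap u v (sg_ k)). Qed.

Lemma slot_sum_front (f : seq 'rV[R]_p -> R) u t : alt f ->
  slot_sum f u t = \sum_(j < size t) (-1) ^+ j * f (hess u (nth 0 t j) :: map L (rem_nth j t)).
Proof.
elim: t f => [|v t IH] f af /=; first by rewrite big_ord0.
rewrite big_ord_recl /= mul1r /rem_nth /= drop0; congr (_ + _).
rewrite (IH _ (alt_cons _ af)); apply: eq_bigr => j _.
by rewrite (@alt_swap _ _ _ [::])// exprS mulN1r mulrN mulNr.
Qed.

(** A symmetric second derivative meets an alternating form: each pair of entries occurs twice, once
    from either entry, with opposite signs. *)
Lemma slot_sum_cancel (f : seq 'rV[R]_p -> R) t : alt f ->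
  \sum_(i < size t) (-1) ^+ i * slot_sum f (nth 0 t i) (rem_nth i t) = 0.
Proof.
elim: t f => [|v t IH] f af /=; first by rewrite big_ord0.
rewrite big_ord_recl /= mul1r {1}/rem_nth /= drop0 slot_sum_front//.
rewrite [X in _ + X](eq_bigr (fun i : 'I_(size t) =>
    - ((-1) ^+ i * f (hess (nth 0 t i) v :: map L (rem_nth i t))) -
    (-1) ^+ i * slot_sum (fun q => f (L v :: q)) (nth 0 t i) (rem_nth i t))); last first.
  by move=> i _; rewrite exprS mulN1r mulNr /rem_nth /= mulrDr opprD.
rewrite big_split /= !sumrN (IH _ (alt_cons _ af)) oppr0 addr0 -sumrB big1// => i _.
by rewrite hessC subrr.
Qed.

(** Antisymmetrisation kills the second derivatives of [g] produced by [D_pull] and leaves the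
    derivatives of the coefficients of [w]. *)
Lemma dl_pull w s : smw w (g x) -> (\forall z \near g x, alt (w z)) ->
  dl (pullv g w) x s = dl w (g x) (map L s).
Proof.
move=> sw aw; rewrite /dl size_map.
under eq_bigr => i _ do rewrite (D_pull _ _ sw aw) mulrDr.
rewrite big_split /= slot_sum_cancel; last exact: nbhs_singleton aw.
rewrite addr0; apply: eq_bigr => i _.
by rewrite (nth_map 0)// /rem_nth map_cat map_take map_drop.
Qed.

End Pull.
End ExteriorCalculus.

Lemma open_near (T : topologicalType) (U : set T) x : open U -> U x ->
  \forall y \near x, U y.
Proof. by move=> oU Ux; exact: open_nbhs_nbhs. Qed.

(** * Forms on manifolds *)

Section Charts.
Context (R : realType) (n : nat) (X : topologicalType) (A : atlas R n X).
Hypothesis HA : is_atlas A.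
Implicit Types (p q : X) (x y : 'rV[R]_n).

Definition zp p := cmap (A p) p.

Lemma cimg_zp p : cimg (A p) (zp p).
Proof. by exists p => //; exact: atlas_mem. Qed.

Lemma cinv_zp p : cinv (A p) (zp p) = p.
Proof. by apply: (atlas_inv HA); exact: atlas_mem. Qed.

Lemma cdom_cinv q x : cimg (A q) x -> cdom (A q) (cinv (A q) x).
Proof. by case=> p dp <-; rewrite (atlas_inv HA). Qed.

Lemma cinvK q x : cimg (A q) x -> cmap (A q) (cinv (A q) x) = x.
Proof. by case=> p dp <-; rewrite (atlas_inv HA). Qed.

Lemma cimg_cmap q p : cdom (A q) p -> cimg (A q) (cmap (A q) p).
Proof. by exists p. Qed.

Lemma near_cimg q x : cimg (A q) x -> \forall y \near x, cimg (A q) y.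
Proof. by move=> qx; apply: open_nbhs_nbhs; split=> //; exact: (atlas_img_open HA). Qed.

Lemma near_cinv q x (W : X -> Prop) : cimg (A q) x ->
  (\forall p \near cinv (A q) x, W p) -> \forall y \near x, W (cinv (A q) y).
Proof. by move=> qx; exact: (atlas_inv_cont HA qx). Qed.

Lemma near_dom q x q' : cimg (A q) x -> cdom (A q') (cinv (A q) x) ->
  \forall y \near x, cdom (A q') (cinv (A q) y).
Proof.
move=> qx dx; apply: near_cinv => //.
exact: (open_near (atlas_dom_open HA q') dx).
Qed.

Lemma open_chart q (W : set X) : open W -> open (cmap (A q) @` (cdom (A q) `&` W)).
Proof.
move=> oW; rewrite openE => x [p [dp Wp] <-].
have qx := cimg_cmap dp.
have e := atlas_inv HA dp.
have Wn : \forall y \near cmap (A q) p, W (cinv (A q) y).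
  by apply: near_cinv => //; rewrite e; exact: (open_near oW Wp).
near=> y; exists (cinv (A q) y); last by apply: cinvK; near: y; exact: near_cimg.
split; last by near: y.
by apply: cdom_cinv; near: y; exact: near_cimg.
Unshelve. all: by end_near. Qed.

Definition trans q q' := fun y => cmap (A q') (cinv (A q) y).

Lemma trans_smv q q' x : cimg (A q) x -> cdom (A q') (cinv (A q) x) -> smv (trans q q') x.
Proof.
move=> qx dx.
apply: (@smv_Ck _ _ _ (cmap (A q) @` (cdom (A q) `&` cdom (A q')))).
- by apply: open_chart; exact: atlas_dom_open.
- by exists (cinv (A q) x); [split=> //; exact: cdom_cinv|exact: cinvK].
- exact: (atlas_compat HA q q').
Qed.

End Charts.

(* A form of mixed degree is a function of lists of tangent vectors, so that the
   degree does not occur in types. *)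
Notation lfm R n X := (X -> seq 'rV[R]_n -> R^o).

Section Forms.
Context (R : realType) (n : nat) (X : topologicalType) (A : atlas R n X).
Hypothesis HA : is_atlas A.
Implicit Types (p q : X) (x y : 'rV[R]_n) (om et : lfm R n X).

(** The tangent space at a point is read in that point's own chart. A constant vector of chart [q]
    must therefore be carried by the chart change to the chart at [cinv (A q) x], which varies with
    [x]. *)
Definition lf q om : 'rV[R]_n -> seq 'rV[R]_n -> R^o := fun x s =>
  om (cinv (A q) x) (map (Dv (trans A q (cinv (A q) x)) x) s).

Definition sm om := (forall p, alt (om p)) /\
  forall q x, cimg (A q) x -> smw (lf q om) x.

Lemma dom_self q x : cimg (A q) x -> cdom (A (cinv (A q) x)) (cinv (A q) x).
Proof. by move=> _; exact: atlas_mem. Qed.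

Lemma lf_zp p om s : lf p om (zp A p) s = om p s.
Proof.
rewrite /lf cinv_zp//; congr (om p _); rewrite -[RHS]map_id; apply: eq_map => u.
rewrite -[RHS](Dv_id (zp A p)); apply: Dv_ext.
by apply: filterS (near_cimg HA (cimg_zp HA p)) => y; exact: cinvK.
Qed.

Lemma lf_alt om q x : (forall p, alt (om p)) -> cimg (A q) x -> alt (lf q om x).
Proof.
move=> aom qx; apply: alt_map => //; apply: Dv_lin.
by apply: trans_smv => //; exact: dom_self.
Qed.

Lemma lf_alt_near om q x : (forall p, alt (om p)) -> cimg (A q) x ->
  \forall y \near x, alt (lf q om y).
Proof. by move=> aom qx; apply: filterS (near_cimg HA qx) => y; exact: lf_alt. Qed.

Definition wlf om et : lfm R n X := fun p s => wl (om p) (et p) s.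
Definition dform om : lfm R n X := fun p s => dl (lf p om) (zp A p) s.

Lemma lf_wlf om et q x s : lf q (wlf om et) x s = wl (lf q om x) (lf q et x) s.
Proof. by rewrite /lf /wlf wl_map. Qed.

Lemma sm_wlf om et : sm om -> sm et -> sm (wlf om et).
Proof.
move=> [ao so] [ae se]; split=> [p|q x qx s]; first exact: wl_alt.
apply: sm1_eq (smw_wl (so q x qx) (se q x qx) s) => y.
by rewrite lf_wlf.
Qed.

Lemma sm_comb a om et : sm om -> sm et -> sm (fun p s => a * om p s + et p s).
Proof.
move=> [ao so] [ae se]; split=> [p|q x qx s]; first exact: alt_comb.
by apply: sm1D; [apply: sm1Z; exact: so|exact: se].
Qed.

Lemma sm_zero : sm (fun _ _ => 0).
Proof. by split=> [p|q x qx s]; [exact: alt_zero|exact: sm1_cst]. Qed.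

Lemma sm_one : sm (fun _ => @one R 'rV[R]_n).
Proof.
split=> [p|q x qx s]; first exact: alt_one.
by rewrite /lf; apply: sm1_eq (sm1_cst (one s) x) => y; rewrite /one size_map.
Qed.

End Forms.

(** * Smooth maps and pullbacks *)

Section Maps.
Context (R : realType) (n m : nat) (X Y : topologicalType).
Context (A : atlas R n X) (B : atlas R m Y).
Hypothesis HA : is_atlas A.
Hypothesis HB : is_atlas B.
Implicit Types (f : X -> Y).

(** Any charts may be used at source and target, whereas [smooth_map] fixes those at [p] and [f p].
    The notions agree by composition with chart changes ([smooth_map_smap], [smap_smooth_map]). *)
Definition smap f := continuous f /\
  forall q q' x, cimg (A q) x -> cdom (B q') (f (cinv (A q) x)) ->
    smv (fun y => cmap (B q') (f (cinv (A q) y))) x.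

Lemma near_smap f q q' x : smap f -> cimg (A q) x -> cdom (B q') (f (cinv (A q) x)) ->
  \forall y \near x, cdom (B q') (f (cinv (A q) y)).
Proof.
move=> [cf _] qx dx; apply: (near_cinv HA (W := fun p => cdom (B q') (f p)) qx).
apply: cf; exact: (open_near (atlas_dom_open HB q') dx).
Qed.

Lemma smooth_map_smap f : smooth_map A B f -> smap f.
Proof.
move=> [cf Cf]; split=> // q q' x qx dx.
set p := cinv (A q) x in dx *.
have dp : cdom (A p) p by exact: atlas_mem.
have dfp : cdom (B (f p)) (f p) by exact: atlas_mem.
pose F y := cmap (B (f p)) (f (cinv (A p) y)).
have sF : smv F (zp A p).
  apply: (@smv_Ck _ _ _ (cmap (A p) @` (cdom (A p) `&` f @^-1` cdom (B (f p))))).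
  - apply: open_chart => //; apply: open_comp; last exact: atlas_dom_open.
    by move=> z _; exact: cf.
  - by exists p.
  - exact: (Cf p).
have tx : trans A q p x = zp A p by [].
have Fz : F (zp A p) = zp B (f p) by rewrite /F cinv_zp.
have st : smv (trans A q p) x by exact: trans_smv.
have sT : smv (trans B (f p) q') (F (zp A p)).
  by apply: (trans_smv HB); rewrite Fz; [exact: cimg_zp|rewrite cinv_zp].
have := smv_comp st (smv_comp (g := trans B (f p) q') sF sT).
apply: smv_ext.
have near1 : \forall y \near x, f (cinv (A q) y) \in cdom (B (f p)) /\ cdom (A p) (cinv (A q) y).
  near=> y; split; last by near: y; exact: near_dom.
  rewrite inE; near: y.
  apply: (near_cinv HA (W := fun p' => cdom (B (f p)) (f p')) qx).
  apply: cf; exact: (open_near (atlas_dom_open HB _) dfp).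
apply: filterS near1 => y []; rewrite inE => d1 d2.
by rewrite /trans /F (atlas_inv HA d2) (atlas_inv HB d1).
Unshelve. all: by end_near. Qed.

Lemma smap_smooth_map f : smap f -> smooth_map A B f.
Proof.
move=> [cf sf]; split=> // p; apply: Ck_smv.
  apply: open_chart => //; apply: open_comp; last exact: atlas_dom_open.
  by move=> z _; exact: cf.
move=> x [p' [dp fp'] <-]; apply: sf; first exact: cimg_cmap.
by rewrite (atlas_inv HA).
Qed.

Definition tg f p u : 'rV[R]_m :=
  Dv (fun y => cmap (B (f p)) (f (cinv (A p) y))) (zp A p) u.

Lemma smap_at f p : smap f -> smv (fun y => cmap (B (f p)) (f (cinv (A p) y))) (zp A p).
Proof.
move=> [_ sf]; apply: sf; first exact: cimg_zp.
by rewrite cinv_zp//; exact: atlas_mem.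
Qed.

Lemma tg_lin f p : smap f -> linear (tg f p).
Proof. by move=> sf; apply: Dv_lin; exact: smap_at. Qed.

Lemma tangent_mxE f p u : smap f -> u *m tangent_mx A B f p = tg f p u.
Proof. by move=> sf; rewrite Dv_jacobian//; exact: smap_at. Qed.

Definition pull f (om : lfm R m Y) : lfm R n X := fun p s => om (f p) (map (tg f p) s).

(** By the chain rule both sides feed [om] the differential of one map, [f] read from chart [q] to
    the chart at the image point: on the left through the chart at [cinv (A q) x], on the right
    through the target chart [q']. *)
Lemma lf_pull f om q q' x s : smap f -> cimg (A q) x -> cdom (B q') (f (cinv (A q) x)) ->
  lf A q (pull f om) x s =
  pullv (fun y => cmap (B q') (f (cinv (A q) y))) (lf B q' om) x s.
Proof.
move=> sf qx dx; rewrite /lf /pull /pullv.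
set p := cinv (A q) x in dx *.
have dp : cdom (A p) p by exact: atlas_mem.
have dfp : cdom (B (f p)) (f p) by exact: atlas_mem.
rewrite (atlas_inv HB dx); congr (om (f p) _); rewrite -!map_comp.
apply: eq_map => u /=; rewrite /tg.
have tx : trans A q p x = zp A p by [].
rewrite -tx -[LHS]Dv_comp; last 2 first.
- exact: trans_smv.
- by rewrite tx; exact: smap_at.
rewrite -[RHS](@Dv_comp _ _ _ _ (fun y => cmap (B q') (f (cinv (A q) y)))); last 2 first.
- exact: sf.2.
- by apply: (trans_smv HB); [exact: cimg_cmap|rewrite (atlas_inv HB)].
apply: Dv_ext; near=> y.
have d1 : cdom (A p) (cinv (A q) y) by near: y; exact: near_dom.
have d2 : cdom (B q') (f (cinv (A q) y)) by near: y; exact: near_smap.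
by rewrite /trans (atlas_inv HA d1) (atlas_inv HB d2).
Unshelve. all: by end_near. Qed.

Lemma lf_pull_near f om q q' x s : smap f -> cimg (A q) x ->
  cdom (B q') (f (cinv (A q) x)) ->
  \forall y \near x, lf A q (pull f om) y s =
    pullv (fun y => cmap (B q') (f (cinv (A q) y))) (lf B q' om) y s.
Proof.
move=> sf qx dx; near=> y; apply: lf_pull => //; near: y.
  exact: near_cimg.
exact: near_smap.
Unshelve. all: by end_near. Qed.

Lemma sm_pull f om : smap f -> sm B om -> sm A (pull f om).
Proof.
move=> sf [ao so]; split=> [p|q x qx s].
  by apply: alt_map => //; exact: tg_lin.
have dx : cdom (B (f (cinv (A q) x))) (f (cinv (A q) x)) by exact: atlas_mem.
have bx := cimg_cmap dx.
have nb := filterS _ (lf_pull_near om s sf qx dx).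
apply: sm1_ext (@smw_pull _ _ _ (fun y => cmap (B (f (cinv (A q) x))) (f (cinv (A q) y)))
  x _ (lf B (f (cinv (A q) x)) om) _ _ s).
- by apply: nb => y ->.
- exact: sf.2.
- exact: so.
- exact: lf_alt_near.
Qed.

Lemma pull_wlf f om et p s : pull f (wlf om et) p s = wlf (pull f om) (pull f et) p s.
Proof. by rewrite /pull /wlf wl_map. Qed.

End Maps.

(** * Independence of the exterior derivative from the chart *)

Section Change.
Context (R : realType) (n : nat) (X : topologicalType) (A : atlas R n X).
Hypothesis HA : is_atlas A.

Lemma smap_id : smap A A id.
Proof. by split=> [x|q q' x]; [exact: cvg_id|exact: (trans_smv HA)]. Qed.

Lemma tg_id p u : tg A A id p u = u.
Proof.
rewrite -[RHS](Dv_id (zp A p)); apply: Dv_ext.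
by apply: filterS (near_cimg HA (cimg_zp HA p)) => y; exact: cinvK.
Qed.

Lemma pull_id (om : lfm R n X) : pull A A id om = om.
Proof.
apply/funext => p; apply/funext => s; rewrite /pull (eq_map (tg_id p)).
by rewrite map_id.
Qed.

Lemma lf_change om q q' x s : cimg (A q) x -> cdom (A q') (cinv (A q) x) ->
  lf A q om x s = pullv (trans A q q') (lf A q' om) x s.
Proof. by move=> qx dx; rewrite -[in LHS](pull_id om) (lf_pull HA HA _ _ smap_id qx dx). Qed.

Lemma lf_change_near om q q' x s : cimg (A q) x -> cdom (A q') (cinv (A q) x) ->
  \forall y \near x, lf A q om y s = pullv (trans A q q') (lf A q' om) y s.
Proof.
move=> qx dx; near=> y; apply: lf_change; near: y; first exact: near_cimg.
exact: near_dom.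
Unshelve. all: by end_near. Qed.

(** [dform] uses another chart at each point; naturality of [dl] under chart changes shows that a
    single chart computes it on its whole image. Smoothness and dd = 0 follow. *)
Lemma lf_dform om q x s : sm A om -> cimg (A q) x ->
  lf A q (dform A om) x s = dl (lf A q om) x s.
Proof.
move=> [ao so] qx; rewrite {1}/lf /dform.
set p := cinv (A q) x.
have dp : cdom (A p) p by exact: atlas_mem.
have tx : trans A q p x = zp A p by [].
rewrite -tx -(dl_pull (trans_smv HA qx dp)); last 2 first.
- by rewrite tx; apply: so; exact: cimg_zp.
- by rewrite tx; apply: lf_alt_near => //; exact: cimg_zp.
by apply: dl_ext => t; apply: filterS (lf_change_near om t qx dp) => y ->.
Qed.

Lemma sm_dform om : sm A om -> sm A (dform A om).
Proof.
move=> so; split=> [p|q x qx s].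
  apply: dl_alt; first by apply: so.2; exact: cimg_zp.
  by apply: lf_alt_near; [exact: HA|exact: so.1|exact: cimg_zp].
apply: sm1_ext (smw_dl (so.2 q x qx) s).
by apply: filterS (near_cimg HA qx) => y qy; rewrite lf_dform.
Qed.

Lemma dform_dform om p s : sm A om -> dform A (dform A om) p s = 0.
Proof.
move=> so; rewrite /dform -/(dform A om) -[RHS](dl_dl s (so.2 _ _ (cimg_zp HA p))).
apply: dl_ext => t; apply: filterS (near_cimg HA (cimg_zp HA p)) => y qy.
exact: lf_dform.
Qed.

Lemma dform_wlf om et p s : sm A om -> sm A et ->
  dform A (wlf om et) p s =
  wlf (dform A om) et p s + wlf (fun p => sg (om p)) (dform A et) p s.
Proof.
move=> so se; have zz := cimg_zp HA p; rewrite /dform.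
rewrite (@dl_ext _ _ _ (fun y t => wl (lf A p om y) (lf A p et y) t : R^o)).
  rewrite (dl_wl _ (so.2 _ _ zz) (se.2 _ _ zz)) /wlf.
  have e w : lf A p w (zp A p) = w p by apply/funext => t; exact: lf_zp.
  by rewrite !e.
by move=> t; near=> y; exact: lf_wlf.
Unshelve. all: by end_near. Qed.

End Change.

Section MapsD.
Context (R : realType) (n m l : nat) (X Y Z : topologicalType).
Context (A : atlas R n X) (B : atlas R m Y) (C : atlas R l Z).
Hypothesis HA : is_atlas A.
Hypothesis HB : is_atlas B.
Hypothesis HC : is_atlas C.

Lemma pull_dform (f : X -> Y) om p s : smap A B f -> sm B om ->
  pull A B f (dform B om) p s = dform A (pull A B f om) p s.
Proof.
move=> sf so; rewrite /pull /dform.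
have dfp : cdom (B (f p)) (f (cinv (A p) (zp A p))) by rewrite cinv_zp//; exact: atlas_mem.
have Fz : cmap (B (f p)) (f (cinv (A p) (zp A p))) = zp B (f p) by rewrite cinv_zp.
have := dl_pull (smap_at HA HB p sf) s (w := lf B (f p) om).
rewrite Fz => <-; last 2 first.
- by apply: so.2; exact: cimg_zp.
- by apply: lf_alt_near; [exact: HB|exact: so.1|exact: cimg_zp].
apply: dl_ext => t.
by apply: filterS (lf_pull_near HA HB om t sf (cimg_zp HA p) dfp) => y ->.
Qed.

Lemma smap_comp (f : X -> Y) (g : Y -> Z) : smap A B f -> smap B C g ->
  smap A C (fun p => g (f p)).
Proof.
move=> sf sg; split=> [p|q q' x qx dx].
  by apply: continuous_comp; [exact: sf.1|exact: sg.1].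
set q1 := f (cinv (A q) x) in dx *.
have d1 : cdom (B q1) (f (cinv (A q) x)) by exact: atlas_mem.
apply: smv_ext (smv_comp (sf.2 q q1 x qx d1) (sg.2 q1 q' _ (cimg_cmap d1) _)).
  apply: filterS (near_smap HA HB sf qx d1) => y dy.
  by rewrite (atlas_inv HB).
by rewrite (atlas_inv HB).
Qed.

Lemma tg_comp (f : X -> Y) (g : Y -> Z) p u : smap A B f -> smap B C g ->
  tg A C (fun p => g (f p)) p u = tg B C g (f p) (tg A B f p u).
Proof.
move=> sf sg; rewrite /tg.
have Fz : cmap (B (f p)) (f (cinv (A p) (zp A p))) = zp B (f p) by rewrite cinv_zp.
rewrite -Fz -[RHS]Dv_comp; last 2 first.
- exact: smap_at.
- by rewrite Fz; exact: smap_at.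
apply: Dv_ext.
have dfp : cdom (B (f p)) (f (cinv (A p) (zp A p))) by rewrite cinv_zp//; exact: atlas_mem.
apply: filterS (near_smap HA HB sf (cimg_zp HA p) dfp) => y dy.
by rewrite (atlas_inv HB).
Qed.

Lemma smap_cst (c : Y) : smap A B (fun=> c).
Proof.
split=> [p|q q' x qx dx]; first exact: cst_continuous.
by move=> j; exact: sm1_cst.
Qed.

Lemma tg_cst (c : Y) p u : tg A B (fun=> c) p u = 0.
Proof. by apply/rowP => j; rewrite mxE [RHS]mxE D_cstE. Qed.

End MapsD.

Section RowBlocks.
Context (R : realType).

Lemma Dv_row n p q (F : 'rV[R]_n -> 'rV[R]_p) (H : 'rV[R]_n -> 'rV[R]_q) x u :
  Dv (fun z => row_mx (F z) (H z)) x u = row_mx (Dv F x u) (Dv H x u).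
Proof.
apply/rowP => j; rewrite -(splitK j) /unsplit; case: (fintype.split j) => i.
  rewrite row_mxEl !mxE; congr ('D_u _ x); apply/funext => z.
  by rewrite row_mxEl.
rewrite row_mxEr !mxE; congr ('D_u _ x); apply/funext => z.
by rewrite row_mxEr.
Qed.

Lemma smv_row n p q (F : 'rV[R]_n -> 'rV[R]_p) (H : 'rV[R]_n -> 'rV[R]_q) x :
  smv F x -> smv H x -> smv (fun z => row_mx (F z) (H z)) x.
Proof.
move=> sF sH j; rewrite -(splitK j) /unsplit; case: (fintype.split j) => i.
  by apply: sm1_eq (sF i) => z; rewrite row_mxEl.
by apply: sm1_eq (sH i) => z; rewrite row_mxEr.
Qed.

Lemma smv_lsub n p (z : 'rV[R]_(n + p)) : smv lsubmx z.
Proof. by move=> j; apply: sm1_eq (sm1_coord (lshift p j) z) => y; rewrite mxE. Qed.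

Lemma smv_rsub n p (z : 'rV[R]_(n + p)) : smv rsubmx z.
Proof. by move=> j; apply: sm1_eq (sm1_coord (rshift n j) z) => y; rewrite mxE. Qed.

Lemma Dv_lsub n p (z u : 'rV[R]_(n + p)) : Dv lsubmx z u = lsubmx u.
Proof.
apply/rowP => j; rewrite !mxE -(D_coordE (lshift p j) z); congr ('D_u _ z).
by apply/funext => y; rewrite mxE.
Qed.

Lemma Dv_rsub n p (z u : 'rV[R]_(n + p)) : Dv rsubmx z u = rsubmx u.
Proof.
apply/rowP => j; rewrite !mxE -(D_coordE (rshift n j) z); congr ('D_u _ z).
by apply/funext => y; rewrite mxE.
Qed.

Lemma smv_cst n p (c : 'rV[R]_p) (x : 'rV[R]_n) : smv (fun=> c) x.
Proof. by move=> j; exact: sm1_cst. Qed.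

Lemma Dv_cst n p (c : 'rV[R]_p) (x u : 'rV[R]_n) : Dv (fun=> c) x u = 0.
Proof. by apply/rowP => j; rewrite mxE [RHS]mxE D_cstE. Qed.

End RowBlocks.

Notation inl u := (row_mx u 0).
Notation inr u := (row_mx 0 u).

Lemma lin0 (R : pzRingType) (V W : lmodType R) (L : V -> W) : linear L -> L 0 = 0.
Proof.
move=> lL; apply: (@addrI _ (L 0)).
by have := lL 1 0 0; rewrite !scale1r !addr0.
Qed.

Lemma cont_pair (T U W : topologicalType) (f : T -> U) (g : T -> W) x :
  {for x, continuous f} -> {for x, continuous g} ->
  {for x, continuous (fun y => (f y, g y))}.
Proof. by move=> cf cg; apply: cvg_pair. Qed.

(** * Product manifolds *)

Section ProductAtlas.
Context (R : realType) (n m : nat) (X Y : topologicalType).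
Context (A : atlas R n X) (B : atlas R m Y).
Hypothesis HA : is_atlas A.
Hypothesis HB : is_atlas B.
Local Notation AB := (prod_atlas A B).

Lemma cimg_prod p q z :
  cimg (AB (p, q)) z <-> cimg (A p) (lsubmx z) /\ cimg (B q) (rsubmx z).
Proof.
split=> [[[x y] /= [dx dy] <-]|[[x dx ex] [y dy ey]]].
  by rewrite row_mxKl row_mxKr; split; exact: cimg_cmap.
by exists (x, y) => //=; rewrite ex ey hsubmxK.
Qed.

Lemma cimg_row p q x y : cimg (A p) x -> cimg (B q) y -> cimg (AB (p, q)) (row_mx x y).
Proof. by move=> px qy; apply/cimg_prod; rewrite row_mxKl row_mxKr. Qed.

Lemma prod_is_atlas : is_atlas AB.
Proof.
split.
- by move=> [p q]; split; exact: atlas_mem.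
- move=> [p q]; rewrite openE => -[x y] [/= dx dy].
  exists (cdom (A p), cdom (B q)) => //=; split.
    by apply: open_nbhs_nbhs; split=> //; exact: (atlas_dom_open HA).
  by apply: open_nbhs_nbhs; split=> //; exact: (atlas_dom_open HB).
- move=> [p q].
  have -> : cimg (AB (p, q)) = (lsubmx @^-1` cimg (A p)) `&` (rsubmx @^-1` cimg (B q)).
    by apply/seteqP; split=> z /cimg_prod.
  apply: openI; apply: open_comp; try exact: (atlas_img_open HA); try exact: (atlas_img_open HB).
    by move=> z _; exact: (smv_cts (smv_lsub z)).
  by move=> z _; exact: (smv_cts (smv_rsub z)).
- move=> [p q] [x y] [/= dx dy].
  by rewrite row_mxKl row_mxKr (atlas_inv HA)// (atlas_inv HB).
- move=> [p q] [x y] [/= dx dy]; apply: rv_cont => j.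
  rewrite -(splitK j) /unsplit; case: (fintype.split j) => i.
    have -> : (fun xy : X * Y => row_mx (cmap (A p) xy.1) (cmap (B q) xy.2) 0 (lshift m i) : R^o) =
        (fun xy => cmap (A p) xy.1 0 i).
      by apply/funext => xy; rewrite row_mxEl.
    apply: (@continuous_comp _ _ _ (fun xy : X * Y => cmap (A p) xy.1) (fun M : 'rV[R]_n => M 0 i)).
      apply: (@continuous_comp _ _ _ (fun xy : X * Y => xy.1)); first exact: cvg_fst.
      exact: (atlas_map_cont HA dx).
    exact: coord_continuous.
  have -> : (fun xy : X * Y => row_mx (cmap (A p) xy.1) (cmap (B q) xy.2) 0 (rshift n i) : R^o) =
      (fun xy => cmap (B q) xy.2 0 i).
    by apply/funext => xy; rewrite row_mxEr.
  apply: (@continuous_comp _ _ _ (fun xy : X * Y => cmap (B q) xy.2) (fun M : 'rV[R]_m => M 0 i)).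
    apply: (@continuous_comp _ _ _ (fun xy : X * Y => xy.2)); first exact: cvg_snd.
    exact: (atlas_map_cont HB dy).
  exact: coord_continuous.
- move=> [p q] z /cimg_prod[pz qz].
  apply: (@cont_pair _ _ _ (fun z => cinv (A p) (lsubmx z)) (fun z => cinv (B q) (rsubmx z))).
    apply: (@continuous_comp _ _ _ (lsubmx : 'rV[R]_(n + m) -> _) (cinv (A p))).
      exact: (smv_cts (smv_lsub z)).
    exact: (atlas_inv_cont HA pz).
  apply: (@continuous_comp _ _ _ (rsubmx : 'rV[R]_(n + m) -> _) (cinv (B q))).
    exact: (smv_cts (smv_rsub z)).
  exact: (atlas_inv_cont HB qz).
- move=> [p q] [p' q'].
  have sAB z : (cmap (AB (p, q)) @` (cdom (AB (p, q)) `&` cdom (AB (p', q')))) z ->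
      smv (cmap (AB (p', q')) \o cinv (AB (p, q))) z.
    move=> [[x y] [/= [dx dy] [dx' dy']] <-].
    apply: smv_row.
      apply: (smv_comp (smv_lsub _) (g := trans A p p')); rewrite row_mxKl.
      by apply: (trans_smv HA); [exact: cimg_cmap|rewrite (atlas_inv HA)].
    apply: (smv_comp (smv_rsub _) (g := trans B q q')); rewrite row_mxKr.
    by apply: (trans_smv HB); [exact: cimg_cmap|rewrite (atlas_inv HB)].
  apply: Ck_smv => //.
  have -> : cmap (AB (p, q)) @` (cdom (AB (p, q)) `&` cdom (AB (p', q'))) =
     (lsubmx @^-1` (cmap (A p) @` (cdom (A p) `&` cdom (A p')))) `&`
     (rsubmx @^-1` (cmap (B q) @` (cdom (B q) `&` cdom (B q')))).
    apply/seteqP; split=> [z [[x y] [/= [dx dy] [dx' dy']] <-]|z [/= [x [dx dx'] ex] [y [dy dy'] ey]]].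
      by split=> /=; rewrite ?row_mxKl ?row_mxKr; [exists x|exists y].
    by exists (x, y) => //=; rewrite ex ey hsubmxK.
  apply: openI; apply: open_comp.
  + by move=> z _; exact: (smv_cts (smv_lsub z)).
  + by apply: (open_chart HA); exact: (atlas_dom_open HA).
  + by move=> z _; exact: (smv_cts (smv_rsub z)).
  + by apply: (open_chart HB); exact: (atlas_dom_open HB).
Qed.

Lemma smap_fst : smap AB A (@fst X Y).
Proof.
split=> [p|[q1 q2] q' z /cimg_prod[z1 z2] dz]; first exact: cvg_fst.
by apply: (smv_comp (smv_lsub z) (g := trans A q1 q')); exact: trans_smv.
Qed.

Lemma smap_snd : smap AB B (@snd X Y).
Proof.
split=> [p|[q1 q2] q' z /cimg_prod[z1 z2] dz]; first exact: cvg_snd.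
by apply: (smv_comp (smv_rsub z) (g := trans B q2 q')); exact: trans_smv.
Qed.

Lemma tg_fst pq z : tg AB A fst pq z = lsubmx z.
Proof.
case: pq => p q; rewrite /tg /=.
have e : lsubmx (row_mx (cmap (A p) p) (cmap (B q) q)) = zp A p by rewrite row_mxKl.
rewrite (@Dv_comp _ _ _ _ lsubmx (trans A p p)); last 2 first.
- exact: smv_lsub.
- by rewrite e; apply: (trans_smv HA); [exact: cimg_zp|rewrite cinv_zp//; exact: atlas_mem].
by rewrite e Dv_lsub; exact: (tg_id HA).
Qed.

Lemma tg_snd pq z : tg AB B snd pq z = rsubmx z.
Proof.
case: pq => p q; rewrite /tg /=.
have e : rsubmx (row_mx (cmap (A p) p) (cmap (B q) q)) = zp B q by rewrite row_mxKr.
rewrite (@Dv_comp _ _ _ _ rsubmx (trans B q q)); last 2 first.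
- exact: smv_rsub.
- by rewrite e; apply: (trans_smv HB); [exact: cimg_zp|rewrite cinv_zp//; exact: atlas_mem].
by rewrite e Dv_rsub; exact: (tg_id HB).
Qed.

Lemma Dv_trans_l p q p' q' x y u : cimg (A p) x -> cimg (B q) y ->
  cdom (A p') (cinv (A p) x) -> cdom (B q') (cinv (B q) y) ->
  Dv (trans AB (p, q) (p', q')) (row_mx x y) (inl u) = inl (Dv (trans A p p') x u).
Proof.
move=> px qy dx dy; rewrite /trans /= Dv_row.
have sA : smv (trans A p p') (lsubmx (row_mx x y)) by rewrite row_mxKl; exact: trans_smv.
have sB : smv (trans B q q') (rsubmx (row_mx x y)) by rewrite row_mxKr; exact: trans_smv.
rewrite (@Dv_comp _ _ _ _ lsubmx (trans A p p') (row_mx x y) (inl u) (smv_lsub _) sA).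
rewrite (@Dv_comp _ _ _ _ rsubmx (trans B q q') (row_mx x y) (inl u) (smv_rsub _) sB).
rewrite Dv_lsub Dv_rsub !row_mxKl !row_mxKr; congr row_mx.
exact/lin0/Dv_lin/(trans_smv HB qy dy).
Qed.

Lemma Dv_trans_r p q p' q' x y u : cimg (A p) x -> cimg (B q) y ->
  cdom (A p') (cinv (A p) x) -> cdom (B q') (cinv (B q) y) ->
  Dv (trans AB (p, q) (p', q')) (row_mx x y) (inr u) = inr (Dv (trans B q q') y u).
Proof.
move=> px qy dx dy; rewrite /trans /= Dv_row.
have sA : smv (trans A p p') (lsubmx (row_mx x y)) by rewrite row_mxKl; exact: trans_smv.
have sB : smv (trans B q q') (rsubmx (row_mx x y)) by rewrite row_mxKr; exact: trans_smv.
rewrite (@Dv_comp _ _ _ _ lsubmx (trans A p p') (row_mx x y) (inr u) (smv_lsub _) sA).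
rewrite (@Dv_comp _ _ _ _ rsubmx (trans B q q') (row_mx x y) (inr u) (smv_rsub _) sB).
rewrite Dv_lsub Dv_rsub !row_mxKl !row_mxKr; congr row_mx.
exact/lin0/Dv_lin/(trans_smv HA px dx).
Qed.

Lemma lf_row p q Om x y s t : cimg (A p) x -> cimg (B q) y ->
  lf AB (p, q) Om (row_mx x y)
    (map (fun u => inl u) s ++ map (fun u => inr u) t) =
  Om (cinv (A p) x, cinv (B q) y)
    (map (fun u => inl (Dv (trans A p (cinv (A p) x)) x u)) s ++
     map (fun u => inr (Dv (trans B q (cinv (B q) y)) y u)) t).
Proof.
move=> px qy; rewrite /lf /= row_mxKl row_mxKr map_cat -!map_comp.
have dx : cdom (A (cinv (A p) x)) (cinv (A p) x) by exact: atlas_mem.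
have dy : cdom (B (cinv (B q) y)) (cinv (B q) y) by exact: atlas_mem.
congr (Om _ (_ ++ _)); apply: eq_map => u /=; first exact: Dv_trans_l.
exact: Dv_trans_r.
Qed.

End ProductAtlas.

Section Pairing.
Context (R : realType) (n m l : nat) (X Y Z : topologicalType).
Context (A : atlas R n X) (B : atlas R m Y) (C : atlas R l Z).
Hypothesis HA : is_atlas A.
Hypothesis HB : is_atlas B.
Hypothesis HC : is_atlas C.
Local Notation AB := (prod_atlas A B).

Lemma smap_pair (f : Z -> X) (g : Z -> Y) : smap C A f -> smap C B g ->
  smap C AB (fun z => (f z, g z)).
Proof.
move=> sf sg; split=> [z|q [q1 q2] x qx [/= d1 d2]].
  by apply: cvg_pair; [exact: sf.1|exact: sg.1].
by apply: smv_row; [exact: sf.2|exact: sg.2].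
Qed.

Lemma tg_pair (f : Z -> X) (g : Z -> Y) z u :
  tg C AB (fun z => (f z, g z)) z u = row_mx (tg C A f z u) (tg C B g z u).
Proof. exact: Dv_row. Qed.

End Pairing.

Lemma near_near (T : topologicalType) (x : T) (P : T -> Prop) :
  (\forall y \near x, P y) -> \forall y \near x, \forall z \near y, P z.
Proof.
move=> /near_openE[U [oU Ux UP]]; apply: filterS (open_near oU Ux) => y Uy.
by apply: filterS (open_near oU Uy) => z; exact: UP.
Qed.

(** * Functionals at a point *)

Section IteratedDerivatives.
Context (R : realType).

Fixpoint dd n (a : seq 'rV[R]_n) (f : 'rV[R]_n -> R^o) : 'rV[R]_n -> R^o :=
  if a is u :: a' then fun x => 'D_u (dd a' f) x else f.

Lemma dd_cat n (a b : seq 'rV[R]_n) f : dd (a ++ b) f = dd a (dd b f).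
Proof. by elim: a => //= u a ->. Qed.

Lemma dd_near n (a : seq 'rV[R]_n) f g (x : 'rV[R]_n) :
  (\forall y \near x, f y = g y) -> \forall y \near x, dd a f y = dd a g y.
Proof.
move=> fg; elim: a => //= u a IH.
by apply: filterS (near_near IH) => y; exact: near_eq_derive.
Qed.

Lemma dd_ext n (a : seq 'rV[R]_n) f g (x : 'rV[R]_n) :
  (\forall y \near x, f y = g y) -> dd a f x = dd a g x.
Proof. by move=> fg; exact: nbhs_singleton (dd_near a fg). Qed.

Lemma sm1_dd n (a : seq 'rV[R]_n) f x : sm1 f x -> sm1 (dd a f) x.
Proof. by move=> sf; elim: a => //= u a; exact: sm1_D. Qed.

Lemma dd_comb n (a : seq 'rV[R]_n) (c : R) f g x : sm1 f x -> sm1 g x ->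
  dd a (fun y => c * f y + g y : R^o) x = c * dd a f x + dd a g x.
Proof.
elim: a x => //= u a IH x sf sg.
rewrite (near_eq_derive _ (g := fun y => c * dd a f y + dd a g y : R^o)).
  rewrite D_addE; [|by apply: sm1Z; exact: sm1_dd|exact: sm1_dd].
  by rewrite D_mulcE//; exact: sm1_dd.
near=> y; apply: IH; near: y; exact: sm1_near.
Unshelve. all: by end_near. Qed.

Lemma dd_zero n (a : seq 'rV[R]_n) x : dd a (fun=> 0) x = 0.
Proof.
have -> : dd a (fun=> 0) = fun=> 0; last by [].
by elim: a => //= u a ->; apply/funext => y; rewrite D_cstE.
Qed.

Lemma dd_sum n (a : seq 'rV[R]_n) (I : Type) (r : seq I) (c : I -> R) (F : I -> 'rV[R]_n -> R^o) x :
  (forall i, sm1 (F i) x) ->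
  dd a (fun y => \sum_(i <- r) c i * F i y) x = \sum_(i <- r) c i * dd a (F i) x.
Proof.
move=> sF; elim: r => [|i r IH].
  rewrite big_nil -[RHS](dd_zero a x); congr (dd a _ x).
  by apply/funext => y; rewrite big_nil.
rewrite big_cons -IH -dd_comb//; last by apply: sm1_sum => j; apply: sm1Z.
by congr (dd a _ x); apply/funext => y; rewrite big_cons.
Qed.

Lemma dd_D n (a : seq 'rV[R]_n) u f x : sm1 f x ->
  'D_u (dd a f) x = dd a (fun y => 'D_u f y) x.
Proof.
elim: a x => //= v a IH x sf; rewrite D_swap; last exact: sm1_dd.
apply: near_eq_derive; near=> y; apply: IH; near: y; exact: sm1_near.
Unshelve. all: by end_near. Qed.

Lemma dd_catC n (a b : seq 'rV[R]_n) f x : sm1 f x -> dd (a ++ b) f x = dd (b ++ a) f x.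
Proof.
elim: a x => [|u a IH] x sf /=; first by rewrite cats0.
rewrite (near_eq_derive _ (g := dd (b ++ a) f)).
  rewrite dd_cat [dd (b ++ u :: a) _]dd_cat /=.
  by rewrite dd_D//; exact: sm1_dd.
near=> y; apply: IH; near: y; exact: sm1_near.
Unshelve. all: by end_near. Qed.

Lemma dd_mul n (a : seq 'rV[R]_n) f g x : sm1 f x -> sm1 g x ->
  dd a (fun y => f y * g y : R^o) x =
  \sum_(t <- splits a) dd t.1.2 f x * dd t.2 g x.
Proof.
elim: a x => [|u a IH] x sf sg /=; first by rewrite big_seq1.
rewrite (near_eq_derive _ (g := fun y => \sum_(t <- splits a) dd t.1.2 f y * dd t.2 g y)).
  rewrite D_sumE; last by move=> t; apply: sm1M; exact: sm1_dd.
  rewrite big_cat !big_map /= -big_split /=; apply: eq_bigr => t _.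
  by rewrite D_mulE//; exact: sm1_dd.
by near=> y; apply: IH; near: y; exact: sm1_near.
Unshelve. all: by end_near. Qed.

Lemma dd_left n m (a : seq 'rV[R]_n) (f : 'rV[R]_(n + m) -> R^o) y :
  dd a (fun x => f (row_mx x y)) = fun x => dd (map (fun u => inl u) a) f (row_mx x y).
Proof.
elim: a => //= u a ->; apply/funext => x; rewrite /derive.
apply: (congr1 (fun F => lim (F @ 0^'))); apply/funext => h /=.
by rewrite scale_row_mx scaler0 add_row_mx add0r.
Qed.

Lemma dd_right n m (a : seq 'rV[R]_m) (f : 'rV[R]_(n + m) -> R^o) x :
  dd a (fun y => f (row_mx x y)) = fun y => dd (map (fun u => inr u) a) f (row_mx x y).
Proof.
elim: a => //= u a ->; apply/funext => y; rewrite /derive.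
apply: (congr1 (fun F => lim (F @ 0^'))); apply/funext => h /=.
by rewrite scale_row_mx scaler0 add_row_mx add0r.
Qed.

(** The chain rule on the diagonal: each direction [u] acts as [inl u + inr u], and symmetry of
    iterated derivatives sorts the left directions to the front. *)
Lemma dd_diag n (a : seq 'rV[R]_n) (f : 'rV[R]_(n + n) -> R^o) x :
  sm1 f (row_mx x x) -> dd a (fun x => f (row_mx x x)) x =
  \sum_(t <- splits a)
    dd (map (fun u => inl u) t.1.2 ++ map (fun u => inr u) t.2) f (row_mx x x).
Proof.
have sdiag (x' : 'rV[R]_n) : smv (fun z : 'rV[R]_n => row_mx z z) x'.
  by apply: smv_row; exact: smv_id.
elim: a x => [|u a IH] x sf /=; first by rewrite big_seq1.
pose S y := \sum_(t <- splits a)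
    dd (map (fun u => inl u) t.1.2 ++ map (fun u => inr u) t.2) f y.
have sS : sm1 S (row_mx x x) by apply: sm1_sum => t; exact: sm1_dd.
rewrite (near_eq_derive _ (g := fun y => S (row_mx y y))); last first.
  near=> y; apply: IH; near: y.
  exact: (smv_cts (sdiag x)) (sm1_near sf).
rewrite (D_chain _ (sdiag x) sS) Dv_row Dv_id.
have -> : row_mx u u = 1 *: inl u + inr u by rewrite scale1r add_row_mx addr0 add0r.
rewrite (D_dirE _ _ _ sS) mul1r big_cat !big_map /=.
rewrite !D_sumE; [|by move=> t; exact: sm1_dd..].
congr (_ + _); apply: eq_bigr => t _ /=.
transitivity ('D_(inr u) (dd (map (fun u => inl u) t.1.2)
    (dd (map (fun u => inr u) t.2) f)) (row_mx x x)); first by rewrite -dd_cat.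
by rewrite (dd_D _ _ (sm1_dd _ sf)) dd_cat.
Unshelve. all: by end_near. Qed.

Lemma dd_alt n (a : seq 'rV[R]_n) (w : 'rV[R]_n -> seq 'rV[R]_n -> R^o) x :
  smw w x -> (\forall y \near x, alt (w y)) -> alt (fun s => dd a (fun y => w y s) x).
Proof.
move=> sw aw; split=> [s1 s2 c u v|s1 s2 u].
  rewrite -dd_comb; try exact: sw.
  by apply: dd_ext; apply: filterS aw => y ay; exact: (alt_lin ay).
rewrite -[RHS](dd_zero a x); apply: dd_ext; apply: filterS aw => y ay.
exact: (alt_rep ay).
Qed.

End IteratedDerivatives.

Section PointFunctionals.
Context (R : realType) (n : nat) (X : topologicalType) (A : atlas R n X).
Hypothesis HA : is_atlas A.
Implicit Types (p : X) (om : lfm R n X).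

Definition E p (a s : seq 'rV[R]_n) om : R := dd a (fun x => lf A p om x s) (zp A p).

Definition ev p (L : seq (R * seq 'rV[R]_n * seq 'rV[R]_n)) om : R :=
  \sum_(c <- L) c.1.1 * E p c.1.2 c.2 om.

Lemma E_comb p a s c om et : sm A om -> sm A et ->
  E p a s (fun p s => c * om p s + et p s) = c * E p a s om + E p a s et.
Proof.
move=> [_ so] [_ se]; have zz := cimg_zp HA p.
by rewrite -dd_comb; [|exact: so|exact: se].
Qed.

Lemma ev_comb p L c om et : sm A om -> sm A et ->
  ev p L (fun p s => c * om p s + et p s) = c * ev p L om + ev p L et.
Proof.
move=> so se; rewrite /ev mulr_sumr -big_split; apply: eq_bigr => t _ /=.
by rewrite E_comb// mulrDr mulrCA.
Qed.

Lemma E_near p a s om et : (\forall q \near p, om q = et q) -> E p a s om = E p a s et.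
Proof.
move=> oe; have zz := cimg_zp HA p; apply: dd_ext.
have := near_cinv HA (W := fun q => om q = et q) zz; rewrite cinv_zp// => /(_ oe).
by apply: filterS => y; rewrite /lf => ->.
Qed.

Lemma E_dform p a s om : sm A om ->
  E p a s (dform A om) =
  \sum_(i < size s) (-1) ^+ i * E p (rcons a (nth 0 s i)) (rem_nth i s) om.
Proof.
move=> so; have zz := cimg_zp HA p; rewrite /E.
rewrite (dd_ext _ (g := fun x => dl (lf A p om) x s)); last first.
  by apply: filterS (near_cimg HA zz) => y; exact: lf_dform.
rewrite dd_sum; last by move=> i; apply: sm1_D; exact: so.2.
by apply: eq_bigr => i _; rewrite -cats1 dd_cat.
Qed.

Lemma E_wlf p a s om et : sm A om -> sm A et ->
  E p a s (wlf om et) = \sum_(t <- splits s) \sum_(q <- splits a)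
    (-1) ^+ t.1.1 * (E p q.1.2 t.1.2 om * E p q.2 t.2 et).
Proof.
move=> so se; have zz := cimg_zp HA p; rewrite /E.
rewrite (dd_ext _ (g := fun x => \sum_(t <- splits s)
    (-1) ^+ t.1.1 * (lf A p om x t.1.2 * lf A p et x t.2))); last first.
  by near=> y; rewrite lf_wlf wl_splits.
rewrite dd_sum; last by move=> t; apply: sm1M; [exact: so.2|exact: se.2].
apply: eq_bigr => t _; rewrite dd_mul; [|exact: so.2|exact: se.2].
by rewrite mulr_sumr.
Unshelve. all: by end_near. Qed.

End PointFunctionals.

(** * Partial evaluation of forms on a product *)

Section Slant.
Context (R : realType) (n m : nat) (X Y : topologicalType).
Context (A : atlas R n X) (B : atlas R m Y).
Hypothesis HA : is_atlas A.
Hypothesis HB : is_atlas B.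
Local Notation AB := (prod_atlas A B).
Local Notation lmap s := (map (fun u => inl u) s).
Local Notation rmap s := (map (fun u => inr u) s).

Definition slice (Om : lfm R (n + m) (X * Y)) x s : lfm R m Y :=
  fun y t => Om (x, y) (lmap s ++ rmap t).

(** Partial evaluation of [Om] in the second factor, the vectors tangent to the first factor
    standing in front. Followed by a current on the first factor it gives the cross product, with no
    decomposition of [Om] into product forms. *)
Definition sl (S : lfm R m Y -> R) (Om : lfm R (n + m) (X * Y)) : lfm R n X :=
  fun x s => S (slice Om x s).

Lemma lf_slice Om p s q y t : cimg (B q) y ->
  lf B q (slice Om p s) y t = lf AB (p, q) Om (row_mx (zp A p) y) (lmap s ++ rmap t).
Proof.
move=> qy; rewrite (lf_row HA HB)//; last exact: cimg_zp.
rewrite /lf /slice cinv_zp// -map_comp; congr (Om _ (_ ++ _)).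
by apply: eq_map => u; congr row_mx; rewrite -[LHS](tg_id HA p).
Qed.

Lemma row_smv_l (x : 'rV[R]_n) (y : 'rV[R]_m) : smv (fun z => row_mx z y) x.
Proof. by apply: smv_row; [exact: smv_id|exact: smv_cst]. Qed.

Lemma row_smv_r (x : 'rV[R]_n) (y : 'rV[R]_m) : smv (fun z => row_mx x z) y.
Proof. by apply: smv_row; [exact: smv_cst|exact: smv_id]. Qed.

Lemma inl_lin : linear (fun u : 'rV[R]_n => inl u : 'rV[R]_(n + m)).
Proof. by move=> a u v; rewrite scale_row_mx add_row_mx scaler0 addr0. Qed.

Lemma inr_lin : linear (fun u : 'rV[R]_m => inr u : 'rV[R]_(n + m)).
Proof. by move=> a u v; rewrite scale_row_mx add_row_mx scaler0 addr0. Qed.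

Lemma sm_slice Om p s : sm AB Om -> sm B (slice Om p s).
Proof.
move=> [aO sO]; split=> [q|q y qy t].
  exact: (alt_map inr_lin (alt_pre (lmap s) (aO (p, q)))).
apply: sm1_ext (sm1_comp (row_smv_r (zp A p) y) (sO (p, q) _ _ (lmap s ++ rmap t))).
  by apply: filterS (near_cimg HB qy) => z qz; rewrite lf_slice.
by apply: cimg_row => //; exact: cimg_zp.
Qed.

Lemma lf_sl Om p x q b s t : sm AB Om -> cimg (A p) x ->
  lf A p (sl (E B q b t) Om) x s =
  dd (rmap b) (fun z => lf AB (p, q) Om z (lmap s ++ rmap t)) (row_mx x (zp B q)).
Proof.
move=> sO px; have zq := cimg_zp HB q.
transitivity (dd b (fun y => lf AB (p, q) Om (row_mx x y) (lmap s ++ rmap t)) (zp B q)).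
  apply: dd_ext; apply: filterS (near_cimg HB zq) => y qy.
  by rewrite (lf_row HA HB)// /lf /slice -!map_comp.
by rewrite (dd_right b (fun z => lf AB (p, q) Om z (lmap s ++ rmap t)) x).
Qed.

(** In a product chart the slant is a derivative of coefficients of [Om], restricted to the slice
    through [zp B q]; alternation and smoothness are inherited from there. *)
Lemma sm_slE Om q b t : sm AB Om -> sm A (sl (E B q b t) Om).
Proof.
move=> sO; have zq := cimg_zp HB q; split=> [p|p x px s].
  have -> : sl (E B q b t) Om p = fun s => dd (rmap b)
      (fun z => lf AB (p, q) Om z (lmap s ++ rmap t)) (row_mx (zp A p) (zp B q)).
    by apply/funext => s; rewrite -lf_sl ?lf_zp//; exact: cimg_zp.
  have cz : cimg (AB (p, q)) (row_mx (zp A p) (zp B q)).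
    by apply: cimg_row => //; exact: cimg_zp.
  have aa : alt (fun s => dd (rmap b) (fun z => lf AB (p, q) Om z s) (row_mx (zp A p) (zp B q))).
    by apply: dd_alt; [exact: sO.2|apply: lf_alt_near => //; [exact: prod_is_atlas|exact: sO.1]].
  exact: (alt_map inl_lin (alt_suf (rmap t) aa)).
have cz : cimg (AB (p, q)) (row_mx x (zp B q)) by exact: cimg_row.
apply: sm1_ext (sm1_comp (row_smv_l x (zp B q)) (sm1_dd (rmap b) (sO.2 _ _ cz (lmap s ++ rmap t)))).
by apply: filterS (near_cimg HA px) => z pz; rewrite lf_sl.
Qed.

Lemma sl_ev Om q L p s : sl (ev B q L) Om p s =
  \sum_(c <- L) c.1.1 * sl (E B q c.1.2 c.2) Om p s.
Proof. by []. Qed.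

Lemma sm_sl Om q L : sm AB Om -> sm A (sl (ev B q L) Om).
Proof.
move=> sO; elim: L => [|c L IH].
  have -> : sl (ev B q [::]) Om = fun _ _ => 0.
    by apply/funext => p; apply/funext => s; rewrite sl_ev big_nil.
  exact: sm_zero.
have -> : sl (ev B q (c :: L)) Om = fun p s =>
    c.1.1 * sl (E B q c.1.2 c.2) Om p s + sl (ev B q L) Om p s.
  by apply/funext => p; apply/funext => s; rewrite sl_ev big_cons.
by apply: sm_comb => //; exact: sm_slE.
Qed.

Lemma E_slE Om p q a s b t : sm AB Om ->
  E A p a s (sl (E B q b t) Om) = E AB (p, q) (lmap a ++ rmap b) (lmap s ++ rmap t) Om.
Proof.
move=> sO; have zp_ := cimg_zp HA p; have zq := cimg_zp HB q; rewrite /E dd_cat.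
rewrite (dd_ext _ (g := fun x => dd (rmap b)
    (fun z => lf AB (p, q) Om z (lmap s ++ rmap t)) (row_mx x (zp B q)))).
  by rewrite (dd_left a (dd (rmap b) (fun z => lf AB (p, q) Om z (lmap s ++ rmap t)))).
by apply: filterS (near_cimg HA zp_) => x px; exact: lf_sl.
Qed.

End Slant.

(** * Comparison with matrix-valued forms *)

Section PermutedWedge.
Context (R : realType) (V : lmodType R).
Implicit Types (f g : seq V -> R) (s t : seq V).

Definition perm_seq d (sg : 'S_d) s := [seq nth 0 s (sg i) | i <- enum 'I_d].

Definition perm_wedge d k f g s : R :=
  \sum_(t : 'S_d) (-1) ^+ t * (f (take k (perm_seq t s)) * g (drop k (perm_seq t s))).

Lemma size_perm_seq d (sg : 'S_d) s : size (perm_seq sg s) = d.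
Proof. by rewrite size_map size_enum_ord. Qed.

Lemma nth_perm_seq d (sg : 'S_d) s (i : 'I_d) : nth 0 (perm_seq sg s) i = nth 0 s (sg i).
Proof. by rewrite (nth_map i) ?size_enum_ord// nth_ord_enum. Qed.

Definition ins i u s := take i s ++ u :: drop i s.

Lemma perm_seq_lift d (i : 'I_d.+1) (t : 'S_d) u s :
  perm_seq (lift_perm i ord0 t) (u :: s) = ins i u (perm_seq t s).
Proof.
have id_ : (i <= d)%N by rewrite -ltnS.
apply: (@eq_from_nth _ 0).
  by rewrite size_perm_seq /ins size_cat /= size_take_min size_drop !size_perm_seq; lia.
move=> j; rewrite size_perm_seq => jd; pose j' := Ordinal jd.
rewrite -[j]/(val j') nth_perm_seq /ins nth_cat size_take_min size_perm_seq (minn_idPl id_).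
case: (unliftP i j') => [k ->|->]; last first.
  by rewrite lift_perm_id /= ltnn subnn.
rewrite lift_perm_lift /= /bump.
case ik: (i <= k)%N; rewrite ?add1n ?add0n.
  by rewrite ltnNge (leqW ik) /= subSn//= nth_drop subnKC// nth_perm_seq.
by rewrite ltnNge ik /= nth_take ?ltnNge ?ik// nth_perm_seq.
Qed.

(** A permutation of [d.+1] letters is the place [i] of the first letter together with a permutation
    of the others. *)
Lemma sum_lift_perm d (F : 'S_d.+1 -> R) :
  \sum_s F s = \sum_(i < d.+1) \sum_(t : 'S_d) F (lift_perm i ord0 t).
Proof.
rewrite pair_big /=; apply: reindex; apply: onW_bij.
apply: inj_card_bij => [[i t] [i' t'] /= e|]; last first.
  by rewrite card_prod card_ord !card_Sn factS.
have ii : i = i'.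
  by apply: (@perm_inj _ (lift_perm i' ord0 t')); rewrite -e lift_perm_id e lift_perm_id.
rewrite -ii in e *; congr (_, _); apply/permP => k.
by apply: (@lift_inj _ ord0); rewrite -!(lift_perm_lift i) e.
Qed.

Lemma sign_shuffle (a b x y e : R) : e * e = 1 ->
  a * e * b * (x * (e * y)) = b * (a * x * y).
Proof. by move=> ee; transitivity (a * b * x * y * (e * e)); [ring|rewrite ee; ring]. Qed.

(** Full antisymmetrisation counts each shuffle once for every reordering of its two blocks.
    Induction on the length sorts the permutations by the place of the first entry [u]: one of the
    first [k] places contracts [f], a later one contracts [g]. *)
Lemma perm_wedge_splits d k l f g s : d = (k + l)%N -> size s = d ->
  alt f -> alt g -> (forall t, size t != k -> f t = 0) -> (forall t, size t != l -> g t = 0) ->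
  perm_wedge d k f g s = (k`! * l`!)%:R * wl f g s.
Proof.
elim: d k l f g s => [|d IH] k l f g [|u s]//=.
  move=> /esym /eqP; rewrite addn_eq0 => /andP[/eqP -> /eqP ->] _ af ag f0 g0.
  rewrite /perm_wedge (eq_bigr (fun=> f [::] * g [::])).
    by rewrite sumr_const card_Sn mulr1n mul1r.
  move=> t _; have -> : perm_seq t ([::] : seq V) = [::].
    by apply: size0nil; rewrite size_perm_seq.
  have -> : t = 1%g by apply/permP => -[].
  by rewrite odd_perm1 mul1r.
move=> dkl [es] af ag f0 g0.
rewrite /perm_wedge sum_lift_perm.
(* Only the block in which [u] lands matters: moving [u] to the front of its block cancels the sign
   of [lift_perm], except that in the second block a factor (-1)^k survives, which is the [sg] in
   [W2]. *)
pose W1 := \sum_(t : 'S_d) (-1) ^+ t *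
  (f (u :: take k.-1 (perm_seq t s)) * g (drop k.-1 (perm_seq t s))).
pose W2 := \sum_(t : 'S_d) (-1) ^+ t *
  (sg f (take k (perm_seq t s)) * g (u :: drop k (perm_seq t s))).
transitivity (\sum_(i < d.+1) if (i < k)%N then W1 else W2).
  apply: eq_bigr => i _; case: ifP => ik.
    apply: eq_bigr => t _; rewrite perm_seq_lift odd_lift_perm /= signr_addb.
    have k1 : k = k.-1.+1 by rewrite (ltn_predK ik).
    have ik1 : (i <= k.-1)%N by rewrite -ltnS -k1.
    have kk : (k.-1 <= size (perm_seq t s))%N by rewrite size_perm_seq; lia.
    rewrite /ins take_cat drop_cat size_take_min size_perm_seq.
    rewrite (minn_idPl _); last by rewrite (leq_trans ik1)// -(size_perm_seq t s).
    rewrite ltnNge (ltnW ik) /= k1 subSn//= take_drop subnK// drop_drop subnK//.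
    rewrite (_ : take i _ = take i (take k.-1 (perm_seq t s))); last by rewrite take_takel.
    rewrite alt_move0// cat_take_drop size_take_min size_take_min.
    rewrite (minn_idPl _); last by rewrite leq_min ik1 (leq_trans ik1).
    rewrite addbF signr_odd; set x := f _; set y := g _.
    rewrite -!mulrA mulrCA; congr (_ * _); rewrite !mulrA -expr2 sqrr_sign.
    by rewrite mul1r.
  apply: eq_bigr => t _; rewrite perm_seq_lift odd_lift_perm /= signr_addb.
  have ki : (k <= i)%N by rewrite leqNgt ik.
  have il : (i <= d)%N by rewrite -ltnS.
  have sp := size_perm_seq t s.
  rewrite /ins take_cat drop_cat size_take_min size_perm_seq (minn_idPl il).
  rewrite (_ : (k < i)%N = ~~ ((i : nat) == k)); last by rewrite ltn_neqAle ki andbT eq_sym.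
  have [eik|nik] /= := eqVneq (i : nat) k.
    rewrite -eik subnn take0 cats0 /= /sg size_take_min sp (minn_idPl il) addbF signr_odd.
    by rewrite -!mulrA mulrCA.
  have ki' : (k < i)%N by rewrite ltn_neqAle eq_sym nik.
  rewrite take_takel ?(ltnW ki')//.
  have -> : drop k (take i (perm_seq t s)) = take (i - k) (drop k (perm_seq t s)).
    by rewrite take_drop subnK// ltnW.
  have -> : drop i (perm_seq t s) = drop (i - k) (drop k (perm_seq t s)).
    by rewrite drop_drop subnK// ltnW.
  rewrite alt_move0// cat_take_drop size_take_min size_drop sp.
  rewrite (minn_idPl _); last by rewrite leq_sub2r.
  rewrite /sg size_take_min sp (minn_idPl _); last exact: leq_trans ki il.
  rewrite addbF signr_odd.
  have -> : (-1) ^+ i = (-1) ^+ k * (-1) ^+ (i - k) :> R by rewrite -exprD subnKC// ltnW.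
  by apply: sign_shuffle; rewrite -expr2 sqrr_sign.
rewrite -(big_mkord xpredT (fun i => if (i < k)%N then W1 else W2)) dkl.
rewrite (big_cat_nat _ (n := k))//=; last exact: leq_addr.
rewrite (eq_big_nat _ _ (F2 := fun=> W1)); last by move=> i /andP[_ ->].
rewrite [X in _ + X](eq_big_nat _ _ (F2 := fun=> W2)); last first.
  by move=> i /andP[ki _]; rewrite ltnNge ki.
rewrite !sumr_const_nat subn0 addKn.
have -> : W1 *+ k = (k`! * l`!)%:R * wl (fun t => f (u :: t)) g s.
  case: k => [|k] in dkl f0 W1 W2 *.
    rewrite mulr0n (_ : (fun t => _) = fun=> 0) ?wl0l ?mulr0//.
    by apply/funext => t; exact: f0.
  rewrite (_ : W1 = perm_wedge d k (fun t => f (u :: t)) g s)//.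
  rewrite (IH k l)//; first by rewrite factS -mulr_natl mulrA -natrM mulnA.
  - by case: dkl.
  - exact: alt_cons.
  - by move=> t tk; apply: f0; rewrite /= eqSS.
have -> : W2 *+ l = (k`! * l`!)%:R * wl (sg f) (fun t => g (u :: t)) s.
  case: l => [|l] in dkl g0 W1 W2 *.
    rewrite mulr0n (_ : (fun t => _) = fun=> 0) ?wl0r ?mulr0//.
    by apply/funext => t; exact: g0.
  rewrite (_ : W2 = perm_wedge d k (sg f) (fun t => g (u :: t)) s)//.
  rewrite (IH k l)//; first by rewrite factS -mulr_natl mulrA -natrM mulnCA.
  - by move: dkl; rewrite addnS => -[].
  - exact: alt_sg.
  - exact: alt_cons.
  - by move=> t tk; rewrite /sg f0// mulr0.
  - by move=> t tl; apply: g0; rewrite /= eqSS.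
by rewrite mulrDr.
Qed.

End PermutedWedge.

Section Rows.
Context (R : realType) (n : nat).

Definition rows k (M : 'M[R]_(k, n)) : seq 'rV[R]_n := [seq row i M | i <- enum 'I_k].
Definition mxs k (s : seq 'rV[R]_n) : 'M[R]_(k, n) := \matrix_(i < k) nth 0 s i.

Lemma size_rows k (M : 'M[R]_(k, n)) : size (rows M) = k.
Proof. by rewrite size_map size_enum_ord. Qed.

Lemma nth_rows k (M : 'M[R]_(k, n)) (i : 'I_k) : nth 0 (rows M) i = row i M.
Proof. by rewrite (nth_map i) ?size_enum_ord// nth_ord_enum. Qed.

Lemma rowsK k (M : 'M[R]_(k, n)) : mxs k (rows M) = M.
Proof. by apply/row_matrixP => i; rewrite rowK nth_rows. Qed.

Lemma mxsK k s : size s = k -> rows (mxs k s) = s.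
Proof.
move=> sk; apply: (@eq_from_nth _ 0); rewrite size_rows// => i ik.
by rewrite -[i]/(val (Ordinal ik)) nth_rows rowK.
Qed.

Lemma rows_set k (M : 'M[R]_(k, n)) i u :
  rows (set_row i u M) = take i (rows M) ++ u :: drop i.+1 (rows M).
Proof.
apply: (@eq_from_nth _ 0).
  rewrite size_cat /= size_take_min size_drop !size_rows.
  by have := ltn_ord i; lia.
move=> j; rewrite size_rows => jk; rewrite -[j]/(val (Ordinal jk)) nth_rows.
rewrite nth_cat size_take_min size_rows (minn_idPl (ltnW (ltn_ord i))) /=.
have [ji|ij|eij] := ltngtP j i.
- rewrite nth_take// -[j]/(val (Ordinal jk)) nth_rows.
  by apply/rowP => c; rewrite !mxE -val_eqE /= ltn_eqF.
- rewrite -(subnSK ij) /= nth_drop subnKC//.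
  rewrite -[j]/(val (Ordinal jk)) nth_rows.
  by apply/rowP => c; rewrite !mxE -val_eqE /= gtn_eqF.
- have -> : (j - i = 0)%N by rewrite eij subnn.
  apply/rowP => c; rewrite !mxE; case: eqP => // -[]; exact: val_inj.
Qed.

Lemma rows_row' k (M : 'M[R]_(k.+1, n)) i : rows (row' i M) = rem_nth i (rows M).
Proof.
apply: (@eq_from_nth _ 0).
  rewrite size_cat size_take_min size_drop !size_rows.
  by have := ltn_ord i; lia.
move=> j; rewrite size_rows => jk; rewrite -[j]/(val (Ordinal jk)) nth_rows.
rewrite nth_cat size_take_min size_rows (minn_idPl (ltnW (ltn_ord i))).
have -> : row (Ordinal jk) (row' i M) = row (lift i (Ordinal jk)) M.
  by apply/rowP => c; rewrite !mxE.
rewrite -nth_rows /= /bump; case: (leqP i j) => ij.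
  by rewrite nth_drop addSn subnKC.
by rewrite nth_take.
Qed.

Lemma rows_col k (u : 'rV[R]_n) (M : 'M[R]_(k, n)) :
  rows (col_mx u M : 'M[R]_(k.+1, n)) = u :: rows M.
Proof.
apply: (@eq_from_nth _ 0); first by rewrite /= !size_rows.
move=> j; rewrite size_rows => jk; rewrite -[j]/(val (Ordinal jk)) nth_rows.
case: j jk => [|j] jk /=.
  apply/rowP => c; rewrite mxE.
  have -> : Ordinal jk = @lshift 1 k ord0 :> 'I_(1 + k) by exact: val_inj.
  exact: (@col_mxEu R 1 k n u M ord0 c).
rewrite -[j]/(val (Ordinal (jk : (j < k)%N))) nth_rows; apply/rowP => c; rewrite mxE [RHS]mxE.
have -> : Ordinal jk = @rshift 1 k (Ordinal (jk : (j < k)%N)) :> 'I_(1 + k) by exact: val_inj.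
exact: (@col_mxEd R 1 k n u M _ c).
Qed.

Lemma seq_split_nth T (x0 : T) i (s : seq T) : (i < size s)%N ->
  s = take i s ++ nth x0 s i :: drop i.+1 s.
Proof. by move=> si; rewrite -drop_nth// cat_take_drop. Qed.

Lemma alt_alternating k (f : seq 'rV[R]_n -> R) :
  alt f -> alternating_form (fun M : 'M[R]_(k, n) => f (rows M) : R^o).
Proof.
move=> af; split=> [i M a u v|M i j ij rij].
  by rewrite !rows_set (alt_lin af).
wlog lij : i j ij rij / (i < j)%N.
  by move=> H; case: (ltngtP i j) => [|ji|/val_inj e];
    [exact: H|apply: (H j i); rewrite // eq_sym|rewrite e eqxx in ij].
rewrite (seq_split_nth 0 (i := i) (s := rows M)) ?size_rows//.
have jd : (j - i.+1 < size (drop i.+1 (rows M)))%N.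
  by rewrite size_drop size_rows ltn_sub2r// (leq_ltn_trans lij).
rewrite (seq_split_nth 0 jd) nth_drop subnKC// !nth_rows -rij.
exact: alt_rep_far.
Qed.

Lemma mxs_set k (s1 s2 : seq 'rV[R]_n) u (ik : (size s1 < k)%N) :
  size (s1 ++ u :: s2) = k ->
  mxs k (s1 ++ u :: s2) = set_row (Ordinal ik) u (mxs k (s1 ++ 0 :: s2)).
Proof.
move=> sk; apply/row_matrixP => i; rewrite rowK.
apply/rowP => c; rewrite !mxE -val_eqE /=; case: eqP => [->|ne].
  by rewrite nth_cat ltnn subnn.
rewrite !nth_cat; case: ltnP => // l.
have : (size s1 < i)%N by rewrite ltn_neqAle l andbT; apply/eqP => e; apply: ne.
by move=> l'; rewrite -(subnSK l').
Qed.

Lemma alternating_alt k (w : 'M[R]_(k, n) -> R^o) : alternating_form w ->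
  alt (fun s => if size s == k then w (mxs k s) : R else 0).
Proof.
move=> [wl_ wr]; split=> [s1 s2 a u v|s1 s2 u].
  have sz x : size (s1 ++ x :: s2) = size (s1 ++ u :: s2) by rewrite !size_cat.
  rewrite !(sz _); case: eqP => [sk|_]; last by rewrite mulr0 addr0.
  have ik : (size s1 < k)%N by rewrite -sk size_cat /= addnS ltnS leq_addr.
  have H x := mxs_set ik (etrans (sz x) sk).
  rewrite (H (a *: u + v)) (H u) (H v).
  exact: wl_.
case: eqP => // sk.
have ik : (size s1 < k)%N by rewrite -sk size_cat /= addnS ltnS leq_addr.
have jk : ((size s1).+1 < k)%N by rewrite -sk size_cat /= !addnS !ltnS leq_addr.
apply: (wr _ (Ordinal ik) (Ordinal jk)); first by rewrite -val_eqE /= ltn_eqF.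
by rewrite !rowK /= !nth_cat ltnn subnn ltnNge leqnSn /= subSn// subnn.
Qed.

End Rows.

Section Hat.
Context (R : realType) (n : nat) (X : topologicalType) (A : atlas R n X).
Hypothesis HA : is_atlas A.
Implicit Types (p q : X).

(** A form of degree k as a form of mixed degree, zero on lists of other lengths; [hom] extracts the
    component of degree k again. *)
Definition hat k (w : form R n X k) : lfm R n X := fun p s =>
  if size s == k then w p (mxs k s) else 0.

Definition hom k (om : lfm R n X) : form R n X k := fun p M => om p (rows M).

Arguments hom k om p M : clear implicits.

Lemma homK k (w : form R n X k) : hom k (hat w) = w.
Proof.
apply/funext => p; apply/funext => M; by rewrite /hom /hat size_rows eqxx rowsK.
Qed.

Lemma hat_hom k om p s : hat (hom k om) p s = if size s == k then om p s else 0.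
Proof. by rewrite /hat; case: eqP => // sk; rewrite /hom mxsK. Qed.

Lemma local_formE k (w : form R n X k) q M x : cimg (A q) x ->
  local_form A w q M x = lf A q (hat w) x (rows M).
Proof.
move=> qx; rewrite /lf /hat size_map size_rows eqxx /local_form.
congr (w _ _); apply/row_matrixP => i; rewrite rowK row_mul.
rewrite (nth_map 0) ?size_rows// nth_rows Dv_jacobian//.
by apply: trans_smv => //; exact: atlas_mem.
Qed.

Lemma smooth_hat k (w : form R n X k) : smooth_form A w -> sm A (hat w).
Proof.
move=> [aw Cw]; split=> [p|q x qx s]; first exact: alternating_alt.
have [sk|sk] := eqVneq (size s) k; last first.
  by apply: sm1_eq (sm1_cst 0 x) => y; rewrite /lf /hat size_map (negbTE sk).
have : sm1 (local_form A w q (mxs k s)) x.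
  by exists (cimg (A q)); split=> //; [exact: (atlas_img_open HA)|exact: Cw].
apply: sm1_ext; apply: filterS (near_cimg HA qx) => y qy.
by rewrite local_formE// mxsK.
Qed.

Lemma sm_hom k om : sm A om -> smooth_form A (hom k om).
Proof.
move=> [ao so]; split=> [p|q M]; first exact: alt_alternating.
apply: Ck_sm1; first exact: (atlas_img_open HA).
move=> x qx; apply: sm1_ext (so q x qx (rows M)).
apply: filterS (near_cimg HA qx) => y qy.
by rewrite local_formE// /lf hat_hom size_map size_rows eqxx.
Qed.

Lemma sm_hat_hom k om : sm A om -> sm A (hat (hom k om)).
Proof. by move=> so; apply/smooth_hat/sm_hom. Qed.

Lemma hat_extd k (w : form R n X k) p s : smooth_form A w ->
  hat (extd A w) p s = dform A (hat w) p s.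
Proof.
move=> sw; have zz := cimg_zp HA p; rewrite {1}/hat /dform /dl; case: eqP => sk.
  rewrite /extd sk; apply: eq_bigr => i _; rewrite rowK; congr (_ * _).
  apply: near_eq_derive; apply: filterS (near_cimg HA zz) => y qy.
  by rewrite local_formE// rows_row' mxsK.
rewrite big1// => i _.
rewrite (_ : (fun y => lf A p (hat w) y (rem_nth i s)) = fun=> 0) ?D_cstE ?mulr0//.
apply/funext => y; rewrite /lf /hat size_map size_cat size_take_min size_drop.
rewrite (minn_idPl (ltnW (ltn_ord i))) (_ : _ == k = false)//.
by apply/eqP; have := ltn_ord i; lia.
Qed.

(** The factorials that normalise [wedge] cancel the multiplicity found in [perm_wedge_splits]; on
    lists of another length no split fits both degrees. *)
Lemma hat_wedge k l (w : form R n X k) (v : form R n X l) p s :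
  alternating_form (w p) -> alternating_form (v p) ->
  hat (wedge w v) p s = wlf (hat w) (hat v) p s.
Proof.
move=> aw av; rewrite /wlf {1}/hat; case: eqP => sk.
  have := @perm_wedge_splits _ _ (k + l) k l (hat w p) (hat v p) s erefl sk
    (alternating_alt aw) (alternating_alt av).
  have fz : (k`! * l`!)%:R != 0 :> R by rewrite pnatr_eq0 muln_eq0 negb_or -!lt0n !fact_gt0.
  move=> H; apply: (mulfI fz); rewrite -H; last 2 first.
  - by move=> t; rewrite /hat => /negbTE ->.
  - by move=> t; rewrite /hat => /negbTE ->.
  rewrite /wedge mulrA mulfV// mul1r /perm_wedge; apply: eq_bigr => t _.
  have st := size_perm_seq t s.
  have e1 : size (take k (perm_seq t s)) = k by rewrite size_take_min st (minn_idPl (leq_addr _ _)).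
  have e2 : size (drop k (perm_seq t s)) = l by rewrite size_drop st addKn.
  rewrite /hat e1 e2 !eqxx; congr (_ * (w p _ * v p _)).
    apply/row_matrixP => i; rewrite rowK nth_take//.
    rewrite -[val i]/(val (lshift l i)) nth_perm_seq.
    by apply/rowP => c; rewrite !mxE.
  apply/row_matrixP => i; rewrite rowK nth_drop.
  rewrite -[(k + i)%N]/(val (rshift k i)) nth_perm_seq.
  by apply/rowP => c; rewrite !mxE.
rewrite wl_splits; apply/esym.
suff H : Allp (fun t : nat * seq 'rV[R]_n * seq 'rV[R]_n => hat w p t.1.2 * hat v p t.2 = 0) (splits s).
  by rewrite (eq_big_Forall (G := fun=> 0) H) ?big1// => t ->; rewrite mulr0.
apply: Allp_impl (splits_size s) => t st; rewrite /hat.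
case: eqP => e1; rewrite ?mul0r//; case: eqP => e2; rewrite ?mulr0//.
by case: sk; rewrite -st e1 e2.
Qed.

Lemma hat_unit : hat (@unit_form R n X) = fun _ => @one R 'rV[R]_n.
Proof. by apply/funext => p; apply/funext => s; rewrite /hat /one; case: eqP. Qed.

Lemma hat_contraction k (xi : X -> 'rV[R]_n) (w : form R n X k.+1) p s :
  hat (contraction xi w) p s = hat w p (xi p :: s).
Proof.
rewrite /hat /= eqSS; case: eqP => // sk; rewrite /contraction.
congr (w p _); rewrite -[LHS]rowsK rows_col mxsK//.
Qed.

End Hat.

Arguments hom {R n X} k om p M.

Lemma hat_pullback (R : realType) (n m : nat) (X Y : topologicalType)
    (A : atlas R n X) (B : atlas R m Y) (HA : is_atlas A) (HB : is_atlas B)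
    (f : X -> Y) k (w : form R m Y k) p s : smap A B f ->
  hat (pullback A B f w) p s = pull A B f (hat w) p s.
Proof.
move=> sf; rewrite /hat /pull size_map; case: eqP => // sk.
rewrite /pullback; congr (w _ _); apply/row_matrixP => i.
rewrite row_mul !rowK (nth_map 0) ?sk//.
exact: (tangent_mxE HA HB).
Qed.

Section PointCurrentFunctionals.
Context (R : realType) (n : nat) (X : topologicalType) (A : atlas R n X).
Hypothesis HA : is_atlas A.
Implicit Types (p q : X) (om et : lfm R n X).

Lemma E_hat_hom p a s k om :
  E A p a s (hat (hom k om)) = if size s == k then E A p a s om else 0.
Proof.
rewrite /E; have e y : lf A p (hat (hom k om)) y s = if size s == k then lf A p om y s else 0.
  by rewrite /lf hat_hom size_map.
case: eqP => sk.
  by congr (dd a _ _); apply/funext => y; rewrite e; case: eqP.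
rewrite -[RHS](dd_zero a (zp A p)); congr (dd a _ _); apply/funext => y.
by rewrite e; case: eqP.
Qed.

Definition cbound p (T : ptcurrent A p) : nat :=
  sval (cid (supp_degree (asboolW (valP T)))).

(* The value of [T] on a form of mixed degree. *)
Definition chat p (T : ptcurrent A p) om : R := \sum_(k < cbound T) cev (ptval T) (hom k om).

Lemma ptcurrentP p (T : ptcurrent A p) : supported_at A p (ptval T).
Proof. exact: (asboolW (valP T)). Qed.

Lemma cboundP p (T : ptcurrent A p) k (w : form R n X k) :
  (cbound T <= k)%N -> cev (ptval T) w = 0.
Proof. exact: (svalP (cid (supp_degree (asboolW (valP T))))). Qed.

Lemma chatE p (T : ptcurrent A p) N om : (cbound T <= N)%N ->
  chat T om = \sum_(k < N) cev (ptval T) (hom k om).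
Proof.
move=> TN; rewrite /chat -!(big_mkord xpredT (fun k => cev (ptval T) (hom k om))).
rewrite [RHS](big_cat_nat _ (n := cbound T))//= [X in _ + X]big_nat_cond.
by rewrite [X in _ + X]big1 ?addr0// => k /andP[/andP[Tk _] _]; rewrite cboundP.
Qed.

Lemma current_form0 p (T : ptcurrent A p) k : cev (ptval T) (0 : form R n X k) = 0.
Proof.
have s0 : smooth_form A (0 : form R n X k).
  have := sm_hom HA k (sm_zero A).
  by rewrite (_ : hom k _ = 0)//.
have [_ lT _] := supp_current (ptcurrentP T) k.
have := lT 1 0 0 s0 s0; rewrite !scale1r addr0 => e.
by apply: (@addrI _ (cev (ptval T) (0 : form R n X k) : R)); rewrite addr0 -e.
Qed.

Lemma chat_hat p (T : ptcurrent A p) k (w : form R n X k) :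
  chat T (hat w) = cev (ptval T) w.
Proof.
rewrite (@chatE p T (maxn (cbound T) k.+1)); last exact: leq_maxl.
have kN : (k < maxn (cbound T) k.+1)%N by rewrite leq_max leqnn orbT.
rewrite (bigD1 (Ordinal kN))//= homK big1 ?addr0// => j jk.
rewrite (_ : hom j (hat w) = 0) ?current_form0//.
apply/funext => q; apply/funext => M; rewrite /hom /hat size_rows.
by rewrite -val_eqE /= in jk; rewrite (negbTE jk).
Qed.

(** Off the smooth forms both currents are 0 by convention. *)
Lemma ptcurrent_eq p (T S : ptcurrent A p) :
  (forall k (w : form R n X k), smooth_form A w -> cev (ptval T) w = cev (ptval S) w) -> T = S.
Proof.
move=> TS; apply/val_inj/funext => -[k w].
have [sw|nsw] := pselect (smooth_form A w); first exact: TS.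
have jT := current_junk (supp_current (ptcurrentP T) k) nsw.
have jS := current_junk (supp_current (ptcurrentP S) k) nsw.
rewrite -[LHS]/(cev (ptval T) w) -[RHS]/(cev (ptval S) w); exact: (etrans jT (esym jS)).
Qed.

Lemma chat_inj p (T S : ptcurrent A p) :
  (forall om, sm A om -> chat T om = chat S om) -> T = S.
Proof.
move=> TS; apply: ptcurrent_eq => k w sw.
by rewrite -!chat_hat; apply: TS; exact: smooth_hat.
Qed.

Lemma chat_comb p (T : ptcurrent A p) c om et : sm A om -> sm A et ->
  chat T (fun p s => c * om p s + et p s) = c * chat T om + chat T et.
Proof.
move=> so se; rewrite /chat mulr_sumr -big_split; apply: eq_bigr => k _ /=.
have [_ lT _] := supp_current (ptcurrentP T) k.
exact: (lT c _ _ (sm_hom HA k so) (sm_hom HA k se)).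
Qed.

Lemma chat_lin p c (T S : ptcurrent A p) om :
  chat (c *: T + S) om = c * chat T om + chat S om.
Proof.
pose N := maxn (cbound (c *: T + S)) (maxn (cbound T) (cbound S)).
rewrite !(@chatE _ _ N) ?leq_max ?leqnn ?orbT// mulr_sumr -big_split.
exact: eq_bigr.
Qed.

Lemma chat0 p om : chat (0 : ptcurrent A p) om = 0.
Proof. by rewrite /chat big1. Qed.

Lemma ev_hat_hom p L k om : ev A p L (hat (hom k om)) =
  \sum_(c <- L) if size c.2 == k then c.1.1 * E A p c.1.2 c.2 om else 0.
Proof.
by apply: eq_bigr => c _; rewrite E_hat_hom; case: ifP => // _; rewrite mulr0.
Qed.

End PointCurrentFunctionals.

(** * Differential operators along a map *)

Section DifferentialOperators.
Context (R : realType) (n m : nat) (phi : 'rV[R]_n -> 'rV[R]_m).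
Context (U : set 'rV[R]_n) (D : set 'rV[R]_m).
Hypothesis oU : open U.
Hypothesis sphi : forall y, U y -> smv phi y.
Hypothesis UD : forall y, U y -> D (phi y).

Local Notation lform p := ('rV[R]_p -> seq 'rV[R]_p -> R^o).

Definition bmap p (al : seq 'I_p) : seq 'rV[R]_p := map (fun i => delta_mx 0 i) al.

Definition good (w : lform m) := forall z, D z -> smw w z /\ alt (w z).

Lemma good_cons w u : good w -> good (fun z q => w z (u :: q)).
Proof.
move=> gw z Dz; have [sw aw] := gw z Dz; split; first exact: smw_cons.
exact: alt_cons.
Qed.

(* Differential operators along [phi] of order at most [r], from k-forms to functions. *)
Definition DOp (r k : nat) (P : lform m -> 'rV[R]_n -> R^o) :=
  exists l : seq (('rV[R]_n -> R^o) * seq 'I_m * seq 'I_m),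
    Allp (fun c => [/\ forall y, U y -> sm1 c.1.1 y, (size c.1.2 <= r)%N & size c.2 = k]) l /\
    forall w, good w -> forall y, U y -> P w y = \sum_(c <- l)
      c.1.1 y * dd (bmap c.1.2) (fun z => w z (bmap c.2)) (phi y).

Lemma DOp_ext r k P Q : (forall w, good w -> forall y, U y -> P w y = Q w y) ->
  DOp r k P -> DOp r k Q.
Proof.
by move=> PQ [l [lP lE]]; exists l; split=> // w gw y Uy; rewrite -PQ// lE.
Qed.

Lemma DOp0 r k : DOp r k (fun _ _ => 0).
Proof. by exists [::]; split=> // w _ y _; rewrite big_nil. Qed.

Lemma DOpD r k P Q : DOp r k P -> DOp r k Q -> DOp r k (fun w y => P w y + Q w y).
Proof.
move=> [l [lP lE]] [l' [lP' lE']]; exists (l ++ l'); split; first exact: Allp_cat.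
by move=> w gw y Uy; rewrite big_cat lE// lE'.
Qed.

Lemma DOp_sum r k (I : Type) (s : seq I) P : (forall i, DOp r k (P i)) ->
  DOp r k (fun w y => \sum_(i <- s) P i w y).
Proof.
move=> HP; elim: s => [|i s IH].
  by apply: DOp_ext (DOp0 r k) => w _ y _; rewrite big_nil.
by apply: DOp_ext (DOpD (HP i) IH) => w _ y _; rewrite big_cons.
Qed.

Lemma DOp_mul r k g P : (forall y, U y -> sm1 g y) -> DOp r k P ->
  DOp r k (fun w y => g y * P w y).
Proof.
move=> gs [l [lP lE]].
exists [seq (fun y => g y * c.1.1 y : R^o, c.1.2, c.2) | c <- l]; split.
  by apply: Allp_map; apply: Allp_impl lP => c [? ? ?]; split=> //= y Uy; apply: sm1M; auto.
move=> w gw y Uy; rewrite lE// big_map mulr_sumr; apply: eq_bigr => c _ /=.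
by rewrite mulrA.
Qed.

Lemma DOp_elem r k g al I : (forall y, U y -> sm1 g y) -> (size al <= r)%N -> size I = k ->
  DOp r k (fun w y => g y * dd (bmap al) (fun z => w z (bmap I)) (phi y)).
Proof.
move=> sg_ alr Ik; exists [:: (g, al, I)]; split=> // w gw y Uy.
by rewrite big_seq1.
Qed.

Lemma DOp_cons r k P i : DOp r k P ->
  DOp r k.+1 (fun w => P (fun z q => w z (delta_mx 0 i :: q))).
Proof.
move=> [l [lP lE]]; exists [seq (c.1, i :: c.2) | c <- l]; split.
  by apply: Allp_map; apply: Allp_impl lP => c [? ? /= ->].
by move=> w gw y Uy; rewrite lE ?big_map//; exact: good_cons.
Qed.

Lemma sm1_dd_phi w al I y : good w -> U y ->
  sm1 (fun y => dd (bmap al) (fun z => w z (bmap I)) (phi y)) y.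
Proof.
move=> gw Uy; apply: (sm1_comp (sphi Uy)); apply: sm1_dd.
exact: (gw _ (UD Uy)).1.
Qed.

(** The derivative falls on a coefficient, or, by the chain rule along [phi], adds one partial
    derivative of the form. *)
Lemma DOp_D r k P u : DOp r k P -> DOp r.+1 k (fun w y => 'D_u (P w) y).
Proof.
move=> [l [lP lE]].
pose Q (c : ('rV[R]_n -> R^o) * seq 'I_m * seq 'I_m) (w : lform m) y : R^o :=
  'D_u (fun y => c.1.1 y * dd (bmap c.1.2) (fun z => w z (bmap c.2)) (phi y) : R^o) y.
have HQ : DOp r.+1 k (fun w y => \sum_(c <- l) Q c w y).
  elim: l lP {lE} => [|c l IH] /= lP.
    by apply: DOp_ext (DOp0 _ k) => w _ y _; rewrite big_nil.
  have [[sc cr ck] lP'] := lP.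
  suff Hc : DOp r.+1 k (Q c).
    by apply: DOp_ext (DOpD Hc (IH lP')) => w _ y _; rewrite big_cons.
  pose Q2 (w : lform m) y : R^o := \sum_j (c.1.1 y * 'D_u (fun y => phi y 0 j : R^o) y) *
     dd (bmap (j :: c.1.2)) (fun z => w z (bmap c.2)) (phi y).
  apply: (@DOp_ext _ _ (fun w y => 'D_u c.1.1 y * dd (bmap c.1.2) (fun z => w z (bmap c.2)) (phi y)
    + Q2 w y)).
    move=> w gw y Uy; rewrite /Q D_mulE; [|exact: sc|exact: sm1_dd_phi].
    congr (_ + _); rewrite /Q2.
    have sF : sm1 (dd (bmap c.1.2) (fun z => w z (bmap c.2))) (phi y).
      by apply: sm1_dd; exact: (gw _ (UD Uy)).1.
    rewrite (D_chain _ (sphi Uy) sF) (D_basisE _ sF) mulr_sumr; apply: eq_bigr => j _.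
    by rewrite mxE mulrA.
  apply: DOpD.
    by apply: DOp_elem => //; [move=> y Uy; exact/sm1_D/sc|exact: leqW].
  apply: DOp_sum => j; apply: DOp_elem => //.
  by move=> y Uy; apply: sm1M; [exact: sc|apply: sm1_D; exact: (sphi Uy j)].
apply: DOp_ext HQ => w gw y Uy.
rewrite (near_eq_derive _ (g := fun y => \sum_(c <- l) c.1.1 y * dd (bmap c.1.2)
    (fun z => w z (bmap c.2)) (phi y))); last first.
  by apply: filterS (open_near oU Uy) => x Ux; rewrite lE.
have : Allp (fun c => sm1 (fun y => c.1.1 y * dd (bmap c.1.2) (fun z => w z (bmap c.2)) (phi y)) y) l.
  by apply: Allp_impl lP => c [sc _ _]; apply: sm1M; [exact: sc|exact: sm1_dd_phi].
elim: l {lP lE} => [|c l IH] /= lP.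
  rewrite big_nil (_ : (fun _ => _) = fun=> 0) ?D_cstE//.
  by apply/funext => x; rewrite big_nil.
rewrite big_cons IH; last by case: lP.
rewrite [in RHS](_ : (fun _ => _) = (fun y => c.1.1 y * dd (bmap c.1.2)
    (fun z => w z (bmap c.2)) (phi y) + \sum_(c <- l) c.1.1 y * dd (bmap c.1.2)
    (fun z => w z (bmap c.2)) (phi y))); last by apply/funext => x; rewrite big_cons.
case: lP => sc lP; rewrite D_addE//.
elim: l lP {IH} => [|c' l IH] /= lP.
  by apply: sm1_eq (sm1_cst 0 y) => x; rewrite big_nil.
by case: lP => sc' lP; apply: sm1_eq (sm1D sc' (IH lP)) => x; rewrite big_cons.
Qed.

Lemma DOp_pull0 s : DOp 0 (size s) (fun w y => pullv phi w y s).
Proof.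
elim: s => [|u s IH].
  apply: (@DOp_ext _ _ (fun w y => 1 * dd (bmap [::]) (fun z => w z (bmap [::])) (phi y))).
    by move=> w gw y Uy; rewrite mul1r.
  by apply: DOp_elem => // y Uy; exact: sm1_cst.
apply: (@DOp_ext _ _ (fun w y => \sum_k 'D_u (fun y => phi y 0 k : R^o) y *
    pullv phi (fun z q => w z (delta_mx 0 k :: q)) y s)).
  move=> w gw y Uy; have [sw aw] := gw _ (UD Uy).
  rewrite /pullv /= [Dv phi y u in RHS]rv_decomp (@alt_sum _ _ _ [::])//.
  by apply: eq_bigr => k _; rewrite mxE.
apply: DOp_sum => k; apply: (DOp_mul (P := fun w y => pullv phi (fun z q => w z (delta_mx 0 k ::
  q)) y s)); last first.
  exact: (DOp_cons (P := fun w y => pullv phi w y s) k IH).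
by move=> y Uy; apply: sm1_D; exact: (sphi Uy k).
Qed.

Lemma DOp_dd a r k P : DOp r k P -> DOp (size a + r) k (fun w y => dd a (P w) y).
Proof. by move=> HP; elim: a => //= u a; exact: DOp_D. Qed.

(** The coefficients do not depend on the form. This one fact reduces arbitrary directions to basis
    vectors, bounds the order of a push-forward and transports cut-off estimates between charts. *)
Lemma DOp_pull a s : DOp (size a) (size s) (fun w y => dd a (fun y => pullv phi w y s) y).
Proof. by have := DOp_dd a (DOp_pull0 s); rewrite addn0. Qed.

End DifferentialOperators.

(** * Finite combinations of derivatives as currents *)

Section Representations.
Context (R : realType) (n : nat) (X : topologicalType) (A : atlas R n X).
Hypothesis HA : is_atlas A.
Implicit Types (p q : X) (om et : lfm R n X).
Local Notation vec := 'rV[R]_n.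

Lemma good_lf om p : sm A om -> good (cimg (A p)) (lf A p om).
Proof. by move=> so z pz; split; [exact: so.2|exact: lf_alt so.1 pz]. Qed.

(** The seminorms involve only basis vectors and partial derivatives; [DOp_pull] for the identity
    map expresses arbitrary directions through them. *)
Lemma E_basis p (a s : seq vec) : exists l : seq (R * seq 'I_n * seq 'I_n),
  Allp (fun c => (size c.1.2 <= size a)%N /\ size c.2 = size s) l /\
  forall om, sm A om -> E A p a s om =
    \sum_(c <- l) c.1.1 * E A p (bmap R c.1.2) (bmap R c.2) om.
Proof.
have zz := cimg_zp HA p.
have [l [lP lE]] := @DOp_pull R n n (fun y => y) (cimg (A p)) (cimg (A p))
  (atlas_img_open HA (p := p)) (fun y _ => smv_id y) (fun y H => H) a s.
exists [seq (c.1.1 (zp A p) : R, c.1.2, c.2) | c <- l]; split.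
  by apply: Allp_map; apply: Allp_impl lP => c [].
move=> om so; rewrite big_map /= -(lE _ (good_lf (p := p) so) _ zz) /E; congr (dd a _ _).
by apply/funext => y; rewrite /pullv (eq_map (Dv_id y)) map_id.
Qed.

Definition rep := seq (R * seq vec * seq vec).

Definition rep_le k r (L : rep) := Allp (fun c => (size c.1.2 <= r)%N /\ size c.2 = k) L.

Definition basis_rep (l : seq (R * seq 'I_n * seq 'I_n)) : rep :=
  [seq (c.1.1, bmap R c.1.2, bmap R c.2) | c <- l].

Lemma ev_basis p (L : rep) : exists l : seq (R * seq 'I_n * seq 'I_n),
  (forall k r, rep_le k r L -> Allp (fun c => (size c.1.2 <= r)%N /\ size c.2 = k) l) /\
  forall om, sm A om -> ev A p L om = ev A p (basis_rep l) om.
Proof.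
elim: L => [|c L [l [lP lE]]]; first by exists [::]; split.
have [l1 [l1P l1E]] := E_basis p c.1.2 c.2.
exists ([seq (c.1.1 * d.1.1, d.1.2, d.2) | d <- l1] ++ l); split.
  move=> k r [[cr ck] LP]; apply: Allp_cat; last exact: lP.
  apply: Allp_map; apply: Allp_impl l1P => d [d1 d2]; split=> /=.
    exact: leq_trans cr.
  by rewrite d2.
move=> om so; rewrite /ev /basis_rep big_cons map_cat big_cat -map_comp big_map /=.
have := lE om so; rewrite /ev /basis_rep => ->; congr (_ + _).
rewrite l1E// mulr_sumr; apply: eq_bigr => d _ /=.
by rewrite mulrA.
Qed.

Lemma ev_cat p (L L' : rep) om : ev A p (L ++ L') om = ev A p L om + ev A p L' om.
Proof. by rewrite /ev big_cat. Qed.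

Definition scale_rep (c : R) (L : rep) : rep := [seq (c * d.1.1, d.1.2, d.2) | d <- L].

Lemma ev_scale p c (L : rep) om : ev A p (scale_rep c L) om = c * ev A p L om.
Proof. by rewrite /ev big_map mulr_sumr; apply: eq_bigr => d _; rewrite /= mulrA. Qed.

Definition mkc (Phi : lfm R n X -> R) : current R n X := fun w =>
  if `[< smooth_form A (tagged w) >] then Phi (hat (tagged w)) else 0.

Lemma mkcE Phi k (w : form R n X k) : smooth_form A w -> cev (mkc Phi) w = Phi (hat w).
Proof. by move=> sw; rewrite /cev /mkc /= asboolT. Qed.

Lemma mkc_junk Phi k (w : form R n X k) : ~ smooth_form A w -> cev (mkc Phi) w = 0.
Proof. by move=> sw; rewrite /cev /mkc /= asboolF. Qed.

Lemma bmap_rows k (I : seq 'I_n) : size I = k -> exists I' : 'I_k -> 'I_n,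
  rows (basis_mx R I') = bmap R I.
Proof.
move=> Ik; have tk : size I == k by apply/eqP.
exists (tnth (Tuple tk)); apply: (@eq_from_nth _ 0); first by rewrite size_rows size_map.
move=> i; rewrite size_rows => ik; rewrite -[i]/(val (Ordinal ik)) nth_rows rowK.
by rewrite (tnth_nth (tnth (Tuple tk) (Ordinal ik))) (nth_map (tnth (Tuple tk) (Ordinal ik))) ?Ik.
Qed.

Lemma iter_derivE (al : seq 'I_n) f : iter_deriv al f = dd (bmap R al) f.
Proof. by elim: al => //= i al; rewrite /iter_deriv /= => ->. Qed.

Lemma smooth_lin k (a : R) (w v : form R n X k) : smooth_form A w -> smooth_form A v ->
  smooth_form A (a *: w + v).
Proof.
move=> sw sv; rewrite -(homK (a *: w + v)).
have -> : hat (a *: w + v) = fun p s => a * hat w p s + hat v p s.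
  by apply/funext => p; apply/funext => s; rewrite /hat; case: eqP; rewrite ?mulr0 ?addr0.
apply: (sm_hom HA); apply: sm_comb => //; exact: smooth_hat.
Qed.

Lemma hat_lin k (a : R) (w v : form R n X k) :
  hat (a *: w + v) = fun p s => a * hat w p s + hat v p s.
Proof.
by apply/funext => p; apply/funext => s; rewrite /hat; case: eqP; rewrite ?mulr0 ?addr0.
Qed.

Lemma ev_bound p (l : seq (R * seq 'I_n * seq 'I_n)) k (w : form R n X k) m b :
  Allp (fun c => (size c.1.2 <= m)%N) l ->
  0 <= b -> (forall al (I : 'I_k -> 'I_n), (size al <= m)%N ->
    `|iter_deriv al (local_form A w p (basis_mx R I)) (zp A p)| <= b) ->
  `|ev A p (basis_rep l) (hat w)| <= (\sum_(c <- l) `|c.1.1|) * b.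
Proof.
move=> lm b0 Hb; have zz := cimg_zp HA p.
rewrite /ev big_map; elim: l lm => [|c l IH] lm.
  by rewrite !big_nil normr0 mul0r.
case: lm => cm lm; rewrite !big_cons mulrDl (le_trans (ler_normD _ _))// lerD ?IH//.
rewrite normrM ler_wpM2l//=.
have [ck|ck] := eqVneq (size c.2) k; last first.
  rewrite /E (_ : (fun x => _) = fun=> 0) ?dd_zero ?normr0//.
  by apply/funext => x; rewrite /lf /hat !size_map (negbTE ck).
have [I' I'E] := bmap_rows ck.
have := Hb c.1.2 I' cm; rewrite iter_derivE /E (dd_ext _ (g := fun x => lf A p (hat w) x (bmap R c.2)))//.
by apply: filterS (near_cimg HA zz) => y qy; rewrite local_formE// I'E.
Qed.

(** Only finitely many partial derivatives at [zp A p] enter, so one chart and a one-point compact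
    set bound the functional. *)
Lemma mkc_supported p Phi (L : rep) : (forall om, sm A om -> Phi om = ev A p L om) ->
  supported_at A p (mkc Phi).
Proof.
move=> PL; have [l [_ lE]] := ev_basis p L.
have zz := cimg_zp HA p.
have cE k (w : form R n X k) : smooth_form A w -> cev (mkc Phi) w = ev A p (basis_rep l) (hat w).
  by move=> sw; have sh := smooth_hat HA sw; rewrite mkcE// PL// lE.
split.
- move=> k; split; first exact: mkc_junk.
    move=> a w v sw sv; rewrite !cE//; last exact: smooth_lin.
    by rewrite hat_lin ev_comb//; exact: smooth_hat.
  pose M := \max_(c <- l) size c.1.2.
  exists (\sum_(c <- l) `|c.1.1|), M, 1%N, (fun=> p), (fun=> [set zp A p]); split=> //.
    by move=> _; split; [exact: compact_set1|move=> _ ->].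
  move=> w sw b b0 Hb; rewrite cE//; apply: (@ev_bound _ _ _ _ M) => //.
    rewrite /M; elim: l {lE cE M Hb} => //= c l IH; rewrite big_cons; split.
      exact: leq_maxl.
    by apply: Allp_impl IH => d dl; rewrite (leq_trans dl)// leq_maxr.
  by move=> al I alM; apply: (Hb ord0).
- move=> k w sw w0; rewrite mkcE// PL ?/ev; last exact: smooth_hat.
  rewrite big1// => c _; rewrite (@E_near _ _ _ _ HA p c.1.2 c.2 _ (fun _ _ => 0)).
    by rewrite /E /lf dd_zero mulr0.
  apply: filterS w0 => q wq; apply/funext => s; rewrite /hat wq.
  by case: ifP.
- exists (\max_(c <- L) (size c.2).+1) => k w Lk.
  have [sw|nsw] := pselect (smooth_form A w); last exact: mkc_junk.
  rewrite mkcE// PL ?/ev; last exact: smooth_hat.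
  elim: L Lk {PL lE cE} => [|c L IH]; first by rewrite !big_nil.
  rewrite big_cons geq_max => /andP[ck Lk]; rewrite big_cons IH// addr0.
  rewrite /E (_ : (fun x => _) = fun=> 0) ?dd_zero ?mulr0//.
  by apply/funext => x; rewrite /lf /hat !size_map ltn_eqF.
Qed.

(** The default [0] is never taken when [has_rep] holds, by [mkc_supported]. *)
Definition mk p (Phi : lfm R n X -> R) : ptcurrent A p := insubd 0 (mkc Phi).

Definition has_rep p (Phi : lfm R n X -> R) :=
  exists L : rep, forall om, sm A om -> Phi om = ev A p L om.

Lemma mk_val p Phi : has_rep p Phi -> ptval (mk p Phi) = mkc Phi.
Proof.
move=> [L PL]; rewrite /mk -[LHS]/(val _) insubdK//; apply/asboolP.
exact: mkc_supported PL.
Qed.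

Lemma ev_hat_sum p (L : rep) om N : Allp (fun c => (size c.2 < N)%N) L ->
  \sum_(k < N) ev A p L (hat (hom k om)) = ev A p L om.
Proof.
move=> LN; under eq_bigr do rewrite ev_hat_hom.
rewrite exchange_big /= /ev; apply: (eq_big_Forall LN) => c cN.
rewrite (bigD1 (Ordinal cN))//= eqxx big1 ?addr0// => j jc.
by case: eqP => // e; case/eqP: jc; apply: val_inj; rewrite /= e.
Qed.

Lemma chat_mk p Phi om : has_rep p Phi -> sm A om -> chat (mk p Phi) om = Phi om.
Proof.
move=> hP so; have [L PL] := hP.
pose N := maxn (cbound (mk p Phi)) (\max_(c <- L) (size c.2).+1).
rewrite (@chatE _ _ _ _ _ _ N) ?leq_maxl// PL// -(@ev_hat_sum p L om N).
  apply: eq_bigr => k _; have sk := sm_hom HA k so.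
  by rewrite mk_val// mkcE// PL//; exact: smooth_hat.
rewrite /N; elim: L {hP PL N} => //= c L IH; rewrite big_cons; split.
  by rewrite !leq_max leqnn orbT.
apply: Allp_impl IH => d dl; apply: leq_trans dl _.
by rewrite geq_max leq_maxl /= leq_max leq_max leqnn !orbT.
Qed.

End Representations.

Lemma D_comp1 (R : realType) (V : normedModType R) (f : R -> R) (df : R) (g : V -> R) y v :
  is_derive (g y) 1 f df -> differentiable g y ->
  derivable (fun y => f (g y)) y v /\ 'D_v (fun y => f (g y)) y = df * 'D_v g y.
Proof.
move=> [Df fdf] dg.
have dff : differentiable f (g y) by apply/derivable1_diffP.
have dfg : differentiable (f \o g) y by exact: differentiable_comp.
split; first exact: diff_derivable.
rewrite (deriveE v dfg) (deriveE v dg) diff_comp//=.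
have lin (r : R) : 'd f (g y) r = r * 'd f (g y) (1 : R).
  by rewrite -{1}[r]mulr1 -[r * 1]/(r *: (1 : R^o)) linearZ.
by rewrite lin -(deriveE (1 : R) dff) fdf mulrC.
Qed.

(** * Currents supported at a point *)

Section FlatFunction.
Context (R : realType).
Implicit Types (P : {poly R}).

(** The functions P(1/t) exp(-1/t), extended by 0 to t <= 0, form a family closed under
    differentiation; [dflat] gives the polynomial of the derivative. *)
Definition flat P (t : R) : R := if 0 < t then P.[t^-1] * expR (- t^-1) else 0.

Definition dflat P : {poly R} := 'X^2 * (P - P^`()).

Lemma poly_exp_bound P : exists2 C : R, 0 <= C & forall s : R, 0 < s -> `|P.[s] * expR (- s)| <= C.
Proof.
have mono i : exists2 C : R, 0 <= C & forall s, 0 < s -> s ^+ i * expR (- s) <= C.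
  case: i => [|i].
    by exists 1 => // s s0; rewrite mul1r expRN invf_le1 ?expR_gt0// (le_trans _ (expR_ge1Dx _))// lerDl ltW.
  (* From s/(i+1) <= exp(s/(i+1)), raised to the power i+1. *)
  exists (i.+1%:R ^+ i.+1) => [|s s0]; first by rewrite exprn_ge0.
  rewrite expRN ler_pdivrMr ?expR_gt0//.
  have e : s = i.+1%:R * (s / i.+1%:R) by rewrite mulrCA divff ?mulr1// pnatr_eq0.
  rewrite [in leRHS]e expRM_natl -exprMn lerXn2r ?nnegrE//; first exact: ltW.
  rewrite {1}e ler_wpM2l// (le_trans _ (expR_ge1Dx _))// lerDr//.
elim/poly_ind: P => [|P c [C C0 PC]].
  by exists 0 => // s s0; rewrite horner0 mul0r normr0.
have HX Q : exists2 C, 0 <= C & forall s : R, 0 < s -> `|Q.[s] * expR (- s)| <= C.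
  have -> : Q = \sum_(i < size Q) Q`_i *: 'X^i by rewrite -[LHS]coefK poly_def.
  elim/big_ind : _ => [|Q1 Q2 [C1 C10 H1] [C2 C20 H2]|i _].
  - by exists 0 => // s s0; rewrite horner0 mul0r normr0.
  - exists (C1 + C2) => [|s s0]; first exact: addr_ge0.
    by rewrite hornerD mulrDl (le_trans (ler_normD _ _))// lerD ?H1 ?H2.
  - have [D D0 HD] := mono i; exists (`|Q`_i| * D) => [|s s0]; first exact: mulr_ge0.
    rewrite hornerZ hornerXn -mulrA normrM ler_wpM2l// ger0_norm ?HD//.
    by rewrite mulr_ge0 ?expR_ge0// exprn_ge0// ltW.
exact: HX.
Qed.

(** Away from 0 this is the chain rule. At 0, [poly_exp_bound] for ['X^2 * P] bounds the function by
    a multiple of h^2, so the difference quotient tends to 0. *)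
Lemma is_derive_flat P (t : R) : is_derive t 1 (flat P) (flat (dflat P) t).
Proof.
have [t0|t0|t0] := ltgtP t 0.
- have fl0 Q : flat Q t = 0 by rewrite /flat ltNge ltW.
  rewrite fl0; apply: (near_eq_is_derive (f := cst 0)).
    near=> s; rewrite /flat ltNge ltW//; near: s.
    exact: lt_nbhsl.
- have Dinv : is_derive t 1 (fun s : R => s^-1) (- t ^- 2).
    have := is_deriveV (f := id) (x := t) (v := 1) (t := 1) (lt0r_neq0 t0) (is_derive_id _ _).
    by rewrite /GRing.scale /= mulr1.
  have Df (s : R) : is_derive s (1:R) (fun s : R => P.[s] * expR (- s) : R) ((P^`() - P).[s] * expR (- s)).
    have DP : is_derive s 1 (horner P) P^`().[s].
      by split; [exact: derivable_horner|rewrite derivE derive1E].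
    have DE : is_derive s 1 (fun s : R => expR (- s)) (- expR (- s)).
      have Dn : is_derive s 1 (fun s : R => - s) (-1).
        have := is_deriveN (f := id) (x := s) (v := 1) (df := 1) (is_derive_id _ _); exact.
      have [d1 d2] := @D_comp1 R R expR _ (fun s : R => - s) s 1 (is_derive_expR _)
        ((derivable1_diffP _ _).1 (@ex_derive _ _ _ _ _ _ _ Dn)).
      split=> //; rewrite d2 (@derive_val _ _ _ _ _ _ _ Dn); ring.
    have DM := is_deriveM DP DE; apply: (is_derive_eq DM).
    by rewrite /GRing.scale /= hornerD hornerN; ring.
  have [d1 d2] := @D_comp1 R R (fun s => P.[s] * expR (- s)) _ (fun s : R => s^-1) t 1 (Df _)
     ((derivable1_diffP _ _).1 (@ex_derive _ _ _ _ _ _ _ Dinv)).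
  have DF : is_derive t (1:R) (fun s : R => P.[s^-1] * expR (- s^-1) : R) (flat (dflat P) t).
    split=> //; rewrite d2 (@derive_val _ _ _ _ _ _ _ Dinv) /flat t0 /dflat.
    by rewrite -exprVn !hornerE /=; ring.
  apply: near_eq_is_derive DF.
  near=> s; rewrite /flat ifT//; near: s; exact: lt_nbhsr.
- rewrite t0; have -> : flat (dflat P) 0 = 0 by rewrite /flat ltxx.
  have [C C0 HC] := poly_exp_bound ('X^2 * P).
  have bnd (h : R) : `|flat P h| <= C * `|h| ^+ 2.
    rewrite /flat; case: ifP => h0; last by rewrite normr0 mulr_ge0// exprn_ge0.
    have hi : 0 < h^-1 by rewrite invr_gt0.
    have := HC _ hi; rewrite hornerM hornerXn -mulrA normrM gtr0_norm ?exprn_gt0//.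
    rewrite exprVn mulrC ler_pdivrMr ?exprn_gt0// [`|h|]gtr0_norm//.
  have cv : h^-1 *: ((flat P \o shift 0) (h *: 1) - flat P 0) @[h --> 0^'] --> (0 : R).
    apply/cvgr0Pnorm_le => /= e e0.
    have eC : 0 < e / (C + 1) by rewrite divr_gt0// ltr_wpDl.
    near=> h.
    have h0 : h != 0 by near: h; exact: nbhs_dnbhs_neq.
    have he : `|h| <= e / (C + 1).
      near: h; apply: nbhs_dnbhs; apply/nbhs_normP; exists (e / (C + 1)) => //= x.
      by rewrite /ball_ /= sub0r normrN => /ltW.
    rewrite /= addr0 [h%:A]mulr1 {2}/flat ltxx subr0 normrZ normfV.
    rewrite ler_pdivrMl ?normr_gt0// (le_trans (bnd h))// expr2 mulrA mulrC.
    rewrite ler_wpM2l// (le_trans (ler_wpM2l C0 he))// mulrCA ger_pMr//.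
    by rewrite ler_pdivrMr ?ltr_wpDl// mul1r lerDl.
  split; last exact/cvg_lim.
  by apply/cvg_ex; exists 0.
Unshelve. all: by end_near. Qed.

Lemma sm1_flat n P (g : 'rV[R]_n -> R^o) x : sm1 g x -> sm1 (fun y => flat P (g y) : R^o) x.
Proof.
case=> O [oO Ox Cg]; exists O; split=> // m.
have dg y : O y -> differentiable (g : 'rV[R]_n -> R) y.
  by move=> Oy; exact: C1_differentiable (Cg 1%N).
have cf Q y : O y -> {for y, continuous (fun y => flat Q (g y) : R^o)}.
  move=> Oy; apply: (@continuous_comp _ _ _ g (flat Q)); first exact: (Ck_cont (Cg 0%N)).
  apply: differentiable_continuous; apply/derivable1_diffP.
  exact: (@ex_derive _ _ _ _ _ _ _ (is_derive_flat Q _)).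
elim: m P => [|m IH] P; first by split=> // y Oy; exact: cf.
split=> [y Oy|v]; first exact: cf.
have H y (Oy : O y) := @D_comp1 R 'rV[R]_n (flat P) _ g y v (is_derive_flat P _) (dg y Oy).
split=> [y /H[]//|].
apply: (Ck_ext oO _ (CkM oO (IH (dflat P)) ((Cg m.+1).2 v).2)) => y /H[_ e].
by rewrite e.
Qed.

Lemma flat1_ge0 t : 0 <= flat 1 t.
Proof. by rewrite /flat; case: ifP => // _; rewrite hornerC mul1r expR_ge0. Qed.

Lemma flat1_mono t t' : 0 < t -> t <= t' -> flat 1 t <= flat 1 t'.
Proof.
move=> t0 tt'; have t'0 := lt_le_trans t0 tt'.
by rewrite /flat t0 t'0 !hornerC !mul1r ler_expR lerN2 lef_pV2.
Qed.

Lemma flat_le0 P t : t <= 0 -> flat P t = 0.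
Proof. by move=> t0; rewrite /flat ltNge t0. Qed.

End FlatFunction.

(** Local bounds become one bound on a compact set: near-covering compactness is applied with the
    filter at infinity in the parameter [M]. *)
Lemma bounded_near_compact (R : realType) (T : topologicalType) (K : set T) (Q : R -> T -> Prop) :
  compact K -> (forall M M' x, M <= M' -> Q M x -> Q M' x) ->
  (forall x, K x -> exists M, \forall y \near x, Q M y) ->
  exists2 M, 0 <= M & forall x, K x -> Q M x.
Proof.
move=> /compact_near_coveringP cK Qm Qn.
have := cK R +oo Q _ _; case.
  move=> x Kx; have [M HM] := Qn x Kx.
  exists (Q M, [set M' | M <= M']) => [|[y M'] [/= Qy MM']]; last exact: Qm MM' Qy.
  by split; [exact: HM|apply: nbhs_pinfty_ge; exact: num_real].
move=> M [Mr HM]; exists (Num.max 0 (M + 1)); first by rewrite le_max lexx.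
by apply: HM; rewrite lt_max ltrDl ltr01 orbT.
Qed.

(** * Cut-off functions *)

Section Bump.
Context (R : realType) (n : nat).
Implicit Types (y z : 'rV[R]_n).

(** The least value of [flat 1 (t ^+ 2 - 1 / 4)] for t of absolute value at least 1, by
    monotonicity. *)
Definition bump_c : R := flat 1 (3 / 4).

(** Built from coordinates because row vectors carry the maximum norm. The sum vanishes when all
    coordinates are at most 1/2 in absolute value, and reaches [bump_c] once one of them is at least
    1, where the outer [flat 1] vanishes. *)
Definition bmp y : R^o :=
  flat 1 (bump_c - \sum_i flat 1 (y 0 i ^+ 2 - 1 / 4)) / flat 1 bump_c.

Lemma bump_c_gt0 : 0 < bump_c.
Proof. by rewrite /bump_c /flat divr_gt0// hornerC mul1r expR_gt0. Qed.

Lemma flat1_gt0 (t : R) : 0 < t -> 0 < flat 1 t.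
Proof. by move=> t0; rewrite /flat t0 hornerC mul1r expR_gt0. Qed.

Lemma sm1_bmp y : sm1 bmp y.
Proof.
have s1 : sm1 (fun y : 'rV[R]_n => bump_c - \sum_i flat 1 (y 0 i ^+ 2 - 1 / 4) : R^o) y.
  apply: sm1D; first exact: sm1_cst.
  apply: sm1N; apply: sm1_sum => i; apply: sm1_flat.
  apply: sm1D; last exact: sm1_cst.
  by apply: sm1_eq (sm1M (sm1_coord i y) (sm1_coord i y)) => z; rewrite expr2.
apply: sm1_eq (sm1M (sm1_flat 1 s1) (sm1_cst (flat 1 bump_c)^-1 y)) => z.
by [].
Qed.

Lemma bmp1 y : `|y| <= 1 / 2 -> bmp y = 1.
Proof.
move=> y2; rewrite /bmp big1 ?subr0 ?divff// => [|i _].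
  by rewrite gt_eqF// flat1_gt0// bump_c_gt0.
apply: flat_le0; rewrite subr_le0.
have yi : `|y 0 i| <= 1 / 2 by rewrite (le_trans _ y2)// mx_norm_coord.
rewrite -real_normK ?num_real// (le_trans (lerXn2r _ _ _ yi)) ?nnegrE//.
by rewrite expr2; lra.
Qed.

Lemma bmp0 y : 1 <= `|y| -> bmp y = 0.
Proof.
move=> y1; have [i iy] : exists i, 1 <= `|y 0 i|.
  move: y1; rewrite [leRHS]/Num.Def.normr /= mx_normrE => /bigmax_geP[|[[j i] _]].
    by rewrite ler10.
  by rewrite ord1; exists i.
rewrite /bmp flat_le0 ?mul0r// subr_le0 (bigD1 i)//=.
rewrite -[leLHS]addr0 lerD//; last by apply: sumr_ge0 => j _; exact: flat1_ge0.
apply: flat1_mono; first by rewrite divr_gt0.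
rewrite -real_normK ?num_real//.
have : 1 <= `|y 0 i| ^+ 2 by rewrite exprn_ege1.
lra.
Qed.

Lemma compact_cball (z : 'rV[R]_n) (r : R) : compact [set y | `|y - z| <= r].
Proof.
apply: bounded_closed_compact.
  exists (`|z| + r); split; first exact: num_real.
  move=> M HM y /= yr; rewrite (le_trans _ (ltW HM))// -[y](subrK z) addrC.
  by rewrite (le_trans (ler_normD _ _))// lerD2l.
rewrite (_ : [set y | _] = (fun y => `|y - z|) @^-1` [set t | t <= r])//.
apply: closed_comp; last exact: closed_le.
move=> y _; apply: (@continuous_comp _ _ _ (fun y => y - z) (fun y => `|y|)).
  by apply: continuousB; [exact: cvg_id|exact: cst_continuous].
exact: norm_continuous.
Qed.

Lemma bounded_cball (f : 'rV[R]_n -> R^o) z r :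
  (forall y, `|y - z| <= r -> {for y, continuous f}) ->
  exists2 M, 0 <= M & forall y, `|y - z| <= r -> `|f y| <= M.
Proof.
move=> cf; apply: (bounded_near_compact (Q := fun (M : R) y => is_true (`|f y| <= M)) (@compact_cball z r)).
  by move=> M M' y MM' /le_trans; apply.
move=> y yr; exists (`|f y| + 1); have := cf y yr.
move=> /cvgr_norm_le; apply; by rewrite ltrDl.
Qed.

Lemma dd_bmp_bound a : exists2 M, 0 <= M & forall y, `|dd a bmp y| <= M.
Proof.
have [M M0 HM] := @bounded_cball (dd a bmp) 0 1 (fun y _ => sm1_cts (sm1_dd a (sm1_bmp y))).
exists M => // y; have [y1|y1] := leP `|y| 1; first by apply: HM; rewrite subr0.
rewrite (dd_ext _ (g := fun=> 0)) ?dd_zero ?normr0//.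
have : \forall z \near y, 1 < `|z|.
  have : `|z| @[z --> y] --> `|y| by exact: norm_continuous.
  by move=> /cvgr_gt; apply.
by apply: filterS => z z1; rewrite bmp0// ltW.
Qed.

(** In use [k] is the inverse of a radius, and each derivative costs one such factor ([dd_sbmp]). *)
Definition sbmp (z : 'rV[R]_n) (k : R) y : R^o := bmp (k *: (y - z)).

Lemma smv_affine (k : R) z y : smv (fun y : 'rV[R]_n => k *: (y - z)) y.
Proof.
move=> j; apply: sm1_eq (sm1Z k (sm1D (sm1_coord j y) (sm1_cst (- z 0 j) y))) => y'.
by rewrite !mxE.
Qed.

Lemma Dv_affine (k : R) z y u : Dv (fun y : 'rV[R]_n => k *: (y - z)) y u = k *: u.
Proof.
apply/rowP => j; rewrite mxE [RHS]mxE.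
rewrite (_ : (fun _ => _) = fun y : 'rV[R]_n => k * (y 0 j + (- z 0 j)) : R^o); last first.
  by apply/funext => y'; rewrite !mxE.
rewrite D_mulcE; last by apply: sm1D; [exact: sm1_coord|exact: sm1_cst].
by rewrite D_addE ?D_coordE ?D_cstE ?addr0//; [exact: sm1_coord|exact: sm1_cst].
Qed.

Lemma sm1_sbmp z k y : sm1 (sbmp z k) y.
Proof. exact: (sm1_comp (smv_affine k z y) (sm1_bmp _)). Qed.

Lemma dd_sbmp z k a y : dd a (sbmp z k) y = k ^+ size a * dd a bmp (k *: (y - z)).
Proof.
elim: a y => [|u a IH] y /=; first by rewrite mul1r.
rewrite (_ : dd a (sbmp z k) = fun y => k ^+ size a * dd a bmp (k *: (y - z)) : R^o); last first.
  exact/funext.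
have sd := sm1_dd a (sm1_bmp (k *: (y - z))).
rewrite D_mulcE; last exact: (sm1_comp (smv_affine k z y) sd).
rewrite (D_chain _ (smv_affine k z y) sd) Dv_affine.
rewrite -[k *: u]addr0 (D_dirE _ _ _ sd) derive0 addr0.
by rewrite exprSr mulrA.
Qed.

End Bump.

Section Uniform.
Context (R : realType).

(** There are finitely many words of length at most [m], so bounds found word by word have a common
    upper bound; the induction splits off the first letter. *)
Lemma fin_unif n (Q : R -> seq 'I_n -> Prop) (m : nat) :
  (forall M M' al, M <= M' -> Q M al -> Q M' al) ->
  (forall al, (size al <= m)%N -> exists M, Q M al) ->
  exists2 M : R, 0 <= M & forall al, (size al <= m)%N -> Q M al.
Proof.
elim: m Q => [|m IH] Q Qm Qe.
  have [M HM] := Qe [::] isT; exists (Num.max 0 M); first by rewrite le_max lexx.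
  move=> [|//] _; apply: Qm HM; by rewrite le_max lexx orbT.
have /choice[C HC] i : exists M, 0 <= M /\ forall al, (size al <= m)%N -> Q M (i :: al).
  have [|al al_m|M M0 HM] := IH (fun M al => Q M (i :: al)).
  - by move=> M M' al; exact: Qm.
  - exact: Qe.
  - by exists M.
have [M0 HM0] := Qe [::] isT.
exists (\sum_i C i + `|M0|).
  by rewrite addr_ge0// sumr_ge0// => i _; have [] := HC i.
move=> [|i al] al_m.
  apply: Qm HM0; rewrite -[leLHS]add0r lerD ?ler_norm//.
  by rewrite sumr_ge0// => i _; have [] := HC i.
have [C0 HCi] := HC i; apply: Qm (HCi al al_m).
rewrite (bigD1 i)//= -addrA lerDl addr_ge0// sumr_ge0// => j _.
by have [] := HC j.
Qed.

End Uniform.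

Section FlatFunctions.
Context (R : realType) (n : nat).
Implicit Types (f : 'rV[R]_n -> R^o) (y z : 'rV[R]_n).

(** Taylor's estimate by descent on the order of the derivative: each mean value step along the
    segment from [z] gains one power of the distance to [z]. *)
Lemma taylor_flat f z r m : (forall y, `|y - z| <= r -> sm1 f y) -> 
  (forall al : seq 'I_n, (size al <= m)%N -> dd (bmap R al) f z = 0) ->
  forall j (al : seq 'I_n), (size al + j = m.+1)%N -> exists2 C : R, 0 <= C &
    forall y, `|y - z| <= r -> `|dd (bmap R al) f y| <= C * `|y - z| ^+ j.
Proof.
move=> sf f0; elim=> [|j IH] al al_m.
  have [M M0 HM] := @bounded_cball R n (dd (bmap R al) f) z r
    (fun y yr => sm1_cts (sm1_dd _ (sf y yr))).
  by exists M => // y yr; rewrite mulr1 HM.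
have /choice[C HC] i : exists C : R, 0 <= C /\ forall y, `|y - z| <= r ->
    `|'D_(delta_mx 0 i) (dd (bmap R al) f) y| <= C * `|y - z| ^+ j.
  have [|C C0 HC] := IH (i :: al); first by rewrite /= addSnnS.
  by exists C.
exists (\sum_i C i) => [|y yr]; first by rewrite sumr_ge0// => i _; have [] := HC i.
have yE : y = (1 : R) *: (y - z) + z by rewrite scale1r subrK.
have sd x : `|x - z| <= r -> sm1 (dd (bmap R al) f) x by move=> /sf; exact: sm1_dd.
have inball (s : R) : `|s| <= 1 -> `|(s *: (y - z) + z) - z| <= `|y - z|.
  by move=> s1; rewrite addrK normrZ ler_piMl.
have [s|s s1] := @MVT_line R 'rV[R]_n (dd (bmap R al) f) z (y - z) 1.
  rewrite normr1 => s1; apply: sm1_der; apply: sd.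
  exact: le_trans (inball _ s1) yr.
rewrite normr1 in s1.
rewrite -yE f0 ?subr0 ?mul1r; last by rewrite -ltnS -al_m addnS ltnS leq_addr.
move=> ->.
have xr := le_trans (inball _ s1) yr; have sx := sd _ xr.
rewrite (D_basisE _ sx) exprS mulrCA mulr_suml.
rewrite mulr_sumr (le_trans (ler_norm_sum _ _ _))// ler_sum// => i _.
rewrite normrM ler_pM//; first exact: mx_norm_coord.
have [C0 HCi] := HC i; apply: (le_trans (HCi _ xr)).
by rewrite ler_wpM2l// lerXn2r ?nnegrE//; exact: inball.
Qed.

Lemma sbmp_out z (e : R) y : 0 < e -> e <= `|y - z| -> sbmp z e^-1 y = 0.
Proof.
move=> e0 ey; rewrite /sbmp bmp0// normrZ gtr0_norm ?invr_gt0//.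
by rewrite mulrC ler_pdivlMr ?mul1r.
Qed.

Lemma sbmp_in z (e : R) : 0 < e -> \forall y \near z, sbmp z e^-1 y = 1.
Proof.
move=> e0; have e2 : 0 < e / 2 by rewrite divr_gt0.
apply/nbhs_normP; exists (e / 2) => //= y; rewrite /ball_ /= distrC => /ltW ye.
rewrite /sbmp bmp1// normrZ gtr0_norm ?invr_gt0//.
by rewrite mulrC ler_pdivrMr// mulrC mulrA mulr1.
Qed.

(** In the Leibniz expansion i derivatives of the cut-off cost e^(-i), while a derivative of order j
    of [f] is of size e^(m+1-j) on the ball of radius e. Since i + j <= m and e <= 1, every term is
    O(e). *)
Lemma flat_cutoff f z r m : r <= 1 -> (forall y, `|y - z| <= r -> sm1 f y) -> 
  (forall al : seq 'I_n, (size al <= m)%N -> dd (bmap R al) f z = 0) ->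
  forall al : seq 'I_n, (size al <= m)%N -> exists2 C : R, 0 <= C &
    forall (e : R) y, 0 < e -> e <= r ->
      `|dd (bmap R al) (fun y => sbmp z e^-1 y * f y : R^o) y| <= C * e.
Proof.
move=> r1 sf f0 al al_m.
have est (t : nat * seq 'I_n * seq 'I_n) : exists C : R, 0 <= C /\
    ((size t.1.2 + size t.2 <= m)%N -> forall (e : R) y, 0 < e -> e <= r -> `|y - z| <= e ->
    `|dd (bmap R t.1.2) (sbmp z e^-1) y * dd (bmap R t.2) f y| <= C * e).
  case: (leqP (size t.1.2 + size t.2) m) => tm; last by exists 0; split=> //.
  have [M M0 HM] := @dd_bmp_bound R n (bmap R t.1.2).
  have [|C C0 HC] := taylor_flat sf f0 (j := (m.+1 - size t.2)%N) (al := t.2).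
    by rewrite subnKC// leqW// (leq_trans _ tm)// leq_addl.
  exists (M * C); split=> [|_ e y e0 er ye]; first exact: mulr_ge0.
  rewrite dd_sbmp !normrM size_map normrX normfV (gtr0_norm e0).
  apply: (@le_trans _ _ (e^-1 ^+ size t.1.2 * M * (C * e ^+ (m.+1 - size t.2)))).
    apply: ler_pM => //; rewrite ?mulr_ge0 ?exprn_ge0 ?invr_ge0 ?(ltW e0)//.
      by rewrite ler_wpM2l// exprn_ge0// invr_ge0 ltW.
    rewrite (le_trans (HC _ (le_trans ye er)))// ler_wpM2l//.
    by rewrite lerXn2r ?nnegrE// ltW.
  have -> : (m.+1 - size t.2 = size t.1.2 + (m - size t.2 - size t.1.2).+1)%N by lia.
  rewrite exprD exprVn.
  have ne : e ^+ size t.1.2 != 0 by rewrite expf_neq0// gt_eqF.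
  have cancel (a b M' C' : R) : a != 0 -> a^-1 * M' * (C' * (a * b)) = M' * C' * b.
    by move=> a0; field.
  rewrite cancel//.
  rewrite ler_wpM2l ?mulr_ge0// exprS ger_pMr// exprn_ile1 ?(ltW e0)//.
  exact: le_trans er r1.
have /choice[C HC] := est.
exists (\sum_(t <- splits al) C t) => [|e y e0 er].
  by rewrite sumr_ge0// => t _; have [] := HC t.
have CC t : 0 <= C t by have [] := HC t.
have [ye|ye] := leP `|y - z| e; last first.
  rewrite (@dd_ext _ _ _ _ (fun=> 0)) ?dd_zero ?normr0.
    by rewrite mulr_ge0 ?sumr_ge0// ltW.
  have : \forall x \near y, e < `|x - z|.
    have : `|x - z| @[x --> y] --> `|y - z|.
      have cB : {for y, continuous (fun x : 'rV[R]_n => x - z)}.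
        by apply: continuousB; [exact: cvg_id|exact: cst_continuous].
      exact: (continuous_comp cB (@norm_continuous _ _ _)).
    by move=> /cvgr_gt; apply.
  by apply: filterS => x xe; rewrite sbmp_out ?mul0r// ltW.
rewrite dd_mul; [|exact: sm1_sbmp|exact: sf (le_trans ye er)].
rewrite splits_map big_map mulr_suml (le_trans (ler_norm_sum _ _ _))//=.
have := splits_size al; elim: (splits al) => [|t s IH] /=.
  by rewrite !big_nil.
move=> [ts /IH{}IH]; rewrite !big_cons lerD//.
by apply: (HC t).2 => //; rewrite ts.
Qed.

End FlatFunctions.

Lemma AllpP (I : eqType) (P : I -> Prop) (r : seq I) :
  (forall i, i \in r -> P i) <-> Allp P r.
Proof.
elim: r => //= i r IH; split=> [H|[Pi /IH H] j].
  by split; [apply: H; rewrite inE eqxx|apply/IH => j jr; apply: H; rewrite inE jr orbT].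
by rewrite inE => /orP[/eqP->//|/H].
Qed.

Section Vanishing.
Context (R : realType) (V : lmodType R) (P : V -> Prop).
Hypothesis Pcomb : forall (a : R) u v, P u -> P v -> P (a *: u + v).

Definition lin_on (T : V -> R) :=
  forall (a : R) u v, P u -> P v -> T (a *: u + v) = a * T u + T v.

(** If a vector in the common kernel of the other functionals has a nonzero value under [phi i],
    subtracting a multiple of [phi i] from [T] reduces to the others; if there is none, dropping
    [phi i] does not change the kernel. The predicate [P] stands for smoothness inside the space of
    all forms. *)
Lemma kernel_comb (I : eqType) (r : seq I) (phi : I -> V -> R) (T : V -> R) :
  lin_on T -> (forall i, lin_on (phi i)) ->
  (forall v, P v -> Allp (fun i => phi i v = 0) r -> T v = 0) ->
  exists c : seq (R * I), Allp (fun d => d.2 \in r) c /\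
    forall v, P v -> T v = \sum_(d <- c) d.1 * phi d.2 v.
Proof.
move=> lT lphi; elim: r T lT => [|i r IH] T lT HT.
  by exists [::]; split=> // v Pv; rewrite big_nil HT.
have weak (c : seq (R * I)) : Allp (fun d => d.2 \in r) c ->
    Allp (fun d => d.2 \in i :: r) c.
  by apply: Allp_impl => d; rewrite inE orbC => ->.
have [[v0 [Pv0 rv0 i0]]|no] := pselect (exists v0, [/\ P v0, Allp (fun i => phi i v0 = 0) r & phi i v0 != 0]).
  pose b := T v0 / phi i v0.
  have [|v Pv rv|c [cr cE]] := IH (fun v => - b * phi i v + T v).
  - move=> a u v Pu Pv; rewrite lT// lphi//; ring.
  - pose w := (- (phi i v / phi i v0)) *: v0 + v.
    have Pw : P w by exact: Pcomb.
    have iw : phi i w = 0 by rewrite lphi//; field.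
    have rw : Allp (fun i => phi i w = 0) r.
      elim: r rv0 rv {IH HT weak} => //= j r IHr [j0 r0] [jv rv]; split; last exact: IHr.
      by rewrite lphi// j0 jv mulr0 addr0.
    have := HT w Pw (conj iw rw); rewrite lT// => Tw.
    by rewrite -Tw /b; field.
  - exists ((b, i) :: c); split; first by split; [rewrite inE eqxx|exact: weak].
    by move=> v Pv; rewrite big_cons -cE//=; ring.
have [v Pv rv|c [cr cE]] := IH T lT.
  apply: HT => //; split=> //; have [//|i0] := eqVneq (phi i v) 0.
  by case: no; exists v.
by exists c; split=> //; exact: weak.
Qed.

End Vanishing.

Section Structure.
Context (R : realType) (n : nat) (X : topologicalType) (A : atlas R n X).
Hypothesis HA : is_atlas A.
Hypothesis HX : hausdorff_space X.
Implicit Types (p q : X) (om et : lfm R n X).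

Definition cutoff p (e : R) q : R :=
  if `[< cdom (A p) q >] then sbmp (zp A p) e^-1 (cmap (A p) q) else 0.

Lemma chart_radius p : exists r : R, [/\ 0 < r, r <= 1 &
  forall y, `|y - zp A p| <= r -> cimg (A p) y].
Proof.
have [d d0 Hd] := ball_of_near (near_cimg HA (cimg_zp HA p)).
exists (Num.min 1 (d / 2)); split.
- by rewrite lt_min ltr01 divr_gt0.
- by rewrite ge_min lexx.
- move=> y yr; rewrite -(subrK (zp A p) y); apply: Hd; apply: (le_lt_trans yr).
  by rewrite gt_min; apply/orP; right; rewrite ltr_pdivrMr// ltr_pMr// ltr1n.
Qed.

(** The support lies in the image of a closed ball of the chart, which is compact, hence closed in a
    Hausdorff space. This makes the extension by 0 smooth across the boundary of the chart. *)
Lemma cutoff_out p r :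
  (forall y, `|y - zp A p| <= r -> cimg (A p) y) ->
  exists C : set X, [/\ closed C, C `<=` cdom (A p) &
    forall e q, 0 < e -> e <= r -> ~ C q -> cutoff p e q = 0].
Proof.
move=> Hr; exists (cinv (A p) @` [set y | `|y - zp A p| <= r]); split.
- apply: compact_closed => //; apply: continuous_compact; last exact: compact_cball.
  apply: continuous_in_subspaceT => y /set_mem /= yr.
  exact: (atlas_inv_cont HA) (Hr _ yr).
- by move=> _ [y /= yr <-]; apply: cdom_cinv => //; exact: Hr.
- move=> e q e0 er qC; rewrite /cutoff; case: asboolP => // dq.
  apply: sbmp_out => //; apply/ltW; rewrite ltNge; apply/negP => qe.
  by apply: qC; exists (cmap (A p) q); [exact: le_trans er|exact: (atlas_inv HA)].
Qed.

Lemma sm_cutoff p r e om : 0 < e -> e <= r ->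
  (forall y, `|y - zp A p| <= r -> cimg (A p) y) ->
  sm A om -> sm A (fun q s => cutoff p e q * om q s).
Proof.
move=> e0 er Hr [ao so]; split.
  move=> q; have -> : (fun s => cutoff p e q * om q s) = (fun s => cutoff p e q * om q s + 0).
    by apply/funext => s; rewrite addr0.
  by apply: alt_comb; [exact: ao|exact: alt_zero].
move=> q x qx s.
apply: (sm1M (f := fun y => cutoff p e (cinv (A q) y) : R^o)); last exact: so.
have [C [cC Cd C0]] := cutoff_out Hr.
have [dx|dx] := pselect (cdom (A p) (cinv (A q) x)).
  apply: (@sm1_ext _ _ (fun y => sbmp (zp A p) e^-1 (trans A q p y))).
    by apply: filterS (near_dom HA qx dx) => y dy; rewrite /cutoff asboolT.
  exact: sm1_comp (trans_smv HA qx dx) (sm1_sbmp _ _ _).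
apply: (@sm1_ext _ _ (fun=> 0)); last exact: sm1_cst.
have : \forall y \near x, ~ C (cinv (A q) y).
  apply: (near_cinv HA (W := fun p => ~ C p)) => //; apply: open_near.
    exact: closed_openC.
  by move=> /Cd.
by apply: filterS => y yC; rewrite C0.
Qed.

Lemma near_sum_bound (I : Type) (l : seq I) (x : 'rV[R]_n) (B : R -> Prop)
    (F : I -> R -> 'rV[R]_n -> R) :
  Allp (fun i => exists M : R, \forall y \near x, forall e, B e -> `|F i e y| <= M * e) l ->
  exists M : R, \forall y \near x, forall e, B e -> `|\sum_(i <- l) F i e y| <= M * e.
Proof.
elim: l => [_|i l IH [[M HM] /IH[M' HM']]].
  by exists 0; near=> y => e _; rewrite big_nil normr0 mul0r.
exists (M + M'); near=> y => e Be; rewrite big_cons mulrDl (le_trans (ler_normD _ _))// lerD//.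
  by move: e Be; near: y.
by move: e Be; near: y.
Unshelve. all: by end_near. Qed.

(** The seminorms may use any chart [q]. Over the chart at [p] the chart change turns [flat_cutoff]
    into an estimate with locally bounded coefficients; elsewhere the cut-off vanishes on a
    neighbourhood. The constant does not depend on [e]. *)
Lemma cutoff_estimate p r q x om m (al I : seq 'I_n) : 0 < r -> r <= 1 ->
  (forall y, `|y - zp A p| <= r -> cimg (A p) y) -> sm A om ->
  (forall be (J : seq 'I_n), (size be <= m)%N -> size J = size I ->
    E A p (bmap R be) (bmap R J) om = 0) ->
  (size al <= m)%N -> cimg (A q) x ->
  exists M : R, \forall y \near x, forall e, 0 < e /\ e <= r ->
    `|dd (bmap R al) (fun y => lf A q (fun q s => cutoff p e q * om q s) y (bmap R I)) y| <= M * e.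
Proof.
move=> r0 r1 Hr so flat al_m qx.
have [dx|dx] := pselect (cdom (A p) (cinv (A q) x)); last first.
  have [C [cC Cd C0]] := cutoff_out Hr.
  have H : \forall y \near x, \forall z \near y, ~ C (cinv (A q) z).
    apply: near_near; apply: (near_cinv HA (W := fun p => ~ C p)) => //; apply: open_near.
      exact: closed_openC.
    by move=> /Cd.
  exists 0; apply: filterS H => y yC e [e0 er].
  rewrite (@dd_ext _ _ _ _ (fun=> 0)) ?dd_zero ?normr0 ?mul0r//.
  by apply: filterS yC => z zC; rewrite /lf C0// mul0r.
pose U := cmap (A q) @` (cdom (A q) `&` cdom (A p)).
have UE y : U y <-> cimg (A q) y /\ cdom (A p) (cinv (A q) y).
  split=> [[p' [qp' pp'] <-]|[qy py]].
    by split; [exact: cimg_cmap|rewrite (atlas_inv HA)].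
  by exists (cinv (A q) y); [split=> //; exact: cdom_cinv|exact: cinvK].
have oU : open U by apply: open_chart => //; exact: (atlas_dom_open HA).
have sphi y : U y -> smv (trans A q p) y by move=> /UE[*]; exact: trans_smv.
have UD y : U y -> cimg (A p) (trans A q p y) by move=> /UE[*]; exact: cimg_cmap.
have [l [lP lE]] := DOp_pull oU sphi UD (bmap R al) (bmap R I).
have Ux : U x by apply/UE.
have [M HM] : exists M : R, \forall y \near x, forall e, 0 < e /\ e <= r ->
    `|\sum_(c <- l) c.1.1 y * dd (bmap R c.1.2) (fun z => sbmp (zp A p) e^-1 z *
       lf A p om z (bmap R c.2)) (trans A q p y)| <= M * e.
  apply: (near_sum_bound (B := fun e => 0 < e /\ e <= r)).
  apply: Allp_impl lP => c [cs cm cI]; rewrite !size_map in cm cI.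
  have sf y : `|y - zp A p| <= r -> sm1 (fun z => lf A p om z (bmap R c.2)) y.
    by move=> /Hr py; exact: so.2.
  have f0 (be : seq 'I_n) : (size be <= m)%N ->
      dd (bmap R be) (fun z => lf A p om z (bmap R c.2)) (zp A p) = 0.
    by move=> be_m; exact: flat.
  have [C C0 HC] := flat_cutoff r1 sf f0 (leq_trans cm al_m).
  have := sm1_cts (cs _ Ux) => /cvgr_norm_le /(_ (`|c.1.1 x| + 1)).
  rewrite ltrDl ltr01 => /(_ isT) Hg; exists ((`|c.1.1 x| + 1) * C).
  apply: filterS Hg => y gy e [e0 er]; rewrite normrM -mulrA ler_pM// .
  exact: HC.
exists M; apply: filterS2 HM (open_near oU Ux) => y HM Uy e He.
have [qy py] := (UE y).1 Uy.
have schi : sm A (fun q s => cutoff p e q * om q s) by apply: (@sm_cutoff p r) => //; case: He.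
rewrite (dd_ext _ (lf_change_near HA _ _ qy py)) lE//; last exact: good_lf.
rewrite (le_trans _ (HM e He))// le_eqVlt; apply/orP; left; apply/eqP; congr (`|_|).
apply: eq_bigr => c _; congr (_ * _); apply: dd_ext.
apply: filterS (near_cimg HA (UD _ Uy)) => z pz.
by rewrite /lf /cutoff asboolT ?cinvK//; exact: cdom_cinv.
Qed.

Lemma basis_mx_rows k (J : 'I_k -> 'I_n) : rows (basis_mx R J) = bmap R [seq J i | i <- enum 'I_k].
Proof.
rewrite /rows /bmap; elim: (enum _) => //= i s ->; congr (_ :: _).
by apply/rowP => j; rewrite !mxE.
Qed.

Lemma iter_local_form k (om : lfm R n X) q al (J : 'I_k -> 'I_n) x : cimg (A q) x ->
  iter_deriv al (local_form A (hom k om) q (basis_mx R J)) x =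
  dd (bmap R al) (fun y => lf A q om y (bmap R [seq J i | i <- enum 'I_k])) x.
Proof.
move=> qx; rewrite iter_derivE; apply: dd_ext.
apply: filterS (near_cimg HA qx) => y qy.
rewrite (local_formE HA)// basis_mx_rows /lf hat_hom.
by rewrite size_map -basis_mx_rows size_rows eqxx.
Qed.

(* The estimate shared by [is_current] and [order_le]. *)
Definition seminorm_bound k m (T : form R n X k -> R^o) :=
  exists (c : R) (N : nat) (q : 'I_N -> X) (K : 'I_N -> set 'rV[R]_n),
    (forall l, compact (K l) /\ K l `<=` cimg (A (q l))) /\
    forall w, smooth_form A w -> forall b, 0 <= b ->
      (forall l x al (I : 'I_k -> 'I_n), K l x -> (size al <= m)%N ->
        `|iter_deriv al (local_form A w (q l) (basis_mx R I)) x| <= b) ->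
      `|T w| <= c * b.

(** Cutting [w] off at radius [e] leaves it unchanged near [p], hence also its value under [T],
    while the relevant seminorms become O(e). So the value is O(e) for every small [e]. *)
Lemma flat_vanish p k m (T : form R n X k -> R^o) w :
  linear_on_forms A None T -> seminorm_bound m T ->
  (forall w, smooth_form A w -> (\forall x \near p, w x = 0) -> T w = 0) ->
  smooth_form A w ->
  (forall be (J : seq 'I_n), (size be <= m)%N -> size J = k ->
    E A p (bmap R be) (bmap R J) (hat w) = 0) -> T w = 0.
Proof.
move=> lT [c [N [q [K [cK bT]]]]] T0 sw flat.
have sh := smooth_hat HA sw.
have [r [r0 r1 Hr]] := chart_radius p.
pose ch e : lfm R n X := fun q s => cutoff p e q * hat w q s.
have sch e : 0 < e -> e <= r -> sm A (ch e) by move=> e0 er; exact: (sm_cutoff e0 er).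
have TE e : 0 < e -> e <= r -> T w = T (hom k (ch e)).
  move=> e0 er; have se : smooth_form A (hom k (ch e)) by apply: sm_hom => //; exact: sch.
  have : T (- 1 *: hom k (ch e) + w) = 0.
    apply: T0; first exact: smooth_lin.
    have : \forall x \near p, cutoff p e x = 1.
      have Hc := atlas_map_cont HA (atlas_mem HA p).
      have Hs : \forall y \near p, sbmp (zp A p) e^-1 (cmap (A p) y) = 1.
        exact: Hc _ (sbmp_in (zp A p) e0).
      have := open_near (atlas_dom_open HA p) (atlas_mem HA p).
      by move: Hs; apply: filterS2 => y y1 dy; rewrite /cutoff asboolT.
    apply: filterS => y y1; apply/funext => M.
    have -> : (- 1 *: hom k (ch e) + w) y M = - 1 * hom k (ch e) y M + w y M by [].
    by rewrite /hom /ch y1 mul1r mulN1r -{2}(homK w) addNr.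
  by rewrite lT// scaleN1r => /eqP; rewrite addrC subr_eq0 => /eqP.
have bnd l (al I : seq 'I_n) : (size al <= m)%N -> size I = k -> exists2 M : R, 0 <= M &
    forall x, K l x -> forall e, 0 < e /\ e <= r ->
    `|dd (bmap R al) (fun y => lf A (q l) (ch e) y (bmap R I)) x| <= M * e.
  move=> al_m Ik; apply: (bounded_near_compact (cK l).1
    (Q := fun M x => forall e, 0 < e /\ e <= r -> is_true
    (`|dd (bmap R al) (fun y => lf A (q l) (ch e) y (bmap R I)) x| <= M * e))).
    move=> M M' x MM' H e He; apply: le_trans (H e He) _.
    by rewrite ler_wpM2r//; case: He => /ltW.
  move=> x /(cK l).2 qx; apply: (cutoff_estimate r0 r1 Hr sh _ al_m qx) => be J be_m JI.
  by apply: flat => //; rewrite JI.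
(* The constants in [bnd] depend on the word of derivatives and on the word of basis vectors; both
   range over finite sets, hence [fin_unif] twice. *)
have unif l : exists M : R, 0 <= M /\ forall al I : seq 'I_n, (size al <= m)%N -> size I = k ->
    forall x, K l x -> forall e, 0 < e /\ e <= r ->
    `|dd (bmap R al) (fun y => lf A (q l) (ch e) y (bmap R I)) x| <= M * e.
  have mono (S : Prop) M M' x al I : M <= M' ->
      (S -> K l x -> forall e, 0 < e /\ e <= r ->
      `|dd (bmap R al) (fun y => lf A (q l) (ch e) y (bmap R I)) x| <= M * e) ->
      (S -> K l x -> forall e, 0 < e /\ e <= r ->
      `|dd (bmap R al) (fun y => lf A (q l) (ch e) y (bmap R I)) x| <= M' * e).
    move=> MM' H HS Kx e He; apply: le_trans (H HS Kx e He) _.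
    by rewrite ler_wpM2r//; case: He => /ltW.
  have [||M M0 HM] := @fin_unif R n (fun M al => forall I : seq 'I_n, size I = k -> forall x, K l x
    -> forall e, 0 < e /\ e <= r ->
    `|dd (bmap R al) (fun y => lf A (q l) (ch e) y (bmap R I)) x| <= M * e) m.
  - move=> M M' al MM' H I Ik x; move: Ik; apply: mono MM' _ => Ik; exact: H.
  - move=> al al_m.
    have [||M M0 HM] := @fin_unif R n (fun M I => size I = k -> forall x, K l x -> forall e, 0 < e
      /\ e <= r ->
    `|dd (bmap R al) (fun y => lf A (q l) (ch e) y (bmap R I)) x| <= M * e) k.
    + move=> M M' I MM' H Ik x; move: Ik; apply: mono MM' _ => Ik; exact: H.
    + move=> I _; have [Ik|nIk] := eqVneq (size I) k; last by exists 0 => Ik; rewrite Ik eqxx in nIk.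
      by have [M M0 HM] := bnd l al I al_m Ik; exists M.
    + by exists M => I Ik; apply: HM => //; rewrite Ik.
  - by exists M; split=> // al I al_m; exact: HM.
have /choice[M HM] := unif.
pose B := \sum_l M l; have M0 l : 0 <= M l by have [] := HM l.
have B0 : 0 <= B by rewrite sumr_ge0.
have Tb e : 0 < e -> e <= r -> `|T w| <= `|c| * B * e.
  move=> e0 er; rewrite (TE e e0 er).
  apply: (@le_trans _ _ (c * (B * e))).
    apply: bT => [||l x al I Kx al_m].
    - by apply: sm_hom => //; exact: sch.
    - by rewrite mulr_ge0// ltW.
    rewrite iter_local_form; last exact: (cK l).2.
    have [_ H] := HM l; apply: le_trans (H al [seq I i | i <- enum 'I_k] al_m _ x Kx e _) _ => //.
      by rewrite size_map size_enum_ord.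
    by rewrite ler_wpM2r ?(ltW e0)// /B (bigD1 l)//= lerDl sumr_ge0.
  by rewrite mulrA ler_wpM2r ?(ltW e0)// ler_wpM2r// ler_norm.
apply/eqP; rewrite -normr_le0 leNgt; apply/negP => t0.
(* With the radius [e] chosen next, the bound is at most half of the absolute value of [T w], a
   contradiction; the [1] makes [D] positive. *)
pose D := `|c| * B + 1; have D0 : 0 < D by rewrite ltr_wpDl// mulr_ge0.
pose e := Num.min r (`|T w| / (2 * D)).
have tD : 0 < `|T w| / (2 * D) by rewrite divr_gt0// mulr_gt0.
have e0 : 0 < e by rewrite lt_min r0.
have er : e <= r by rewrite ge_min lexx.
have := Tb e e0 er; rewrite leNgt => /negP; apply.
apply: (@le_lt_trans _ _ (D * e)); first by rewrite ler_wpM2r ?(ltW e0)// lerDl.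
apply: (@le_lt_trans _ _ (D * (`|T w| / (2 * D)))).
  by rewrite ler_wpM2l ?(ltW D0)// ge_min lexx orbT.
rewrite (_ : D * _ = `|T w| / 2) ?ltr_pdivrMr ?ltr_pMr ?ltr1n//.
by field; rewrite gt_eqF.
Qed.

(** By [flat_vanish], [T] kills the common kernel of the finitely many functionals [E A p] on basis
    words with at most [m] derivatives; [kernel_comb] then writes [T] as a combination of them. *)
Lemma structure p k m (T : form R n X k -> R^o) :
  linear_on_forms A None T -> seminorm_bound m T ->
  (forall w, smooth_form A w -> (\forall x \near p, w x = 0) -> T w = 0) ->
  exists2 L : rep R n, rep_le k m L &
    forall w, smooth_form A w -> T w = ev A p L (hat w).
Proof.
move=> lT bT T0.
pose words j : seq (seq 'I_n) := [seq val t | t : j.-tuple 'I_n].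
have wordsP j s : s \in words j <-> size s = j.
  split=> [/mapP[t _ ->]|sj]; first by rewrite size_tuple.
  by apply/mapP; exists (Tuple (introT eqP sj)) => //; rewrite mem_enum.
pose r := [seq (al, J) | al <- flatten [seq words j | j <- iota 0 m.+1], J <- words k].
have rP al I : (al, I) \in r <-> (size al <= m)%N /\ size I = k.
  split=> [/allpairsP[[al' J'] [Ha /wordsP Hb [-> ->]]]|[al_m Ik]].
    case/(elimT flattenP): Ha => s /mapP[j]; rewrite mem_iota ltnS /= => jm -> /wordsP sj.
    by rewrite sj.
  apply/allpairsP; exists (al, I); split; [|exact/wordsP|by []].
  by apply: (introT flattenP); exists (words (size al)); [apply/map_f; rewrite mem_iota|exact/wordsP].
have [||||c [cr cE]] := @kernel_comb R (form R n X k) (@smooth_form R n X A k) _ _ r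
   (fun i w => E A p (bmap R i.1) (bmap R i.2) (hat w)) T.
- exact: smooth_lin.
- exact: lT.
- by move=> i a u v su sv; rewrite hat_lin E_comb//; exact: smooth_hat.
- move=> w sw /AllpP H; apply: (flat_vanish lT bT T0 sw) => be J be_m Jk.
  by apply: (H (be, J)); apply/rP.
exists [seq (d.1, bmap R d.2.1, bmap R d.2.2) | d <- c].
  apply: Allp_map; apply: Allp_impl cr => -[d [al I]] /rP[al_m Ik] /=.
  by rewrite !size_map.
by move=> w sw; rewrite cE// /ev big_map.
Qed.

Lemma current_bound k (T : form R n X k -> R^o) : is_current A T ->
  exists m, seminorm_bound m T.
Proof. by case=> _ _ [c [m [N [q [K [_ ? ?]]]]]]; exists m, c, N, q, K. Qed.

Lemma ptcurrent_rep p (T : ptcurrent A p) :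
  exists L : rep R n, forall om, sm A om -> chat T om = ev A p L om.
Proof.
have [Tc T0 _] := ptcurrentP T.
have H k : exists L : rep R n, (exists m, rep_le k m L) /\
    forall w : form R n X k, smooth_form A w -> cev (ptval T) w = ev A p L (hat w).
  have [m bm] := current_bound (Tc k).
  have [L Lm LE] := structure (current_linear (Tc k)) bm (T0 k).
  by exists L; split=> //; exists m.
have {H}/choice[L HL] := H.
exists (flatten [seq L k | k <- iota 0 (cbound T)]) => om so.
rewrite /chat -(big_mkord xpredT (fun k => cev (ptval T) (hom k om))).
rewrite /index_iota subn0; elim: (iota _ _) => [|k s IH] /=.
  by rewrite /ev !big_nil.
rewrite big_cons ev_cat IH; congr (_ + _).
have [[m Lm] LE] := HL k; rewrite LE; last exact: sm_hom.
rewrite ev_hat_hom /ev; apply: (eq_big_Forall Lm) => c [_ ->].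
by rewrite eqxx.
Qed.

Lemma smooth_Creg r k (w : form R n X k) : smooth_form A w -> Creg_form A (Some r) w.
Proof. by move=> [aw sw]; split=> // q M; exact: sw. Qed.

(** On smooth forms the extension [T'] gives a bound by seminorms of some order [m] at most [r], and
    [structure] uses no more derivatives than the seminorms do. *)
Lemma order_rep p (T : ptcurrent A p) k r : order_le A k r (ptval T) ->
  exists2 L : rep R n, rep_le k r L & forall om, sm A om -> chat T om = ev A p L om.
Proof.
move=> [Tk [T' [lT' [c [m [N [q [K [mr cK bT]]]]] TT']]]].
have [Tc T0 _] := ptcurrentP T.
have bm : seminorm_bound m (cev (ptval T) (k := k)).
  exists c, N, q, K; split=> // w sw b b0 H; rewrite TT'//.
  by apply: bT => //; exact: smooth_Creg.
have [L Lm LE] := structure (current_linear (Tc k)) bm (T0 k).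
exists L => [|om so]; first by apply: Allp_impl Lm => d [d1 d2]; split=> //; exact: leq_trans mr.
rewrite (@chatE _ _ _ _ _ T (cbound T + k.+1))//; last exact: leq_addr.
have kN : (k < cbound T + k.+1)%N by rewrite addnS ltnS leq_addl.
rewrite (bigD1 (Ordinal kN))//= big1 ?addr0 => [|i ik]; last first.
  by apply: Tk; apply: contra ik => /eqP ik; apply/eqP/val_inj.
rewrite LE; last exact: sm_hom.
rewrite ev_hat_hom /ev; apply: (eq_big_Forall Lm) => d [_ ->].
by rewrite eqxx.
Qed.

End Structure.

(** * The order of an explicit combination *)

Section OrderOfRep.
Context (R : realType) (n : nat) (X : topologicalType) (A : atlas R n X).
Hypothesis HA : is_atlas A.
Implicit Types (p : X).

Lemma Ck_dd (O : set 'rV[R]_n) (f : 'rV[R]_n -> R^o) m a : open O ->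
  (size a <= m)%N -> Ck m O f -> Ck (m - size a) O (dd a f).
Proof.
move=> oO; elim: a => [|u a IH] /= am fm; first by rewrite subn0.
have := IH (ltnW am) fm; rewrite -subSS subSn//.
by move=> [_ /(_ u)[]].
Qed.

Lemma dd_combC (O : set 'rV[R]_n) (f g : 'rV[R]_n -> R^o) m a c x : open O ->
  (size a <= m)%N -> Ck m O f -> Ck m O g -> O x ->
  dd a (fun y => c * f y + g y : R^o) x = c * dd a f x + dd a g x.
Proof.
move=> oO; elim: a x => //= u a IH x am fm gm Ox.
have aE : (m - size (u :: a)).+1 = (m - size a)%N by move: am => /=; lia.
have [_ /(_ u)[df _]] : Ck (m - size (u :: a)).+1 O (dd a f).
  by rewrite aE; apply: Ck_dd => //; exact: ltnW.
have [_ /(_ u)[dg _]] : Ck (m - size (u :: a)).+1 O (dd a g).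
  by rewrite aE; apply: Ck_dd => //; exact: ltnW.
rewrite (near_eq_derive _ (g := (c \*: dd a f) + dd a g)); last first.
  by apply: filterS (open_near oO Ox) => y Oy; rewrite IH// ltnW.
rewrite deriveD ?deriveZ//; [exact: df|exact: derivableZ (df _ Ox)|exact: dg].
Qed.

(** The explicit formula still makes sense on forms of class C^r, which gives the extension. Its
    linearity there needs [dd_combC], as the rules for smooth germs do not apply. *)
Lemma rep_order p (T : ptcurrent A p) (L : rep R n) k r : rep_le k r L ->
  (forall om, sm A om -> chat T om = ev A p L om) -> order_le A k r (ptval T).
Proof.
move=> Lr LE; have [Tc _ _] := ptcurrentP T; split.
  move=> j w jk; have [sw|nsw] := pselect (smooth_form A w); last exact: current_junk (Tc j) _ nsw.
  rewrite -(chat_hat HA) LE; last exact: smooth_hat.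
  rewrite -[hat w](_ : hat (hom j (hat w)) = _); last by rewrite homK.
  rewrite ev_hat_hom; have {LE} := Lr; elim: L {Lr} => [|c L IH] /=; first by rewrite big_nil.
  by move=> [[_ ck] /IH{}IH]; rewrite big_cons IH ck eq_sym (negbTE jk) addr0.
have [l [lP lE]] := ev_basis HA p L; have {}lP := lP _ _ Lr.
exists (fun w => \sum_(c <- l) c.1.1 * dd (bmap R c.1.2)
   (local_form A w p (mxs k (bmap R c.2))) (zp A p)); split.
- move=> a w v [_ sw] [_ sv].
  elim: l lP {lE} => [|c l IH] /=; first by rewrite !big_nil scaler0 addr0.
  move=> [[cr ck] /IH{}IH]; rewrite !big_cons IH.
  rewrite (_ : local_form A (a *: w + v) p _ = fun y => a * local_form A w p (mxs k (bmap R c.2)) y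
    + local_form A v p (mxs k (bmap R c.2)) y)//.
  rewrite (dd_combC _ (atlas_img_open HA (p := p)) (m := r))//; last exact: cimg_zp.
  + by rewrite /GRing.scale /=; ring.
  + by rewrite size_map.
  + exact: sw.
  + exact: sv.
- exists (\sum_(c <- l) `|c.1.1|), r, 1%N, (fun=> p), (fun=> [set zp A p]); split=> //.
    move=> _; split; first exact: compact_set1.
    by move=> _ ->; exact: cimg_zp.
  move=> w _ b b0 H; elim: l lP {lE} => [|c l IH] /=.
    by rewrite !big_nil normr0 mul0r.
  move=> [[cr ck] /IH{}IH]; rewrite !big_cons mulrDl (le_trans (ler_normD _ _))// lerD//.
  rewrite normrM ler_wpM2l//.
  have [J JE] := bmap_rows R ck; rewrite -JE rowsK -iter_derivE.
  exact: (H ord0).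
- move=> w sw; have sh := smooth_hat HA sw.
  rewrite -(chat_hat HA) LE// lE// /ev big_map; apply: (eq_big_Forall lP) => c [_ ck].
  congr (_ * _); apply: dd_ext; apply: filterS (near_cimg HA (cimg_zp HA p)) => y py.
  by rewrite (local_formE HA)// mxsK// size_map.
Qed.

End OrderOfRep.

(** * Tensor products and finitely supported sections *)

Section TensorTheory.
Context (R : realType).

(** Two decompositions of a tensor are compared through scalar bilinear forms; this decides the
    value of [tlift] when linear functionals separate the points of the target. *)
Definition separated (Z : lmodType R) :=
  forall z : Z, (forall l : Z -> R^o, linear l -> l z = 0) -> z = 0.

Definition sepfam (V : lmodType R) (I : Type) (l : I -> V -> R^o) :=
  (forall i, linear (l i)) /\ forall v, (forall i, l i v = 0) -> v = 0.

Definition bilin (V W Z : lmodType R) (b : V -> W -> Z) :=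
  (forall y, linear (b^~ y)) /\ (forall x, linear (b x)).

Lemma lin_0 (V W : lmodType R) (f : V -> W) : linear f -> f 0 = 0.
Proof.
move=> lf; have := lf 1 0 0; rewrite !scale1r addr0 => /eqP.
by rewrite eq_sym -subr_eq0 addrK => /eqP.
Qed.

Lemma lin_D (V W : lmodType R) (f : V -> W) x y : linear f -> f (x + y) = f x + f y.
Proof. by move=> lf; have := lf 1 x y; rewrite !scale1r. Qed.

Lemma lin_Z (V W : lmodType R) (f : V -> W) a x : linear f -> f (a *: x) = a *: f x.
Proof. by move=> lf; have := lf a x 0; rewrite !addr0 lin_0// addr0. Qed.

Lemma lin_sum (V W : lmodType R) (f : V -> W) (I : Type) (r : seq I) (F : I -> V) :
  linear f -> f (\sum_(i <- r) F i) = \sum_(i <- r) f (F i).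
Proof.
move=> lf; elim: r => [|i r IH]; first by rewrite !big_nil lin_0.
by rewrite !big_cons lin_D// IH.
Qed.

Lemma lin_B (V W : lmodType R) (f : V -> W) x y : linear f -> f (x - y) = f x - f y.
Proof. by move=> lf; rewrite lin_D// -scaleN1r lin_Z// scaleN1r. Qed.

Lemma lin_comp (V W Z : lmodType R) (f : V -> W) (g : W -> Z) :
  linear f -> linear g -> linear (fun x => g (f x)).
Proof. by move=> lf lg a x y; rewrite lf lg. Qed.

Lemma sepfam_separated (V : lmodType R) (I : Type) (l : I -> V -> R^o) :
  sepfam l -> separated V.
Proof. by move=> [ll l0] v H; apply: l0 => i; exact: H. Qed.

Lemma sepfam_eq (V : lmodType R) (I : Type) (l : I -> V -> R^o) u v :
  sepfam l -> (forall i, l i u = l i v) -> u = v.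
Proof.
move=> [ll l0] H; apply/eqP; rewrite -subr_eq0; apply/eqP/l0 => i.
by rewrite lin_B// H subrr.
Qed.

Lemma separated_reg : separated R^o.
Proof. by move=> z /(_ id); apply => a x y. Qed.

Section OneTensor.
Context (V W : lmodType R).
Implicit Types (t : tensor V W).

Definition bform (b : V -> W -> R^o) (bb : bilin b) : bilinear_form V W := exist _ b bb.

Lemma tensor_val_sum (s : seq (V * W)) :
  tensor_val (\sum_(u <- s) u.1 ⊗ u.2) = \sum_(u <- s) pure_functional u.1 u.2.
Proof.
by elim: s => [|u s IH]; [rewrite !big_nil|rewrite !big_cons -IH].
Qed.

Lemma tensor_sum t : exists s : seq (V * W), t = \sum_(u <- s) u.1 ⊗ u.2.
Proof.
have [s sE] := asboolW (valP t); exists s; apply/val_inj; rewrite [LHS]sE.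
by rewrite -tensor_val_sum.
Qed.

Lemma tensor_valE (s : seq (V * W)) b :
  tensor_val (\sum_(u <- s) u.1 ⊗ u.2) b = \sum_(u <- s) sval b u.1 u.2.
Proof.
rewrite tensor_val_sum; elim: s => [|u s IH]; first by rewrite !big_nil.
by rewrite !big_cons -IH.
Qed.

Lemma tensor_evalP t t' : (forall b, tensor_val t b = tensor_val t' b) -> t = t'.
Proof. by move=> H; apply/val_inj/funext. Qed.

Lemma pure_bilin : bilin (fun x y => x ⊗ y : tensor V W).
Proof.
split=> [y a x x'|x a y y']; apply: tensor_evalP => b.
  exact: (svalP b).1.
exact: (svalP b).2.
Qed.

Lemma separated_tensor : separated (tensor V W).
Proof.
move=> t H; apply: tensor_evalP => b.
by apply: (H (fun t => tensor_val t b)).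
Qed.

Section Lift.
Context (Z : lmodType R) (b : V -> W -> Z).
Hypothesis bb : bilin b.
Hypothesis sZ : separated Z.

Lemma tliftE t (s : seq (V * W)) : t = \sum_(u <- s) u.1 ⊗ u.2 ->
  tlift b t = \sum_(u <- s) b u.1 u.2.
Proof.
move=> ts; rewrite /tlift; set s' := sval _.
have ts' : t = \sum_(u <- s') u.1 ⊗ u.2.
  apply/val_inj; rewrite /s'; case: cid => s1 /= s1E; rewrite [LHS]s1E.
  by rewrite -tensor_val_sum.
apply/eqP; rewrite -subr_eq0; apply/eqP/sZ => l ll.
have lb : bilin (fun x y => l (b x y)).
  by split=> [y|x]; apply: lin_comp => //; [exact: bb.1|exact: bb.2].
rewrite lin_B// !(lin_sum _ _ ll).
have := congr1 (fun t => tensor_val t (bform lb)) (etrans (esym ts) ts').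
by rewrite !tensor_valE /= => ->; rewrite subrr.
Qed.

Lemma tlift_pure x y : tlift b (x ⊗ y) = b x y.
Proof. by rewrite (@tliftE _ [:: (x, y)]) big_seq1. Qed.

Lemma tlift_lin : linear (tlift b).
Proof.
move=> a t t'; have [s sE] := tensor_sum t; have [s' sE'] := tensor_sum t'.
rewrite (tliftE sE) (tliftE sE') (@tliftE _ ([seq (a *: u.1, u.2) | u <- s] ++ s')).
  rewrite big_cat big_map scaler_sumr; congr (_ + _); apply: eq_bigr => u _.
  exact: (lin_Z _ _ (bb.1 _)).
rewrite sE sE' big_cat big_map scaler_sumr; congr (_ + _); apply: eq_bigr => u _ /=.
by rewrite (lin_Z _ _ (pure_bilin.1 _)).
Qed.

Lemma tlift_ord t N (x : 'I_N -> V) (y : 'I_N -> W) : t = \sum_u x u ⊗ y u ->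
  tlift b t = \sum_u b (x u) (y u).
Proof.
move=> tE; rewrite (@tliftE _ [seq (x u, y u) | u <- enum 'I_N]).
  by rewrite big_map big_enum.
by rewrite tE big_map big_enum.
Qed.

End Lift.

Lemma tlift_map (Z Z' : lmodType R) (b : V -> W -> Z) (h : Z -> Z') t :
  linear h -> h (tlift b t) = tlift (fun x y => h (b x y)) t.
Proof. by move=> lh; rewrite /tlift lin_sum. Qed.

Lemma tlift_ext (Z : lmodType R) (b b' : V -> W -> Z) t :
  (forall x y, b x y = b' x y) -> tlift b t = tlift b' t.
Proof. by move=> H; rewrite /tlift; apply: eq_bigr. Qed.

Lemma tlift_id t : tlift (fun x y => x ⊗ y) t = t.
Proof.
have [s sE] := tensor_sum t.
by rewrite (tliftE pure_bilin separated_tensor sE).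
Qed.

Lemma sep_bilin (I J : Type) (l : I -> V -> R^o) (l' : J -> W -> R^o) i j :
  sepfam l -> sepfam l' -> bilin (fun x y => l i x * l' j y : R^o).
Proof.
move=> [ll _] [ll' _]; split=> [y a x x'|x a y y'] /=.
  by rewrite ll mulrDl -scalerAl.
by rewrite ll' mulrDr -scalerAr.
Qed.

(** Induction on the number of terms, with no choice of bases. If some [l' j] is nonzero on the
    first right factor, the hypothesis writes the first left factor as a combination of the others;
    absorbing it into their right factors removes a term. *)
Lemma tensor_sep (I J : Type) (l : I -> V -> R^o) (l' : J -> W -> R^o) :
  sepfam l -> sepfam l' ->
  sepfam (fun ij t => tlift (fun x y => l ij.1 x * l' ij.2 y : R^o) t).
Proof.
move=> sl sl'; have bl i j := sep_bilin i j sl sl'; split.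
  by move=> [i j]; apply: tlift_lin => //; exact: separated_reg.
move=> t H; have [s tE] := tensor_sum t.
have {}H i j : \sum_(u <- s) (l i u.1 * l' j u.2 : R^o) = 0.
  by rewrite -(tliftE (bl i j) separated_reg tE); exact: (H (i, j)).
rewrite tE {t tE}.
have [N sN] := ubnP (size s).
elim: N s sN H => // N IH [|[x y] s] /=; first by rewrite big_nil.
rewrite ltnS => sN H.
have [[j c0]|y0] := pselect (exists j, l' j y != 0); last first.
  have {}y0 : y = 0 by apply: sl'.2 => j; have [//|yj] := eqVneq (l' j y) 0; case: y0; exists j.
  rewrite big_cons /= y0 (lin_0 (pure_bilin.2 x)) add0r; apply: IH => // i j.
  by have := H i j; rewrite big_cons /= y0 (lin_0 (sl'.1 j)) mulr0 add0r.
set c := l' j y in c0.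
have xE : x = \sum_(u <- s) (- (l' j u.2 / c)) *: u.1.
  apply: (sepfam_eq sl) => i; have := H i j; rewrite big_cons /=.
  rewrite (lin_sum _ _ (sl.1 i)).
  move=> /eqP; rewrite addr_eq0 => /eqP e.
  apply: (mulIf c0); rewrite e -sumrN mulr_suml; apply: eq_bigr => u _.
  rewrite (lin_Z _ _ (sl.1 i)); rewrite /GRing.scale /=.
  by rewrite mulNr mulNr mulrAC divfK// mulrC.
rewrite big_cons /= [X in X ⊗ y]xE.
pose s' := [seq (u.1, u.2 - (l' j u.2 / c) *: y) | u <- s].
have sE : (\sum_(u <- s) - (l' j u.2 / c) *: u.1) ⊗ y + \sum_(u <- s) u.1 ⊗ u.2 =
    \sum_(u <- s') u.1 ⊗ u.2.
  rewrite (lin_sum _ _ (pure_bilin.1 y)) -big_split big_map; apply: eq_bigr => u _ /=.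
  rewrite (lin_Z _ _ (pure_bilin.1 y)) (lin_D _ _ (pure_bilin.2 _)) addrC; congr (_ + _).
  rewrite -[in RHS]scaleNr.
  exact: esym (lin_Z (- (l' j u.2 / c) : R) y (pure_bilin.2 u.1)).
rewrite sE; apply: IH; first by rewrite size_map.
move=> i k; rewrite big_map -[RHS](H i k) big_cons /= [X in l i X]xE.
rewrite (lin_sum _ _ (sl.1 i)) mulr_suml -big_split; apply: eq_bigr => u _ /=.
rewrite (lin_Z _ _ (sl.1 i)) (lin_D _ _ (sl'.1 k)) -scaleNr (lin_Z _ _ (sl'.1 k)).
rewrite /GRing.scale /=; set p := l i _; set q := l' k _; set r := l' k _; set z := l' j _.
by rewrite mulrDr addrC; congr (_ + _); rewrite mulrCA mulrA.
Qed.

End OneTensor.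

End TensorTheory.

Section FiniteSectionTheory.
Context (R : realType) (X : choiceType) (E : X -> lmodType R).
Implicit Types (s t : gfin E).

Lemma gdelta_in x (v : E x) : gdelta v x = v.
Proof. exact: dfwith_in. Qed.

Lemma gdelta_out x y (v : E x) : x != y -> gdelta v y = 0.
Proof. by move=> xy; exact: dfwith_out. Qed.

Lemma gdelta_lin x : linear (fun v : E x => gdelta v : gfin E).
Proof.
move=> a u v; apply: gfin_eq => y.
have [e|xy] := eqVneq x y.
  subst y; have H (w : E x) : gdelta w x = w by exact: gdelta_in.
  by rewrite -[RHS]/(a *: gdelta u x + gdelta v x) !H.
by rewrite -[RHS]/(a *: gdelta u y + gdelta v y) !gdelta_out// scaler0 addr0.
Qed.

Definition glift (Z : lmodType R) (L : forall x, E x -> Z) s : Z :=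
  \sum_(x \in gsupp s) L x (s x).

Lemma gsupp_seq s : exists2 r : seq X, uniq r & forall x, s x != 0 -> x \in r.
Proof.
exists (finmap.enum_fset (fset_set (gsupp s))) => [|x sx]; first exact: finmap.fset_uniq.
by have := gfinP s; rewrite -/(gsupp s) => fs; rewrite in_fset_set// inE.
Qed.

Section Glift.
Context (Z : lmodType R) (L : forall x, E x -> Z).
Hypothesis lL : forall x, linear (@L x).

Lemma gliftE (r : seq X) s : uniq r -> (forall x, s x != 0 -> x \in r) ->
  glift L s = \sum_(x <- r) L (s x).
Proof.
move=> ur sr; apply: fsbig_fwiden => //; move=> x [_ /= /negP].
by rewrite negbK => /eqP->; exact: lin_0.
Qed.

Lemma glift_lin : linear (glift L).
Proof.
move=> a s t; have [r ur rP] := gsupp_seq s; have [r' ur' rP'] := gsupp_seq t.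
pose r2 := undup (r ++ r').
have u2 : uniq r2 by exact: undup_uniq.
rewrite !(@gliftE r2)// => [|x tx|x sx|x].
- rewrite scaler_sumr -big_split; apply: eq_bigr => x _.
  by rewrite -[(a *: s + t) x]/(a *: s x + t x) lL.
- by rewrite mem_undup mem_cat rP' ?orbT.
- by rewrite mem_undup mem_cat rP.
- rewrite mem_undup mem_cat => st; apply/orP.
  have [sx|] := eqVneq (s x) 0; last by move=> /rP; left.
  right; apply: rP'; move: st; rewrite -[(a *: s + t) x]/(a *: s x + t x).
  by rewrite sx scaler0 add0r.
Qed.

Lemma glift_delta x (v : E x) : glift L (gdelta v) = L v.
Proof.
rewrite (@gliftE [:: x])// ?big_seq1 ?gdelta_in// => y.
rewrite inE; apply: contraNT => yx; apply/eqP; apply: gdelta_out.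
by rewrite eq_sym.
Qed.

End Glift.

Lemma gfin_sum s : exists r : seq X, s = \sum_(x <- r) gdelta (s x).
Proof.
have [r ur rP] := gsupp_seq s; exists r; apply: gfin_eq => y.
have -> : (\sum_(x <- r) gdelta (s x) : gfin E) y = \sum_(x <- r) gdelta (s x) y.
  elim: r {ur rP} => [|x r IH]; first by rewrite !big_nil.
  by rewrite !big_cons -IH.
have [yr|yr] := boolP (y \in r).
  rewrite (bigD1_seq y)// gdelta_in big1 => [|x xy]; first by rewrite /= addr0.
  exact: gdelta_out.
rewrite big_seq big1 => [|x xr]; last first.
  by rewrite gdelta_out//; apply: contra yr => /eqP<-.
by apply/eqP; apply: contraNT yr; exact: rP.
Qed.

Lemma gfin_ind (P : gfin E -> Prop) : P 0 -> (forall s t, P s -> P t -> P (s + t)) ->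
  (forall x (v : E x), P (gdelta v)) -> forall s, P s.
Proof.
move=> P0 PD Pd s; have [r ->] := gfin_sum s.
by apply: big_ind => // x _; exact: Pd.
Qed.

End FiniteSectionTheory.

Section FiniteSectionMaps.
Context (R : realType) (X Y : choiceType) (E : X -> lmodType R) (F : Y -> lmodType R).

Section Gamma.
Context (f : X -> Y) (phi : forall x, E x -> F (f x)).
Hypothesis lphi : forall x, linear (@phi x).

Let lgp x : linear (fun v : E x => gdelta (phi v) : gfin F).
Proof. by move=> a u v; rewrite lphi gdelta_lin. Qed.

Lemma gamma_lin : linear (gamma phi).
Proof. exact: (glift_lin lgp). Qed.

Lemma gamma_delta x (v : E x) : gamma phi (gdelta v) = gdelta (phi v).
Proof. exact: (glift_delta lgp). Qed.

End Gamma.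

Lemma gbox_bilin : bilin (fun (s : gfin E) (t : gfin F) => gbox s t).
Proof.
split=> [t a s s'|s a t t']; apply: gfin_eq => -[x y] /=.
  exact: (pure_bilin _ _).1.
exact: (pure_bilin _ _).2.
Qed.

Lemma gbox_delta x y (v : E x) (w : F y) :
  gbox (gdelta v) (gdelta w) = @gdelta R _ _ (x, y) (v ⊗ w).
Proof.
apply: gfin_eq => -[x' y'].
have [[<- <-]|ne] := pselect ((x, y) = (x', y')).
  by rewrite gdelta_in -[LHS]/(gdelta v x ⊗ gdelta w y) !gdelta_in.
rewrite gdelta_out; last exact/eqP.
rewrite -[LHS]/(gdelta v x' ⊗ gdelta w y').
have [xx'|xx'] := eqVneq x x'; last by rewrite gdelta_out// (lin_0 ((pure_bilin _ _).1 _)).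
have [yy'|yy'] := eqVneq y y'; last by rewrite [X in _ ⊗ X]gdelta_out// (lin_0 ((pure_bilin _ _).2 _)).
by case: ne; rewrite xx' yy'.
Qed.

End FiniteSectionMaps.

Lemma chat_linear (R : realType) (n : nat) (X : topologicalType) (A : atlas R n X)
  p (om : lfm R n X) : linear (fun T : ptcurrent A p => chat T om : R^o).
Proof. by move=> c T S; exact: chat_lin. Qed.

(** * Operations on point currents *)

Section Generators.
Context (R : realType) (n : nat) (X : topologicalType) (A : atlas R n X).
Hypothesis HA : is_atlas A.
Hypothesis HX : hausdorff_space X.
Implicit Types (p : X) (om et : lfm R n X).
Local Notation vec := 'rV[R]_n.

Definition mkE p (a s : seq vec) : ptcurrent A p := mk A p (E A p a s).

Lemma E_rep p (a s : seq vec) : has_rep A p (E A p a s).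
Proof. by exists [:: (1, a, s)] => om so; rewrite /ev big_seq1 mul1r. Qed.

Lemma chat_mkE p (a s : seq vec) om : sm A om -> chat (mkE p a s) om = E A p a s om.
Proof. by move=> so; apply: chat_mk => //; exact: E_rep. Qed.

Definition comb p (L : rep R n) : ptcurrent A p := \sum_(c <- L) c.1.1 *: mkE p c.1.2 c.2.

Lemma chat_comb_rep p L om : sm A om -> chat (comb p L) om = ev A p L om.
Proof.
move=> so; rewrite /comb (lin_sum _ _ (chat_linear om)) /ev; apply: eq_bigr => c _.
by rewrite (lin_Z _ _ (chat_linear om)) chat_mkE.
Qed.

Lemma pt_comb p (T : ptcurrent A p) : exists L, T = comb p L.
Proof.
have [L HL] := ptcurrent_rep HA HX T; exists L; apply: (chat_inj HA) => om so.
by rewrite HL// chat_comb_rep.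
Qed.

(** The form in which the structure theorem is used: a linear property of currents at [p] is checked
    on the generators. *)
Lemma pt_ind p (P : ptcurrent A p -> Prop) : P 0 ->
  (forall c T S, P T -> P S -> P (c *: T + S)) -> (forall a s, P (mkE p a s)) ->
  forall T, P T.
Proof.
move=> P0 PD PE T; have [L ->] := pt_comb T; rewrite /comb.
by elim: L => [|c L IH]; rewrite ?big_nil ?big_cons//; exact: PD.
Qed.

Lemma order_comb p (T : ptcurrent A p) k r :
  order_le A k r (ptval T) <-> exists2 L, rep_le k r L & T = comb p L.
Proof.
split=> [/(order_rep HA HX)[L Lr LE]|[L Lr ->]].
  by exists L => //; apply: (chat_inj HA) => om so; rewrite LE// chat_comb_rep.
by apply: (rep_order HA Lr) => om so; exact: chat_comb_rep.
Qed.

Lemma order_lin p k r c (T S : ptcurrent A p) : order_le A k r (ptval T) ->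
  order_le A k r (ptval S) -> order_le A k r (ptval (c *: T + S)).
Proof.
move=> /order_comb[L Lr ->] /order_comb[L' Lr' ->]; apply/order_comb.
exists (scale_rep c L ++ L').
  by apply: Allp_cat => //; apply: Allp_map; exact: Lr.
rewrite /comb big_cat big_map scaler_sumr; congr (_ + _); apply: eq_bigr => d _.
by rewrite scalerA.
Qed.

Lemma order0 p k r : order_le A k r (ptval (0 : ptcurrent A p)).
Proof. by apply/order_comb; exists [::] => //; rewrite /comb big_nil. Qed.

Lemma order_mkE p a s k r : size s = k -> (size a <= r)%N ->
  order_le A k r (ptval (mkE p a s)).
Proof.
move=> sk ar; apply/order_comb; exists [:: (1, a, s)] => //.
by rewrite /comb big_seq1 scale1r.
Qed.

Lemma order_ind p k r (P : ptcurrent A p -> Prop) : P 0 ->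
  (forall c T S, P T -> P S -> P (c *: T + S)) ->
  (forall a s, size s = k -> (size a <= r)%N -> P (mkE p a s)) ->
  forall T, order_le A k r (ptval T) -> P T.
Proof.
move=> P0 PD PE T /order_comb[L Lr ->]; rewrite /comb.
elim: L Lr => [_|c L IH [[cr ck] /IH{}IH]]; rewrite ?big_nil ?big_cons//.
by apply: PD => //; exact: PE.
Qed.

Lemma order_mono p k r r' (T : ptcurrent A p) : (r <= r')%N ->
  order_le A k r (ptval T) -> order_le A k r' (ptval T).
Proof.
move=> rr /order_comb[L Lr ->]; apply/order_comb; exists L => //.
by apply: Allp_impl Lr => c [c1 c2]; split=> //; exact: leq_trans rr.
Qed.

Definition smform := {om : lfm R n X | sm A om}.

Lemma chat_sep p : sepfam (fun (om : smform) (T : ptcurrent A p) => chat T (sval om) : R^o).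
Proof.
split=> [om|T H]; first exact: chat_linear.
by apply: (chat_inj HA) => om so; rewrite chat0; exact: (H (exist _ om so)).
Qed.

Lemma sep_pt p : separated (ptcurrent A p).
Proof. exact: sepfam_separated (chat_sep p). Qed.

End Generators.

(** * Transposes of operators on forms *)

Section Operators.
Context (R : realType) (n m : nat) (X Y : topologicalType).
Context (A : atlas R n X) (B : atlas R m Y).
Hypothesis HA : is_atlas A.
Hypothesis HB : is_atlas B.
Hypothesis HX : hausdorff_space X.

Section OneOperator.
Context (th : lfm R m Y -> lfm R n X) (p : X) (q : Y).
Hypothesis th_sm : forall om, sm B om -> sm A (th om).
Hypothesis th_rep : forall a s, has_rep B q (fun om => E A p a s (th om)).

(** The transpose of the operator [th] on forms. Representability on generators extends to all
    currents at [p] by [pt_comb], so the default of [mk] is not taken. Push-forward, degree sign,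
    boundary, degree projection and cross product are instances. *)
Definition op (T : ptcurrent A p) : ptcurrent B q := mk B q (fun om => chat T (th om)).

Lemma op_rep (T : ptcurrent A p) : has_rep B q (fun om => chat T (th om)).
Proof.
have [L ->] := pt_comb HA HX T.
suff [L' HL'] : has_rep B q (fun om => ev A p L (th om)).
  by exists L' => om so; rewrite chat_comb_rep ?HL'//; exact: th_sm.
elim: L => [|c L [L' IH]]; first by exists [::] => om _; rewrite /ev !big_nil.
have [L1 H1] := th_rep c.1.2 c.2.
exists (scale_rep c.1.1 L1 ++ L') => om so.
by rewrite ev_cat ev_scale -H1// -IH// /ev big_cons.
Qed.

Lemma chat_op (T : ptcurrent A p) om : sm B om -> chat (op T) om = chat T (th om).
Proof. by move=> so; apply: chat_mk => //; exact: op_rep. Qed.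

Lemma op_lin : linear op.
Proof.
move=> c T S; apply: (chat_inj HB) => om so.
by rewrite chat_lin !chat_op// chat_lin.
Qed.

End OneOperator.

Section Push.
Context (f : X -> Y).
Hypothesis sf : smap A B f.

(** In charts [DOp_pull] keeps the degree and does not raise the order; its coefficients at [zp A p]
    give a combination of generators at [f p]. *)
Lemma push_rep p a s : exists2 L : rep R m, rep_le (size s) (size a) L &
  forall om, sm B om -> E A p a s (pull A B f om) = ev B (f p) L om.
Proof.
pose phi y := cmap (B (f p)) (f (cinv (A p) y)).
pose U := cmap (A p) @` (cdom (A p) `&` (fun x => cdom (B (f p)) (f x))).
have UE y : U y <-> cimg (A p) y /\ cdom (B (f p)) (f (cinv (A p) y)).
  split=> [[x [px fx] <-]|[py fy]].
    by split; [exact: cimg_cmap|rewrite (atlas_inv HA)].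
  by exists (cinv (A p) y); [split=> //; exact: cdom_cinv|exact: cinvK].
have oU : open U.
  apply: open_chart => //; have := (@continuousP X Y f).1 sf.1.
  by move=> /(_ _ (atlas_dom_open HB (f p))).
have sphi y : U y -> smv phi y by move=> /UE[py fy]; exact: sf.2.
have UD y : U y -> cimg (B (f p)) (phi y) by move=> /UE[py fy]; exact: cimg_cmap.
have [l [lP lE]] := DOp_pull oU sphi UD a s.
have zz := cimg_zp HA p.
have fz : cdom (B (f p)) (f (cinv (A p) (zp A p))) by rewrite cinv_zp//; exact: atlas_mem.
have Uz : U (zp A p) by apply/UE.
exists [seq (c.1.1 (zp A p) : R, bmap R c.1.2, bmap R c.2) | c <- l].
  by apply: Allp_map; apply: Allp_impl lP => c [_ c1 c2]; rewrite !size_map.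
move=> om so; rewrite /E (dd_ext _ (lf_pull_near HA HB om s sf zz fz)).
rewrite lE//; last exact: good_lf.
rewrite /ev big_map; apply: eq_bigr => c _ /=.
by rewrite /E /phi cinv_zp.
Qed.

Definition push p : ptcurrent A p -> ptcurrent B (f p) := @op (pull A B f) p (f p).

Lemma push_hasrep p a s : has_rep B (f p) (fun om => E A p a s (pull A B f om)).
Proof. by have [L _ HL] := push_rep p a s; exists L. Qed.

Lemma chat_push p (T : ptcurrent A p) om : sm B om ->
  chat (push T) om = chat T (pull A B f om).
Proof. by apply: chat_op; [move=> et; exact: sm_pull|exact: push_hasrep]. Qed.

Lemma push_lin p : linear (@push p).
Proof. by apply: op_lin; [move=> et; exact: sm_pull|exact: push_hasrep]. Qed.

Lemma push_order (HY : hausdorff_space Y) p k r (T : ptcurrent A p) :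
  order_le A k r (ptval T) -> order_le B k r (ptval (push T)).
Proof.
apply: (order_ind HA HX (P := fun T => order_le B k r (ptval (push T)))).
- rewrite (lin_0 (@push_lin p)); exact: order0.
- by move=> c T1 S1 HT HS; rewrite push_lin; exact: order_lin.
- move=> a s sk ar; have [L Lr LE] := push_rep p a s; apply/(order_comb HB HY); exists L.
    by apply: Allp_impl Lr => c [c1 c2]; split; [exact: leq_trans ar|rewrite c2].
  apply: (chat_inj HB) => om so.
  by rewrite chat_push// chat_comb_rep// -LE// chat_mkE//; exact: sm_pull.
Qed.

End Push.

End Operators.

Section Sign.
Context (R : realType) (n : nat) (X : topologicalType) (A : atlas R n X).
Hypothesis HA : is_atlas A.
Hypothesis HX : hausdorff_space X.
Implicit Types (p : X) (om et : lfm R n X).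

Definition sgf om : lfm R n X := fun p => sg (om p).

Lemma sm_sgf om : sm A om -> sm A (sgf om).
Proof.
move=> so; split=> [p|q x qx s]; first exact: alt_sg (so.1 p).
apply: sm1_eq (sm1Z ((-1) ^+ size s) (so.2 q x qx s)) => y.
by rewrite /lf /sgf /sg size_map.
Qed.

Lemma E_sgf p a s om : sm A om -> E A p a s (sgf om) = (-1) ^+ size s * E A p a s om.
Proof.
move=> so; rewrite /E.
rewrite (_ : (fun x => _) = (fun x => (-1) ^+ size s * lf A p om x s + (fun=> 0) x : R^o)).
  rewrite dd_comb ?dd_zero ?addr0//; last exact: sm1_cst.
  exact: so.2 (cimg_zp HA p) s.
by apply/funext => y; rewrite addr0 /lf /sgf /sg size_map.
Qed.

Lemma sgf_rep p a s : has_rep A p (fun om => E A p a s (sgf om)).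
Proof.
by exists [:: ((-1) ^+ size s, a, s)] => om so; rewrite E_sgf// /ev big_seq1.
Qed.

Definition sigpt p : ptcurrent A p -> ptcurrent A p := @op R n n X X A A sgf p p.

Lemma chat_sigpt p (T : ptcurrent A p) om : sm A om -> chat (sigpt T) om = chat T (sgf om).
Proof. by apply: chat_op => //; [exact: sm_sgf|exact: sgf_rep]. Qed.

Lemma sigpt_lin p : linear (@sigpt p).
Proof. by apply: op_lin => //; [exact: sm_sgf|exact: sgf_rep]. Qed.

Lemma sigpt_mkE p a s : sigpt (mkE A p a s) = (-1) ^+ size s *: mkE A p a s.
Proof.
apply: (chat_inj HA) => om so.
rewrite chat_sigpt// chat_mkE ?E_sgf//; last exact: sm_sgf.
by rewrite (lin_Z _ _ (chat_linear om)) chat_mkE.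
Qed.

Lemma dform_rep p a s : exists2 L : rep R n, rep_le (size s).-1 (size a).+1 L &
  forall om, sm A om -> E A p a s (dform A om) = ev A p L om.
Proof.
exists [seq ((-1) ^+ nat_of_ord i, rcons a (nth 0 s i), rem_nth i s) | i <- enum 'I_(size s)].
  apply: Allp_map; elim: (enum _) => //= i l IH; split=> //; rewrite size_rcons; split=> //.
  rewrite /rem_nth size_cat size_take size_drop ltn_ord.
  by have := ltn_ord i; lia.
by move=> om so; rewrite E_dform// /ev big_map big_enum.
Qed.

Definition bdpt p : ptcurrent A p -> ptcurrent A p := @op R n n X X A A (dform A) p p.

Lemma dform_hasrep p a s : has_rep A p (fun om => E A p a s (dform A om)).
Proof. by have [L _ HL] := dform_rep p a s; exists L. Qed.

Lemma chat_bdpt p (T : ptcurrent A p) om : sm A om -> chat (bdpt T) om = chat T (dform A om).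
Proof. by apply: chat_op => //; [move=> et; exact: sm_dform|exact: dform_hasrep]. Qed.

Lemma bdpt_lin p : linear (@bdpt p).
Proof. by apply: op_lin => //; [move=> et; exact: sm_dform|exact: dform_hasrep]. Qed.

Lemma bdpt_order p k r (T : ptcurrent A p) :
  order_le A k r (ptval T) -> order_le A k.-1 r.+1 (ptval (bdpt T)).
Proof.
apply: (order_ind HA HX (P := fun T => order_le A k.-1 r.+1 (ptval (bdpt T)))).
- rewrite (lin_0 (@bdpt_lin p)); exact: order0.
- by move=> c T1 S1 HT HS; rewrite bdpt_lin; exact: order_lin.
- move=> a s sk ar; have [L Lr LE] := dform_rep p a s; apply/(order_comb HA HX); exists L.
    by apply: Allp_impl Lr => c [c1 c2]; split; [exact: leq_trans c1 _|rewrite c2 sk].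
  apply: (chat_inj HA) => om so.
  by rewrite chat_bdpt// chat_comb_rep// -LE// chat_mkE//; exact: sm_dform.
Qed.

Lemma bdpt_degree0 p r (T : ptcurrent A p) : order_le A 0 r (ptval T) -> bdpt T = 0.
Proof.
apply: (order_ind HA HX (P := fun T => bdpt T = 0)).
- exact: lin_0 (@bdpt_lin p).
- by move=> c T1 S1 HT HS; rewrite bdpt_lin HT HS scaler0 addr0.
- move=> a s /size0nil-> ar; apply: (chat_inj HA) => om so.
  by rewrite chat_bdpt// chat_mkE ?E_dform ?big_ord0 ?chat0//; exact: sm_dform.
Qed.

Lemma bdpt_bdpt p (T : ptcurrent A p) : bdpt (bdpt T) = 0.
Proof.
apply: (chat_inj HA) => om so; rewrite chat0 !chat_bdpt//; last exact: sm_dform.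
rewrite (_ : dform A (dform A om) = (fun _ _ => 0)).
  have := chat_comb HA T (-1) (sm_zero A) (sm_zero A).
  rewrite (_ : (fun p s => _) = (fun _ _ => 0)); first by move=> ->; rewrite mulN1r addNr.
  by apply/funext => x; apply/funext => s; rewrite mulr0 addr0.
by apply/funext => x; apply/funext => s; exact: dform_dform.
Qed.

Definition degf k om : lfm R n X := hat (hom k om).

Lemma degf_rep p k a s : exists2 L : rep R n, rep_le k (size a) L &
  forall om, sm A om -> E A p a s (degf k om) = ev A p L om.
Proof.
have [sk|sk] := eqVneq (size s) k.
  by exists [:: (1, a, s)] => // om so; rewrite E_hat_hom sk eqxx /ev big_seq1 mul1r.
by exists [::] => // om so; rewrite E_hat_hom (negbTE sk) /ev big_nil.
Qed.

Definition degpt k p : ptcurrent A p -> ptcurrent A p := @op R n n X X A A (degf k) p p.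

Lemma degf_hasrep p k a s : has_rep A p (fun om => E A p a s (degf k om)).
Proof. by have [L _ HL] := degf_rep p k a s; exists L. Qed.

Lemma chat_degpt k p (T : ptcurrent A p) om : sm A om -> chat (degpt k T) om = chat T (degf k om).
Proof. by apply: chat_op => //; [move=> et; exact: sm_hat_hom|exact: degf_hasrep]. Qed.

Lemma degpt_lin k p : linear (@degpt k p).
Proof. by apply: op_lin => //; [move=> et; exact: sm_hat_hom|exact: degf_hasrep]. Qed.

Lemma degpt_mkE k p a s : degpt k (mkE A p a s) = if size s == k then mkE A p a s else 0.
Proof.
apply: (chat_inj HA) => om so; rewrite chat_degpt// chat_mkE//; last exact: sm_hat_hom.
by rewrite E_hat_hom//; case: ifP => _; rewrite ?chat_mkE ?chat0//.
Qed.

Lemma degpt_order k j r p (T : ptcurrent A p) : order_le A j r (ptval T) ->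
  degpt k T = if j == k then T else 0.
Proof.
apply: (order_ind HA HX (P := fun T => degpt k T = if j == k then T else 0)).
- by rewrite (lin_0 (@degpt_lin k p)); case: ifP.
- move=> c T1 S1 HT HS; rewrite degpt_lin HT HS; case: ifP => // _.
  by rewrite scaler0 addr0.
- by move=> a s sj _; rewrite degpt_mkE sj.
Qed.

(** Stated for all [M] beyond [N] and with one order [r] for all degrees, so that the bounds of two
    currents can be merged. *)
Lemma degpt_sum p (T : ptcurrent A p) : exists N, exists r, forall M, (N <= M)%N ->
  T = \sum_(k < M) degpt k T /\ forall k, order_le A k r (ptval (degpt k T)).
Proof.
have [L ->] := pt_comb HA HX T; elim: L => [|c L [N [r IH]]].
  exists 0%N, 0%N => M _; rewrite /comb big_nil; split.
    by rewrite big1// => k _; exact: lin_0 (@degpt_lin k p).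
  by move=> k; rewrite (lin_0 (@degpt_lin k p)); exact: order0.
exists (maxn (size c.2).+1 N), (maxn (size c.1.2) r) => M.
rewrite geq_max => /andP[cM /IH[IH1 IH2]].
rewrite /comb big_cons -/(comb A p L); split.
  have -> : \sum_(k < M) degpt k (c.1.1 *: mkE A p c.1.2 c.2 + comb A p L) =
    c.1.1 *: (\sum_(k < M) degpt k (mkE A p c.1.2 c.2)) + \sum_(k < M) degpt k (comb A p L).
    by rewrite scaler_sumr -big_split; apply: eq_bigr => k _; rewrite degpt_lin.
  rewrite -IH1; congr (_ *: _ + _).
  rewrite (bigD1 (Ordinal cM))//= degpt_mkE eqxx big1 ?addr0// => k kc.
  by rewrite degpt_mkE; case: eqP => // e; case/eqP: kc; apply/val_inj.
move=> k; rewrite degpt_lin; apply: order_lin => //; last first.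
  by apply: order_mono (IH2 k) => //; exact: leq_maxr.
rewrite degpt_mkE; case: eqP => [e|_]; last exact: order0.
by apply: order_mkE => //; exact: leq_maxl.
Qed.

End Sign.

Lemma hausdorff_pair (T U : topologicalType) :
  hausdorff_space T -> hausdorff_space U -> hausdorff_space (T * U)%type.
Proof.
move=> hT hU [p p'] [q q'] cl; congr (_, _).
  apply: hT => C D pC qD.
  have [|[x y] [/= Cx Dx]] := cl (fst @^-1` C) (fst @^-1` D) _ (cvg_fst qD).
    exact: (cvg_fst pC).
  by exists x.
apply: hU => C D pC qD.
have [|[x y] [/= Cx Dx]] := cl (snd @^-1` C) (snd @^-1` D) _ (cvg_snd qD).
  exact: (cvg_snd pC).
by exists y.
Qed.

Section PullComp.
Context (R : realType) (n m l : nat) (X Y Z : topologicalType).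
Context (A : atlas R n X) (B : atlas R m Y) (C : atlas R l Z).
Hypothesis HA : is_atlas A.
Hypothesis HB : is_atlas B.
Hypothesis HC : is_atlas C.

Lemma pull_comp (f : X -> Y) (g : Y -> Z) (om : lfm R l Z) : smap A B f -> smap B C g ->
  pull A B f (pull B C g om) = pull A C (fun x => g (f x)) om.
Proof.
move=> sf sg; apply/funext => p; apply/funext => s; rewrite /pull -map_comp.
by congr (om _ _); apply: eq_map => u /=; rewrite (tg_comp HA HB HC).
Qed.

End PullComp.

(** * Cross products *)

Section Cross.
Context (R : realType) (n m : nat) (X Y : topologicalType).
Context (A : atlas R n X) (B : atlas R m Y).
Hypothesis HA : is_atlas A.
Hypothesis HB : is_atlas B.
Hypothesis HX : hausdorff_space X.
Hypothesis HY : hausdorff_space Y.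
Local Notation AB := (prod_atlas A B).
Local Notation lmap s := (map (fun u => inl u) s).
Local Notation rmap s := (map (fun u => inr u) s).
Implicit Types (p : X) (q : Y) (Om : lfm R (n + m) (X * Y)).

Lemma sl_chat q L Om : sm AB Om -> sl (chat (comb B q L)) Om = sl (ev B q L) Om.
Proof.
move=> sO; apply/funext => x; apply/funext => s.
by rewrite /sl chat_comb_rep//; exact: (sm_slice HA HB).
Qed.

Lemma sm_sl_chat q (S : ptcurrent B q) Om : sm AB Om -> sm A (sl (chat S) Om).
Proof. by move=> sO; have [L ->] := pt_comb HB HY S; rewrite sl_chat//; exact: sm_sl. Qed.

Lemma E_sl_ev p a s q L Om : sm AB Om -> E A p a s (sl (ev B q L) Om) =
  \sum_(c <- L) c.1.1 * E AB (p, q) (lmap a ++ rmap c.1.2) (lmap s ++ rmap c.2) Om.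
Proof.
move=> sO; elim: L => [|c L IH].
  rewrite big_nil (_ : sl _ _ = (fun _ _ => 0)).
    by rewrite /E dd_zero.
  by apply/funext => x; apply/funext => t; rewrite sl_ev big_nil.
have -> : sl (ev B q (c :: L)) Om = fun p s =>
    c.1.1 * sl (E B q c.1.2 c.2) Om p s + sl (ev B q L) Om p s.
  by apply/funext => x; apply/funext => t; rewrite sl_ev big_cons.
by rewrite E_comb ?IH ?big_cons ?E_slE//; [exact: sm_slE|exact: sm_sl].
Qed.

Lemma cross_rep p q (S : ptcurrent B q) a s :
  has_rep AB (p, q) (fun Om => E A p a s (sl (chat S) Om)).
Proof.
have [L ->] := pt_comb HB HY S.
exists [seq (c.1.1, lmap a ++ rmap c.1.2, lmap s ++ rmap c.2) | c <- L] => Om sO.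
by rewrite sl_chat// E_sl_ev// /ev big_map.
Qed.

Definition cross p q (T : ptcurrent A p) (S : ptcurrent B q) : ptcurrent AB (p, q) :=
  op AB (sl (chat S)) (p, q) T.

Lemma chat_cross p q (T : ptcurrent A p) (S : ptcurrent B q) Om : sm AB Om ->
  chat (cross T S) Om = chat T (sl (chat S) Om).
Proof.
apply: chat_op => //; first exact: prod_is_atlas.
  by move=> et; exact: sm_sl_chat.
exact: cross_rep.
Qed.

Lemma cross_mkE p q a s b t : cross (mkE A p a s) (mkE B q b t) =
  mkE AB (p, q) (lmap a ++ rmap b) (lmap s ++ rmap t).
Proof.
apply: (chat_inj (prod_is_atlas HA HB)) => Om sO.
have HAB := prod_is_atlas HA HB.
rewrite chat_cross// !chat_mkE//; last exact: sm_sl_chat.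
rewrite -E_slE//; congr (E _ _ _ _ _); apply/funext => x; apply/funext => w.
by rewrite /sl chat_mkE//; exact: (sm_slice HA HB).
Qed.

Lemma cross_bilin p q : bilin (fun (T : ptcurrent A p) (S : ptcurrent B q) => cross T S).
Proof.
have HAB := prod_is_atlas HA HB.
split=> [S c T T'|T c S S']; apply: (chat_inj HAB) => Om sO.
  by rewrite chat_lin !chat_cross// chat_lin.
rewrite chat_lin !chat_cross//.
rewrite -(chat_comb HA T c (sm_sl_chat S sO) (sm_sl_chat S' sO)).
congr (chat T _); apply/funext => x; apply/funext => w.
by rewrite /sl chat_lin.
Qed.

End Cross.

Section BoundaryGenerators.
Context (R : realType) (n : nat) (X : topologicalType) (A : atlas R n X).
Hypothesis HA : is_atlas A.
Hypothesis HX : hausdorff_space X.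

Lemma bdpt_mkE p a s : bdpt (mkE A p a s) =
  \sum_(i < size s) (-1) ^+ i *: mkE A p (rcons a (nth 0 s i)) (rem_nth i s).
Proof.
apply: (chat_inj HA) => om so; rewrite chat_bdpt// chat_mkE//; last exact: sm_dform.
rewrite E_dform// (lin_sum _ _ (chat_linear om)); apply: eq_bigr => i _.
by rewrite (lin_Z _ _ (chat_linear om)) chat_mkE.
Qed.

Lemma mkE_catC p a b c s : mkE A p (a ++ b ++ c) s = mkE A p (a ++ c ++ b) s.
Proof.
apply: (chat_inj HA) => om so; rewrite !chat_mkE// /E (dd_cat _ (b ++ c)) (dd_cat _ (c ++ b)).
have sz := so.2 p _ (cimg_zp HA p) s.
apply: dd_ext.
apply: filterS (sm1_near sz) => y sy.
by rewrite dd_catC.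
Qed.

End BoundaryGenerators.

Section BoundaryCross.
Context (R : realType) (n m : nat) (X Y : topologicalType).
Context (A : atlas R n X) (B : atlas R m Y).
Hypothesis HA : is_atlas A.
Hypothesis HB : is_atlas B.
Hypothesis HX : hausdorff_space X.
Hypothesis HY : hausdorff_space Y.
Local Notation AB := (prod_atlas A B).
Local Notation lmap s := (map (fun u => inl u) s).
Local Notation rmap s := (map (fun u => inr u) s).

(** Cross products of generators concatenate, so the boundary sum splits: the first [size s] terms
    remove a vector of [s], the others one of [t] with the additional sign (-1)^(size s) of [sigpt].
    The appended derivative is moved into place by [mkE_catC]. *)
Lemma bdpt_cross p q (T : ptcurrent A p) (S : ptcurrent B q) :
  bdpt (cross T S) = cross (bdpt T) S + cross (sigpt T) (bdpt S).
Proof.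
have HAB := prod_is_atlas HA HB; have HXY := hausdorff_pair HX HY.
have cb := cross_bilin HA HB HX HY p q.
have lb := bdpt_lin HAB HXY (p := (p, q)).
move: T; apply: (pt_ind HA HX) => [|c T T' HT HT'|a s].
- rewrite (lin_0 (bdpt_lin HA HX (p := p))) (lin_0 (sigpt_lin HA HX (p := p))).
  by rewrite !(lin_0 (cb.1 _)) (lin_0 lb) addr0.
- rewrite (bdpt_lin HA HX) (sigpt_lin HA HX) !cb.1 lb HT HT' scalerDr.
  by rewrite addrACA.
move: S; apply: (pt_ind HB HY) => [|c T T' HT HT'|b t].
- rewrite (lin_0 (bdpt_lin HB HY (p := q))).
  by rewrite !(lin_0 (cb.2 _)) (lin_0 lb) addr0.
- rewrite (bdpt_lin HB HY) !cb.2 lb HT HT' scalerDr.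
  by rewrite addrACA.
rewrite cross_mkE// !bdpt_mkE// sigpt_mkE// (lin_Z _ _ (cb.1 _)).
rewrite (lin_sum _ _ (cb.1 _)) (lin_sum _ _ (cb.2 _)).
pose F i := (-1) ^+ i *: mkE AB (p, q) (rcons (lmap a ++ rmap b)
   (nth 0 (lmap s ++ rmap t) i)) (rem_nth i (lmap s ++ rmap t)).
rewrite -(big_mkord xpredT F) size_cat !size_map (@big_cat_nat _ _ _ (size s))//=; last exact: leq_addr.
congr (_ + _).
  rewrite big_mkord; apply: eq_bigr => i _; rewrite (lin_Z _ _ (cb.1 _)) cross_mkE// /F.
  congr (_ *: _); rewrite nth_cat size_map ltn_ord (nth_map 0)//.
  rewrite /rem_nth take_cat drop_cat !size_map ltn_ord.
  have -> : (if (i.+1 < size s)%N then drop i.+1 (lmap s) ++ rmap t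
      else drop (i.+1 - size s) (rmap t)) = lmap (drop i.+1 s) ++ rmap t.
    rewrite -map_drop; case: ltnP => // si; rewrite (drop_oversize si) /=.
    have -> : i.+1 = size s by apply/eqP; rewrite eqn_leq si andbT.
    by rewrite subnn drop0.
  rewrite -map_take -cats1 -catA mkE_catC// -cats1.
  by rewrite !map_cat -!catA.
rewrite -{1}[size s]add0n big_addn addKn big_mkord scaler_sumr; apply: eq_bigr => j _.
rewrite (lin_Z _ _ (cb.2 _)) cross_mkE// scalerA /F -exprD (addnC (nat_of_ord j)); congr (_ *: _).
rewrite nth_cat size_map ltnNge leq_addr /= addKn (nth_map 0)//.
rewrite /rem_nth take_cat drop_cat !size_map ltnNge leq_addr /= addKn.
rewrite -addnS ltnNge leq_addr /= addKn.
rewrite -cats1 -catA; congr (mkE _ _ _ _); first by rewrite -cats1 map_cat.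
by rewrite map_cat map_take map_drop catA.
Qed.

Lemma bdpt_push (f : X -> Y) p (T : ptcurrent A p) : smap A B f ->
  bdpt (push B f T) = push B f (bdpt T).
Proof.
move=> sf; apply: (chat_inj HB) => om so.
rewrite chat_bdpt// !chat_push// ?chat_bdpt//; [|exact: sm_pull|exact: sm_dform].
by congr (chat T _); apply/funext => x; apply/funext => s; exact: pull_dform.
Qed.

End BoundaryCross.

(** * The coproduct and the counit in a fibre *)

Section Coproduct.
Context (R : realType) (n : nat) (X : topologicalType) (A : atlas R n X).
Hypothesis HA : is_atlas A.
Hypothesis HX : hausdorff_space X.
Implicit Types (p : X) (om et : lfm R n X).

Definition is_dual_wedge p (T : ptcurrent A p) (t : tensor (ptcurrent A p) (ptcurrent A p)) :=
  forall om et, sm A om -> sm A et ->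
    tlift (fun a b => chat a om * chat b et : R^o) t = chat T (wlf om et).

Lemma test_bilin p om et :
  bilin (fun a b : ptcurrent A p => chat a om * chat b et : R^o).
Proof.
split=> [y a x x'|x a y y'] /=.
  by rewrite chat_lin mulrDl /GRing.scale /= mulrA.
by rewrite chat_lin mulrDr mulrCA.
Qed.

Lemma dual_wedge_uniq p (T : ptcurrent A p) t t' :
  is_dual_wedge T t -> is_dual_wedge T t' -> t = t'.
Proof.
move=> Ht Ht'; apply: (sepfam_eq (tensor_sep (chat_sep HA p) (chat_sep HA p))).
by move=> [[om so] [et se]] /=; rewrite Ht// Ht'.
Qed.

Lemma dual_wedge_lin p c (T T' : ptcurrent A p) t t' :
  is_dual_wedge T t -> is_dual_wedge T' t' -> is_dual_wedge (c *: T + T') (c *: t + t').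
Proof.
move=> Ht Ht' om et so se.
by rewrite (tlift_lin (test_bilin p om et) (@separated_reg R)) Ht// Ht'// chat_lin.
Qed.

Definition Dmk p (a s : seq 'rV[R]_n) : tensor (ptcurrent A p) (ptcurrent A p) :=
  \sum_(t <- splits s) \sum_(q <- splits a)
    (-1) ^+ t.1.1 *: (mkE A p q.1.2 t.1.2 ⊗ mkE A p q.2 t.2).

Lemma dual_wedge_mkE p a s : is_dual_wedge (mkE A p a s) (Dmk p a s).
Proof.
move=> om et so se; have tl := tlift_lin (test_bilin p om et) (@separated_reg R).
rewrite chat_mkE//; last exact: sm_wlf.
rewrite E_wlf// (lin_sum _ _ tl); apply: eq_bigr => t _.
rewrite (lin_sum _ _ tl); apply: eq_bigr => q _.
rewrite (lin_Z _ _ tl) (tlift_pure (test_bilin p om et) (@separated_reg R)).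
by rewrite !chat_mkE.
Qed.

Lemma dual_wedge_ex p (T : ptcurrent A p) : exists t, is_dual_wedge T t.
Proof.
move: T; apply: (pt_ind HA HX) => [|c T S [t Ht] [t' Ht']|a s].
- exists 0 => om et so se.
  by rewrite (lin_0 (tlift_lin (test_bilin p om et) (@separated_reg R))) chat0.
- by exists (c *: t + t'); exact: dual_wedge_lin.
- by exists (Dmk p a s); exact: dual_wedge_mkE.
Qed.

(** Chosen by [cid]; pairs of smooth forms separate tensors, so the choice is unique and therefore
    linear in [T]. *)
Definition Dpt p (T : ptcurrent A p) := sval (cid (dual_wedge_ex T)).

Lemma Dpt_test p (T : ptcurrent A p) : is_dual_wedge T (Dpt T).
Proof. by rewrite /Dpt; case: cid. Qed.

Lemma Dpt_lin p : linear (@Dpt p).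
Proof.
move=> c T S; apply: (dual_wedge_uniq (@Dpt_test p _)).
by apply: dual_wedge_lin; exact: Dpt_test.
Qed.

Lemma Dpt_mkE p a s : Dpt (mkE A p a s) = Dmk p a s.
Proof. exact: dual_wedge_uniq (@Dpt_test p _) (dual_wedge_mkE p a s). Qed.

Definition epspt p (T : ptcurrent A p) : R^o := chat T (fun _ => @one R 'rV[R]_n).

Lemma epspt_lin p : linear (@epspt p).
Proof. exact: chat_linear. Qed.

Lemma counitl_pt p (T : ptcurrent A p) : tlift (fun a b => epspt a *: b) (Dpt T) = T.
Proof.
apply: (chat_inj HA) => om so.
rewrite (tlift_map _ _ (chat_linear om)).
rewrite (tlift_ext (b' := fun a b => chat a (fun _ => @one R 'rV[R]_n) * chat b om : R^o)); last first.
  by move=> x y; rewrite (lin_Z _ _ (chat_linear om)).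
rewrite Dpt_test//; last exact: sm_one.
by congr (chat T _); apply/funext => x; apply/funext => s; rewrite /wlf wl1l.
Qed.

Lemma counitr_pt p (T : ptcurrent A p) : tlift (fun a b => epspt b *: a) (Dpt T) = T.
Proof.
apply: (chat_inj HA) => om so.
rewrite (tlift_map _ _ (chat_linear om)).
rewrite (tlift_ext (b' := fun a b => chat a om * chat b (fun _ => @one R 'rV[R]_n) : R^o)); last first.
  by move=> x y; rewrite (lin_Z _ _ (chat_linear om)) mulrC.
rewrite Dpt_test//; last exact: sm_one.
by congr (chat T _); apply/funext => x; apply/funext => s; rewrite /wlf wl1r.
Qed.

Local Notation AA := (prod_atlas A A).
Local Notation lmap s := (map (fun u : 'rV[R]_n => inl u : 'rV[R]_(n + n)) s).
Local Notation rmap s := (map (fun u : 'rV[R]_n => inr u : 'rV[R]_(n + n)) s).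

Lemma smap_diag : smap A AA (fun x => (x, x)).
Proof. by apply: smap_pair => //; exact: smap_id. Qed.

(** The right side is the coproduct of a generator with cross products in place of tensors: the
    coproduct is a push-forward along the diagonal. The antipode identities are computed in this
    form. *)
Lemma E_diag p a s Om : sm AA Om -> E A p a s (pull A AA (fun x => (x, x)) Om) =
  \sum_(t <- splits s) \sum_(q <- splits a) (-1) ^+ t.1.1 *
    E AA (p, p) (lmap q.1.2 ++ rmap q.2) (lmap t.1.2 ++ rmap t.2) Om.
Proof.
move=> sO; have HAA := prod_is_atlas HA HA; have zz := cimg_zp HA p.
have dz : cdom (AA (p, p)) ((fun x => (x, x)) (cinv (A p) (zp A p))).
  by rewrite cinv_zp//; exact: (atlas_mem HAA).
pose F (t : nat * seq 'rV[R]_n * seq 'rV[R]_n) z := lf AA (p, p) Om z (lmap t.1.2 ++ rmap t.2) : R^o.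
have cz : cimg (AA (p, p)) (row_mx (zp A p) (zp A p)) by exact: cimg_row.
have sF t : sm1 (fun y => F t (row_mx y y)) (zp A p).
  apply: (sm1_comp (f := fun y => row_mx y y)); last exact: sO.2.
  by apply: smv_row; exact: smv_id.
rewrite /E (dd_ext _ (g := fun y => \sum_(t <- splits s) (-1) ^+ t.1.1 * F t (row_mx y y))).
  rewrite dd_sum//; apply: eq_bigr => t _; rewrite (dd_diag _ (f := F t)); last exact: sO.2.
  by rewrite mulr_sumr; apply: eq_bigr.
apply: filterS2 (lf_pull_near HA HAA Om s smap_diag zz dz) (near_cimg HA zz) => y -> py.
rewrite /pullv /= cinvK//.
have aO : alt (lf AA (p, p) Om (row_mx y y)) by apply: lf_alt; [exact: HAA|exact: sO.1|exact: cimg_row].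
rewrite -(alt_diag (fun u => inl u) (fun u => inr u) s aO).
congr (lf _ _ _ _ _); apply: eq_map => u.
rewrite (Dv_ext (f' := fun y => row_mx y y)).
  by rewrite Dv_row Dv_id add_row_mx addr0 add0r.
by apply: filterS (near_cimg HA py) => z pz; rewrite cinvK.
Qed.

End Coproduct.

Lemma maps_assoc (T : Type) (f1 f2 f3 g1 g2 g3 h1 h2 : T -> T) s w t :
  (forall u, f1 (f2 u) = f3 u) -> (forall u, f1 (g1 u) = g2 (g3 u)) ->
  (forall u, h1 u = g2 (h2 u)) ->
  map f1 (map f2 s ++ map g1 w) ++ map h1 t = map f3 s ++ map g2 (map g3 w ++ map h2 t).
Proof.
move=> ff fg gh; rewrite !map_cat catA -!map_comp.
by rewrite (eq_map (f := f1 \o f2) ff) (eq_map (f := f1 \o g1) fg) (eq_map (f := h1) gh).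
Qed.

(** * Point currents on a Lie group *)

Section GroupCurrents.
Context (R : realType) (n : nat) (G : lieGroupType R n).
Local Notation A := (lie_atlas : atlas R n G).
Local Notation AA := (prod_atlas A A).
Local Notation e := (1%g : G).
Local Notation lmap s := (map (fun u : 'rV[R]_n => inl u : 'rV[R]_(n + n)) s).
Local Notation rmap s := (map (fun u : 'rV[R]_n => inr u : 'rV[R]_(n + n)) s).
Implicit Types (p q x y z : G) (om et : lfm R n G) (s t : seq 'rV[R]_n).

Lemma GA : is_atlas A. Proof. exact: lie_is_atlas. Qed.
Lemma GG : is_atlas AA. Proof. exact: prod_is_atlas GA GA. Qed.
Lemma GH : hausdorff_space G. Proof. exact: lie_hausdorff. Qed.

Definition mulm (xy : G * G) : G := (xy.1 * xy.2)%g.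
Definition invm x : G := (x^-1)%g.

Lemma smap_mulm : smap AA A mulm.
Proof. exact: (smooth_map_smap GG GA lie_mul_smooth). Qed.

Lemma smap_invm : smap A A invm.
Proof. exact: (smooth_map_smap GA GA lie_inv_smooth). Qed.

Lemma smap_R y : smap A A (fun x => (x * y)%g).
Proof.
have sp : smap A AA (fun x => (x, y)) by apply: smap_pair; [exact: smap_id GA|exact: smap_cst].
exact: (smap_comp GA GG sp smap_mulm).
Qed.

Lemma smap_L x : smap A A (fun y => (x * y)%g).
Proof.
have sp : smap A AA (fun y => (x, y)) by apply: smap_pair; [exact: smap_cst|exact: smap_id GA].
exact: (smap_comp GA GG sp smap_mulm).
Qed.

Definition tR y x := tg A A (fun x => (x * y)%g) x.
Definition tL x y := tg A A (fun y => (x * y)%g) y.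

Lemma tg_eq (f g : G -> G) x u : f =1 g -> tg A A f x u = tg A A g x u.
Proof. by move=> /funext->. Qed.

Lemma tg_mul_l x y u : tg AA A mulm (x, y) (inl u) = tR y x u.
Proof.
have sp : smap A AA (fun x => (x, y)) by apply: smap_pair; [exact: smap_id GA|exact: smap_cst].
have := tg_comp GA GG GA x u sp smap_mulm.
by rewrite tg_pair (tg_id GA) tg_cst.
Qed.

Lemma tg_mul_r x y u : tg AA A mulm (x, y) (inr u) = tL x y u.
Proof.
have sp : smap A AA (fun y => (x, y)) by apply: smap_pair; [exact: smap_cst|exact: smap_id GA].
have := tg_comp GA GG GA y u sp smap_mulm.
by rewrite tg_pair (tg_id GA) tg_cst.
Qed.

Lemma tR_comp x y z u : tR z (x * y)%g (tR y x u) = tR (y * z)%g x u.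
Proof.
rewrite /tR -(tg_comp GA GA GA x u (smap_R y) (smap_R z)).
by apply: tg_eq => w; rewrite mulgA.
Qed.

Lemma tL_comp x y z u : tL x (y * z)%g (tL y z u) = tL (x * y)%g z u.
Proof.
rewrite /tL -(tg_comp GA GA GA z u (smap_L y) (smap_L x)).
by apply: tg_eq => w; rewrite mulgA.
Qed.

Lemma tRL x y z u : tR z (x * y)%g (tL x y u) = tL x (y * z)%g (tR z y u).
Proof.
rewrite /tR /tL -(tg_comp GA GA GA y u (smap_L x) (smap_R z)).
rewrite -(tg_comp GA GA GA y u (smap_R z) (smap_L x)).
by apply: tg_eq => w; rewrite mulgA.
Qed.

Lemma tR1 x u : tR e x u = u.
Proof.
by rewrite /tR (tg_eq (g := id)) ?(tg_id GA)// => w; rewrite mulg1.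
Qed.

Lemma tL1 x u : tL e x u = u.
Proof.
by rewrite /tL (tg_eq (g := id)) ?(tg_id GA)// => w; rewrite mul1g.
Qed.

Lemma pull_mul om x y s t : pull AA A mulm om (x, y) (lmap s ++ rmap t) =
  om (x * y)%g (map (tR y x) s ++ map (tL x y) t).
Proof.
rewrite /pull map_cat -!map_comp; apply: (f_equal (om _)); congr (_ ++ _); apply: eq_map => u /=.
  exact: tg_mul_l.
exact: tg_mul_r.
Qed.

Definition mulpt p q (T : ptcurrent A p) (S : ptcurrent A q) : ptcurrent A (p * q)%g :=
  push A mulm (cross T S).

Lemma GGH : hausdorff_space (G * G)%type.
Proof. exact: hausdorff_pair GH GH. Qed.

Lemma sm_pull_mulm om : sm A om -> sm AA (pull AA A mulm om).
Proof. exact: (sm_pull GG GA smap_mulm). Qed.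

Lemma sm_mul_sl q (S : ptcurrent A q) om : sm A om -> sm A (sl (chat S) (pull AA A mulm om)).
Proof.
by move=> so; apply: (sm_sl_chat GA GA GH); exact: sm_pull_mulm.
Qed.

Lemma chat_mulpt p q (T : ptcurrent A p) (S : ptcurrent A q) om : sm A om ->
  chat (mulpt T S) om = chat T (sl (chat S) (pull AA A mulm om)).
Proof.
move=> so; apply: etrans (chat_push GG GA GGH smap_mulm (cross T S) so) _.
apply: (chat_cross GA GA GH GH).
exact: sm_pull_mulm.
Qed.

Lemma mulpt_bilin p q : bilin (fun (T : ptcurrent A p) (S : ptcurrent A q) => mulpt T S).
Proof.
have cb := cross_bilin GA GA GH GH p q.
have pl := push_lin GG GA GGH smap_mulm (p := (p, q)).
by split=> [S c T T'|T c S S']; rewrite /mulpt (cb.1, cb.2) pl.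
Qed.

Lemma mulpt_mkE p q a s b t : mulpt (mkE A p a s) (mkE A q b t) =
  push A mulm (mkE AA (p, q) (lmap a ++ rmap b) (lmap s ++ rmap t)).
Proof. by rewrite /mulpt (cross_mkE GA GA GH GH). Qed.

Lemma chat_mulpt_mkE p q a s b t om : sm A om ->
  chat (mulpt (mkE A p a s) (mkE A q b t)) om =
  E AA (p, q) (lmap a ++ rmap b) (lmap s ++ rmap t) (pull AA A mulm om).
Proof.
move=> so; rewrite mulpt_mkE.
apply: etrans (chat_push GG GA GGH smap_mulm (mkE AA (p, q) _ _) so) _.
apply: (chat_mkE GG); exact: sm_pull_mulm.
Qed.

Lemma sm_slice_mul om x s : sm A om -> sm A (slice (pull AA A mulm om) x s).
Proof.
move=> so; apply: (sm_slice GA GA).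
exact: sm_pull_mulm.
Qed.

(** Both sides evaluate [om] at the product of three points. What must agree is the transport of the
    vectors of each factor, which is the compatibility of left and right translations ([tR_comp],
    [tRL], [tL_comp]). *)
Lemma chat_mulptA p q r (T : ptcurrent A p) (S : ptcurrent A q) (U : ptcurrent A r) om :
  sm A om -> chat (mulpt (mulpt T S) U) om = chat (mulpt T (mulpt S U)) om.
Proof.
move=> so; have sU := sm_mul_sl U so.
rewrite !chat_mulpt//; congr (chat T _); apply/funext => x; apply/funext => s.
rewrite /sl chat_mulpt; last exact: sm_slice_mul.
congr (chat S _); apply/funext => y; apply/funext => w.
rewrite /slice pull_mul /sl; congr (chat U _); apply/funext => z; apply/funext => t.
rewrite /slice !pull_mul; apply: (f_equal2 om); first by rewrite mulgA.
apply: maps_assoc => u; first exact: tR_comp.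
  exact: tRL.
by rewrite tL_comp.
Qed.

Definition dirac p : ptcurrent A p := mkE A p [::] [::].

Lemma chat_dirac p om : sm A om -> chat (dirac p) om = om p [::].
Proof. by move=> so; rewrite (chat_mkE GA p [::] [::] so) /E /= (lf_zp GA). Qed.

Lemma chat_mul1l p (T : ptcurrent A p) om : sm A om ->
  chat (mulpt (dirac e) T) om = chat T om.
Proof.
move=> so; rewrite chat_mulpt// chat_dirac; last exact: sm_mul_sl.
rewrite /sl; congr (chat T _); apply/funext => y; apply/funext => t.
rewrite /slice pull_mul mul1g /=; congr (om _ _); rewrite -[RHS]map_id.
by apply: eq_map => u; rewrite tL1.
Qed.

Lemma chat_mul1r p (T : ptcurrent A p) om : sm A om ->
  chat (mulpt T (dirac e)) om = chat T om.
Proof.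
move=> so; rewrite chat_mulpt//; congr (chat T _); apply/funext => y; apply/funext => t.
rewrite /sl chat_dirac; last exact: sm_slice_mul.
rewrite /slice pull_mul mulg1 /= cats0; congr (om _ _); rewrite -[RHS]map_id.
by apply: eq_map => u; rewrite tR1.
Qed.

Lemma bdpt_mulpt p q (T : ptcurrent A p) (S : ptcurrent A q) :
  bdpt (mulpt T S) = mulpt (bdpt T) S + mulpt (sigpt T) (bdpt S).
Proof.
apply: etrans (bdpt_push GG GA GGH GH (cross T S) smap_mulm) _.
rewrite (bdpt_cross GA GA GH GH); by rewrite (lin_D _ _ (push_lin GG GA GGH smap_mulm (p := (p, q)))).
Qed.

Lemma mulpt_order p q i j (s t : nat) (T : ptcurrent A p) (S : ptcurrent A q) :
  order_le A i s (ptval T) -> order_le A j t (ptval S) ->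
  order_le A (i + j) (s + t) (ptval (mulpt T S)).
Proof.
have mb := mulpt_bilin p q.
move=> HT HS; move: T HT; apply: (order_ind GA GH (P := fun T => order_le A (i + j) (s + t) (ptval
  (mulpt T S)))).
- by rewrite (lin_0 (mb.1 S)); exact: (order0 GA GH).
- by move=> c T T' HT HT'; rewrite mb.1; exact: (order_lin GA GH).
move=> a k ki ak; move: S HS; apply: (order_ind GA GH (P := fun S => order_le A (i + j) (s + t)
  (ptval (mulpt (mkE A p a k) S)))).
- by rewrite (lin_0 (mb.2 _)); exact: (order0 GA GH).
- by move=> c T T' HT HT'; rewrite mb.2; exact: (order_lin GA GH).
move=> b l lj bt; rewrite mulpt_mkE; apply: (push_order GG GA GGH smap_mulm GH (p := (p, q))).
apply: (order_mkE GG GGH); rewrite size_cat !size_map ?ki ?lj//.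
exact: leq_add.
Qed.

Lemma pull_one (X Y : topologicalType) m k (B : atlas R m X) (C : atlas R k Y) (f : X -> Y) :
  pull B C f (fun _ => @one R 'rV[R]_k) = (fun _ => @one R 'rV[R]_m).
Proof. by apply/funext => x; apply/funext => s; rewrite /pull /one size_map. Qed.

Lemma chat_zero p (T : ptcurrent A p) : chat T (fun _ _ => 0) = 0.
Proof.
have := chat_comb GA T (-1) (sm_zero A) (sm_zero A).
rewrite (_ : (fun p s => _) = (fun _ _ => 0)); first by move=> ->; rewrite mulN1r addNr.
by apply/funext => x; apply/funext => s; rewrite mulr0 addr0.
Qed.

Lemma chat_scale p (T : ptcurrent A p) c om : sm A om ->
  chat T (fun x s => c * om x s) = c * chat T om.
Proof.
move=> so; rewrite -[RHS]addr0 -(chat_zero T) -(chat_comb GA T c so (sm_zero A)).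
by congr (chat T _); apply/funext => x; apply/funext => s; rewrite addr0.
Qed.

(** The pullback of the unit form is the unit form, and on concatenated lists it factors, as a
    concatenation is empty exactly when both parts are. *)
Lemma epspt_mulpt p q (T : ptcurrent A p) (S : ptcurrent A q) :
  epspt (mulpt T S) = epspt T * epspt S.
Proof.
have s1 := sm_one A; rewrite /epspt chat_mulpt// pull_one mulrC -chat_scale//.
congr (chat T _); apply/funext => x; apply/funext => s; rewrite /sl.
rewrite mulrC -chat_scale//; congr (chat S _); apply/funext => y; apply/funext => t.
by rewrite /slice /one size_cat !size_map addn_eq0 mulrC -natrM mulnb andbC.
Qed.

Lemma epspt_dirac p : epspt (dirac p) = 1.
Proof. by rewrite /epspt chat_dirac//; exact: sm_one A. Qed.

Lemma splits_cat_sum (T : Type) (M : nmodType) (a b : seq T) (F : seq T -> seq T -> M) :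
  \sum_(q <- splits (a ++ b)) F q.1.2 q.2 =
  \sum_(q <- splits a) \sum_(r <- splits b) F (q.1.2 ++ r.1.2) (q.2 ++ r.2).
Proof.
elim: a F => [|u a IH] F /=; first by rewrite big_seq1.
rewrite !big_cat !big_map /= (IH (fun a b => F (u :: a) b)) (IH (fun a b => F a (u :: b))).
by [].
Qed.

End GroupCurrents.
Arguments GA {R n G}. Arguments GG {R n G}. Arguments GH {R n G}. Arguments GGH {R n G}.
Arguments smap_mulm {R n G}. Arguments smap_invm {R n G}.

Section GroupCurrents2.
Context (R : realType) (n : nat) (G : lieGroupType R n).
Local Notation A := (lie_atlas : atlas R n G).
Local Notation AA := (prod_atlas A A).
Local Notation e := (1%g : G).
Local Notation lmap s := (map (fun u : 'rV[R]_n => inl u : 'rV[R]_(n + n)) s).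
Local Notation rmap s := (map (fun u : 'rV[R]_n => inr u : 'rV[R]_(n + n)) s).
Local Notation mulm := (@mulm R n G).
Local Notation invm := (@invm R n G).
Implicit Types (p q x y z : G) (om et : lfm R n G) (s t : seq 'rV[R]_n).

Definition Dmul p q a s b t : tensor (ptcurrent A (p * q)%g) (ptcurrent A (p * q)%g) :=
  \sum_(t1 <- splits s) \sum_(q1 <- splits a) \sum_(t2 <- splits t) \sum_(q2 <- splits b)
    (-1) ^+ (t1.1.1 + t2.1.1 + size t1.2 * size t2.1.2) *:
    (mulpt (mkE A p q1.1.2 t1.1.2) (mkE A q q2.1.2 t2.1.2) ⊗
     mulpt (mkE A p q1.2 t1.2) (mkE A q q2.2 t2.2)).

(** Tested on pairs of forms: the group law pulls a wedge back to the wedge of the pullbacks, and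
    splitting the concatenated vectors by [wl_cat] produces the Koszul sign. *)
Lemma Dpt_mulpt p q a s b t : Dpt GA GH (mulpt (mkE A p a s) (mkE A q b t)) = Dmul p q a s b t.
Proof.
apply: (dual_wedge_uniq GA (Dpt_test GA GH _)) => om et so se.
have tb := test_bilin A (p * q)%g om et.
have tl := tlift_lin tb (@separated_reg R).
rewrite chat_mulpt_mkE; last exact: sm_wlf.
have -> : pull AA A mulm (wlf om et) = wlf (pull AA A mulm om) (pull AA A mulm et).
  by apply/funext => x; apply/funext => w; exact: pull_wlf.
have spo : sm AA (pull AA A mulm om) by exact: sm_pull_mulm.
have spe : sm AA (pull AA A mulm et) by exact: sm_pull_mulm.
rewrite (E_wlf GG)//.
pose F w a1 a2 (s1 s2 : seq 'rV[R]_(n + n)) : R := (-1) ^+ w *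
  (E AA (p, q) a1 s1 (pull AA A mulm om) * E AA (p, q) a2 s2 (pull AA A mulm et)).
rewrite exchange_big /=.
rewrite (splits_cat_sum _ _ (fun a1 a2 => \sum_(t0 <- splits (lmap s ++ rmap t)) F t0.1.1 a1 a2 t0.1.2 t0.2)).
transitivity (\sum_(t1 <- splits s) \sum_(q1 <- splits a) \sum_(t2 <- splits t) \sum_(q2 <- splits b)
   F (t1.1.1 + t2.1.1 + size t1.2 * size t2.1.2)%N (lmap q1.1.2 ++ rmap q2.1.2) (lmap q1.2 ++ rmap q2.2)
     (lmap t1.1.2 ++ rmap t2.1.2) (lmap t1.2 ++ rmap t2.2)).
  rewrite (lin_sum _ _ tl); apply: eq_bigr => t1 _; rewrite (lin_sum _ _ tl); apply: eq_bigr => q1 _.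
  rewrite (lin_sum _ _ tl); apply: eq_bigr => t2 _; rewrite (lin_sum _ _ tl); apply: eq_bigr => q2 _.
  by rewrite (lin_Z _ _ tl) (tlift_pure tb (@separated_reg R)) !chat_mulpt_mkE.
rewrite exchange_big /= !splits_map big_map; apply: eq_bigr => q1 _ /=.
under eq_bigr => t1 _ do rewrite exchange_big.
rewrite exchange_big /= big_map; apply: eq_bigr => q2 _ /=.
pose f (s1 : seq 'rV[R]_(n + n)) : R := E AA (p, q) (lmap q1.1.2 ++ rmap q2.1.2) s1 (pull AA A mulm om).
pose g (s2 : seq 'rV[R]_(n + n)) : R := E AA (p, q) (lmap q1.2 ++ rmap q2.2) s2 (pull AA A mulm et).
transitivity (wl f g (lmap s ++ rmap t)); last exact: wl_splits.
rewrite wl_cat !splits_map big_map; apply: eq_bigr => t1 _.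
by rewrite big_map; apply: eq_bigr => t2 _; rewrite /F /= !size_map.
Qed.

Definition Spt p (T : ptcurrent A p) : ptcurrent A (p^-1)%g := push A invm T.

Lemma Spt_lin p : linear (@Spt p).
Proof. exact: (push_lin GA GA GH smap_invm (p := p)). Qed.

Lemma chat_Spt p (T : ptcurrent A p) om : sm A om -> chat (Spt T) om = chat T (pull A A invm om).
Proof. exact: (chat_push GA GA GH smap_invm). Qed.

Lemma Spt_order p k r (T : ptcurrent A p) :
  order_le A k r (ptval T) -> order_le A k r (ptval (Spt T)).
Proof. exact: (push_order GA GA GH smap_invm GH). Qed.

Definition ldivm (xy : G * G) : G := (xy.1^-1 * xy.2)%g.
Definition rdivm (xy : G * G) : G := (xy.1 * xy.2^-1)%g.

Let tg_inv0 x : tg A A invm x 0 = 0.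
Proof. exact: lin_0 (tg_lin GA GA x smap_invm). Qed.

Let smap_iv_l : smap AA AA (fun z : G * G => (invm z.1, z.2)).
Proof.
apply: smap_pair; last exact: smap_snd A GA.
exact: (smap_comp GG GA (smap_fst A GA) smap_invm).
Qed.

Let smap_iv_r : smap AA AA (fun z : G * G => (z.1, invm z.2)).
Proof.
apply: smap_pair; first exact: smap_fst A GA.
exact: (smap_comp GG GA (smap_snd A GA) smap_invm).
Qed.

Let tg_iv_l (z : G * G) u : tg AA AA (fun z : G * G => (invm z.1, z.2)) z u =
  row_mx (tg A A invm z.1 (lsubmx u)) (rsubmx u).
Proof.
by rewrite tg_pair (tg_comp GG GA GA _ _ (smap_fst A GA) smap_invm) (tg_fst A GA) (tg_snd A GA).
Qed.

Let tg_iv_r (z : G * G) u : tg AA AA (fun z : G * G => (z.1, invm z.2)) z u =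
  row_mx (lsubmx u) (tg A A invm z.2 (rsubmx u)).
Proof.
by rewrite tg_pair (tg_comp GG GA GA _ _ (smap_snd A GA) smap_invm) (tg_fst A GA) (tg_snd A GA).
Qed.

Lemma smap_ldivm : smap AA A ldivm.
Proof. exact: (smap_comp GG GG smap_iv_l smap_mulm). Qed.

Lemma smap_rdivm : smap AA A rdivm.
Proof. exact: (smap_comp GG GG smap_iv_r smap_mulm). Qed.

Lemma pull_ldivm om x y s t : pull AA A ldivm om (x, y) (lmap s ++ rmap t) =
  pull AA A mulm om ((x^-1)%g, y) (lmap (map (tg A A invm x) s) ++ rmap t).
Proof.
rewrite -(pull_comp GG GG GA om smap_iv_l smap_mulm) {1}/pull; apply: (f_equal (pull AA A mulm om _)).
rewrite map_cat -!map_comp; apply: (f_equal2 cat); apply: eq_map => u.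
  by rewrite /= tg_iv_l row_mxKl row_mxKr.
by rewrite /= tg_iv_l row_mxKl row_mxKr tg_inv0.
Qed.

Lemma pull_rdivm om x y s t : pull AA A rdivm om (x, y) (lmap s ++ rmap t) =
  pull AA A mulm om (x, (y^-1)%g) (lmap s ++ rmap (map (tg A A invm y) t)).
Proof.
rewrite -(pull_comp GG GG GA om smap_iv_r smap_mulm) {1}/pull; apply: (f_equal (pull AA A mulm om _)).
rewrite map_cat -!map_comp; apply: (f_equal2 cat); apply: eq_map => u.
  by rewrite /= tg_iv_r row_mxKl row_mxKr tg_inv0.
by rewrite /= tg_iv_r row_mxKl row_mxKr.
Qed.

(** Pushing the coproduct forward along [f] is pushing forward along the constant map [f (x, x)],
    and pullback under a constant map keeps only the degree 0 value at [e]. With [ldivm] and [rdivm]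
    for [f] this yields the two antipode identities. *)
Lemma E_const p a s om (f : G * G -> G) : smap AA A f -> (forall x, f (x, x) = e) -> sm A om ->
  \sum_(t <- splits s) \sum_(q <- splits a) (-1) ^+ t.1.1 *
    E AA (p, p) (lmap q.1.2 ++ rmap q.2) (lmap t.1.2 ++ rmap t.2) (pull AA A f om) =
  om e [::] * E A p a s (fun _ => @one R 'rV[R]_n).
Proof.
move=> sf fe so; rewrite -(E_diag GA); last exact: (sm_pull GG GA sf).
have sd : smap A AA (fun x => (x, x)) by exact: (smap_diag GA).
rewrite (pull_comp GA GG GA om sd sf).
have -> : (fun x => f (x, x)) = fun=> e by apply/funext.
have -> : pull A A (fun=> e) om = fun x s => om e [::] * @one R 'rV[R]_n s + 0.
  apply/funext => x; apply/funext => w; rewrite /pull addr0 /one.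
  case: w => [|u w] /=; first by rewrite mulr1.
  rewrite (tg_cst) mulr0; exact: (alt0 [::] _ (so.1 e)).
by rewrite (E_comb GA _ _ _ _ (sm_one A) (sm_zero A)) /E dd_zero addr0.
Qed.

Lemma antipodel_mkE p a s om : sm A om ->
  \sum_(t <- splits s) \sum_(q <- splits a) (-1) ^+ t.1.1 *
    chat (mulpt (Spt (mkE A p q.1.2 t.1.2)) (mkE A p q.2 t.2)) om =
  om e [::] * E A p a s (fun _ => @one R 'rV[R]_n).
Proof.
move=> so; rewrite -(E_const p a s smap_ldivm (fun x => mulVg x) so).
apply: eq_bigr => t _; apply: eq_bigr => q _; congr (_ * _).
rewrite chat_mulpt// chat_Spt; last exact: sm_mul_sl.
rewrite (_ : pull A A invm _ = sl (E A p q.2 t.2) (pull AA A ldivm om)).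
  rewrite (chat_mkE GA) ?(E_slE GA GA)//.
    exact: (sm_pull GG GA smap_ldivm).
  apply: (sm_slE GA GA); exact: (sm_pull GG GA smap_ldivm).
apply/funext => x; apply/funext => w; rewrite /pull /sl (chat_mkE GA); last exact: sm_slice_mul.
congr (E _ _ _ _ _); apply/funext => y; apply/funext => r.
exact: (esym (pull_ldivm om x y w r)).
Qed.

Lemma antipoder_mkE p a s om : sm A om ->
  \sum_(t <- splits s) \sum_(q <- splits a) (-1) ^+ t.1.1 *
    chat (mulpt (mkE A p q.1.2 t.1.2) (Spt (mkE A p q.2 t.2))) om =
  om e [::] * E A p a s (fun _ => @one R 'rV[R]_n).
Proof.
move=> so; rewrite -(E_const p a s smap_rdivm (fun x => mulgV x) so).
apply: eq_bigr => t _; apply: eq_bigr => q _; congr (_ * _).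
have sr : sm AA (pull AA A rdivm om).
  exact: (sm_pull GG GA smap_rdivm).
rewrite chat_mulpt// (_ : sl _ _ = sl (E A p q.2 t.2) (pull AA A rdivm om)).
  by rewrite (chat_mkE GA) ?(E_slE GA GA)//; exact: (sm_slE GA GA).
apply/funext => x; apply/funext => w; rewrite /sl.
rewrite chat_Spt; last exact: sm_slice_mul.
rewrite (chat_mkE GA); last first.
  exact: (sm_pull GA GA smap_invm (sm_slice_mul _ _ so)).
congr (E _ _ _ _ _); apply/funext => y; apply/funext => r.
exact: (esym (pull_rdivm om x y w r)).
Qed.

End GroupCurrents2.

Section FiberIdentities.
Context (R : realType) (n : nat) (X : topologicalType) (A : atlas R n X).
Hypothesis HA : is_atlas A.
Hypothesis HX : hausdorff_space X.
Variable p : X.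
Local Notation U := (ptcurrent A p).
Local Notation Dp := (Dpt HA HX (p := p)).

(** The transpose of the Leibniz rule [dform_wlf]. *)
Lemma Dpt_bdpt (T : U) : Dp (bdpt T) = tlift (fun a b => bdpt a ⊗ b + sigpt a ⊗ bdpt b) (Dp T).
Proof.
apply: (dual_wedge_uniq HA (Dpt_test HA HX _)) => om et so se.
have tl := tlift_lin (test_bilin A p om et) (@separated_reg R).
rewrite (tlift_map _ _ tl).
rewrite (tlift_ext (b' := fun a b => chat a (dform A om) * chat b et + chat a (sgf om) * chat b
  (dform A et) : R^o)); last first.
  move=> x y; rewrite (lin_D _ _ tl) !(tlift_pure (test_bilin A p om et) (@separated_reg R)).
  by rewrite !chat_bdpt// chat_sigpt.
have -> : tlift (fun a b : U => chat a (dform A om) * chat b et + chat a (sgf om) * chat b (dform A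
  et) : R^o) (Dp T)
   = tlift (fun a b : U => chat a (dform A om) * chat b et : R^o) (Dp T) +
     tlift (fun a b : U => chat a (sgf om) * chat b (dform A et) : R^o) (Dp T).
  by rewrite /tlift big_split.
have sd := sm_dform HA so; have sd' := sm_dform HA se; have sg' := sm_sgf so.
rewrite !Dpt_test// chat_bdpt//; last exact: sm_wlf.
rewrite -[chat T (wlf (dform A om) et)]mul1r -chat_comb//; [|exact: sm_wlf|exact: sm_wlf].
congr (chat T _); apply/funext => x; apply/funext => s.
by rewrite mul1r dform_wlf.
Qed.

(** The transpose of [wl_assoc], tested on triples of forms, which separate the iterated tensor
    product by two uses of [tensor_sep]. *)
Lemma coassoc_pt (T : U) :
  tlift (fun x1 x2 => tlift (fun a b => a ⊗ (b ⊗ x2)) (Dp x1)) (Dp T) =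
  tlift (fun x1 x2 => tlift (fun a b => x1 ⊗ (a ⊗ b)) (Dp x2)) (Dp T) :> tensor U (tensor U U).
Proof.
have cs := chat_sep HA p; have cs2 := tensor_sep cs cs.
apply: (sepfam_eq (tensor_sep cs cs2)) => -[ [w1 s1] [ [w2 s2] [w3 s3] ] ] /=.
have b23 := test_bilin A p w2 w3.
have bb : bilin (fun (x : U) (y : tensor U U) => chat x w1 *
   tlift (fun a b : U => chat a w2 * chat b w3 : R^o) y : R^o).
  exact: (sep_bilin (exist _ w1 s1 : smform A) ((exist _ w2 s2, exist _ w3 s3) : smform A * smform A) cs cs2).
have tl := tlift_lin bb (@separated_reg R).
have tl2 := tlift_lin b23 (@separated_reg R).
have s12 := sm_wlf s1 s2; have s23 := sm_wlf s2 s3.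
transitivity (tlift (fun a b : U => chat a (wlf w1 w2) * chat b w3 : R^o) (Dp T)).
  rewrite (tlift_map _ _ tl); apply: tlift_ext => x1 x2.
  rewrite (tlift_map _ _ tl) -(Dpt_test HA HX x1 s1 s2).
  have lm : linear (fun r : R^o => r * chat x2 w3 : R^o) by move=> c u v; rewrite mulrDl scalerAl.
  rewrite (tlift_map _ _ lm); apply: tlift_ext => a b.
  rewrite (tlift_pure bb (@separated_reg R)) (tlift_pure b23 (@separated_reg R)).
  by rewrite mulrA.
rewrite Dpt_test//.
have -> : wlf (wlf w1 w2) w3 = wlf w1 (wlf w2 w3).
  by apply/funext => x; apply/funext => s; exact: wl_assoc.
rewrite -(Dpt_test HA HX)// (tlift_map _ _ tl); apply: tlift_ext => x1 x2.
rewrite (tlift_map _ _ tl) -(Dpt_test HA HX x2 s2 s3).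
have lm : linear (fun r : R^o => chat x1 w1 * r : R^o) by move=> c u v; rewrite mulrDr scalerAr.
rewrite (tlift_map _ _ lm); apply: tlift_ext => a b.
by rewrite (tlift_pure bb (@separated_reg R)) (tlift_pure b23 (@separated_reg R)).
Qed.

End FiberIdentities.

(** * Currents of finite support *)

Section GlobalCurrents.
Context (R : realType) (n : nat) (G : lieGroupType R n).
Local Notation A := (lie_atlas : atlas R n G).
Local Notation AA := (prod_atlas A A).
Local Notation e := (1%g : G).
Local Notation U := (current_bundle G).
Local Notation C := (CG G).
Implicit Types (p q : G) (om et : lfm R n G).

Definition dg p (T : ptcurrent A p) : C := @gdelta R G U p T.
Definition gen p a s : C := dg (mkE A p a s).

Lemma dg_lin p : linear (@dg p).
Proof. exact: (@gdelta_lin R G U p). Qed.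

Definition probe (i : G * smform A) (x : C) : R^o := chat (x i.1 : ptcurrent A i.1) (sval i.2).

Lemma probe_sep : sepfam probe.
Proof.
split=> [[p om] c x y|x H]; first exact: chat_lin.
apply: gfin_eq => p; apply: (chat_sep GA p).2 => om.
exact: (H (p, om)).
Qed.

Lemma sep_C : separated C. Proof. exact: sepfam_separated probe_sep. Qed.

(** Fibres over points that are equal but not convertible, such as [p * e] and [p], cannot be
    compared directly; after [dg] the comparison takes place in one space. *)
Lemma dg_eq p q (T : ptcurrent A p) (S : ptcurrent A q) : p = q ->
  (forall om, sm A om -> chat T om = chat S om) -> dg T = dg S.
Proof. by move=> pq; subst q => H; congr dg; exact: (chat_inj GA). Qed.

Lemma C_ind (P : C -> Prop) : P 0 -> (forall c x y, P x -> P y -> P (c *: x + y)) ->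
  (forall p (T : ptcurrent A p), P (dg T)) -> forall x, P x.
Proof.
move=> P0 PD Pd; apply: gfin_ind => // x y Px Py.
by rewrite -[x]scale1r; exact: PD.
Qed.

Lemma C_gen (P : C -> Prop) : P 0 -> (forall c x y, P x -> P y -> P (c *: x + y)) ->
  (forall p a s, P (gen p a s)) -> forall x, P x.
Proof.
move=> P0 PD Pg; apply: C_ind => // p; apply: (pt_ind GA GH) => [|c T S HT HS|a s].
- by rewrite (lin_0 (@dg_lin p)).
- by rewrite dg_lin; exact: PD.
- exact: Pg.
Qed.

Lemma lin_C (Z : lmodType R) (f g : C -> Z) : linear f -> linear g ->
  (forall p (T : ptcurrent A p), f (dg T) = g (dg T)) -> forall x, f x = g x.
Proof.
move=> lf lg H; apply: C_ind => [|c x y fx fy|//]; first by rewrite !lin_0.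
by rewrite lf lg fx fy.
Qed.

Lemma lin_gen (Z : lmodType R) (f g : C -> Z) : linear f -> linear g ->
  (forall p a s, f (gen p a s) = g (gen p a s)) -> forall x, f x = g x.
Proof.
move=> lf lg H; apply: C_gen => [|c x y fx fy|//]; first by rewrite !lin_0.
by rewrite lf lg fx fy.
Qed.

Definition mphi (pq : G * G) : box_bundle U U pq -> U (pq.1 * pq.2)%g :=
  tlift (fun (T : ptcurrent A pq.1) (S : ptcurrent A pq.2) => mulpt T S).

Lemma mphi_lin pq : linear (@mphi pq).
Proof. have H := @tlift_lin R _ _ (U (pq.1 * pq.2)%g) _ (mulpt_bilin pq.1 pq.2) (sep_pt GA (p :=
  _)). exact: H. Qed.

Definition cmul (x y : C) : C := gamma mphi (gbox x y).

Lemma cmul_bilin : bilin cmul.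
Proof.
have gl := gamma_lin mphi_lin; have gb := @gbox_bilin R G G U U.
by split=> [y c x x'|x c y y']; rewrite /cmul (gb.1, gb.2) gl.
Qed.

Lemma cmul_dg p q (T : ptcurrent A p) (S : ptcurrent A q) :
  cmul (dg T) (dg S) = dg (mulpt T S).
Proof.
rewrite /cmul /dg gbox_delta (gamma_delta mphi_lin).
have H := @tlift_pure R _ _ (U (p * q)%g) _ (mulpt_bilin p q) (sep_pt GA (p := _)) T S.
by rewrite -[in RHS]H.
Qed.

Definition endo (phi : forall p, ptcurrent A p -> ptcurrent A p) (x : C) : C :=
  gamma (E := U) (F := U) (f := id) phi x.

Section Endo.
Context (phi : forall p, ptcurrent A p -> ptcurrent A p).
Hypothesis lphi : forall p, linear (@phi p).

Lemma endo_lin : linear (endo phi).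
Proof. exact: (gamma_lin (E := U) (F := U) (f := id) lphi). Qed.

Lemma endo_dg p (T : ptcurrent A p) : endo phi (dg T) = dg (phi T).
Proof. exact: (gamma_delta (E := U) (F := U) (f := id) lphi). Qed.

Lemma endo_at p (x : C) : endo phi x p = phi (x p).
Proof.
move: x; apply: C_ind => [|c x y Hx Hy|q T].
- by rewrite (lin_0 endo_lin) (lin_0 (@lphi p)).
- rewrite endo_lin -[LHS]/(c *: endo phi x p + endo phi y p) Hx Hy.
  by rewrite -[(c *: x + y) p]/(c *: x p + y p) lphi.
rewrite endo_dg /dg; have [e|ne] := eqVneq q p.
  by subst q; rewrite !gdelta_in.
by rewrite !gdelta_out// (lin_0 (@lphi p)).
Qed.

End Endo.

Definition cbd := endo (@bdpt R n G A).
Definition csig := endo (@sigpt R n G A).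
Definition cdeg k := endo (@degpt R n G A k).

Lemma lbd p : linear (@bdpt R n G A p). Proof. exact: bdpt_lin GA GH p. Qed.
Lemma lsig p : linear (@sigpt R n G A p). Proof. exact: sigpt_lin GA GH p. Qed.
Lemma ldeg k p : linear (@degpt R n G A k p). Proof. exact: degpt_lin GA GH k p. Qed.

Definition cS (x : C) : C := gamma (E := U) (F := U) (f := fun g : G => (g^-1)%g) (@Spt R n G) x.

Lemma cS_lin : linear cS.
Proof. exact: (gamma_lin (E := U) (F := U) (f := fun g : G => (g^-1)%g) (@Spt_lin R n G)). Qed.

Lemma cS_dg p (T : ptcurrent A p) : cS (dg T) = dg (Spt T).
Proof. exact: (gamma_delta (E := U) (F := U) (f := fun g : G => (g^-1)%g) (@Spt_lin R n G)). Qed.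

Definition dphi p : U p -> diag_bundle U p := @Dpt R n G A GA GH p.
Definition cDelta (x : C) : tensor C C := gdiag (gamma (f := id) dphi x).

Lemma dphi_lin p : linear (@dphi p). Proof. exact: Dpt_lin. Qed.

Lemma dg2_bilin p : bilin (fun a b : U p => dg a ⊗ dg b : tensor C C).
Proof.
split=> [y c x x'|x c y y']; rewrite dg_lin.
  by rewrite (pure_bilin C C).1.
by rewrite (pure_bilin C C).2.
Qed.

Lemma dg2_lin p : linear (tlift (fun a b : U p => dg a ⊗ dg b : tensor C C)).
Proof. by apply: tlift_lin; [exact: dg2_bilin|exact: separated_tensor]. Qed.

Lemma cDelta_lin : linear cDelta.
Proof.
apply: (lin_comp (gamma_lin (f := id) dphi_lin)).
exact: (glift_lin dg2_lin).
Qed.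

Lemma cDelta_dg p (T : ptcurrent A p) :
  cDelta (dg T) = tlift (fun a b : U p => dg a ⊗ dg b) (Dpt GA GH T).
Proof.
rewrite /cDelta /dg (gamma_delta (f := id) dphi_lin).
exact: (glift_delta dg2_lin).
Qed.

(** Moves a computation on the global coproduct into a fibre, where the identities are known. *)
Lemma tlift_cDelta (Z : lmodType R) (f : C -> C -> Z) p (T : ptcurrent A p) :
  bilin f -> separated Z ->
  tlift f (cDelta (dg T)) = tlift (fun a b : U p => f (dg a) (dg b)) (Dpt GA GH T).
Proof.
move=> bf sZ; have [s sE] := tensor_sum (Dpt GA GH T).
have bfd : bilin (fun a b : U p => f (dg a) (dg b)).
  by split=> [y c x x'|x c y y']; rewrite dg_lin (bf.1, bf.2).
rewrite cDelta_dg (tliftE (dg2_bilin p) (@separated_tensor _ _ _) sE) (tliftE bfd sZ sE).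
rewrite (lin_sum _ _ (tlift_lin bf sZ)); apply: eq_bigr => u _.
exact: (tlift_pure bf sZ).
Qed.

Lemma tlift_cDelta_gen (Z : lmodType R) (f : C -> C -> Z) p a s :
  bilin f -> separated Z -> tlift f (cDelta (gen p a s)) =
  \sum_(t <- splits s) \sum_(q <- splits a)
    (-1) ^+ t.1.1 *: f (gen p q.1.2 t.1.2) (gen p q.2 t.2).
Proof.
move=> bf sZ; rewrite tlift_cDelta// Dpt_mkE /Dmk.
have bfd : bilin (fun a b : U p => f (dg a) (dg b)).
  by split=> [y c x x'|x c y y']; rewrite dg_lin (bf.1, bf.2).
have tl := tlift_lin bfd sZ.
rewrite (lin_sum _ _ tl); apply: eq_bigr => t _; rewrite (lin_sum _ _ tl); apply: eq_bigr => q _.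
by rewrite (lin_Z _ _ tl) (tlift_pure bfd sZ).
Qed.

Definition ephi p : U p -> triv_bundle R G p := @epspt R n G A p.
Definition ceps (x : C) : R^o := gsum (gamma (f := id) ephi x).

Lemma ephi_lin p : linear (@ephi p). Proof. exact: epspt_lin. Qed.

Lemma ceps_lin : linear ceps.
Proof.
apply: (lin_comp (gamma_lin (f := id) ephi_lin)).
by apply: (@glift_lin R G (fun _ => R^o) R^o (fun _ x => x)).
Qed.

Lemma ceps_dg p (T : ptcurrent A p) : ceps (dg T) = epspt T.
Proof.
rewrite /ceps /dg (gamma_delta (f := id) ephi_lin).
by apply: (@glift_delta R G (fun _ => R^o) R^o (fun _ x => x)).
Qed.

Definition cone : C := dg (dirac e).

End GlobalCurrents.

Lemma half_lin (R : realType) (V : lmodType R) (u v c : R) (x y x' y' : V) :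
  u *: ((c *: x + y) + v *: (c *: x' + y')) = c *: (u *: (x + v *: x')) + u *: (y + v *: y').
Proof.
rewrite !scalerDr !scalerA addrACA; congr (_ *: _ + _ *: _ + _); first exact: mulrC.
by rewrite mulrC mulrA.
Qed.

Lemma half_twice (R : realType) (V : lmodType R) (x : V) : 2^-1 *: (x + x) = x.
Proof.
rewrite -{1 2}[x]scale1r -scalerDl scalerA.
by rewrite (_ : 2^-1 * (1 + 1) = 1 :> R) ?scale1r//; apply: mulVf; rewrite pnatr_eq0.
Qed.

(** * The Hopf algebra axioms *)

Section HopfAxioms.
Context (R : realType) (n : nat) (G : lieGroupType R n).
Local Notation A := (lie_atlas : atlas R n G).
Local Notation AA := (prod_atlas A A).
Local Notation e := (1%g : G).
Local Notation U := (current_bundle G).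
Local Notation C := (CG G).
Local Notation cone := (@cone R n G).
Local Notation cmul := (@cmul R n G).
Local Notation cDelta := (@cDelta R n G).
Local Notation ceps := (@ceps R n G).
Local Notation cbd := (@cbd R n G).
Local Notation csig := (@csig R n G).
Local Notation cS := (@cS R n G).
Local Notation gen := (@gen R n G).
Implicit Types (p q : G) (om et : lfm R n G) (x y z : C).

Let sC := @sep_C R n G.
Let sCC := @separated_tensor R C C.
Let pb := @pure_bilin R C C.

Lemma csig_lin : linear csig. Proof. exact: endo_lin (@lsig R n G). Qed.
Lemma cbd_lin : linear cbd. Proof. exact: endo_lin (@lbd R n G). Qed.
Lemma cdeg_lin k : linear (@cdeg R n G k). Proof. exact: endo_lin (@ldeg R n G k). Qed.
Lemma csig_dg p (T : ptcurrent A p) : csig (dg T) = dg (sigpt T).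
Proof. exact: endo_dg (@lsig R n G) _ _. Qed.
Lemma cbd_dg p (T : ptcurrent A p) : cbd (dg T) = dg (bdpt T).
Proof. exact: endo_dg (@lbd R n G) _ _. Qed.

Lemma cmulA : associative cmul.
Proof.
have cb := @cmul_bilin R n G.
move=> x y z; move: x; apply: lin_C => [c x x'|c x x'|p T].
- by rewrite cb.1.
- by rewrite !cb.1.
move: y; apply: lin_C => [c y y'|c y y'|q S].
- by rewrite cb.1 cb.2.
- by rewrite cb.2 cb.1.
move: z; apply: lin_C => [c z z'|c z z'|r V].
- by rewrite !cb.2.
- by rewrite cb.2.
rewrite !cmul_dg; apply: dg_eq => [|om so]; first by rewrite mulgA.
by rewrite chat_mulptA.
Qed.

Lemma cmul1l : left_id cone cmul.
Proof.
have cb := @cmul_bilin R n G.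
move=> x; move: x; apply: lin_C => [c x x'|//|p T]; first by rewrite cb.2.
rewrite cmul_dg; apply: dg_eq => [|om so]; first by rewrite mul1g.
by rewrite chat_mul1l.
Qed.

Lemma cmul1r : right_id cone cmul.
Proof.
have cb := @cmul_bilin R n G.
move=> x; move: x; apply: lin_C => [c x x'|//|p T]; first by rewrite cb.1.
rewrite cmul_dg; apply: dg_eq => [|om so]; first by rewrite mulg1.
by rewrite chat_mul1r.
Qed.

Lemma filt_ind k r (P : C -> Prop) : P 0 ->
  (forall c x y, P x -> P y -> P (c *: x + y)) ->
  (forall p a s, size s = k -> (size a <= r)%N -> P (gen p a s)) ->
  forall x, CG_filt k r x -> P x.
Proof.
move=> P0 PD Pg x Fx; have [l ->] := gfin_sum x.
apply: big_ind => // [y z Py Pz|p _]; first by rewrite -[y]scale1r; exact: PD.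
move: (Fx p); move: (x p) => T; apply: (order_ind GA GH (P := fun T => P (dg T))).
- by rewrite (lin_0 (@dg_lin R n G p)).
- by move=> c T1 T2 H1 H2; rewrite dg_lin; exact: PD.
- by move=> a s sk ar; exact: Pg.
Qed.

Lemma filt_dg k r p (T : ptcurrent A p) : order_le A k r (ptval T) -> CG_filt k r (dg T).
Proof.
move=> oT q; rewrite /dg; have [e1|ne] := eqVneq p q.
  by subst q; rewrite gdelta_in.
by rewrite gdelta_out//; exact: (order0 GA GH).
Qed.

Lemma filt_gen k r p a s : size s = k -> (size a <= r)%N -> CG_filt k r (gen p a s).
Proof. by move=> sk ar; apply: filt_dg; exact: (order_mkE GA GH). Qed.

Lemma filt_lin k r c x y : CG_filt k r x -> CG_filt k r y -> CG_filt k r (c *: x + y).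
Proof. by move=> Fx Fy p; exact: (order_lin GA GH c (Fx p) (Fy p)). Qed.

Lemma filt0 k r : CG_filt k r (0 : C).
Proof. by move=> p; exact: (order0 GA GH). Qed.

Lemma filt_mono k r r' x : (r <= r')%N -> CG_filt k r x -> CG_filt k r' x.
Proof. by move=> rr Fx p; exact: (order_mono GA GH rr (Fx p)). Qed.

Lemma cdeg_filt k j r x : CG_filt j r x -> cdeg k x = if j == k then x else 0.
Proof.
move=> Fx; apply: gfin_eq => p; rewrite [LHS](endo_at (@ldeg R n G k)).
rewrite (degpt_order GA GH k (Fx p)).
by case: ifP.
Qed.

Lemma CG_graded : filtered_graded (@CG_filt R n G).
Proof.
split.
- by move=> k r; split; [exact: filt0|move=> a x y; exact: filt_lin].
- by move=> k r s rs x; exact: filt_mono.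
- have H x : exists N r, forall M, (N <= M)%N ->
      x = \sum_(k < M) cdeg k x /\ forall k, CG_filt k r (cdeg k x).
    move: x; apply: C_ind => [|c x y [N [r Hx]] [N' [r' Hy]]|p T].
    + exists 0%N, 0%N => M _; split.
        by rewrite big1// => k _; exact: lin_0 (cdeg_lin k).
      by move=> k; rewrite (lin_0 (cdeg_lin k)); exact: filt0.
    + exists (maxn N N'), (maxn r r') => M; rewrite geq_max => /andP[/Hx[x1 x2] /Hy[y1 y2]]; split.
        rewrite {1}x1 {1}y1 scaler_sumr -big_split; apply: eq_bigr => k _.
        by rewrite [RHS]cdeg_lin.
      move=> k; rewrite cdeg_lin; apply: filt_lin.
        by apply: filt_mono (x2 k); exact: leq_maxl.
      by apply: filt_mono (y2 k); exact: leq_maxr.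
    + have [N [r HT]] := degpt_sum GA GH T; exists N, r => M /HT[T1 T2]; split.
        rewrite {1}T1 (lin_sum _ _ (@dg_lin R n G p)); apply: eq_bigr => k _.
        by rewrite [RHS](endo_dg (@ldeg R n G k)).
      by move=> k; rewrite /cdeg (endo_dg (@ldeg R n G k)); exact: filt_dg.
  move=> x; have [N [r /(_ N (leqnn N))[x1 x2]]] := H x.
  by exists N, (fun k => cdeg k x); split=> // k; exists r.
- move=> N c cd c0 j jN; have lj := @cdeg_lin j.
  have := congr1 (cdeg j) c0; rewrite [RHS](lin_0 lj) [LHS](lin_sum _ _ lj).
  rewrite (bigD1 (Ordinal jN))//= big1 => [|k kj].
    have [r Fr] := cd j; rewrite addr0 => H; have := cdeg_filt j Fr.
  by rewrite eqxx => <-; exact: H.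
  have [r Fr] := cd k; rewrite [LHS](cdeg_filt j Fr).
  by case: eqP => // e1; case/eqP: kj; apply/val_inj.
Qed.

Lemma csig_filt k r x : CG_filt k r x -> csig x = (-1) ^+ k *: x.
Proof.
have ls := csig_lin.
move: x; apply: filt_ind => [|c x y Hx Hy|p a s sk _].
- by rewrite scaler0; exact: lin_0 ls.
- by rewrite ls Hx Hy scalerDr !scalerA mulrC.
- by rewrite csig_dg (sigpt_mkE GA GH) (lin_Z _ _ (@dg_lin R n G p)) sk.
Qed.

Lemma cDelta_one : cDelta cone = cone ⊗ cone.
Proof.
have := tlift_cDelta_gen e [::] [::] pb sCC; rewrite tlift_id => ->.
by rewrite /= !big_seq1 scale1r.
Qed.

Lemma cDelta_coassoc x :
  tlift (fun x1 x2 => tlift (fun a b => a ⊗ (b ⊗ x2)) (cDelta x1)) (cDelta x)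
  = tlift (fun x1 x2 => tlift (fun a b => x1 ⊗ (a ⊗ b)) (cDelta x2)) (cDelta x)
  :> tensor C (tensor C C).
Proof.
have pb3 := @pure_bilin R C (tensor C C).
have s3 := @separated_tensor R C (tensor C C).
have bl x2 : bilin (fun a b : C => a ⊗ (b ⊗ x2) : tensor C (tensor C C)).
  by split=> [z c u v|z c u v]; rewrite ?pb.1 (pb3.1, pb3.2).
have br x1 : bilin (fun a b : C => x1 ⊗ (a ⊗ b) : tensor C (tensor C C)).
  by split=> [z c u v|z c u v]; rewrite (pb.1, pb.2) pb3.2.
have bL : bilin (fun x1 x2 => tlift (fun a b => a ⊗ (b ⊗ x2)) (cDelta x1) : tensor C (tensor C C)).
  split=> [z c u v|z c u v].
    by rewrite cDelta_lin (tlift_lin (bl z) s3).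
  rewrite /tlift scaler_sumr -big_split; apply: eq_bigr => w _ /=.
  by rewrite pb.2 pb3.2.
have bR : bilin (fun x1 x2 => tlift (fun a b => x1 ⊗ (a ⊗ b)) (cDelta x2) : tensor C (tensor C C)).
  split=> [z c u v|z c u v].
    by rewrite /tlift scaler_sumr -big_split; apply: eq_bigr => w _ /=; rewrite pb3.1.
  by rewrite cDelta_lin (tlift_lin (br z) s3).
move: x; apply: lin_C.
- exact: (lin_comp (@cDelta_lin R n G) (tlift_lin bL s3)).
- exact: (lin_comp (@cDelta_lin R n G) (tlift_lin bR s3)).
move=> p T; rewrite !tlift_cDelta//.
have g2 := dg2_bilin p.
pose h (a : U p) (w : tensor (U p) (U p)) : tensor C (tensor C C) :=
  dg a ⊗ tlift (fun b c : U p => dg b ⊗ dg c) w.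
have hb : bilin h.
  split=> [w c u v|w c u v]; rewrite /h.
    by rewrite dg_lin pb3.1.
  by rewrite (dg2_lin (p := p)) pb3.2.
have lh := tlift_lin hb s3.
have hE a b c : tlift h (a ⊗ (b ⊗ c)) = dg a ⊗ (dg b ⊗ dg c).
  by rewrite (tlift_pure hb s3) /h (tlift_pure g2 sCC).
have := congr1 (tlift h) (coassoc_pt GA GH T); rewrite !(tlift_map _ _ lh) => H.
apply: etrans (etrans H _).
  apply: tlift_ext => x1 x2; rewrite (tlift_map _ _ lh) tlift_cDelta//.
  by apply: tlift_ext => a b; rewrite hE.
apply: tlift_ext => x1 x2; rewrite (tlift_map _ _ lh) tlift_cDelta//.
by apply: tlift_ext => a b; rewrite hE.
Qed.

Let scale_bl : bilin (fun x1 x2 : C => ceps x1 *: x2).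
Proof.
split=> [y c x x'|x c y y'].
  by rewrite ceps_lin scalerDl scalerA.
by rewrite scalerDr !scalerA mulrC.
Qed.

Let scale_br : bilin (fun x1 x2 : C => ceps x2 *: x1).
Proof. by case: scale_bl => H1 H2; split=> [y|x]; [exact: H2|exact: H1]. Qed.

Lemma ccounitl x : tlift (fun x1 x2 => ceps x1 *: x2) (cDelta x) = x.
Proof.
move: x; apply: lin_C => [|//|p T].
  exact: (lin_comp (@cDelta_lin R n G) (tlift_lin scale_bl sC)).
rewrite (tlift_cDelta _ scale_bl sC) -[in RHS](counitl_pt GA GH T).
rewrite (tlift_map _ _ (@dg_lin R n G p)); apply: tlift_ext => a b.
by rewrite ceps_dg (lin_Z _ _ (@dg_lin R n G p)).
Qed.

Lemma ccounitr x : tlift (fun x1 x2 => ceps x2 *: x1) (cDelta x) = x.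
Proof.
move: x; apply: lin_C => [|//|p T].
  exact: (lin_comp (@cDelta_lin R n G) (tlift_lin scale_br sC)).
rewrite (tlift_cDelta _ scale_br sC) -[in RHS](counitr_pt GA GH T).
rewrite (tlift_map _ _ (@dg_lin R n G p)); apply: tlift_ext => a b.
by rewrite ceps_dg (lin_Z _ _ (@dg_lin R n G p)).
Qed.

Lemma ceps_one : ceps cone = 1.
Proof. by rewrite ceps_dg epspt_dirac. Qed.

Lemma ceps_mul x y : ceps (cmul x y) = ceps x * ceps y.
Proof.
have cb := @cmul_bilin R n G; have le := @ceps_lin R n G.
move: x; apply: lin_C => [c x x'|c x x'|p T].
- by rewrite cb.1 le.
- by rewrite le mulrDl scalerAl.
move: y; apply: lin_C => [c y y'|c y y'|q S].
- by rewrite cb.2 le.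
- by rewrite le mulrDr scalerAr.
by rewrite cmul_dg !ceps_dg epspt_mulpt.
Qed.

(** The projection to the even part for [b] false, to the odd part for [b] true. *)
Definition par (b : bool) x : C := 2^-1 *: (x + (-1) ^+ b *: csig x).

Lemma par_lin b : linear (par b).
Proof.
by move=> c x y; rewrite /par csig_lin; exact: half_lin.
Qed.

Lemma par_filt b k r x : CG_filt k r x -> par b x = if odd k == b then x else 0.
Proof.
move=> /csig_filt; rewrite /par => ->; rewrite scalerA -(signr_odd _ k).
have two := half_twice x.
case: b; case: (odd k) => /=; rewrite ?expr0 ?expr1 ?mulrNN ?mulr1 ?mul1r ?scale1r ?scaleN1r ?subrr
  ?scaler0//.
Qed.

(** The product of [a ⊗ b] and [a' ⊗ b'] with its Koszul sign, written multilinearly: an even [a']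
    gives no sign, and for an odd [a'] the sign is the degree involution applied to [b]. As no
    degrees occur, it can be evaluated on any decomposition of the two coproducts. *)
Definition sgn_mul (a b a' b' : C) : tensor C C :=
  cmul a (par false a') ⊗ cmul b b' + cmul a (par true a') ⊗ cmul (csig b) b'.

Lemma sgn_mul_filt a b a' b' k r l s : CG_filt k r b -> CG_filt l s a' ->
  sgn_mul a b a' b' = (-1) ^+ (k * l) *: (cmul a a' ⊗ cmul b b').
Proof.
have cb := @cmul_bilin R n G.
move=> Fb Fa; rewrite /sgn_mul !(par_filt _ Fa) (csig_filt Fb) (lin_Z _ _ (cb.1 _)) (lin_Z _ _ (pb.2 _)).
rewrite -(signr_odd _ (k * l)) oddM -(signr_odd _ k).
case: (odd l); rewrite ?andbT ?andbF /= (lin_0 (cb.2 a)) (lin_0 (pb.1 _)).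
  by rewrite add0r.
by rewrite scaler0 addr0 scale1r.
Qed.

Lemma sgn_mul_bilinr a b : bilin (sgn_mul a b).
Proof.
have cb := @cmul_bilin R n G.
split=> [y c x x'|x c y y']; rewrite /sgn_mul.
  by rewrite !par_lin !cb.2 !pb.1 scalerDr addrACA.
by rewrite !cb.2 !pb.2 scalerDr addrACA.
Qed.

Lemma sgn_mul_bilinl t : bilin (fun a b => tlift (sgn_mul a b) t).
Proof.
have cb := @cmul_bilin R n G; have ls := csig_lin.
split=> [y c x x'|x c y y']; rewrite /tlift scaler_sumr -big_split; apply: eq_bigr => w _ /=;
rewrite /sgn_mul.
  by rewrite !cb.1 !pb.1 scalerDr addrACA.
by rewrite ls !cb.1 !pb.2 scalerDr addrACA.
Qed.

(** Both sides are bilinear, so generators suffice; there [Dpt_mulpt] computes the left side and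
    [sgn_mul_filt] the signs on the right. *)
Lemma cDelta_mul x y :
  cDelta (cmul x y) = tlift (fun a b => tlift (sgn_mul a b) (cDelta y)) (cDelta x).
Proof.
have cb := @cmul_bilin R n G; have lD := @cDelta_lin R n G.
move: x; apply: lin_gen => [c x x'|c x x'|p a s].
- by rewrite cb.1 lD.
- by rewrite lD (tlift_lin (sgn_mul_bilinl _) sCC).
rewrite (tlift_cDelta_gen p a s (sgn_mul_bilinl _) sCC).
move: y; apply: lin_gen => [c y y'|c y y'|q b t].
- by rewrite cb.2 lD.
- rewrite scaler_sumr -big_split; apply: eq_bigr => u _; rewrite scaler_sumr -big_split; apply:
  eq_bigr => v _ /=.
  rewrite lD (tlift_lin (sgn_mul_bilinr _ _) sCC) scalerDr !scalerA.
  by rewrite mulrC.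
rewrite /gen cmul_dg cDelta_dg Dpt_mulpt /Dmul.
have gl := dg2_lin (p := (p * q)%g).
rewrite (lin_sum _ _ gl); apply: eq_bigr => t1 _; rewrite (lin_sum _ _ gl); apply: eq_bigr => q1 _.
rewrite (tlift_cDelta_gen q b t (sgn_mul_bilinr _ _) sCC) scaler_sumr.
rewrite (lin_sum _ _ gl); apply: eq_bigr => t2 _; rewrite scaler_sumr.
rewrite (lin_sum _ _ gl); apply: eq_bigr => q2 _.
rewrite (lin_Z _ _ gl) (tlift_pure (dg2_bilin _) sCC).
rewrite (@sgn_mul_filt _ _ _ _ (size t1.2) (size q1.2) (size t2.1.2) (size q2.1.2)); [|exact:
  filt_gen|exact: filt_gen].
by rewrite !scalerA /gen !cmul_dg -!exprD -addnA.
Qed.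

Lemma Delta_mul_decomp x y N M (a b : 'I_N -> C) (a' b' : 'I_M -> C)
    (db : 'I_N -> nat) (da' : 'I_M -> nat) :
  (forall u, degree (@CG_filt R n G) (db u) (b u)) ->
  (forall v, degree (@CG_filt R n G) (da' v) (a' v)) ->
  cDelta x = \sum_u a u ⊗ b u -> cDelta y = \sum_v a' v ⊗ b' v ->
  cDelta (cmul x y) = \sum_u \sum_v
    (-1) ^+ (db u * da' v) *: (cmul (a u) (a' v) ⊗ cmul (b u) (b' v)).
Proof.
move=> Fb Fa Dx Dy; rewrite cDelta_mul (tlift_ord (sgn_mul_bilinl _) sCC Dx).
apply: eq_bigr => u _; rewrite (tlift_ord (sgn_mul_bilinr _ _) sCC Dy).
apply: eq_bigr => v _; have [r Fr] := Fb u; have [s Fs] := Fa v.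
exact: sgn_mul_filt Fr Fs.
Qed.

Let S_bl : bilin (fun x1 x2 : C => cmul (cS x1) x2).
Proof.
have cb := @cmul_bilin R n G.
by split=> [y c x x'|x c y y']; rewrite ?cS_lin (cb.1, cb.2).
Qed.

Let S_br : bilin (fun x1 x2 : C => cmul x1 (cS x2)).
Proof.
have cb := @cmul_bilin R n G.
by split=> [y c x x'|x c y y']; rewrite ?cS_lin (cb.1, cb.2).
Qed.

Let eps_lin : linear (fun x : C => ceps x *: cone).
Proof. by move=> c x y; rewrite ceps_lin scalerDl scalerA. Qed.

(** The products lie over [p^-1 * p], which is only provably [e]; the sum is therefore collected in
    that fibre first and then compared through [dg_eq]. *)
Lemma cantipodel x : tlift (fun x1 x2 => cmul (cS x1) x2) (cDelta x) = ceps x *: cone.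
Proof.
move: x; apply: lin_gen => [||p a s]; [|exact: eps_lin|].
  exact: (lin_comp (@cDelta_lin R n G) (tlift_lin S_bl sC)).
rewrite (tlift_cDelta_gen p a s S_bl sC).
have dl := @dg_lin R n G (p^-1 * p)%g.
transitivity (dg (\sum_(t <- splits s) \sum_(q <- splits a) (-1) ^+ t.1.1 *:
    mulpt (Spt (mkE A p q.1.2 t.1.2)) (mkE A p q.2 t.2))).
  rewrite (lin_sum _ _ dl); apply: eq_bigr => t _; rewrite (lin_sum _ _ dl); apply: eq_bigr => q _.
  by rewrite (lin_Z _ _ dl) /gen cS_dg cmul_dg.
rewrite /cone -(lin_Z _ _ (@dg_lin R n G e)); apply: dg_eq => [|om so]; first by rewrite mulVg.
rewrite (lin_Z _ _ (chat_linear om)) chat_dirac// ceps_dg.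
have cl := chat_linear (A := A) (p := (p^-1 * p)%g) om.
rewrite (lin_sum _ _ cl) /epspt (chat_mkE GA); last exact: sm_one.
transitivity (om e [::] * E A p a s (fun _ => @one R 'rV[R]_n)); last exact: mulrC.
rewrite -(antipodel_mkE p a s so); apply: eq_bigr => t _.
by rewrite (lin_sum _ _ cl); apply: eq_bigr => q _; rewrite (lin_Z _ _ cl).
Qed.

Lemma cantipoder x : tlift (fun x1 x2 => cmul x1 (cS x2)) (cDelta x) = ceps x *: cone.
Proof.
move: x; apply: lin_gen => [||p a s]; [|exact: eps_lin|].
  exact: (lin_comp (@cDelta_lin R n G) (tlift_lin S_br sC)).
rewrite (tlift_cDelta_gen p a s S_br sC).
have dl := @dg_lin R n G (p * p^-1)%g.
transitivity (dg (\sum_(t <- splits s) \sum_(q <- splits a) (-1) ^+ t.1.1 *: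
    mulpt (mkE A p q.1.2 t.1.2) (Spt (mkE A p q.2 t.2)))).
  rewrite (lin_sum _ _ dl); apply: eq_bigr => t _; rewrite (lin_sum _ _ dl); apply: eq_bigr => q _.
  by rewrite (lin_Z _ _ dl) /gen cS_dg cmul_dg.
rewrite /cone -(lin_Z _ _ (@dg_lin R n G e)); apply: dg_eq => [|om so]; first by rewrite mulgV.
rewrite (lin_Z _ _ (chat_linear om)) chat_dirac// ceps_dg.
have cl := chat_linear (A := A) (p := (p * p^-1)%g) om.
rewrite (lin_sum _ _ cl) /epspt (chat_mkE GA); last exact: sm_one.
transitivity (om e [::] * E A p a s (fun _ => @one R 'rV[R]_n)); last exact: mulrC.
rewrite -(antipoder_mkE p a s so); apply: eq_bigr => t _.
by rewrite (lin_sum _ _ cl); apply: eq_bigr => q _; rewrite (lin_Z _ _ cl).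
Qed.

Lemma CG_hopf : graded_hopf (@CG_filt R n G) cone cmul cDelta ceps cS.
Proof.
have cb := @cmul_bilin R n G.
split.
- exact: cb.1.
- exact: cb.2.
- exact: cmulA.
- exact: cmul1l.
- exact: cmul1r.
- by exists 0%N; exact: filt_gen.
- exact: cDelta_lin.
- exact: cDelta_coassoc.
- exact: ceps_lin.
- exact: ccounitl.
- exact: ccounitr.
- exact: cDelta_one.
- exact: Delta_mul_decomp.
- exact: ceps_one.
- exact: ceps_mul.
- exact: cS_lin.
- exact: cantipodel.
- exact: cantipoder.
Qed.

Lemma cmul_filt i j (s t : nat) x y :
  CG_filt i s x -> CG_filt j t y -> CG_filt (i + j) (s + t) (cmul x y).
Proof.
have cb := @cmul_bilin R n G.
move=> Fx Fy; move: x Fx; apply: filt_ind => [|c x x' Hx Hx'|p a k ki ak].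
- by rewrite (lin_0 (cb.1 y)); exact: filt0.
- by rewrite cb.1; exact: filt_lin.
move: y Fy; apply: filt_ind => [|c x x' Hx Hx'|q b l lj bt].
- by rewrite (lin_0 (cb.2 _)); exact: filt0.
- by rewrite cb.2; exact: filt_lin.
rewrite /gen cmul_dg; apply: filt_dg.
by apply: mulpt_order; exact: (order_mkE GA GH).
Qed.

Definition split_filt k r (u : C * C) :=
  exists i j s t, [/\ (i + j = k)%N, (s + t = r)%N, CG_filt i s u.1 & CG_filt j t u.2].

Lemma cDelta_filt_seq k r x : CG_filt k r x -> exists2 l : seq (C * C),
  Allp (split_filt k r) l & cDelta x = \sum_(u <- l) u.1 ⊗ u.2.
Proof.
have lD := @cDelta_lin R n G.
move: x; apply: filt_ind => [|c x y [l Pl Dx] [l' Pl' Dy]|p a s sk ar].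
- by exists [::] => //; rewrite (lin_0 lD) big_nil.
- exists ([seq (c *: u.1, u.2) | u <- l] ++ l').
    apply: Allp_cat => //; apply: Allp_map; apply: Allp_impl Pl => u [i [j [s [t [ij st Fi Fj]]]]].
    exists i, j, s, t; split=> //=; rewrite -[c *: u.1]addr0.
    by apply: filt_lin => //; exact: filt0.
  rewrite lD Dx Dy big_cat big_map scaler_sumr; congr (_ + _); apply: eq_bigr => u _ /=.
  by rewrite (lin_Z _ _ (pb.1 _)).
exists (flatten [seq [seq ((-1) ^+ t.1.1 *: gen p w.1.2 t.1.2, gen p w.2 t.2) | w <- splits a] | t
  <- splits s]).
  have := splits_size s; elim: (splits s) => //= t l IH [ts /IH{}IH]; apply: Allp_cat => //.
  apply: Allp_map; apply: Allp_impl (splits_size a) => q qa.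
  (* The two orders must add up to exactly [r], so the second one absorbs the slack between [size a]
     and [r]. *)
  exists (size t.1.2), (size t.2), (size q.1.2), (r - size q.1.2)%N; split=> /=.
  + by rewrite ts.
  + by rewrite subnKC// (leq_trans _ ar)// -qa leq_addr.
  + rewrite -[X in CG_filt _ _ X]addr0; apply: filt_lin; [exact: filt_gen|exact: filt0].
  + by apply: filt_gen => //; rewrite leq_subRL ?(leq_trans _ ar) ?qa// -qa leq_addr.
have := tlift_cDelta_gen p a s pb sCC; rewrite tlift_id => ->.
rewrite big_flatten big_map; apply: eq_bigr => t _; rewrite big_map; apply: eq_bigr => q _ /=.
by rewrite (lin_Z _ _ (pb.1 _)).
Qed.

Lemma CG_filtered_hopf : filtered_hopf (@CG_filt R n G) cmul cDelta ceps cS.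
Proof.
split.
- by move=> i j s t x y; exact: cmul_filt.
- move=> k r x /cDelta_filt_seq[l Pl Dx].
  exists (size l), (fun i => (nth (0, 0) l i).1), (fun i => (nth (0, 0) l i).2); split.
    by rewrite Dx (big_nth (0, 0)) big_mkord.
  move=> u; suff : split_filt k r (nth (0, 0) l u) by [].
  case: u => u /=; elim: l Pl u {Dx} => //= v l IH [Pv Pl] [|u]//; rewrite ltnS.
  exact: IH.
- move=> k x k0 [r Fx]; move: x Fx; apply: filt_ind => [|c x y Hx Hy|p a s sk _].
  + exact: lin_0 (@ceps_lin R n G).
  + by rewrite ceps_lin Hx Hy scaler0 addr0.
  + rewrite ceps_dg /epspt (chat_mkE GA); last exact: sm_one.
    rewrite /E (dd_ext _ (g := fun=> 0)) ?dd_zero//.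
    near=> z; rewrite /lf /one size_map sk.
    by rewrite eqn0Ngt k0.
- move=> k r; apply: filt_ind => [|c x' y Hx Hy|p a s sk ar].
  + by rewrite (lin_0 (@cS_lin R n G)); exact: filt0.
  + by rewrite cS_lin; exact: filt_lin.
  + rewrite /gen cS_dg; apply: filt_dg; apply: Spt_order.
    exact: (order_mkE GA GH).
Unshelve. all: by end_near. Qed.

Lemma cbd_cmul x y : cbd (cmul x y) = cmul (cbd x) y + cmul (csig x) (cbd y).
Proof.
have cb := @cmul_bilin R n G; have ls := csig_lin.
move: x; apply: lin_C => [c x x'|c x x'|p T].
- by rewrite cb.1 cbd_lin.
- by rewrite cbd_lin ls !cb.1 scalerDr addrACA.
move: y; apply: lin_C => [c y y'|c y y'|q S].
- by rewrite cb.2 cbd_lin.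
- by rewrite cbd_lin !cb.2 scalerDr addrACA.
rewrite cmul_dg !cbd_dg csig_dg.
by rewrite !cmul_dg bdpt_mulpt (lin_D _ _ (@dg_lin R n G _)).
Qed.

Let bd_bil : bilin (fun a b : C => cbd a ⊗ b + csig a ⊗ cbd b).
Proof.
have ls := csig_lin.
split=> [y c x x'|x c y y'].
  by rewrite cbd_lin ls !pb.1 scalerDr addrACA.
by rewrite cbd_lin !pb.2 scalerDr addrACA.
Qed.

Lemma cDelta_bd x : cDelta (cbd x) = tlift (fun a b => cbd a ⊗ b + csig a ⊗ cbd b) (cDelta x).
Proof.
move: x; apply: lin_C => [||p T].
- exact: (lin_comp cbd_lin (@cDelta_lin R n G)).
- exact: (lin_comp (@cDelta_lin R n G) (tlift_lin bd_bil sCC)).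
rewrite (tlift_cDelta _ bd_bil sCC) cbd_dg cDelta_dg.
have gl := dg2_lin (p := p).
rewrite (Dpt_bdpt GA GH) (tlift_map _ _ gl); apply: tlift_ext => a b.
rewrite (lin_D _ _ gl) !(tlift_pure (dg2_bilin p) sCC).
by rewrite !cbd_dg csig_dg.
Qed.

Lemma CG_differential : hopf_differential (@CG_filt R n G) cmul cDelta cbd.
Proof.
split.
- exact: cbd_lin.
- move=> k r; apply: filt_ind => [|c x' y Hx Hy|p a s sk ar].
  + by rewrite (lin_0 cbd_lin); exact: filt0.
  + by rewrite cbd_lin; exact: filt_lin.
  + rewrite cbd_dg; apply: filt_dg.
    by apply: (@bdpt_order R n G A GA GH p k.+1 r); exact: (order_mkE GA GH).
- move=> x [r Fx]; apply: gfin_eq => p; rewrite [LHS](endo_at (@lbd R n G)).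
  exact: (bdpt_degree0 GA GH (Fx p)).
- move=> x; apply: gfin_eq => p; rewrite [LHS](endo_at (@lbd R n G)).
  by rewrite (endo_at (@lbd R n G)) (bdpt_bdpt GA GH).
- by move=> k x y [r Fx]; rewrite cbd_cmul (csig_filt Fx) (lin_Z _ _ ((@cmul_bilin R n G).1 _)).
- move=> x N a b da Fa Dx; rewrite cDelta_bd (tlift_ord bd_bil sCC Dx).
  apply: eq_bigr => u _; have [r Fr] := Fa u.
  by rewrite (csig_filt Fr) (lin_Z _ _ (pb.1 _)).
Qed.

Lemma CG_dg_hopf : filtered_dg_hopf (@CG_filt R n G) cone cmul cDelta ceps cbd cS.
Proof.
by split; [exact: CG_graded|exact: CG_hopf|exact: CG_filtered_hopf|exact: CG_differential].
Qed.

End HopfAxioms.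

(** * Agreement with the prescribed structure maps *)

Section StructureMaps.
Context (R : realType) (n : nat) (G : lieGroupType R n).
Local Notation A := (lie_atlas : atlas R n G).
Local Notation AA := (prod_atlas A A).
Local Notation e := (1%g : G).
Local Notation C := (CG G).
Local Notation cmul := (@cmul R n G).

Lemma ccur_lin : linear (@CG_current R n G).
Proof.
apply: (@glift_lin R G (current_bundle G) (current R n G) (fun p T => ptval (T : ptcurrent A p))).
by [].
Qed.

Lemma ccur_dg p (T : ptcurrent A p) : CG_current (dg T) = ptval T.
Proof.
apply: (@glift_delta R G (current_bundle G) (current R n G) (fun p T => ptval (T : ptcurrent A p))).
by [].
Qed.

Lemma cev_lin k (w : form R n G k) : linear (fun x : C => cev (CG_current x) w).
Proof. by move=> c x y; rewrite ccur_lin. Qed.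

Lemma cone_unit : is_unit_current (@cone R n G).
Proof.
split=> [w sw|k w].
  rewrite ccur_dg -(chat_hat GA) chat_dirac; last exact: (smooth_hat GA sw).
  by rewrite /hat /=; congr (w _ _); exact: flatmx0.
have [sw|nsw] := pselect (smooth_form A w); rewrite ccur_dg.
  by rewrite -(chat_hat GA) chat_dirac//; exact: (smooth_hat GA sw).
exact: current_junk (supp_current (ptcurrentP (dirac e)) k.+1) _ nsw.
Qed.

Lemma ccounit : is_counit (@ceps R n G).
Proof.
move=> x; move: x; apply: lin_C => [||p T]; first exact: ceps_lin.
  exact: cev_lin.
by rewrite ceps_dg ccur_dg -(chat_hat GA) hat_unit.
Qed.

Lemma cboundary : is_boundary (@cbd R n G).
Proof.
move=> x k w sw; move: x; apply: lin_C => [||p T].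
- exact: (lin_comp (@cbd_lin R n G) (@cev_lin k w)).
- exact: cev_lin.
rewrite cbd_dg !ccur_dg -!(chat_hat GA) chat_bdpt; [|exact: GA|exact: GH|exact: (smooth_hat GA sw)].
by congr (chat T _); apply/funext => q; apply/funext => s; rewrite (hat_extd GA).
Qed.

Lemma ccoproduct : is_coproduct (@cDelta R n G).
Proof.
split; first exact: cDelta_lin.
move=> p T; exists (Dpt GA GH T); first exact: cDelta_dg.
move=> k l w v sw sv.
rewrite (tlift_ext (b' := fun a b : ptcurrent A p => chat a (hat w) * chat b (hat v) : R^o)); last first.
  by move=> a b; rewrite !(chat_hat GA).
rewrite Dpt_test; [|exact: (smooth_hat GA sw)|exact: (smooth_hat GA sv)].
rewrite -(chat_hat GA); congr (chat _ _); apply/funext => q; apply/funext => s.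
by rewrite hat_wedge//; [exact: sw.1|exact: sv.1].
Qed.

(** The differential of [fst] kills the [inr] vectors and that of [snd] the [inl] vectors, so the
    product form splits by [wl_block]; partial evaluation then extracts the two values one after the
    other. *)
Lemma chat_cross_wedge p q (T : ptcurrent A p) (S : ptcurrent A q) i j
    (w : form R n G i) (v : form R n G j) : smooth_form A w -> smooth_form A v ->
  cev (ptval (cross T S)) (wedge (pullback AA A fst w) (pullback AA A snd v)) =
  cev (ptval T) w * cev (ptval S) v.
Proof.
move=> sw sv; have sh := smooth_hat GA sw; have sh' := smooth_hat GA sv.
have sf := smap_fst A (GA (G := G)); have ss := smap_snd A (GA (G := G)).
have s1 : sm AA (pull AA A fst (hat w)) by exact: (sm_pull GG GA sf).
have s2 : sm AA (pull AA A snd (hat v)) by exact: (sm_pull GG GA ss).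
have sp1 : smooth_form AA (pullback AA A fst w).
  rewrite -[pullback _ _ _ _](homK (k := i)).
  have -> : hat (pullback AA A fst w) = pull AA A fst (hat w).
    by apply/funext => x; apply/funext => s; rewrite (hat_pullback GG GA).
  by apply: (sm_hom GG); exact: s1.
have sp2 : smooth_form AA (pullback AA A snd v).
  rewrite -[pullback _ _ _ _](homK (k := j)).
  have -> : hat (pullback AA A snd v) = pull AA A snd (hat v).
    by apply/funext => x; apply/funext => s; rewrite (hat_pullback GG GA).
  by apply: (sm_hom GG); exact: s2.
rewrite -!(chat_hat GA) -(chat_hat GG).
have -> : hat (wedge (pullback AA A fst w) (pullback AA A snd v)) =
    wlf (pull AA A fst (hat w)) (pull AA A snd (hat v)).
  apply/funext => x; apply/funext => s; rewrite hat_wedge; [|exact: sp1.1|exact: sp2.1].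
  by rewrite /wlf; congr (wl _ _ _); apply/funext => t; rewrite (hat_pullback GG GA).
rewrite (chat_cross GA GA GH GH); last exact: sm_wlf.
rewrite mulrC -chat_scale//; congr (chat T _); apply/funext => x; apply/funext => s.
rewrite mulrC -chat_scale//; congr (chat S _); apply/funext => y; apply/funext => t.
rewrite /slice /wlf wl_block.
- rewrite /pull /= -!map_comp; congr (_ * _).
    by apply: (f_equal (hat w x)); rewrite -[RHS]map_id; apply: eq_map => u /=; rewrite (tg_fst A
      GA) row_mxKl.
  by apply: (f_equal (hat v y)); rewrite -[RHS]map_id; apply: eq_map => u /=; rewrite (tg_snd A GA) row_mxKr.
- move=> a b u /List.in_map_iff[u' [<- _]]; rewrite /pull map_cat /= (tg_fst A GA) row_mxKl.
  exact: (alt0 _ _ (sh.1 x)).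
- move=> a u /List.in_map_iff[u' [<- _]]; rewrite /pull /= (tg_snd A GA) row_mxKr.
  exact: (alt0 [::] _ (sh'.1 y)).
Qed.

(** The cross product [Z] is wanted as a current on the product group. It is assembled bilinearly
    from cross products of point currents, with 0 when a factor vanishes ([zcr]). *)
Lemma cconvolution : is_convolution cmul.
Proof.
have cb := @cmul_bilin R n G.
have zcr (x y : C) : x = 0 \/ y = 0 -> exists2 Z, is_cross (CG_current x) (CG_current y) Z &
    forall k (w : form R n G k), smooth_form A w ->
      cev (CG_current (cmul x y)) w =
      cev Z (pullback AA A (fun xy : G * G => (xy.1 * xy.2)%g) w).
  move=> xy; exists 0; first split.
  - by move=> k; exact: is_current0.
  - by move=> i j w v _ _; case: xy => ->; rewrite (lin_0 ccur_lin) [RHS](mulr0, mul0r).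
  - move=> k w _; rewrite (_ : cmul x y = 0) ?(lin_0 ccur_lin)//.
    by case: xy => ->; rewrite (lin_0 (cb.1 _), lin_0 (cb.2 _)).
move=> x y; move: x; apply: C_ind => [|c x x' [Z [cZ HZ] mZ] [Z' [cZ' HZ'] mZ']|p T]; first by
  apply: zcr; left.
  exists (c *: Z + Z'); first split.
  - by move=> k; exact: is_currentZD.
  - move=> i j w v sw sv; rewrite cevZD HZ// HZ'// (cev_lin w).
    by rewrite mulrDl -mulrA.
  - by move=> k w sw; rewrite cb.1 (cev_lin w) mZ// mZ'// cevZD.
move: y; apply: C_ind => [|c x x' [Z [cZ HZ] mZ] [Z' [cZ' HZ'] mZ']|q S]; first by apply: zcr; right.
  exists (c *: Z + Z'); first split.
  - by move=> k; exact: is_currentZD.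
  - move=> i j w v sw sv; rewrite cevZD HZ// HZ'// (cev_lin v).
    by rewrite mulrDr mulrCA.
  - by move=> k w sw; rewrite cb.2 (cev_lin w) mZ// mZ'// cevZD.
exists (ptval (cross T S)); first split.
- by move=> k; exact: supp_current (ptcurrentP (cross T S)) k.
- by move=> i j w v sw sv; rewrite !ccur_dg; exact: chat_cross_wedge.
- move=> k w sw; rewrite cmul_dg ccur_dg -(chat_hat GA) -(chat_hat GG).
  have sh := smooth_hat GA sw.
  apply: etrans (chat_push GG GA GGH smap_mulm (cross T S) sh) _.
  by congr (chat _ _); apply/funext => z; apply/funext => s; rewrite (hat_pullback GG GA)//; exact: smap_mulm.
Qed.

End StructureMaps.

(** Separates the Leibniz term in which all derivatives fall on the second factor; in every other
    term that factor receives fewer. This isolates the principal symbol. *)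
Lemma splits_lead (T : Type) (s : seq T) : exists r : seq (seq T * seq T),
  Allp (fun t => (size t.2 < size s)%N) r /\
  forall (M : nmodType) (F : seq T -> seq T -> M),
    \sum_(t <- splits s) F t.1.2 t.2 = F [::] s + \sum_(t <- r) F t.1 t.2.
Proof.
elim: s => [|u s [r [rs rE]]]; first by exists [::]; split=> // M F; rewrite /= big_seq1 big_nil addr0.
exists ([seq (u :: t.1.2, t.2) | t <- splits s] ++ [seq (t.1, u :: t.2) | t <- r]); split.
  apply: Allp_cat; apply: Allp_map; last exact: Allp_impl rs.
  by apply: Allp_impl (splits_size s) => t /= <-; rewrite ltnS leq_addl.
move=> M F /=; rewrite !big_cat !big_map /= (rE M (fun a b => F a (u :: b))).
by rewrite addrCA.
Qed.

(** * Frames *)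

Section LocalSpan.
Context (R : realType) (n : nat) (G : lieGroupType R n).
Local Notation A := (lie_atlas : atlas R n G).
Local Notation AA := (prod_atlas A A).
Local Notation e := (1%g : G).
Local Notation mulm := (@mulm R n G).
Local Notation z := (zp A e).
Local Notation vec := 'rV[R]_n.
Implicit Types (om et : lfm R n G).

(** Order at most [r] at the unit, with no condition on the degree. *)
Definition low r (Phi : lfm R n G -> R) := exists L : rep R n,
  Allp (fun c => (size c.1.2 <= r)%N) L /\ forall om, sm A om -> Phi om = ev A e L om.

Lemma lowD r Phi Psi : low r Phi -> low r Psi -> low r (fun om => Phi om + Psi om).
Proof.
move=> [L [Lr LE]] [L' [Lr' LE']]; exists (L ++ L'); split; first exact: Allp_cat.
by move=> om so; rewrite ev_cat LE// LE'.
Qed.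

Lemma low_sum r (I : Type) (l : seq I) (F : I -> lfm R n G -> R) :
  Allp (fun i => low r (F i)) l -> low r (fun om => \sum_(i <- l) F i om).
Proof.
elim: l => [_|i l IH [Fi /IH Fl]].
  by exists [::]; split=> // om _; rewrite big_nil /ev big_nil.
have [L [Lr LE]] := lowD Fi Fl; exists L; split=> // om so.
by rewrite big_cons LE.
Qed.

Lemma Allp_all (I : Type) (P : I -> Prop) (l : seq I) : (forall i, P i) -> Allp P l.
Proof. by move=> H; elim: l. Qed.

Lemma lowE r c (a s : seq vec) : (size a <= r)%N -> low r (fun om => c * E A e a s om).
Proof. by move=> ar; exists [:: (c, a, s)]; split=> // om so; rewrite /ev big_seq1. Qed.

Lemma low_ext r Phi Psi : (forall om, sm A om -> Phi om = Psi om) -> low r Phi -> low r Psi.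
Proof. by move=> H [L [Lr LE]]; exists L; split=> // om so; rewrite -H// LE. Qed.

Definition mu (zz : 'rV[R]_(n + n)) : vec := cmap (A e) (mulm (cinv (AA (e, e)) zz)).

Let oee : cdom (A e) (mulm (e, e)).
Proof. by rewrite /mulm mulg1; exact: (atlas_mem GA). Qed.

Let czz : cimg (AA (e, e)) (row_mx z z).
Proof. by apply: cimg_row; exact: (cimg_zp GA). Qed.

Let zpe : zp AA (e, e) = row_mx z z. Proof. by []. Qed.

Let czdom : cdom (A e) (mulm (cinv (AA (e, e)) (row_mx z z))).
Proof. by rewrite -zpe (cinv_zp GG); exact: oee. Qed.

Lemma smv_mu : smv mu (row_mx z z).
Proof. exact: (smap_mulm.2 (e, e) e _ czz czdom). Qed.

Lemma mu_l : \forall y \near z, mu (row_mx y z) = y.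
Proof.
apply: filterS (near_cimg GA (cimg_zp GA e)) => y ey.
rewrite /mu /= row_mxKl row_mxKr (cinv_zp GA) /mulm mulg1.
exact: (cinvK GA).
Qed.

Lemma mu_r : \forall y \near z, mu (row_mx z y) = y.
Proof.
apply: filterS (near_cimg GA (cimg_zp GA e)) => y ey.
rewrite /mu /= row_mxKl row_mxKr (cinv_zp GA) /mulm mul1g.
exact: (cinvK GA).
Qed.

Let near_yz (P : 'rV[R]_(n + n) -> Prop) : (\forall w \near row_mx z z, P w) ->
  \forall y \near z, P (row_mx y z).
Proof. by move=> H; exact: (near_pull (row_smv_l z z) H). Qed.

Lemma Dmu_l v : \forall y \near z, Dv mu (row_mx y z) (inl v) = v.
Proof.
have H := near_near mu_l; have H2 := near_yz (smv_near smv_mu).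
apply: filterS2 H H2 => y yl sy.
have := Dv_comp v (row_smv_l y z) sy.
rewrite (Dv_ext (f' := fun y => y)) ?Dv_id//.
by rewrite Dv_row Dv_id Dv_cst.
Qed.

Lemma Dmu_r v : Dv mu (row_mx z z) (inr v) = v.
Proof.
have := Dv_comp v (row_smv_r z z) smv_mu.
rewrite (Dv_ext (f' := fun y => y)) ?Dv_id//; last exact: mu_r.
by rewrite Dv_row Dv_id Dv_cst.
Qed.

(** In the chart at [e], [xi u] is the left-invariant field with value [u] at the unit, and
    [eta_ u v] is the derivative of that field along [v]. *)
Definition xi (u : vec) (y : vec) : vec := Dv mu (row_mx y z) (inr u).
Definition eta_ (u v : vec) (y : vec) : vec := hess mu (row_mx y z) (inr u) (inl v).

Lemma sm1_xi u k : sm1 (fun y => xi u y 0 k : R^o) z.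
Proof.
apply: sm1_eq (sm1_comp (row_smv_l z z) (sm1_D (inr u) (smv_mu k))) => y.
by rewrite /xi mxE.
Qed.

Lemma sm1_eta u v k : sm1 (fun y => eta_ u v y 0 k : R^o) z.
Proof.
apply: sm1_eq (sm1_comp (row_smv_l z z) (sm1_D (inr u) (sm1_D (inl v) (smv_mu k)))) => y.
by rewrite /eta_ mxE.
Qed.

(** The Lie derivative of [w] along [xi u] at [y], obtained by differentiating the pullback under
    the group law along the second factor. *)
Definition der1 (u : vec) (s : seq vec) (w : vec -> seq vec -> R^o) (y : vec) : R :=
  'D_(inr u) (fun zz => pullv mu w zz (map (fun v => inl v) s)) (row_mx y z).

(** An instance of [D_pull]: the leading part differentiates coefficients of the form along [xi u],
    the rest contains no derivative of the form. The vectors of [s] are unchanged because [mu] is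
    the identity on the first factor near the unit. *)
Lemma der1E u s om : sm A om -> \forall y \near z,
  der1 u s (lf A e om) y =
  \sum_k xi u y 0 k * 'D_(delta_mx 0 k) (fun y => lf A e om y s) y +
  \sum_(j < size s) \sum_k ((-1) ^+ j * eta_ u (nth 0 s j) y 0 k) *
     lf A e om y (delta_mx 0 k :: rem_nth j s).
Proof.
move=> so; have ez := cimg_zp GA e.
have Hl : \forall y \near z, forall v, v \in s -> Dv mu (row_mx y z) (inl v) = v.
  elim: (s) => [|v s' IH]; first by near=> y.
  apply: filterS2 IH (Dmu_l v) => y H1 H2 v'; rewrite inE => /orP[/eqP->//|]; exact: H1.
have H2 := near_yz (smv_near smv_mu).
have H3 := near_cimg GA ez.
apply: filterS2 (filterI Hl H2) (filterI H3 mu_l) => y [Ls sy] [ey muy].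
have wy : smw (lf A e om) y by exact: so.2.
have ay : \forall y0 \near y, alt (lf A e om y0) by exact: lf_alt_near GA _ _ _ so.1 ey.
have mapL (t : seq vec) : (forall v, v \in t -> v \in s) ->
    map (Dv mu (row_mx y z)) (map (fun v => inl v) t) = t.
  move=> ts; rewrite -map_comp -[RHS]map_id; apply/eq_in_map => v /ts vs.
  exact: Ls.
rewrite /der1 (D_pull sy) ?muy// mapL// slot_sum_front; last exact: nbhs_singleton ay.
congr (_ + _); first by rewrite (D_basisE _ (wy s)).
rewrite size_map; apply: eq_bigr => j _; rewrite (nth_map 0)//.
have -> : rem_nth j (map (fun v => inl v) s) = map (fun v : vec => inl v : 'rV[R]_(n + n)) (rem_nth j s).
  by rewrite /rem_nth map_cat map_take map_drop.
rewrite mapL => [|v]; last first.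
  by rewrite /rem_nth mem_cat => /orP[/mem_take|/mem_drop].
rewrite -/(eta_ u (nth 0 s j) y) [X in lf A e om y (X :: _)]rv_decomp.
rewrite (@alt_sum _ _ _ [::]); last exact: nbhs_singleton ay.
by rewrite mulr_sumr; apply: eq_bigr => k _; rewrite mulrA.
Unshelve. all: by end_near. Qed.

Lemma dd_add m (a : seq 'rV[R]_m) (f g : 'rV[R]_m -> R^o) x : sm1 f x -> sm1 g x ->
  dd a (fun y => f y + g y : R^o) x = dd a f x + dd a g x.
Proof.
move=> sf sg_; rewrite -[dd a f x]mul1r -dd_comb//.
by congr (dd a _ x); apply/funext => y; rewrite mul1r.
Qed.

Lemma dd_bigsum m (a : seq 'rV[R]_m) (I : Type) (l : seq I) (F : I -> 'rV[R]_m -> R^o) x :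
  (forall i, sm1 (F i) x) ->
  dd a (fun y => \sum_(i <- l) F i y : R^o) x = \sum_(i <- l) dd a (F i) x.
Proof.
move=> sF; have := dd_sum a l (fun=> 1) sF; rewrite [RHS](eq_bigr (fun i => dd a (F i) x)).
  move=> <-; congr (dd a _ x); apply/funext => y.
  by apply: eq_bigr => i _; rewrite mul1r.
by move=> i _; rewrite mul1r.
Qed.

Lemma chat_der1 a s u om : sm A om ->
  chat (mulpt (mkE A e a s) (mkE A e [:: u] [::])) om = dd a (der1 u s (lf A e om)) z.
Proof.
move=> so; rewrite chat_mulpt_mkE//= cats0 /E dd_cat /=.
rewrite -[der1 _ _ _]/(fun y => (fun zz => 'D_(inr u) (fun zz => pullv mu (lf A e om) zz
  (map (fun v => inl v) s)) zz) (row_mx y z)) dd_left.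
apply: dd_ext; apply: (dd_near [:: inr u]).
exact: (lf_pull_near GG GA om _ smap_mulm czz czdom).
Qed.

(* Right convolution by the first order current of [u] adds [u] to the principal symbol. *)
Lemma leading a u s : low (size a) (fun om =>
  chat (mulpt (mkE A e a s) (mkE A e [:: u] [::])) om - E A e (rcons a u) s om).
Proof.
have [r [rs rE]] := splits_lead a.
pose c j k y := (-1) ^+ j * eta_ u (nth 0 s j) y 0 k : R^o.
have sc j k : sm1 (c j k) z by apply: sm1Z; exact: sm1_eta.
apply: (@low_ext _ (fun om =>
  \sum_k \sum_(t <- r) dd t.1 (fun y => xi u y 0 k : R^o) z * E A e (rcons t.2 (delta_mx 0 k)) s om +
  \sum_(j < size s) \sum_k \sum_(t <- splits a)
    dd t.1.2 (c j k) z * E A e t.2 (delta_mx 0 k :: rem_nth j s) om)); last first.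
  apply: lowD.
    apply: low_sum; apply: Allp_all => k; apply: low_sum; apply: Allp_impl rs => t ta.
    by apply: lowE; rewrite size_rcons.
  apply: low_sum; apply: Allp_all => j; apply: low_sum; apply: Allp_all => k.
  apply: low_sum; apply: Allp_impl (splits_size a) => t ta.
  by apply: lowE; rewrite -ta leq_addl.
move=> om so; have ez := cimg_zp GA e; have sw := so.2 e z ez.
rewrite chat_der1// (dd_ext _ (der1E u s so)).
have sD k : sm1 (fun y => 'D_(delta_mx 0 k) (fun y => lf A e om y s) y) z by apply: sm1_D; exact: sw.
have s1 k : sm1 (fun y => xi u y 0 k * 'D_(delta_mx 0 k) (fun y => lf A e om y s) y : R^o) z.
  by apply: sm1M; [exact: sm1_xi|exact: sD].
have s2 j k : sm1 (fun y => c j k y * lf A e om y (delta_mx 0 k :: rem_nth j s) : R^o) z.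
  by apply: sm1M; [exact: sc|exact: sw].
rewrite (dd_add _ (f := fun y => \sum_k xi u y 0 k * 'D_(delta_mx 0 k) (fun y => lf A e om y s) y)
  (g := fun y => \sum_(j < size s) \sum_k c j k y * lf A e om y (delta_mx 0 k :: rem_nth j s))); first last.
- by apply: sm1_sum => j; apply: sm1_sum => k; exact: s2.
- by apply: sm1_sum => k; exact: s1.
rewrite (dd_bigsum _ _ s1).
rewrite (dd_bigsum _ _ (F := fun (j : 'I_(size s)) y => \sum_k c j k y * lf A e om y (delta_mx 0 k
  :: rem_nth j s))); last first.
  by move=> j; apply: sm1_sum => k; exact: s2.
have -> : E A e (rcons a u) s om = \sum_k u 0 k * E A e (rcons a (delta_mx 0 k)) s om.
  rewrite /E -cats1 dd_cat /= (dd_ext _ (g := fun y => \sum_k u 0 k * 'D_(delta_mx 0 k) (fun y =>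
    lf A e om y s) y)).
    rewrite dd_sum//; apply: eq_bigr => k _; by rewrite -cats1 dd_cat.
  by apply: filterS (sm1_near (sw s)) => y sy; rewrite (D_basisE _ sy).
have -> : \sum_k dd a (fun y => xi u y 0 k * 'D_(delta_mx 0 k) (fun y => lf A e om y s) y : R^o) z =
   \sum_k u 0 k * E A e (rcons a (delta_mx 0 k)) s om +
   \sum_k \sum_(t <- r) dd t.1 (fun y => xi u y 0 k : R^o) z * E A e (rcons t.2 (delta_mx 0 k)) s om.
  rewrite -big_split; apply: eq_bigr => k _ /=.
  rewrite dd_mul; [|exact: sm1_xi|exact: sD].
  rewrite (rE _ (fun a1 a2 => dd a1 (fun y => xi u y 0 k : R^o) z * dd a2 (fun y => 'D_(delta_mx 0
    k) (fun y => lf A e om y s) y) z)) /=.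
  (* The leading coefficient is [xi u] at the unit, which is [u]. *)
  congr (_ + _); first by rewrite /xi Dmu_r /E -cats1 dd_cat.
  by apply: eq_bigr => t _; rewrite /E -cats1 dd_cat.
set S0 := \sum_k u 0 k * _; rewrite -(addrA S0) [S0 + _]addrC addrK; congr (_ + _); apply: eq_bigr => j _.
rewrite dd_bigsum; last exact: s2.
by apply: eq_bigr => k _; rewrite dd_mul.
Qed.

End LocalSpan.

(** * Lie derivatives and the frame *)

Section Frames.
Context (R : realType) (n : nat) (G : lieGroupType R n).
Local Notation A := (lie_atlas : atlas R n G).
Local Notation AA := (prod_atlas A A).
Local Notation e := (1%g : G).
Local Notation mulm := (@mulm R n G).
Local Notation vec := 'rV[R]_n.
Local Notation U := (current_bundle G).
Local Notation C := (CG G).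
Local Notation cmul := (@cmul R n G).
Local Notation lmap s := (map (fun u : 'rV[R]_n => inl u : 'rV[R]_(n + n)) s).
Local Notation rmap s := (map (fun u : 'rV[R]_n => inr u : 'rV[R]_(n + n)) s).
Implicit Types (p q : G) (om et : lfm R n G) (u : vec).

Definition io u om : lfm R n G := fun p s => om p (left_invariant u p :: s).

Lemma left_invariantE u p : left_invariant u p = tL p e u.
Proof. by rewrite /left_invariant (tangent_mxE GA GA e u (smap_L p)). Qed.

(** Right convolution with K(u) is transposed to contraction with the left-invariant field. The
    vector [u] arrives behind the vectors [s], and moving it to the front costs the sign in
    [sgf]. *)
Lemma sl_kappa u om : sm A om ->
  sl (chat (mkE A e [::] [:: u])) (pull AA A mulm om) = sgf (io u om).
Proof.
move=> so; apply/funext => p; apply/funext => s.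
rewrite /sl chat_mkE ?/E /=; [|exact: GA|exact: sm_slice_mul].
rewrite (lf_zp GA) /slice (pull_mul om p e s [:: u]) mulg1 /sgf /sg /io left_invariantE /=.
have -> : map (tR e p) s = s by rewrite -[RHS]map_id; apply: eq_map => w; exact: tR1.
have := alt_move0 s [::] (tL p e u) (so.1 p); rewrite cats0 => <- //.
Qed.

Lemma io_sg u om : sm A om -> io u om = sgf (sl (chat (mkE A e [::] [:: u])) (pull AA A mulm om)).
Proof.
move=> so; rewrite (sl_kappa u so); apply/funext => p; apply/funext => s.
by rewrite /sgf /sg mulrA -expr2 sqrr_sign mul1r.
Qed.

Lemma sm_io u om : sm A om -> sm A (io u om).
Proof. by move=> so; rewrite io_sg//; apply: sm_sgf; exact: sm_mul_sl. Qed.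

(** Cartan's formula on forms of mixed degree; on functions the second term vanishes, in agreement
    with the first clause of [lie_derivative]. *)
Definition Lie u om : lfm R n G := fun p s => io u (dform A om) p s + dform A (io u om) p s.

Lemma sm_add om et : sm A om -> sm A et -> sm A (fun p s => om p s + et p s).
Proof.
move=> so se; have := sm_comb 1 so se; congr (sm A).
by apply/funext => p; apply/funext => s; rewrite mul1r.
Qed.

Lemma sm_Lie u om : sm A om -> sm A (Lie u om).
Proof.
move=> so; apply: sm_add; first by apply: sm_io; exact: (sm_dform GA).
by apply: (sm_dform GA); exact: sm_io.
Qed.

Lemma sgf_dform om : sm A om -> dform A (sgf om) = fun p s => - sgf (dform A om) p s.
Proof.
move=> so; apply/funext => p; apply/funext => s.
have := dl_sg s (so.2 p _ (cimg_zp GA p)); rewrite /dform /sgf => <-.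
apply: (f_equal (fun f => dl f (zp A p) s)); apply/funext => y; apply/funext => t.
by rewrite /lf /sg size_map.
Qed.

Lemma sgfK om : sgf (sgf om) = om.
Proof.
by apply/funext => p; apply/funext => s; rewrite /sgf /sg mulrA -expr2 sqrr_sign mul1r.
Qed.

Lemma sigptK p (T : ptcurrent A p) : sigpt (sigpt T) = T.
Proof.
apply: (chat_inj GA) => om so.
by rewrite !(chat_sigpt GA GH)// ?sgfK//; exact: sm_sgf.
Qed.

Lemma chat_add p (T : ptcurrent A p) om et : sm A om -> sm A et ->
  chat T (fun p s => om p s + et p s) = chat T om + chat T et.
Proof.
move=> so se; have := chat_comb GA T 1 so se; rewrite mul1r => <-; congr (chat T _).
by apply/funext => x; apply/funext => s; rewrite mul1r.
Qed.

Lemma chat_opp p (T : ptcurrent A p) om : sm A om -> chat T (fun p s => - om p s) = - chat T om.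
Proof.
move=> so; rewrite -[RHS]mulN1r -(chat_scale T (-1) so); congr (chat T _).
by apply/funext => x; apply/funext => s; rewrite mulN1r.
Qed.

Lemma mkE_der u : mkE A e [:: u] [::] = bdpt (mkE A e [::] [:: u]).
Proof. by rewrite (bdpt_mkE GA GH) big_ord1 expr0 scale1r. Qed.

(** The boundary rule for the product of [sigpt T] and K(u) is solved for the product of [T] and
    D_u. What remains are two contractions, one after d and one before it. *)
Lemma chat_Lie p (T : ptcurrent A p) u om : sm A om ->
  chat (mulpt T (mkE A e [:: u] [::])) om = chat T (Lie u om).
Proof.
move=> so; set K := mkE A e [::] [:: u].
have sd := sm_dform GA so; have si := sm_io u so.
rewrite mkE_der -/K.
have -> : chat (mulpt T (bdpt K)) om = chat (mulpt (sigpt T) K) (dform A om) -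
   chat (mulpt (bdpt (sigpt T)) K) om.
  rewrite -(chat_bdpt GA GH)// bdpt_mulpt sigptK.
  set V := mulpt (bdpt (sigpt T)) K; set W := mulpt T _.
  by have := chat_lin 1 V W om; rewrite scale1r mul1r => ->; rewrite addrAC subrr add0r.
rewrite !chat_mulpt// !sl_kappa// (chat_bdpt GA GH); last exact: sm_sgf.
have sn : sm A (fun p s => - sgf (dform A (io u om)) p s).
  have := sm_comb (-1) (sm_sgf (sm_dform GA si)) (sm_zero A); congr (sm A).
  by apply/funext => x; apply/funext => s; rewrite mulN1r addr0.
rewrite sgf_dform// !(chat_sigpt GA GH)//; last by apply: sm_sgf; exact: sm_io.
rewrite sgfK /Lie chat_add; [|exact: sm_io|exact: (sm_dform GA)].
congr (_ + _); rewrite -chat_opp; last first.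
  exact: sm_sgf.
congr (chat T _); apply/funext => x; apply/funext => s.
have := f_equal (fun f : lfm R n G => f x s) (sgfK (dform A (io u om))).
by rewrite /sgf /sg => {2}<-; lra.
Qed.

Definition FrF (v al : seq vec) p om := (foldr Lie om v) p (map (tR p e) al).

Lemma has_rep_eq p q Phi : p = q -> has_rep A p Phi -> has_rep A q Phi.
Proof. by move->. Qed.

Lemma has_rep_ext p Phi Psi : (forall om, sm A om -> Phi om = Psi om) ->
  has_rep A p Phi -> has_rep A p Psi.
Proof. by move=> H [L PL]; exists L => om so; rewrite -H// PL. Qed.

Lemma chat_rep p (T : ptcurrent A p) : has_rep A p (chat T).
Proof.
have [L ->] := pt_comb GA GH T; exists L => om so; exact: (chat_comb_rep GA).
Qed.

(** Induction from the right end of [v]: the last Lie derivative acts first on the form, and is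
    right convolution by a first order current at [e]. The point becomes [p * e], hence the
    transport by [has_rep_eq]. *)
Lemma FrF_rep v al p : has_rep A p (FrF v al p).
Proof.
elim/last_ind: v => [|v u IH].
  apply: has_rep_ext (E_rep A p [::] (map (tR p e) al)) => om so.
  by rewrite /E /= (lf_zp GA).
apply: (@has_rep_eq (p * e)%g _ _ (mulg1 p)).
apply: has_rep_ext (chat_rep (mulpt (mk A p (FrF v al p)) (mkE A e [:: u] [::]))) => om so.
rewrite chat_Lie// (chat_mk GA IH); last exact: sm_Lie.
by rewrite /FrF foldr_rcons.
Qed.

Definition FrT v al p : ptcurrent A p := mk A p (FrF v al p).

Lemma chat_FrT v al p om : sm A om -> chat (FrT v al p) om = FrF v al p om.
Proof. by move=> so; apply: (chat_mk GA) => //; exact: FrF_rep. Qed.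

Lemma lie_hat u k (w : form R n G k) : smooth_form A w ->
  smooth_form A (lie_derivative A (left_invariant u) w) /\
  hat (lie_derivative A (left_invariant u) w) = Lie u (hat w).
Proof.
move=> sw; have sh := smooth_hat GA sw.
suff H : hat (lie_derivative A (left_invariant u) w) = Lie u (hat w).
  split=> //; rewrite -(homK (lie_derivative _ _ _)) H.
  by apply: (sm_hom GA); exact: sm_Lie.
apply/funext => p; apply/funext => s; rewrite /Lie.
have dE : hat (contraction (left_invariant u) (extd A w)) p s = io u (dform A (hat w)) p s.
  by rewrite hat_contraction /io (hat_extd GA).
(* The two clauses of [lie_derivative]; for a function the contraction [io u] is zero. *)
case: k w sw sh dE => [|k] w sw sh dE.
  rewrite -dE /=; have -> : io u (hat w) = fun _ _ => 0.
    by apply/funext => x; apply/funext => t.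
  rewrite /dform /dl big1 ?addr0// => i _; rewrite [X in _ * X](_ : _ = 0) ?mulr0//.
  exact: D_cstE.
have hc : hat (contraction (left_invariant u) w) = io u (hat w).
  by apply/funext => x; apply/funext => t; rewrite hat_contraction.
have sc : smooth_form A (contraction (left_invariant u) w).
  by rewrite -(homK (contraction _ _)) hc; apply: (sm_hom GA); exact: sm_io.
rewrite -dE -hc -(hat_extd GA)// addrC.
have -> : lie_derivative A (left_invariant u) w = fun p M =>
  1 * extd A (contraction (left_invariant u) w) p M + contraction (left_invariant u) (extd A w) p M.
  by apply/funext => x; apply/funext => M; rewrite mul1r.
by rewrite /hat; case: eqP => _; rewrite ?addr0// mul1r addrC.
Qed.

Lemma lie_iter v k (w : form R n G k) : smooth_form A w ->
  smooth_form A (foldr (fun u eta => lie_derivative A (left_invariant u) eta) w v) /\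
  hat (foldr (fun u eta => lie_derivative A (left_invariant u) eta) w v) = foldr Lie (hat w) v.
Proof.
move=> sw; elim: v => //= u v [s1 <-]; exact: lie_hat.
Qed.

Lemma frame_currentE v al p : frame_current v al p = mkc A (FrF v al p).
Proof.
apply/funext => -[k w]; rewrite /frame_current /mkc /=.
case: asboolP => //= sw; have [s1 hE] := lie_iter v sw.
rewrite /FrF -hE /hat size_map eq_sym; case: eqP => // sk.
congr (_ p _); apply/row_matrixP => i; rewrite /right_invariant row_mul !rowK.
rewrite (tangent_mxE GA GA e _ (smap_R p)) (nth_map 0) ?sk//.
Qed.

(** The frame as global currents, which can be multiplied even over different points. *)
Definition FF (i : seq vec * seq vec) p : C := dg (fframe (f := U) i p : ptcurrent A p).

Lemma FFE v al p : FF (v, al) p = dg (FrT v al p).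
Proof. by rewrite /FF /= frame_currentE. Qed.

Definition KK al : C := gen e [::] al.
Definition DD u : C := gen e [:: u] [::].
Definition cdirac p : C := dg (dirac p).

Lemma FF_rcons v u al p : FF (rcons v u, al) p = cmul (FF (v, al) p) (DD u).
Proof.
rewrite !FFE cmul_dg; apply: dg_eq; first by rewrite mulg1.
move=> om so; rewrite chat_Lie// !chat_FrT//; last exact: sm_Lie.
by rewrite /FrF foldr_rcons.
Qed.

Lemma FF_nil al p : FF ([::], al) p = gen p [::] (map (tR p e) al).
Proof.
rewrite FFE; apply: dg_eq => // om so.
by rewrite chat_FrT// (chat_mkE GA)// /E /= (lf_zp GA).
Qed.

(** Convolution by a Dirac current on the right acts by right translation, the transport that
    defines the right-invariant multivectors of the frame. *)
Lemma FF_K al p : FF ([::], al) p = cmul (KK al) (cdirac p).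
Proof.
rewrite FF_nil cmul_dg; apply: dg_eq; first by rewrite mul1g.
move=> om so; rewrite (chat_mkE GA)// chat_mulpt_mkE// /E /= (lf_zp GA).
rewrite (lf_zp GG); apply: etrans (esym (pull_mul om e p al [::])).
by rewrite mul1g cats0.
Qed.

Lemma K_cat al be : cmul (KK al) (KK be) = KK (al ++ be).
Proof.
rewrite /KK cmul_dg; apply: dg_eq; first by rewrite mul1g.
move=> om so; rewrite (chat_mkE GA)// chat_mulpt_mkE// /E /= !(lf_zp GA) (lf_zp GG).
rewrite (pull_mul om e e) mul1g; congr (om _ (_ ++ _)); rewrite -[RHS]map_id; apply: eq_map => u.
  exact: tR1.
exact: tL1.
Qed.

Lemma KE v al be p : cmul (KK be) (FF (v, al) p) = FF (v, be ++ al) p.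
Proof.
elim/last_ind: v => [|v u IH]; first by rewrite !FF_K cmulA K_cat.
by rewrite !FF_rcons cmulA IH.
Qed.

Lemma cmul_linl c x x' y : cmul (c *: x + x') y = c *: cmul x y + cmul x' y.
Proof. exact: ((@cmul_bilin R n G).1 y c x x'). Qed.

Lemma cmul_linr c x y y' : cmul x (c *: y + y') = c *: cmul x y + cmul x y'.
Proof. exact: ((@cmul_bilin R n G).2 x c y y'). Qed.

Lemma cmul0l y : cmul 0 y = 0.
Proof. exact: (lin_0 ((@cmul_bilin R n G).1 y)). Qed.

Lemma cmul0r x : cmul x 0 = 0.
Proof. exact: (lin_0 ((@cmul_bilin R n G).2 x)). Qed.

Definition span (x : C) := exists L : seq (R * (seq vec * seq vec)),
  x = \sum_(c <- L) c.1 *: FF c.2 e.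

Lemma span0 : span 0. Proof. by exists [::]; rewrite big_nil. Qed.

Lemma span_lin c x y : span x -> span y -> span (c *: x + y).
Proof.
move=> [L ->] [L' ->]; exists ([seq (c * d.1, d.2) | d <- L] ++ L').
rewrite big_cat big_map scaler_sumr; congr (_ + _).
by apply: eq_bigr => d _; rewrite scalerA.
Qed.

Lemma span_FF i : span (FF i e).
Proof. by exists [:: (1, i)]; rewrite big_seq1 scale1r. Qed.

Lemma span_ind (P : C -> Prop) : P 0 -> (forall c x y, P x -> P y -> P (c *: x + y)) ->
  (forall i, P (FF i e)) -> forall x, span x -> P x.
Proof.
move=> P0 Pl Pi x [L ->]; elim: L => [|c L IH]; first by rewrite big_nil.
by rewrite big_cons; exact: Pl.
Qed.

Lemma span_sum (I : Type) (l : seq I) (F : I -> C) : Allp (fun i => span (F i)) l ->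
  span (\sum_(i <- l) F i).
Proof.
elim: l => [_|i l IH [Fi /IH Fl]]; first by rewrite big_nil; exact: span0.
by rewrite big_cons -[F i]scale1r; exact: span_lin.
Qed.

Lemma span_Z c x : span x -> span (c *: x).
Proof. by move=> sx; rewrite -[_ *: _]addr0; apply: span_lin => //; exact: span0. Qed.

(** Induction on the number of derivatives: by [leading], dropping the last derivative [u] and
    convolving with D_u instead changes the generator only by terms with fewer derivatives, and that
    convolution preserves the span by [FF_rcons]. *)
Lemma span_gen a s : span (gen e a s).
Proof.
move: {2}(size a).+1 (ltnSn (size a)) => r; elim: r a s => // r IH a s ar.
case/lastP: a ar => [_|a u]; first by have := span_FF ([::], s); rewrite FF_K -[cdirac e]/(@cone R
  n G) cmul1r.
rewrite size_rcons ltnS => ar.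
have [L [Lr LE]] := leading G a u s.
have -> : gen e (rcons a u) s = (-1) *: (\sum_(c <- L) c.1.1 *: gen e c.1.2 c.2) +
    cmul (gen e a s) (DD u).
  rewrite -(eq_bigr _ (fun c _ => lin_Z c.1.1 _ (@dg_lin R n G e))) -(lin_sum _ _ (@dg_lin R n G e)).
  rewrite [cmul _ _]cmul_dg.
  have -> : dg (mulpt (mkE A e a s) (mkE A e [:: u] [::])) =
     dg (1 *: comb A e L + mkE A e (rcons a u) s).
    apply: dg_eq; first by rewrite mulg1.
    move=> om so; rewrite chat_lin mul1r (chat_comb_rep GA)// -LE// (chat_mkE GA)//; lra.
  by rewrite dg_lin scale1r scaleN1r addKr.
apply: span_lin.
  apply: span_sum; apply: Allp_impl Lr => c cr; apply: span_Z; apply: IH.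
  exact: leq_ltn_trans cr ar.
have : span (gen e a s) by exact: IH.
move: (gen e a s); apply: span_ind.
- by rewrite cmul0l; exact: span0.
- by move=> c x y sx sy; rewrite cmul_linl; exact: span_lin.
- by move=> [v al]; rewrite -FF_rcons; exact: span_FF.
Qed.

Lemma span_dg q (T : ptcurrent A q) : q = e -> span (dg T).
Proof.
move=> qe; subst q; have [L ->] := pt_comb GA GH T.
rewrite (lin_sum _ _ (@dg_lin R n G e)); apply: span_sum; apply: Allp_all => c.
by rewrite (lin_Z _ _ (@dg_lin R n G e)); apply: span_Z; exact: span_gen.
Qed.

End Frames.

(** * Smooth bundle maps *)

Section SmoothFunctions.
Context (R : realType) (m : nat) (Y : topologicalType) (B : atlas R m Y).
Hypothesis HB : is_atlas B.

Lemma smooth_fun_sm1 (a : Y -> R) : smooth_fun B a <->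
  forall p x, cimg (B p) x -> sm1 (a \o cinv (B p) : _ -> R^o) x.
Proof.
split=> [sa p x px|sa p]; last by apply: Ck_sm1; [exact: atlas_img_open|exact: sa].
by exists (cimg (B p)); split=> //; [exact: atlas_img_open|exact: sa].
Qed.

Lemma smooth_cst (c : R) : smooth_fun B (fun=> c).
Proof. by apply/smooth_fun_sm1 => p x _; exact: sm1_cst. Qed.

Lemma smooth_mul (a b : Y -> R) : smooth_fun B a -> smooth_fun B b ->
  smooth_fun B (fun y => a y * b y).
Proof.
move=> /smooth_fun_sm1 sa /smooth_fun_sm1 sb; apply/smooth_fun_sm1 => p x px.
by apply: (sm1M (sa p x px) (sb p x px)).
Qed.

End SmoothFunctions.

Lemma smooth_comp (R : realType) (m n : nat) (X Y : topologicalType)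
    (A : atlas R n X) (B : atlas R m Y) (a : X -> R) (f : Y -> X) :
  is_atlas A -> is_atlas B -> smap B A f -> smooth_fun A a -> smooth_fun B (fun y => a (f y)).
Proof.
move=> HA HB sf /(smooth_fun_sm1 HA) sa; apply/(smooth_fun_sm1 HB) => p x px.
set q := f (cinv (B p) x).
have qd : cdom (A q) (f (cinv (B p) x)) by exact: atlas_mem.
apply: sm1_ext (sm1_comp (sf.2 p q x px qd) (sa q _ (cimg_cmap qd))).
by apply: filterS (near_smap HB HA sf px qd) => y dy; rewrite /= (atlas_inv HA).
Qed.

Section SmoothFamilies.
Context (R : realType) (n : nat) (G : lieGroupType R n).
Local Notation A := (lie_atlas : atlas R n G).
Local Notation AA := (prod_atlas A A).
Local Notation e := (1%g : G).
Local Notation mulm := (@mulm R n G).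
Local Notation invm := (@invm R n G).
Local Notation vec := 'rV[R]_n.
Local Notation U := (current_bundle G).
Local Notation C := (CG G).
Local Notation cmul := (@cmul R n G).
Local Notation KK := (@KK R n G).
Local Notation DD := (@DD R n G).
Local Notation FF := (@FF R n G).
Local Notation cbd := (@cbd R n G).
Local Notation csig := (@csig R n G).
Local Notation lmap s := (map (fun u : 'rV[R]_n => inl u : 'rV[R]_(n + n)) s).
Local Notation rmap s := (map (fun u : 'rV[R]_n => inr u : 'rV[R]_(n + n)) s).
Implicit Types (p q : G) (om et : lfm R n G) (u : vec).

(** Since [F (g, e) = e], one target chart serves every [g], and the coordinate is a partial
    derivative of one smooth function in a product chart. *)
Lemma smooth_tg (F : G * G -> G) u j : smap AA A F -> (forall g, F (g, e) = e) ->
  smooth_fun A (fun g => tg A A (fun x => F (g, x)) e u 0 j).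
Proof.
move=> sF Fe; apply/(smooth_fun_sm1 GA) => p x px.
have ez := cimg_zp GA e.
pose H (w : 'rV[R]_(n + n)) := cmap (A e) (F (cinv (AA (p, e)) w)).
have smH y : cimg (A p) y -> smv H (row_mx y (zp A e)).
  move=> py; apply: (sF.2 (p, e) e); first exact: cimg_row.
  by rewrite /= row_mxKl row_mxKr (cinv_zp GA) Fe; exact: (atlas_mem GA).
have s1 : sm1 (fun y => 'D_(inr u) (fun w => H w 0 j : R^o) (row_mx y (zp A e))) x.
  exact: (sm1_comp (row_smv_l x (zp A e)) (sm1_D (inr u) (smH x px j))).
apply: sm1_ext s1; apply: filterS (near_cimg GA px) => y py /=.
rewrite /tg Fe.
have := Dv_comp u (row_smv_r y (zp A e)) (smH y py).
rewrite Dv_row Dv_cst Dv_id => E1.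
have -> : (fun w => cmap (A e) (F (cinv (A p) y, cinv (A e) w))) = fun w => H (row_mx y w).
  by apply/funext => w; rewrite /H /= row_mxKl row_mxKr.
by rewrite E1 mxE.
Qed.

Definition Ad p u := tg A A (fun x => (p * x * p^-1)%g) e u.

Let smap_conj : smap AA A (fun z : G * G => (z.1 * z.2 * z.1^-1)%g).
Proof.
have s1 := smap_fst A (GA (G := G)).
have sI := smap_comp GG GA (smap_fst A (GA (G := G))) smap_invm.
exact: (smap_comp GG GG (smap_pair smap_mulm sI) smap_mulm).
Qed.

Lemma smooth_Ad u j : smooth_fun A (fun p => Ad p u 0 j).
Proof.
apply: (smooth_tg u j smap_conj) => g /=; by rewrite mulg1 mulgV.
Qed.

Let smap_conj1 p : smap A A (fun x => (p * x * p^-1)%g).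
Proof. exact: (smap_comp GA GA (smap_L p) (smap_R (p^-1)%g)). Qed.

Lemma Ad_l p u : tR p e (Ad p u) = tL p e u.
Proof.
have := tg_comp GA GA GA e u (smap_conj1 p) (smap_R p).
rewrite mulg1 mulgV -/(tR p e _) -/(Ad p u) => <-.
by apply: tg_eq => x; rewrite mulgVK.
Qed.

Lemma Ad_r p u : tL p e (Ad (p^-1)%g u) = tR p e u.
Proof.
have := tg_comp GA GA GA e u (smap_conj1 (p^-1)%g) (smap_L p).
rewrite mulg1 mulgV -/(tL p e _) -/(Ad _ u) => <-.
by apply: tg_eq => x; rewrite invgK mulgA mulVKg.
Qed.

Lemma mulpt_pt p q (s t : seq vec) om : sm A om ->
  chat (mulpt (mkE A p [::] s) (mkE A q [::] t)) om =
  om (p * q)%g (map (tR q p) s ++ map (tL p q) t).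
Proof. by move=> so; rewrite chat_mulpt_mkE// /E /= (lf_zp GG) (pull_mul om p q s t). Qed.

Lemma delta_K p u : cmul (cdirac p) (KK [:: u]) = cmul (KK [:: Ad p u]) (cdirac p).
Proof.
rewrite [LHS]cmul_dg [RHS]cmul_dg; apply: dg_eq; first by rewrite mulg1 mul1g.
move=> om so; apply: etrans (mulpt_pt p e [::] [:: u] so) _.
apply: etrans _ (esym (mulpt_pt e p [:: Ad p u] [::] so)).
by rewrite /= mulg1 mul1g Ad_l.
Qed.

Lemma K_delta p u : cmul (KK [:: u]) (cdirac p) = cmul (cdirac p) (KK [:: Ad (p^-1)%g u]).
Proof.
rewrite [LHS]cmul_dg [RHS]cmul_dg; apply: dg_eq; first by rewrite mulg1 mul1g.
move=> om so; apply: etrans (mulpt_pt e p [:: u] [::] so) _.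
apply: etrans _ (esym (mulpt_pt p e [::] [:: Ad (p^-1)%g u] so)).
by rewrite /= mulg1 mul1g Ad_r.
Qed.

Lemma cbd_K u : cbd (KK [:: u]) = DD u.
Proof. by rewrite /(DD u) /gen mkE_der -cbd_dg. Qed.

Lemma cbd_dl p : cbd (cdirac p) = 0.
Proof. by rewrite cbd_dg /dirac (bdpt_mkE GA GH) big_ord0 (lin_0 (@dg_lin R n G p)). Qed.

Lemma csig_dl p : csig (cdirac p) = cdirac p.
Proof. by rewrite csig_dg /dirac (sigpt_mkE GA GH) expr0 scale1r. Qed.

(** The boundary of [K_delta]: Dirac currents are cycles of degree 0, so only the K factor is
    differentiated. *)
Lemma D_delta p u : cmul (DD u) (cdirac p) = cmul (cdirac p) (DD (Ad (p^-1)%g u)).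
Proof.
have Kd x y z w : cbd x = w -> cbd y = 0 -> csig x = z -> cbd (cmul x y) = cmul w y.
  by move=> xw y0 xz; rewrite (cbd_cmul x y) xw y0 xz cmul0r addr0.
have dK x y w : cbd x = 0 -> csig x = x -> cbd y = w -> cbd (cmul x y) = cmul x w.
  by move=> x0 xx yw; rewrite (cbd_cmul x y) x0 xx yw cmul0l add0r.
apply: etrans (esym (Kd _ _ _ _ (cbd_K u) (cbd_dl p) erefl)) _.
rewrite (K_delta p u); apply: dK; [exact: cbd_dl|exact: csig_dl|exact: cbd_K].
Qed.

Lemma K_basis (u : vec) : KK [:: u] = \sum_k u 0 k *: KK [:: delta_mx 0 k].
Proof.
rewrite -(eq_bigr _ (fun k _ => lin_Z _ _ (@dg_lin R n G e))) -(lin_sum _ _ (@dg_lin R n G e)).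
apply: dg_eq => // om so; rewrite (lin_sum _ _ (@chat_linear R n G A e om)).
rewrite (eq_bigr (fun k => u 0 k * om e [:: delta_mx 0 k])).
  rewrite (chat_mkE GA)// /E /= (lf_zp GA) {1}(rv_decomp u).
  exact: (alt_sum [::] [::] _ _ _ (so.1 e)).
move=> k _; rewrite (lin_Z _ _ (@chat_linear R n G A e om)) (chat_mkE GA)// /E /= (lf_zp GA) //.
Qed.

Lemma D_basis (u : vec) : DD u = \sum_k u 0 k *: DD (delta_mx 0 k).
Proof.
rewrite -cbd_K K_basis (lin_sum _ _ (@cbd_lin R n G)); apply: eq_bigr => k _.
by rewrite (lin_Z _ _ (@cbd_lin R n G)) cbd_K.
Qed.

Section Families.
Context (m : nat) (Y : topologicalType) (B : atlas R m Y).
Hypothesis HB : is_atlas B.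

(** A smooth section along [h] of the bundle of currents, expressed in [CG G] so that products of
    currents over different points may serve as [phi]. *)
Definition sfam (h : Y -> G) (phi : Y -> C) := exists L : seq ((Y -> R) * (seq vec * seq vec)),
  Allp (fun c => smooth_fun B c.1) L /\
  forall b, phi b = \sum_(c <- L) c.1 b *: FF c.2 (h b).

Lemma sfam_ext h phi psi : phi =1 psi -> sfam h phi -> sfam h psi.
Proof. by move=> H [L [sL LE]]; exists L; split=> // b; rewrite -H LE. Qed.

Lemma sfam0 h : sfam h (fun=> 0).
Proof. by exists [::]; split=> // b; rewrite big_nil. Qed.

Lemma sfamD h phi psi : sfam h phi -> sfam h psi -> sfam h (fun b => phi b + psi b).
Proof.
move=> [L [sL LE]] [L' [sL' LE']]; exists (L ++ L'); split; first exact: Allp_cat.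
by move=> b; rewrite big_cat LE LE'.
Qed.

Lemma sfamZ h a phi : smooth_fun B a -> sfam h phi -> sfam h (fun b => a b *: phi b).
Proof.
move=> sa [L [sL LE]]; exists [seq (fun b => a b * c.1 b, c.2) | c <- L]; split.
  by apply: Allp_map; apply: Allp_impl sL => c sc; exact: smooth_mul.
move=> b; rewrite LE big_map scaler_sumr; apply: eq_bigr => c _; by rewrite scalerA.
Qed.

Lemma sfam_FF h i : sfam h (fun b => FF i (h b)).
Proof.
exists [:: (fun=> 1, i)]; split; first by split=> //; exact: smooth_cst.
by move=> b; rewrite big_seq1 scale1r.
Qed.

Lemma sfam_sum h (I : Type) (l : seq I) (F : I -> Y -> C) : Allp (fun i => sfam h (F i)) l ->
  sfam h (fun b => \sum_(i <- l) F i b).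
Proof.
elim: l => [_|i l IH [Fi /IH Fl]].
  by apply: sfam_ext (sfam0 h) => b; rewrite big_nil.
by apply: sfam_ext (sfamD Fi Fl) => b; rewrite big_cons.
Qed.

(** Fibrewise linear maps commute with the coefficients, so only the frame has to be checked. *)
Lemma sfam_ind h h' (g : Y -> C -> C) : (forall b, linear (g b)) ->
  (forall i, sfam h' (fun b => g b (FF i (h b)))) ->
  forall phi, sfam h phi -> sfam h' (fun b => g b (phi b)).
Proof.
move=> lg gi phi [L [sL LE]].
apply: (@sfam_ext _ (fun b => \sum_(c <- L) c.1 b *: g b (FF c.2 (h b)))).
  move=> b; rewrite LE (lin_sum _ _ (lg b)); apply: eq_bigr => c _.
  by rewrite (lin_Z _ _ (lg b)).
by apply: sfam_sum; apply: Allp_impl sL => c sc; apply: sfamZ => //; exact: gi.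
Qed.

Lemma sfam_D h phi u : sfam h phi -> sfam h (fun b => cmul (phi b) (DD u)).
Proof.
apply: (sfam_ind (g := fun b x => cmul x (DD u))) => [b|[v al]].
  exact: (@cmul_bilin R n G).1.
by apply: sfam_ext (sfam_FF h (rcons v u, al)) => b; rewrite FF_rcons.
Qed.

Lemma sfam_K h phi al : sfam h phi -> sfam h (fun b => cmul (KK al) (phi b)).
Proof.
apply: (sfam_ind (g := fun b x => cmul (KK al) x)) => [b|[v be]].
  exact: (@cmul_bilin R n G).2.
by apply: sfam_ext (sfam_FF h (v, al ++ be)) => b; rewrite KE.
Qed.

(** Puts the Dirac current between the multivector part and a current fixed at [e]. *)
Lemma FF_fact v al p : FF (v, al) p = cmul (cmul (KK al) (cdirac p)) (FF (v, [::]) e).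
Proof.
elim/last_ind: v => [|v u IH]; last by rewrite !FF_rcons cmulA IH.
have K0 : KK [::] = @cone R n G by [].
by rewrite !FF_K K0 cmul1l [cdirac e]/(@cone R n G) cmul1r.
Qed.

Lemma smooth_Ad_comp f u j : smap B A f -> smooth_fun B (fun b => Ad (f b) u 0 j).
Proof. by move=> sf; exact: (smooth_comp GA HB sf (smooth_Ad u j)). Qed.

(** For a frame element [x] at [e], the left Dirac current moves to the right past the K factors,
    the right one to the left past the D factors. Each exchange expands an [Ad] in the basis with
    smooth coefficients, and the two Dirac currents meet over [f b * g b]. *)
Lemma sfam_two_sided h f g x : smap B A f -> smap B A g -> (forall b, h b = (f b * g b)%g) ->
  span x -> sfam h (fun b => cmul (cmul (cdirac (f b)) x) (cdirac (g b))).
Proof.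
move=> sf sg_ hE.
have sgI : smap B A (fun b => (g b)^-1%g) by exact: (smap_comp HB GA sg_ smap_invm).
move: x; apply: span_ind.
- by apply: sfam_ext (sfam0 h) => b; rewrite cmul0r cmul0l.
- move=> c x y Px Py; apply: sfam_ext (sfamD (sfamZ (smooth_cst HB c) Px) Py) => b.
  by rewrite cmul_linr cmul_linl.
move=> [v al]; elim/last_ind: v => [|v u IH].
  elim: al => [|u al IH].
    apply: sfam_ext (sfam_FF h ([::], [::])) => b.
    have K0 : KK [::] = @cone R n G by [].
    rewrite !FF_K K0 !cmul1l [cdirac e]/(@cone R n G) cmul1r.
    by rewrite cmul_dg hE; apply: dg_eq => // om so; rewrite chat_dirac// chat_mulpt_mkE// /E /= (lf_zp GG).
  apply: (@sfam_ext _ (fun b => \sum_k Ad (f b) u 0 k *: cmul (KK [:: delta_mx 0 k])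
      (cmul (cmul (cdirac (f b)) (FF ([::], al) e)) (cdirac (g b))))).
    move=> b; rewrite -(KE [::] al [:: u]) cmulA delta_K K_basis.
    rewrite -!cmulA [RHS](lin_sum _ _ ((@cmul_bilin R n G).1 _)); apply: eq_bigr => k _.
    by rewrite (lin_Z _ _ ((@cmul_bilin R n G).1 _)).
  apply: sfam_sum; apply: Allp_all => k; apply: sfamZ; first exact: smooth_Ad_comp.
  exact: sfam_K.
apply: (@sfam_ext _ (fun b => \sum_k Ad (g b)^-1%g u 0 k *:
   cmul (cmul (cmul (cdirac (f b)) (FF (v, al) e)) (cdirac (g b))) (DD (delta_mx 0 k)))).
  move=> b; rewrite FF_rcons -!cmulA D_delta D_basis !cmulA.
  rewrite [RHS](lin_sum _ _ ((@cmul_bilin R n G).2 _)); apply: eq_bigr => k _.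
  by rewrite (lin_Z _ _ ((@cmul_bilin R n G).2 _)).
apply: sfam_sum; apply: Allp_all => k; apply: sfamZ; first exact: smooth_Ad_comp.
exact: sfam_D.
Qed.

Lemma sfam_FFr h phi v : sfam h phi -> sfam h (fun b => cmul (phi b) (FF (v, [::]) e)).
Proof.
move=> sp; elim/last_ind: v => [|v u IH].
  by apply: sfam_ext sp => b; rewrite FF_K [cdirac e]/(@cone R n G) !cmul1r.
by apply: sfam_ext (sfam_D u IH) => b; rewrite FF_rcons cmulA.
Qed.

(** Returns from global currents to the fibre by evaluating the identity at [h b]. *)
Lemma sfam_bundle h (T : forall b, ptcurrent A (h b)) : sfam h (fun b => dg (T b)) ->
  exists N (a : 'I_N -> Y -> R) (j : 'I_N -> fidx U),
    (forall l, smooth_fun B (a l)) /\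
    forall b, T b = \sum_l a l b *: fframe (j l) (h b).
Proof.
move=> [L [sL LE]]; pose d : (Y -> R) * (seq vec * seq vec) := (fun=> 0, ([::], [::])).
exists (size L), (fun l => (nth d L l).1), (fun l => (nth d L l).2); split.
  move=> [l ll] /=; elim: L sL {LE} l ll => [//|c L IH] [sc sL] [|l] //= ll; exact: IH.
move=> b; have := f_equal (fun x : C => x (h b)) (LE b).
rewrite /dg gdelta_in => ->.
rewrite (eq_bigr _ (fun c _ => esym (lin_Z (c.1 b) _ (@dg_lin R n G (h b))))).
rewrite -(lin_sum _ _ (@dg_lin R n G (h b))) /dg gdelta_in (big_nth d) big_mkord.
by [].
Qed.

End Families.
End SmoothFamilies.

(** * The structure maps in the frame *)

Section InducedMaps.
Context (R : realType) (n : nat) (G : lieGroupType R n).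
Local Notation A := (lie_atlas : atlas R n G).
Local Notation AA := (prod_atlas A A).
Local Notation e := (1%g : G).
Local Notation mulm := (@mulm R n G).
Local Notation invm := (@invm R n G).
Local Notation vec := 'rV[R]_n.
Local Notation U := (current_bundle G).
Local Notation C := (CG G).
Local Notation cmul := (@cmul R n G).
Local Notation KK := (@KK R n G).
Local Notation DD := (@DD R n G).
Local Notation FF := (@FF R n G).
Local Notation cbd := (@cbd R n G).
Local Notation csig := (@csig R n G).
Local Notation cS := (@cS R n G).
Local Notation ceps := (@ceps R n G).
Local Notation cDelta := (@cDelta R n G).
Implicit Types (p q : G) (om et : lfm R n G) (u : vec).

Lemma cbd_KK al : span (cbd (KK al)).
Proof. by rewrite cbd_dg; exact: span_dg. Qed.

Lemma cbd_DD u : cbd (DD u) = 0.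
Proof. rewrite -cbd_K cbd_dg cbd_dg (bdpt_bdpt GA GH); exact: (lin_0 (@dg_lin R n G e)). Qed.

(** D_u and the Dirac currents are cycles, so the boundary only meets the factor K(al), where it
    gives a fixed current at [e], translated to [p]. *)
Lemma sfam_cbd i : sfam A id (fun p => cbd (FF i p)).
Proof.
case: i => v al; elim/last_ind: v => [|v u IH].
  have /= := sfam_two_sided (h := id) (GA (G := G)) (smap_cst A A (e : G)) (smap_id (GA (G := G))).
  move=> /(_ (cbd (KK al)) (fun p => esym (mul1g p)) (cbd_KK al)); apply: sfam_ext => p.
  rewrite [cdirac e]/(@cone R n G) cmul1l FF_K cbd_cmul cbd_dl cmul0r addr0 //.
apply: sfam_ext (sfam_D GA u IH) => p.
by rewrite FF_rcons cbd_cmul cbd_DD cmul0r addr0.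
Qed.

Lemma cbd_induced : endo_induced id cbd.
Proof.
exists (@bdpt R n G A) => //; split; [exact: (smap_smooth_map GA GA (smap_id GA))|exact: lbd|].
move=> i; apply: (sfam_bundle (h := id) (T := fun p => bdpt (fframe (f := U) i p))).
by apply: sfam_ext (sfam_cbd i) => p; exact: cbd_dg.
Qed.

(** The counit is multiplicative and equals 1 on Dirac currents, so the point drops out. *)
Lemma ceps_FF i : exists c, forall p, ceps (FF i p) = c.
Proof.
case: i => v al; elim/last_ind: v => [|v u [c IH]].
  exists (ceps (KK al)) => p; rewrite FF_K ceps_mul [ceps (cdirac p)]ceps_dg epspt_dirac mulr1 //.
by exists (c * ceps (DD u)) => p; rewrite FF_rcons ceps_mul IH.
Qed.

Lemma ceps_induced : counit_induced ceps.
Proof.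
exists (@ephi R n G) => //; split; [exact: (smap_smooth_map GA GA (smap_id GA))|exact: ephi_lin|].
move=> i; have [c cE] := ceps_FF i.
exists 1%N, (fun _ _ => c), (fun=> tt); split=> [l|p]; first exact: (smooth_cst GA).
rewrite big_ord1 /=; have := cE p; rewrite /(FF i p) ceps_dg => E1.
by apply: etrans E1 _; rewrite -[RHS]/(c * 1) mulr1.
Qed.

Definition FF2 (L : seq (R * ((seq vec * seq vec) * (seq vec * seq vec)))) p : tensor C C :=
  \sum_(c <- L) c.1 *: (FF c.2.1 p ⊗ FF c.2.2 p).

Lemma cDelta_DD u : cDelta (DD u) = DD u ⊗ @cone R n G + @cone R n G ⊗ DD u.
Proof.
rewrite -[LHS]tlift_id (tlift_cDelta_gen _ _ _ (pure_bilin C C) (@separated_tensor R C C)).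
by rewrite big_seq1 /= big_cons big_seq1 /= expr0 !scale1r addrC.
Qed.

Lemma DD_filt u : CG_filt 0 1 (DD u).
Proof. exact: filt_gen. Qed.

Lemma cone_filt : CG_filt 0 0 (@cone R n G).
Proof. exact: filt_gen. Qed.

Lemma cDelta_mulD x u : cDelta (cmul x (DD u)) =
  tlift (fun a b => cmul a (DD u) ⊗ b + a ⊗ cmul b (DD u)) (cDelta x).
Proof.
rewrite cDelta_mul; apply: tlift_ext => a b; rewrite cDelta_DD.
have sb : bilin (sgn_mul a b) by exact: sgn_mul_bilinr.
have sT := @separated_tensor R C C.
rewrite (lin_D _ _ (tlift_lin sb sT)) !(tlift_pure sb sT) /sgn_mul.
rewrite !(par_filt _ (DD_filt u)) !(par_filt _ cone_filt) /= !cmul1r !cmul0r.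
by rewrite !(lin_0 ((pure_bilin C C).1 _)) !addr0.
Qed.

Lemma mulD_bilin u : bilin (fun a b : C => cmul a (DD u) ⊗ b + a ⊗ cmul b (DD u) : tensor C C).
Proof.
have [pl pr] := pure_bilin C C.
split=> [y c a a'|x c b b'] /=.
  by rewrite cmul_linl !pl scalerDr addrACA.
by rewrite cmul_linl !pr scalerDr addrACA.
Qed.

(** The coefficients are constant: without derivatives the coproduct is a shuffle sum over [al], and
    each D_u is primitive, so convolving with it acts on one tensor factor at a time. *)
Lemma cDelta_FF i : exists L, forall p, cDelta (FF i p) = FF2 L p.
Proof.
case: i => v al; elim/last_ind: v => [|v u [L IH]].
  exists [seq ((-1) ^+ t.1.1, (([::], t.1.2), ([::], t.2))) | t <- splits al] => p.
  rewrite FF_nil -[LHS]tlift_id (tlift_cDelta_gen _ _ _ (pure_bilin C C) (@separated_tensor R C C)).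
  rewrite splits_map /FF2 !big_map; apply: eq_bigr => t _.
  by rewrite big_seq1 /= !FF_nil.
exists ([seq (c.1, ((rcons c.2.1.1 u, c.2.1.2), c.2.2)) | c <- L] ++
        [seq (c.1, (c.2.1, (rcons c.2.2.1 u, c.2.2.2))) | c <- L]) => p.
rewrite FF_rcons cDelta_mulD IH /FF2.
have lT := tlift_lin (mulD_bilin u) (@separated_tensor R C C).
rewrite (lin_sum _ _ lT) big_cat /= !big_map -big_split /=; apply: eq_bigr => c _.
rewrite (lin_Z _ _ lT) (tlift_pure (mulD_bilin u) (@separated_tensor R C C)) scalerDr.
by case: c => a [[v1 a1] [v2 a2]] /=; rewrite !FF_rcons.
Qed.

(** The identity in the global tensor square is brought back to the fibre by evaluating both tensor
    factors at [p]. *)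
Lemma dphi_FF i p L : cDelta (FF i p) = FF2 L p ->
  dphi (fframe (f := U) i p) = \sum_(c <- L) c.1 *: (fframe (f := U) c.2.1 p ⊗ fframe (f := U) c.2.2 p).
Proof.
pose h (x y : C) : tensor (U p) (U p) := x p ⊗ y p.
have [pl pr] := pure_bilin (U p) (U p).
have hb : bilin h by split=> [y c a a'|x c b b']; rewrite /h; [exact: pl|exact: pr].
have sT := @separated_tensor R (U p) (U p).
have lT := tlift_lin hb sT.
rewrite cDelta_dg => /(f_equal (tlift h)).
rewrite (tlift_map _ _ lT) (@tlift_ext _ _ _ _ _ (fun a b => a ⊗ b)); last first.
  by move=> a b; rewrite (tlift_pure hb sT) /h /dg !gdelta_in.
rewrite tlift_id /dphi => ->; rewrite (lin_sum _ _ lT); apply: eq_bigr => c _.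
by rewrite (lin_Z _ _ lT) (tlift_pure hb sT) /h /(FF _ p) /dg !gdelta_in.
Qed.

Lemma cDelta_induced : coproduct_induced cDelta.
Proof.
exists (@dphi R n G) => //; split; [exact: (smap_smooth_map GA GA (smap_id GA))|exact: dphi_lin|].
move=> i; have [L LE] := cDelta_FF i.
pose d : R * ((seq vec * seq vec) * (seq vec * seq vec)) := (0, (([::], [::]), ([::], [::]))).
exists (size L), (fun l _ => (nth d L l).1), (fun l => (nth d L l).2).
split=> [l|p]; first exact: (smooth_cst GA).
by rewrite (dphi_FF (LE p)) (big_nth d) big_mkord.
Qed.

Lemma span_mul i j : span (cmul (FF i e) (FF j e)).
Proof. by rewrite cmul_dg; apply: span_dg; rewrite mulg1. Qed.

(** By [FF_fact] the product reads: K(al), the Dirac current at p, a fixed current at [e], the Dirac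
    current at q, the D factors of [w]. The middle is [sfam_two_sided], and the outer factors
    preserve smooth families. *)
Lemma sfam_mul i j : sfam AA mulm (fun pq => cmul (FF i pq.1) (FF j pq.2)).
Proof.
case: i j => [v al] [w be].
have x_span : span (cmul (FF (v, [::]) e) (FF ([::], be) e)) by exact: span_mul.
have H := sfam_two_sided (h := mulm) (GG (G := G)) (smap_fst A (GA (G := G))) (smap_snd A (GA (G := G)))
  (fun=> erefl) x_span.
apply: sfam_ext (sfam_FFr GG w (sfam_K GG al H)) => -[p q] /=.
rewrite (FF_fact v al) (FF_fact w be) FF_K [cdirac e]/(@cone R n G) cmul1r.
by rewrite !cmulA.
Qed.

Lemma cmul_induced : product_induced cmul.
Proof.
exists (@mphi R n G) => //; split; [exact: (smap_smooth_map GG GA smap_mulm)|exact: mphi_lin|].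
move=> [i j]; apply: (sfam_bundle (h := mulm)
  (T := fun pq => @mphi R n G pq (fframe (f := box_bundle U U) (i, j) pq))).
apply: sfam_ext (sfam_mul i j) => -[p q] /=.
rewrite [LHS]cmul_dg /mphi tlift_pure//; first exact: mulpt_bilin.
exact: (sep_pt GA (p := (p * q)%g)).
Qed.

(** Inversion turns left translation by [p] into right translation by [p^-1]; transposed to forms
    this is an identity of pullbacks. *)
Lemma cS_dl p x : cS (cmul (cdirac p) x) = cmul (cS x) (cdirac (p^-1)%g).
Proof.
have lm (y : C) : linear (cmul^~ y) := (@cmul_bilin R n G).1 y.
apply: (lin_C (lin_comp ((@cmul_bilin R n G).2 (cdirac p)) (@cS_lin R n G))
  (lin_comp (@cS_lin R n G) (lm (cdirac (p^-1)%g)))) => q T.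
rewrite [cmul (cdirac p) _]cmul_dg !cS_dg [RHS]cmul_dg; apply: dg_eq; first by rewrite invgM.
move=> om so; have sI : sm A (pull A A invm om) by exact: (sm_pull GA GA smap_invm so).
have sp : sm A (sl (chat (dirac (p^-1)%g)) (pull AA A mulm om)) by exact: sm_mul_sl.
rewrite chat_Spt// chat_mulpt// chat_dirac; last exact: sm_mul_sl.
rewrite chat_mulpt// chat_Spt//.
congr (chat T _); apply/funext => y; apply/funext => t.
have sp' : sm A (slice (pull AA A mulm om) (invm y) (map (tg A A invm y) t)) by exact: sm_slice_mul.
apply: etrans (pull_mul (pull A A invm om) p y [::] t) _.
apply: etrans _ (esym (chat_dirac (p^-1)%g sp')).
apply: etrans _ (esym (pull_mul om (invm y) (p^-1)%g (map (tg A A invm y) t) [::])).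
rewrite cats0 /pull /= -!map_comp /invm invgM; apply: (f_equal (om _)); apply: eq_map => u /=.
rewrite -(tg_comp GA GA GA y u (smap_L p) smap_invm).
apply: etrans _ (tg_comp GA GA GA y u smap_invm (smap_R (p^-1)%g)).
by apply: tg_eq => w; rewrite /invm invgM.
Qed.

Lemma dl_mul p q : cmul (cdirac p) (cdirac q) = cdirac (p * q)%g.
Proof.
rewrite cmul_dg; apply: dg_eq => // om so.
by rewrite chat_dirac//; exact: (mulpt_pt p q [::] [::] so).
Qed.

(* Translating the frame back to [e] reduces the antipode to currents at [e]. *)
Lemma sfam_translate i : sfam A (fun=> e) (fun p => cmul (cdirac (p^-1)%g) (FF i p)).
Proof.
case: i => v al.
have H := sfam_two_sided (h := fun=> e) (GA (G := G)) smap_invm (smap_id (GA (G := G)))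
  (fun p => esym (mulVg p)) (span_FF G ([::], al)).
apply: sfam_ext (sfam_FFr GA v H) => p.
by rewrite (FF_fact v al) FF_K [cdirac e]/(@cone R n G) cmul1r !cmulA.
Qed.

Lemma span_cS i : span (cS (FF i e)).
Proof. by rewrite cS_dg; apply: span_dg; rewrite invg1. Qed.

(** The current is the Dirac current at [p] times its translate to [e]. The translate has smooth
    coefficients in the frame at [e], whose elements the antipode sends to fixed currents there, and
    [cS_dl] puts the Dirac current at [p^-1] on the right. *)
Lemma sfam_cS i : sfam A invm (fun p => cS (FF i p)).
Proof.
have [L [sL LE]] := sfam_translate i.
have lS := @cS_lin R n G.
apply: (@sfam_ext _ _ _ _ _ _ _ (fun p => \sum_(c <- L) c.1 p *: cmul (cS (FF c.2 e)) (cdirac (p^-1)%g))).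
  move=> p; have E1 : FF i p = cmul (cdirac p) (cmul (cdirac (p^-1)%g) (FF i p)).
    by rewrite cmulA dl_mul mulgV [cdirac e]/(@cone R n G) cmul1l.
  rewrite {}E1 cS_dl LE (lin_sum _ _ lS) [RHS](lin_sum _ _ ((@cmul_bilin R n G).1 _)).
  by apply: eq_bigr => c _; rewrite (lin_Z _ _ lS) [RHS](lin_Z _ _ ((@cmul_bilin R n G).1 _)).
apply: sfam_sum; apply: Allp_impl sL => c sc; apply: sfamZ => //; first exact: GA.
have H := sfam_two_sided (h := invm) (GA (G := G)) (smap_cst A A (e : G)) smap_invm
  (fun p => esym (mul1g (p^-1)%g)) (span_cS c.2).
by apply: sfam_ext H => p; rewrite [cdirac e]/(@cone R n G) cmul1l.
Qed.

Lemma cS_induced : endo_induced (fun g : G => (g^-1)%g) cS.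
Proof.
exists (@Spt R n G) => //; split; [exact: (smap_smooth_map GA GA smap_invm)|exact: Spt_lin|].
move=> i; apply: (sfam_bundle (h := invm) (T := fun p => Spt (fframe (f := U) i p))).
by apply: sfam_ext (sfam_cS i) => p; exact: cS_dg.
Qed.

End InducedMaps.

Theorem theorem1 (R : realType) (n : nat) (G : lieGroupType R n) :
  exists (one : CG G) (mul : CG G -> CG G -> CG G)
         (Delta : CG G -> tensor (CG G) (CG G)) (eps : CG G -> R^o)
         (bd S : CG G -> CG G),
  [/\ [/\ is_unit_current one, is_convolution mul, is_coproduct Delta,
          is_counit eps & is_boundary bd],
      filtered_dg_hopf (@CG_filt R n G) one mul Delta eps bd S,
      [/\ product_induced mul, coproduct_induced Delta, counit_induced eps &
          endo_induced id bd] &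
      endo_induced (fun g : G => (g^-1)%g) S].
Proof.
exists (@cone R n G), (@cmul R n G), (@cDelta R n G), (@ceps R n G), (@cbd R n G), (@cS R n G).
split; [split|exact: CG_dg_hopf|split|exact: cS_induced].
- exact: cone_unit.
- exact: cconvolution.
- exact: ccoproduct.
- exact: ccounit.
- exact: cboundary.
- exact: cmul_induced.
- exact: cDelta_induced.
- exact: ceps_induced.
- exact: cbd_induced.
Qed.
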